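(* Let $n\geq 1$ and $\alpha>-1$. Let $g$ be a non-constant function on $\mathbb{B}_n$ (i.e. $g$ is not almost everywhere equal to a constant) such that for almost all $z\in\mathbb{B}_n$, $g(z)=|z_1|^{2s_1}\cdots|z_n|^{2s_n}h(|z|)$, where $h$ is a bounded measurable function on $[0,1)$ and $s_1,\ldots,s_n\geq 0$ are real numbers. Then for $f\in L^2_\alpha$, one has $T_fT_g=T_gT_f$ on $\mathcal{P}$ if and only if both of the following hold: (i) $f(\mathrm{e}^{\mathrm{i}\theta}z)=f(z)$ for almost all $\theta\in\mathbb{R}$ and almost all $z\in\mathbb{B}_n$; (ii) for every $1\leq j\leq n$ with $s_j\neq 0$, $f(z_1,\ldots,z_{j-1},|z_j|,z_{j+1},\ldots,z_n)=f(z)$ for almost all $z\in\mathbb{B}_n$.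
   Context: $\mathbb{B}_n$ is the open unit ball of $\mathbb{C}^n$ (Euclidean norm $|z|$); $\nu$ is Lebesgue measure on $\mathbb{B}_n$ normalized so that $\nu(\mathbb{B}_n)=1$. For $\alpha>-1$, $\mathrm{d}\nu_\alpha(z)=c_\alpha(1-|z|^2)^\alpha\,\mathrm{d}\nu(z)$ with $c_\alpha=\frac{\Gamma(n+\alpha+1)}{\Gamma(n+1)\Gamma(\alpha+1)}$. $L^2_\alpha=L^2(\mathbb{B}_n,\mathrm{d}\nu_\alpha)$, and the weighted Bergman space $A^2_\alpha$ is the closed subspace of $L^2_\alpha$ of functions analytic on $\mathbb{B}_n$. $P_\alpha:L^2_\alpha\to A^2_\alpha$ is the orthogonal projection. For $f\in L^2_\alpha$, the Toeplitz operator $T_f$ is densely defined on $A^2_\alpha$ by $T_f\varphi=P_\alpha(f\varphi)$ for bounded analytic $\varphi$; if $f$ is bounded, $T_f$ is a bounded operator on $A^2_\alpha$. $\mathcal{P}$ is the space of analytic polynomials in $z=(z_1,\ldots,z_n)$. (For $g$ as in the theorem, $T_g$ maps $\mathcal{P}$ into $\mathcal{P}$, being diagonal with respect to monomials, so both products are defined on $\mathcal{P}$.) Since $f$ is only defined up to null sets, condition (ii) is understood as: $f$ agrees almost everywhere with a measurable function that depends on $z_j$ only through $|z_j|$; equivalently $f(z_1,\ldots,z_{j-1},\mathrm{e}^{\mathrm{i}\theta}z_j,z_{j+1},\ldots,z_n)=f(z)$ for almost all $\theta\in\mathbb{R}$ and almost all $z\in\mathbb{B}_n$. *)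

(* Defs.v *)
From HB Require Import structures.
From mathcomp Require Import all_boot all_order all_algebra.
From mathcomp Require Import complex.
From mathcomp Require Import all_classical all_reals all_analysis.
From mathcomp Require mpoly.

Set Implicit Arguments.
Unset Strict Implicit.
Unset Printing Implicit Defensive.

Import Order.TTheory GRing.Theory Num.Theory.
Import numFieldNormedType.Exports.

Local Open Scope classical_set_scope.
Local Open Scope ring_scope.

Section product_sigma_finite.
Context d1 d2 (T1 : measurableType d1) (T2 : measurableType d2) (R : realType).
Variables (m1 : {sigma_finite_measure set T1 -> \bar R})
  (m2 : {sigma_finite_measure set T2 -> \bar R}).

(* In mathcomp-analysis 1.16 the canonical sigma-finite structure on m1 \x m2
   is shadowed by the one for pairs of subprobabilities, hence this lemma. *)
Lemma product_measure1_sigma_finite : sigma_finite setT (m1 \x m2)%E.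
Proof.
by case: (lebesgue_integral_fubini.measure_function_Measure_isSigmaFinite__to__measure_function_isSigmaFinite m1 m2).
Qed.

End product_sigma_finite.

Section tuple_measure.
Context d (T : measurableType d) (R : realType).

Definition tuple_cons n (x : T * n.-tuple T) : n.+1.-tuple T :=
  [tuple of x.1 :: x.2].

Lemma measurable_tuple_cons n : measurable_fun setT (@tuple_cons n).
Proof. exact: measurable_cons. Qed.

Variable m : {sigma_finite_measure set T -> \bar R}.

Section step.
Variables (n : nat) (mu : {sigma_finite_measure set (n.-tuple T) -> \bar R}).

Definition tuple_measureS : set (n.+1.-tuple T) -> \bar R :=
  pushforward (m \x mu)%E (@tuple_cons n).

HB.instance Definition _ := Measure.copy tuple_measureS
  (measure_function_pushforward__canonical__measure_function_Measure
    (m \x mu)%E (@measurable_tuple_cons n)).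

Let tuple_measureS_sigma_finite : sigma_finite setT tuple_measureS.
Proof.
have [F FT Foo] := product_measure1_sigma_finite m mu.
pose k (t : n.+1.-tuple T) : T * n.-tuple T := (thead t, [tuple of behead t]).
have mk : measurable_fun setT k.
  apply/measurable_fun_pair; first exact: measurable_tnth.
  exact: measurable_behead.
exists (fun i => k @^-1` F i).
  by rewrite -preimage_bigcup -FT preimage_setT.
move=> i; have [mF Fi] := Foo i; split.
  by rewrite -[X in measurable X]setTI; exact: mk.
rewrite /tuple_measureS /pushforward -comp_preimage.
rewrite (_ : k \o _ = id)//; apply/funext => -[x t] /=.
rewrite /k theadE; congr pair; exact: val_inj.
Qed.

HB.instance Definition _ := Measure_isSigmaFinite.Build _ _ _ tuple_measureS
  tuple_measureS_sigma_finite.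

End step.

Fixpoint tuple_measure n : {sigma_finite_measure set (n.-tuple T) -> \bar R} :=
  match n with
  | 0 => @dirac _ (0.-tuple T) [tuple] R
  | n'.+1 => tuple_measureS (tuple_measure n')
  end.

End tuple_measure.

Notation Cspace R n := 'rV[R[i]^o]_n.

Section complex_space.
Variable R : realType.

Definition lebesgue2 :=
  @product_measure1 _ _ (measurableTypeR R) (measurableTypeR R) R
    lebesgue_measure lebesgue_measure.

HB.instance Definition _ := Measure.on lebesgue2.
HB.instance Definition _ := Measure_isSigmaFinite.Build _ _ _ lebesgue2
  (product_measure1_sigma_finite _ _).

Section fixed_dimension.
Variable n : nat.
Implicit Types (x : n.-tuple (measurableTypeR R * measurableTypeR R))
  (z : Cspace R n) (f : Cspace R n -> R[i]^o).

(* C^n carries its topology and C-linear structure as Cspace R n; measurability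
   and integration on it are those of the space n.-tuple (R * R) of real
   coordinates. *)
Definition lebesgueC := tuple_measure lebesgue2 n.

Definition of_coords x : Cspace R n :=
  \row_k ((tnth x k).1 +i* (tnth x k).2)%C.

Definition vnorm z : R := Num.sqrt (\sum_k Normc.normc (z ord0 k) ^+ 2).

Definition unit_ball : set (Cspace R n) := [set z | vnorm z < 1].

Definition ball_coords := of_coords @^-1` unit_ball.

Definition ae_ball (P : Cspace R n -> Prop) : Prop :=
  {ae lebesgueC, forall x, ball_coords x -> P (of_coords x)}.

Definition measurable_ball f : Prop :=
  measurable_fun ball_coords (fun x => complex.Re (f (of_coords x))) /\
  measurable_fun ball_coords (fun x => complex.Im (f (of_coords x))).

(* Frechet differentiability over the scalar field R[i], i.e. holomorphy *)
Definition analytic_ball f : Prop :=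
  forall z, unit_ball z -> differentiable f z.

Definition analytic_poly (p : mpoly.mpoly n R[i]) : Cspace R n -> R[i]^o :=
  fun z => mpoly.meval (fun k => z ord0 k) p.

Definition expi (t : R) : R[i] := (cos t +i* sin t)%C.

Definition abs_coord (j : 'I_n) z : Cspace R n :=
  \row_k (if k == j then `|z ord0 k| else z ord0 k).

Definition Gamma (a : R) : R :=
  (\int[lebesgue_measure]_(t in `]0, +oo[) (t `^ (a - 1) * expR (- t)))%R.

Section bergman.
Variable alpha : R.

Definition c_alpha : R :=
  Gamma (n%:R + alpha + 1) / (Gamma (n%:R + 1) * Gamma (alpha + 1)).

(* the density of nu_alpha with respect to Lebesgue measure on the ball;
   nu itself is Lebesgue measure divided by the volume of the ball *)
Definition nu_density z : R :=
  c_alpha * (1 - vnorm z ^+ 2) `^ alpha / fine (lebesgueC ball_coords).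

Definition int_nu (u : Cspace R n -> R) : R :=
  (\int[lebesgueC]_(x in ball_coords)
     (u (of_coords x) * nu_density (of_coords x)))%R.

Definition L2 f : Prop :=
  measurable_ball f /\
  (\int[lebesgueC]_(x in ball_coords)
    (Normc.normc (f (of_coords x)) ^+ 2 * nu_density (of_coords x))%:E
   < +oo)%E.

Definition inner u v : R[i] :=
  (int_nu (fun z => complex.Re (u z * conjc (v z)))
   +i* int_nu (fun z => complex.Im (u z * conjc (v z))))%C.

Definition A2 f : Prop := L2 f /\ analytic_ball f.

(* The values of an element of A2 outside the ball are irrelevant, so the
   projection is determined only on the ball. *)
Definition bergman_proj (u : Cspace R n -> R[i]^o) : Cspace R n -> R[i]^o :=
  xget (fun=> 0)
    [set p | A2 p /\ forall q, A2 q -> inner (fun z => u z - p z) q = 0].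

Definition toeplitz f (phi : Cspace R n -> R[i]^o) : Cspace R n -> R[i]^o :=
  bergman_proj (fun z => f z * phi z).

End bergman.
End fixed_dimension.
End complex_space.

(* Main.v *)
(* Since T_g is diagonal on monomials, with eigenvalues gamma_m, the operators
   commute iff (gamma_m - gamma_k) <f z^m, z^k> = 0 for all m and k.  As functions
   of each l_j, both <f z^(m+l), z^(k+l)> and, up to a nonzero factor,
   gamma_(m+l) - gamma_(k+l) are moment sequences on [0, 1].  By a Muntz theorem
   the product of two such sequences vanishes only if one of them does.  Hence
   either <f z^(m+l), z^(k+l)> = 0 for all l >= 1, or gamma_(m+l) = gamma_(k+l)
   for all l >= 1.  By homogeneity and Gaussian integrals, gamma_m is
   Theta(|m|) prod_j Gamma(m_j + s_j + 1) / Gamma(m_j + 1), so when g is not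
   constant the second case forces |m| = |k|, and m_j = k_j wherever s_j <> 0.
   Thus the moments of f times |z_1 ... z_n|^2 that are not invariant under
   z -> e^(it) z and under rotations of these z_j vanish, and a function with
   vanishing moments is zero.  The converse is read off from the same formulas. *)
Require Import Defs.
From HB Require Import structures.
From mathcomp Require Import all_boot all_order all_algebra.
From mathcomp Require Import complex.
From mathcomp Require Import all_classical all_reals all_analysis.
From mathcomp Require Import measurable_realfun.
From mathcomp Require Import zify ring lra.
From mathcomp Require mpoly.
(* Imported again: measurable_realfun also defines measurable_ball. *)
Require Import Defs.

Set Implicit Arguments.
Unset Strict Implicit.
Unset Printing Implicit Defensive.

Import Order.TTheory GRing.Theory Num.Theory.
Import numFieldNormedType.Exports.

Local Open Scope classical_set_scope.
Local Open Scope ring_scope.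

(** * Moment sequences and a Muntz theorem *)

(** The Muntz theorem speaks of exponents i >= 1 only: for a point mass at the origin all moments
    but the one of index 0 vanish. This is why every conclusion about moments is drawn after
    multiplication by |z_1 ... z_n|^2, which is nonzero almost everywhere. Products of two moment
    sequences enter because eigenvalues are quotients of moments, and only their cross-multiplied
    differences are again moment sequences.

    Since f is merely square integrable and g is known only up to a null set, operators are handled
    through their coefficients against monomials. For this the Bergman projection has to exist and
    to be determined by these coefficients: it is built as the sum of a Fourier series in monomials,
    which are complete because the mean of a holomorphic function over a torus, divided by the
    matching monomial of the radii, does not depend on the radii. Averages over the torus use the
    phases of a point distributed by the rotation invariant nu_alpha.

    The rigidity of the eigenvalues must cope with degrees in which all of them vanish, and with n =
    1, where no shift preserves the degree. *)

Section Muntz.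
Variable R : realType.
Local Notation C := R[i].
Local Notation normc := (@Normc.normc R).

Lemma normcE (z : C) : `|z| = (normc z)%:C%C.
Proof. by case: z. Qed.

Lemma normc_ge0 (z : C) : 0 <= normc z.
Proof. by rewrite -lecR -normcE normr_ge0. Qed.

Lemma normc_real (x : R) : normc x%:C%C = `|x|.
Proof. by rewrite /Normc.normc /= expr0n addr0 sqrtr_sqr. Qed.

Lemma normc_sum (I : Type) (r : seq I) (P : pred I) (F : I -> C) :
  normc (\sum_(i <- r | P i) F i) <= \sum_(i <- r | P i) normc (F i).
Proof.
elim/big_rec2 : _ => [|i y x _ le]; first by rewrite Normc.normc0.
by apply: (le_trans (le_normcD _ _)); rewrite lerD2l.
Qed.

Lemma normcX (z : C) k : normc (z ^+ k) = normc z ^+ k.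
Proof. by elim: k => [|k ih]; rewrite ?expr0 ?Normc.normc1// !exprS Normc.normcM ih. Qed.

Definition poly_pair (K : nat -> C) (p : {poly C}) : C :=
  \sum_(i < size p) p`_i * K i.

Lemma poly_pairE K (p : {poly C}) N : (size p <= N)%N ->
  poly_pair K p = \sum_(i < N) p`_i * K i.
Proof.
move=> pN; rewrite /poly_pair (big_ord_widen _ (fun i => p`_i * K i) pN).
rewrite big_mkcond /=; apply: eq_bigr => i _; case: ltnP => // h.
by rewrite nth_default // mul0r.
Qed.

(* K extends to a bounded functional on the polynomials of C([0, 1]), i.e. K is
   the sequence of moments of a complex measure on [0, 1]. *)
Definition moment_seq (K : nat -> C) := exists2 A : R, 0 <= A &
  forall (p : {poly C}) (B : R), 0 <= B ->
    (forall r : R, 0 <= r <= 1 -> normc p.[r%:C%C] <= B) ->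
    normc (poly_pair K p) <= A * B.

Lemma moment_seqD K1 K2 : moment_seq K1 -> moment_seq K2 ->
  moment_seq (fun i => K1 i + K2 i).
Proof.
move=> [A1 A10 h1] [A2 A20 h2]; exists (A1 + A2); first exact: addr_ge0.
move=> p B B0 pB; rewrite (_ : poly_pair _ _ = poly_pair K1 p + poly_pair K2 p).
  by rewrite mulrDl (le_trans (le_normcD _ _))// lerD ?h1 ?h2.
by rewrite /poly_pair -big_split; apply: eq_bigr => i _; rewrite mulrDr.
Qed.

(** These are the moments of the multiplicative convolution, the image of the product of two
    measures under (r, t) -> r t. The two bounds are applied in turn to p(r t), which stays within B
    because r t is again in [0, 1]. *)
Lemma moment_seqM K1 K2 : moment_seq K1 -> moment_seq K2 ->
  moment_seq (fun i => K1 i * K2 i).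
Proof.
move=> [A1 A10 h1] [A2 A20 h2]; exists (A1 * A2); first exact: mulr_ge0.
move=> p B B0 pB.
rewrite (_ : poly_pair _ _ = poly_pair K1 (\poly_(i < size p) (p`_i * K2 i))).
  rewrite -mulrA; apply: h1 => [|r r01]; first exact: mulr_ge0.
  rewrite horner_poly.
  rewrite (_ : \sum_(i < _) _ =
      poly_pair K2 (\poly_(i < size p) (p`_i * r%:C%C ^+ i))).
    apply: h2 => // t t01; rewrite horner_poly.
    rewrite (_ : \sum_(i < _) _ = p.[(r * t)%:C%C]).
      by apply: pB; rewrite mulr_ge0 ?mulr_ile1//; case/andP: r01; case/andP: t01.
    by rewrite horner_coef rmorphM; apply: eq_bigr => i _; rewrite exprMn mulrA.
  rewrite (poly_pairE _ (size_poly _ _)); apply: eq_bigr => i _.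
  by rewrite coef_poly ltn_ord mulrAC.
rewrite (poly_pairE _ (size_poly _ _)); apply: eq_bigr => i _.
by rewrite coef_poly ltn_ord mulrAC mulrA.
Qed.

Lemma moment_seqZ a K : moment_seq K -> moment_seq (fun i => a * K i).
Proof.
move=> [A A0 h]; exists (normc a * A); first by rewrite mulr_ge0 ?normc_ge0.
move=> p B B0 pB; rewrite (_ : poly_pair _ _ = a * poly_pair K p).
  by rewrite Normc.normcM -mulrA ler_wpM2l ?normc_ge0 ?h.
by rewrite /poly_pair mulr_sumr; apply: eq_bigr => i _; rewrite mulrCA.
Qed.

Lemma moment_seqB K1 K2 : moment_seq K1 -> moment_seq K2 ->
  moment_seq (fun i => K1 i - K2 i).
Proof.
move=> h1 h2; have := moment_seqD h1 (moment_seqZ (-1) h2).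
by under eq_fun do rewrite mulN1r.
Qed.

(** The Muntz condition: the reciprocals of the elements of S have divergent sum. The index 0
    contributes nothing, since its inverse is 0. *)
Definition thick (S : nat -> Prop) := forall A : R,
  exists N, A <= \sum_(i < N | `[< S i >]) (i%:R)^-1.

Lemma thickP S : ~ thick S ->
  exists A : R, forall N, \sum_(i < N | `[< S i >]) (i%:R)^-1 <= A.
Proof.
move=> /existsNP[A h]; exists A => N; rewrite leNgt; apply/negP => lt.
by apply: h; exists N; exact: ltW.
Qed.

Lemma thickT : thick (fun=> True).
Proof.
move=> A.
have h : (series (@harmonic R)) @ \oo --> +oo.
  have := @dvg_harmonic R.
  have : nondecreasing_seq (series (@harmonic R)).
    by apply/nondecreasing_series => i _ _; exact: harmonic_ge0.
  move=> nd; case: (pselect (has_ubound (range (series (@harmonic R))))).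
    by move=> ub dv; exfalso; apply: dv; exact: nondecreasing_is_cvgn.
  by move=> _ dv; exact: nondecreasing_dvgn_lt.
have /cvgryPge /(_ A) [N _ hN] := h.
exists N.+1; have := hN N (leqnn N); rewrite /series /= => /le_trans; apply.
rewrite big_mkord (eq_bigl predT); last by move=> i; apply/asboolP.
by rewrite big_ord_recl /= invr0 add0r; apply: ler_sum => i _.
Qed.

(** Two bounded sums of reciprocals would add up to a bound for the harmonic series. *)
Lemma thickU S1 S2 : (forall i, (0 < i)%N -> S1 i \/ S2 i) ->
  thick S1 \/ thick S2.
Proof.
move=> hU; apply: contrapT => /not_orP[/thickP[A1 h1] /thickP[A2 h2]].
have [N] := thickT (A1 + A2 + 1); apply/negP; rewrite -ltNge.
rewrite (le_lt_trans (y := A1 + A2)) ?ltrDl//.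
apply: le_trans (lerD (h1 N) (h2 N)).
rewrite (eq_bigl predT); last by move=> i; apply/asboolP.
rewrite [X in _ <= X + _]big_mkcond [X in _ <= _ + X]big_mkcond -big_split /=.
apply: ler_sum => -[[|i] iN] _ /=; first by rewrite invr0; do 2!case: ifP => _; rewrite addr0.
have v0 : 0 <= i.+1%:R^-1 :> R by rewrite invr_ge0.
have [/asboolP ->|/asboolP ->] := hU i.+1 isT.
  by rewrite lerDl; case: ifP.
by rewrite lerDr; case: ifP.
Qed.

(** a + i b <= (a + b) i for i >= 1, so a + b times the sum over the progression dominates the
    harmonic sum. *)
Lemma thick_arith (S : nat -> Prop) a b : (0 < b)%N ->
  (forall i, S (a + i * b)%N) -> thick S.
Proof.
move=> b0 Sab A.
have [N hN] := thickT ((a + b)%:R * A).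
have ab0 : (0 : R) < (a + b)%:R by rewrite ltr0n addn_gt0 b0 orbT.
exists (a + N * b)%N; rewrite -(ler_pM2l ab0) (le_trans hN)// => {hN}.
rewrite (eq_bigl predT); last by move=> i; apply/asboolP.
elim: N => [|N ih].
  by rewrite big_ord0 mulr_ge0 ?sumr_ge0.
rewrite big_ord_recr /= (_ : a + N.+1 * b = a + N * b + b)%N; last by rewrite mulSn; lia.
rewrite big_split_ord /= mulrDr lerD//.
case: b b0 Sab ab0 {ih} => // b _ Sab ab0.
rewrite (bigD1 ord0) /=; last by rewrite addn0; apply/asboolP; exact: Sab.
rewrite mulrDr addn0.
rewrite -[X in X <= _]addr0 lerD ?mulr_ge0 ?sumr_ge0//.
case: N => [|N]; first by rewrite invr0 mulr_ge0.
rewrite ler_pdivlMr; last by rewrite ltr0n mulSn; lia.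
rewrite mulrC ler_pdivrMr ?ltr0n// -natrM ler_nat; nia.
Qed.

(* One step of von Golitschek's construction. *)
Lemma golitschek_step (p : {poly R}) (l : nat) (B : R) :
  (0 < l)%N -> p`_l = 0 -> p`_0 = 0 ->
  (forall x : R, 0 <= x <= 1 -> `|p.[x]| <= B) ->
  exists r : {poly R}, [/\ forall x : R, 0 <= x <= 1 -> `|r.[x]| <= B / l%:R,
    r`_0 = 0 &
    forall i, i != l -> r`_i = p`_i / (l%:R - i%:R)].
Proof.
move=> l0 pl p0 pB.
(* [r] is x^l times the integral from x to 1 of p(t) t^(-l-1), the solution of x r' - l r = -p that
   vanishes at 1. The term i = l is 0. *)
pose r : {poly R} := \sum_(i < size p) (p`_i / (l%:R - i%:R)) *: ('X^i - 'X^l).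
have ri i : i != l -> r`_i = p`_i / (l%:R - i%:R).
  move=> il; rewrite coef_sum.
  under eq_bigr do rewrite coefZ coefB !coefXn (negbTE il) subr0.
  have [ip|ip] := ltnP i (size p).
    rewrite (bigD1 (Ordinal ip)) //= eqxx mulr1 big1 ?addr0// => j.
    by rewrite -val_eqE /= eq_sym => /negbTE ->; rewrite mulr0.
  rewrite nth_default // mul0r big1// => j _.
  case: eqP => [ij|]; last by rewrite mulr0.
  by move: ip; rewrite ij leqNgt ltn_ord.
have r0 : r`_0 = 0 by rewrite ri ?p0 ?mul0r// eq_sym -lt0n.
have ode x : x * r^`().[x] - l%:R * r.[x] = - p.[x].
  have : 'X * r^`() - l%:R *: r = - p.
    apply/polyP => -[|i]; rewrite coefB coefXM coefZ coefN /=.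
      by rewrite r0 p0 mulr0 subr0 oppr0.
    rewrite coef_deriv -[_ *+ i.+1]mulr_natl -mulrBl.
    have [il|il] := eqVneq i.+1 l; first by rewrite il pl subrr mul0r oppr0.
    rewrite ri // -opprB mulNr mulrC divfK//.
    by rewrite subr_eq0 eqr_nat eq_sym.
  by move=> /(congr1 (fun p => p.[x])); rewrite !hornerE.
have rx0 : r.[0] = 0 by rewrite horner_coef0.
have rx1 : r.[1] = 0.
  rewrite /r horner_sum big1// => i _.
  by rewrite !hornerE !expr1n subrr mulr0.
exists r; split => //.
have lr0 : (0 : R) < l%:R by rewrite ltr0n.
(* At an interior maximum u' = 0, so the equation gives l u = v <= B there; at both ends u is 0. The
   lower bound for r is this bound for -r. *)
have main (u v : {poly R}) : (forall x, x * u^`().[x] - l%:R * u.[x] = - v.[x]) ->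
    u.[0] = 0 -> u.[1] = 0 -> (forall x, 0 <= x <= 1 -> v.[x] <= B) ->
    forall x, 0 <= x <= 1 -> u.[x] <= B / l%:R.
  move=> odeu u0 u1 vB x x01.
  have B0 : 0 <= B by apply: le_trans (normr_ge0 _) (pB 0 _); rewrite lexx ler01.
  have [|c] := @EVT_max R (horner u) 0 1 ler01.
    exact/continuous_subspaceT/continuous_horner.
  rewrite in_itv /= => /andP[c0 c1] cmax.
  apply: (le_trans (cmax x _)); first by rewrite in_itv.
  have [->|cn0] := eqVneq c 0; first by rewrite u0 divr_ge0.
  have [->|cn1] := eqVneq c 1; first by rewrite u1 divr_ge0.
  have cI : c \in `]0, 1[%R by rewrite in_itv /= !lt_neqAle eq_sym cn0 c0 cn1.
  have dc0 : u^`().[c] = 0.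
    have [_ <-] : is_derive c 1 (horner u) 0.
      apply: (@derive1_at_max _ _ 0 1 c ler01 _ cI) => t.
        by move=> _; exact: derivable_horner.
      rewrite in_itv /= => /andP[t0 t1]; apply: cmax.
      by rewrite in_itv /= !ltW.
    by rewrite derivE derive1E.
  have := odeu c; rewrite dc0 mulr0 sub0r => /oppr_inj h.
  by rewrite ler_pdivlMr// mulrC h vB// c0.
move=> x x01; rewrite ler_norml; apply/andP; split.
  rewrite lerNl -hornerN; apply: (main _ (- p)) => //.
  - by move=> y; rewrite derivN !hornerN !mulrN -ode opprB opprK addrC.
  - by rewrite hornerN rx0 oppr0.
  - by rewrite hornerN rx1 oppr0.
  by move=> y y01; rewrite hornerN (le_trans _ (pB _ y01))// -normrN ler_norm.
apply: (main _ p) => // y y01.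
by rewrite (le_trans _ (pB _ y01))// ler_norm.
Qed.

(** Each exponent N of S is added by [golitschek_step], which divides the bound by N and the
    coefficient at q by N - q; rescaling by N - q restores that coefficient to 1 and leaves the
    factor |1 - q/N|. Coefficients at exponents in S are left free, since the sequence to be tested
    vanishes there. *)
Lemma golitschek (S : nat -> Prop) (q N : nat) : (0 < q)%N -> ~ S q ->
  exists p : {poly R}, [/\ p`_q = 1, p`_0 = 0,
    forall i, i != q -> p`_i != 0 -> S i /\ (i < N)%N &
    forall x : R, 0 <= x <= 1 ->
      `|p.[x]| <= \prod_(i < N | `[< S i >]) `|1 - q%:R / i%:R|].
Proof.
move=> q0 Sq; elim: N => [|N [p [pq p0 pS pB]]].
  exists 'X^q; split; rewrite ?coefXn ?eqxx//.
  - by rewrite eq_sym gtn_eqF.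
  - by move=> i iq; rewrite coefXn (negbTE iq) eqxx.
  move=> x /andP[x0 x1]; rewrite hornerXn big_ord0 ger0_norm ?exprn_ge0//.
  exact: exprn_ile1.
rewrite big_mkcond big_ord_recr -big_mkcond /=; case: asboolP => SN; last first.
  exists p; split => //; first by move=> i iq /(pS _ iq)[? /ltnW].
  by move=> x x01; rewrite mulr1 pB.
(* If N = 0 lies in S, its factor in the product is 1 because the inverse of 0 is 0, and the
   polynomial is kept. *)
have [N0|N0] := posnP N.
  exists p; split => //; first by move=> i iq /(pS _ iq)[? /ltnW].
  have NR0 : N%:R = 0 :> R by rewrite N0.
  by move=> x x01; rewrite NR0 invr0 mulr0 subr0 normr1 mulr1 pB.
have Nq : N != q by apply/eqP => h; rewrite h in SN.
have pN : p`_N = 0.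
  by apply/eqP/negPn/negP => /(pS _ Nq)[_]; rewrite ltnn.
have [r [rB r0 ri]] := golitschek_step N0 pN p0 pB.
have NqR : N%:R - q%:R != 0 :> R by rewrite subr_eq0 eqr_nat.
exists ((N%:R - q%:R) *: r); split.
- by rewrite coefZ ri 1?eq_sym// pq mul1r divff.
- by rewrite coefZ r0 mulr0.
- move=> i iq; rewrite coefZ mulf_eq0 negb_or NqR /=.
  have [->//|iN] := eqVneq i N.
  by rewrite ri// mulf_eq0 negb_or => /andP[/(pS _ iq)[? /ltnW]].
move=> x x01; rewrite hornerZ normrM.
have NR0 : N%:R != 0 :> R by rewrite pnatr_eq0 -lt0n.
rewrite (_ : 1 - q%:R / N%:R = (N%:R - q%:R) / N%:R); last first.
  by rewrite mulrBl divff.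
rewrite normrM mulrCA ler_wpM2l//.
rewrite (ger0_norm (_ : 0 <= N%:R^-1)) ?invr_ge0//.
exact: rB.
Qed.

(** The polynomial of [golitschek] pairs with K to exactly K q, because K vanishes on S. Its
    supremum norm is at most a product of |1 - q/i| over S, which tends to 0 as the sum of the 1/i
    diverges. *)
Lemma muntz (K : nat -> C) (S : nat -> Prop) (q : nat) : moment_seq K ->
  thick S -> (forall i, S i -> K i = 0) -> (0 < q)%N -> K q = 0.
Proof.
move=> [A A0 KA] tS KS q0; apply: contrapT => Kq.
have Sq : ~ S q by move=> /KS.
(* For i > q, |1 - q/i| <= 1 - 1/i <= exp(-1/i). The finitely many factors with i <= q, at most 1 +
   q each, are absorbed in [a], whose factor e makes up for exp(-1/i). *)
pose a (i : nat) : R := if (i <= q)%N then (1 + q%:R) * expR 1 else 1.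
have a1 i : 1 <= a i.
  rewrite /a; case: ifP => // _.
  have e1 : 1 <= expR 1 :> R by rewrite -[leLHS]expR0 ler_expR.
  by rewrite -[leLHS]mul1r ler_pM// lerDl.
have bnd i : `|1 - q%:R / i%:R| <= a i * expR (- i%:R^-1) :> R.
  case: i => [|i]; first by rewrite invr0 mulr0 subr0 normr1 oppr0 expR0 mulr1 a1.
  have i0 : (0 : R) < i.+1%:R by rewrite ltr0n.
  rewrite /a; case: ifPn => iq.
    have h1 : `|1 - q%:R / i.+1%:R| <= 1 + q%:R :> R.
      rewrite (le_trans (ler_normB _ _))// normr1 lerD2l ger0_norm//.
      by rewrite ler_pdivrMr// ler_peMr// ler1n.
    rewrite (le_trans h1)// -mulrA ler_peMr// -expRD -[leLHS]expR0 ler_expR.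
    by rewrite subr_ge0 invf_le1// ler1n.
  rewrite mul1r ger0_norm; last first.
    by rewrite subr_ge0 ler_pdivrMr// mul1r ler_nat ltnW// ltnNge.
  apply: le_trans (expR_ge1Dx _); rewrite lerD2l lerN2.
  by rewrite ler_peMl ?invr_ge0// ler1n.
pose D : R := ((1 + q%:R) * expR 1) ^+ q.+1.
have e1 : 1 <= (1 + q%:R) * expR 1 :> R by have := a1 0; rewrite /a leq0n.
have D0 : 0 <= D by rewrite exprn_ge0// (le_trans _ e1).
have prodD N : \prod_(i < N | `[< S i >]) a i <= D.
  apply: (@le_trans _ _ (((1 + q%:R) * expR 1) ^+ minn N q.+1)); last first.
    by rewrite /D ler_weXn2l// geq_minr.
  elim: N => [|N ih]; first by rewrite big_ord0 min0n expr0.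
  rewrite big_mkcond big_ord_recr -big_mkcond /=.
  have [Nq|Nq] := leqP N q.
    rewrite (_ : minn N.+1 q.+1 = (minn N q.+1).+1); last by lia.
    rewrite exprSr ler_pM ?prodr_ge0//.
    - by move=> i _; rewrite (le_trans _ (a1 i)).
    - by case: ifP => // _; rewrite (le_trans _ (a1 N)).
    by case: ifP => // _; rewrite /a Nq.
  rewrite (_ : minn N.+1 q.+1 = minn N q.+1); last by lia.
  by rewrite /a leqNgt Nq /= if_same mulr1.
have prodB N : \prod_(i < N | `[< S i >]) `|1 - q%:R / i%:R| <=
    D * expR (- \sum_(i < N | `[< S i >]) (i%:R)^-1).
  apply: (@le_trans _ _ (\prod_(i < N | `[< S i >]) (a i * expR (- i%:R^-1)))).
    by apply: ler_prod => i _; rewrite normr_ge0 bnd.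
  by rewrite big_split /= -sumrN expR_sum ler_wpM2r ?prodD// prodr_ge0// => i _; rewrite expR_ge0.
have hq N : normc (K q) <= A * (D * expR (- \sum_(i < N | `[< S i >]) (i%:R)^-1)).
  have [p [pq p0 pS pB]] := golitschek N q0 Sq.
  have -> : K q = poly_pair K (map_poly (real_complex R) p).
    have qp : (q < size p)%N.
      by rewrite ltnNge; apply/negP => /(nth_default 0); rewrite pq => /eqP; rewrite oner_eq0.
    rewrite (@poly_pairE _ _ (size p)) ?size_poly// (bigD1 (Ordinal qp))//= coef_map /= pq rmorph1 mul1r.
    rewrite big1 ?addr0// => i; rewrite -val_eqE /= => iq; rewrite coef_map /=.
    have [->|pi] := eqVneq p`_i 0; first by rewrite rmorph0 mul0r.
    by have [/KS -> _] := pS _ iq pi; rewrite mulr0.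
  apply: KA => [|r r01]; first by rewrite mulr_ge0 ?expR_ge0.
  by rewrite horner_map normc_real (le_trans (pB _ r01)).
have k0 : 0 < normc (K q).
  rewrite lt_neqAle normc_ge0 andbT eq_sym; apply/eqP => /Normc.eq0_normc.
  exact: Kq.
have [N hN] := tS ((A * D + 1) / normc (K q)).
have := hq N; apply/negP; rewrite -ltNge mulrA.
set M := \sum_(i < N | _) _ in hN *.
have M0 : 0 <= M by rewrite sumr_ge0.
rewrite expRN; apply: (@le_lt_trans _ _ (A * D / (1 + M))).
  rewrite ler_wpM2l ?mulr_ge0// lef_pV2 ?posrE ?expR_gt0 ?expR_ge1Dx//.
  by rewrite ltr_pwDl.
rewrite ltr_pdivrMr ?ltr_pwDl//; move: hN; rewrite ler_pdivrMr// => hN.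
by rewrite mulrDr mulr1 [_ * M]mulrC; lra.
Qed.

(** The zero sets of the two sequences cover the positive integers, so one of them is thick and
    [muntz] applies to it. *)
Lemma moment_seq_mul0 K1 K2 : moment_seq K1 -> moment_seq K2 ->
  (forall i, (0 < i)%N -> K1 i * K2 i = 0) ->
  (forall i, (0 < i)%N -> K1 i = 0) \/ (forall i, (0 < i)%N -> K2 i = 0).
Proof.
move=> h1 h2 h12.
have [|t|t] := @thickU (fun i => K1 i = 0) (fun i => K2 i = 0).
- by move=> i /h12/eqP; rewrite mulf_eq0 => /orP[/eqP|/eqP]; [left|right].
- by left => i i0; apply: (muntz h1 t).
- by right => i i0; apply: (muntz h2 t).
Qed.

End Muntz.

(** * Integrals of complex-valued functions *)

Section complex_parts.
Variable R : realType.
Implicit Types u v : R[i].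
Local Notation Re := (@complex.Re R).
Local Notation Im := (@complex.Im R).
Local Notation normc := (@Normc.normc R).

Lemma creD u v : Re (u + v) = Re u + Re v. Proof. by case: u v => ? ? []. Qed.
Lemma cimD u v : Im (u + v) = Im u + Im v. Proof. by case: u v => ? ? []. Qed.
Lemma creN u : Re (- u) = - Re u. Proof. by case: u. Qed.
Lemma cimN u : Im (- u) = - Im u. Proof. by case: u. Qed.
Lemma creM u v : Re (u * v) = Re u * Re v - Im u * Im v. Proof. by case: u v => ? ? []. Qed.
Lemma cimM u v : Im (u * v) = Re u * Im v + Im u * Re v. Proof. by case: u v => ? ? []. Qed.
Lemma creJ u : Re (conjc u) = Re u. Proof. by case: u. Qed.
Lemma cimJ u : Im (conjc u) = - Im u. Proof. by case: u. Qed.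
Definition ReImE := (creD, cimD, creN, cimN, creM, cimM, creJ, cimJ).

Lemma normc_sqrt u : normc u = Num.sqrt (Re u ^+ 2 + Im u ^+ 2). Proof. by case: u. Qed.

Lemma normc_sqr u : normc u ^+ 2 = Re u ^+ 2 + Im u ^+ 2.
Proof. by rewrite normc_sqrt sqr_sqrtr// addr_ge0 ?sqr_ge0. Qed.

Lemma normcJ u : normc (conjc u) = normc u.
Proof. by rewrite !normc_sqrt creJ cimJ sqrrN. Qed.

Lemma mulcJ u : u * conjc u = (normc u ^+ 2)%:C%C.
Proof.
rewrite normc_sqr; apply/eqP; rewrite eq_complex; case: u => a b /=.
by rewrite mulrN opprK -!expr2 eqxx/= mulrN mulrC addNr.
Qed.

Lemma Re_le_normc u : `|Re u| <= normc u.
Proof.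
rewrite -ler_sqr ?nnegrE ?normc_ge0// normc_sqr real_normK ?num_real//.
by rewrite lerDl sqr_ge0.
Qed.

Lemma Im_le_normc u : `|Im u| <= normc u.
Proof.
rewrite -ler_sqr ?nnegrE ?normc_ge0// normc_sqr real_normK ?num_real//.
by rewrite lerDr sqr_ge0.
Qed.

Lemma normc_le_ReIm u : normc u <= `|Re u| + `|Im u|.
Proof.
rewrite -ler_sqr ?nnegrE ?normc_ge0 ?addr_ge0// normc_sqr sqrrD !real_normK ?num_real//.
by rewrite lerD2r lerDl mulrn_wge0// mulr_ge0.
Qed.

Lemma normc_eq0 u : (normc u == 0) = (u == 0).
Proof.
apply/eqP/eqP => [/Normc.eq0_normc//|->]; exact: Normc.normc0.
Qed.

Lemma normc_gt0 u : (0 < normc u) = (u != 0).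
Proof. by rewrite lt_neqAle normc_ge0 andbT eq_sym normc_eq0. Qed.

Lemma normcB u v : normc (u - v) = normc (v - u).
Proof. by rewrite -normcN opprB. Qed.

Lemma normc_prod (I : Type) (r : seq I) (P : pred I) (F : I -> R[i]) :
  normc (\prod_(i <- r | P i) F i) = \prod_(i <- r | P i) normc (F i).
Proof.
by apply: (big_morph _ (@Normc.normcM R)); rewrite Normc.normc1.
Qed.

End complex_parts.

Section complex_measurable.
Context d (T : measurableType d) (R : realType).
Implicit Types u v : T -> R[i].
Local Notation Re := (@complex.Re R).
Local Notation Im := (@complex.Im R).
Local Notation normc := (@Normc.normc R).

Definition cmeas u := measurable_fun setT (fun x => Re (u x)) /\
  measurable_fun setT (fun x => Im (u x)).

Lemma cmeas_cst c : cmeas (fun=> c).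
Proof. by split; exact: measurable_cst. Qed.

Lemma cmeas_real (f : T -> R) : measurable_fun setT f -> cmeas (fun x => (f x)%:C%C).
Proof. by move=> mf; split => //; exact: measurable_cst. Qed.

Lemma cmeasD u v : cmeas u -> cmeas v -> cmeas (fun x => u x + v x).
Proof.
move=> [u1 u2] [v1 v2]; split.
  by under eq_fun do rewrite creD; exact: measurable_funD.
by under eq_fun do rewrite cimD; exact: measurable_funD.
Qed.

Lemma cmeasM u v : cmeas u -> cmeas v -> cmeas (fun x => u x * v x).
Proof.
move=> [u1 u2] [v1 v2]; split.
  by under eq_fun do rewrite creM; apply: measurable_funB; apply: measurable_funM.
by under eq_fun do rewrite cimM; apply: measurable_funD; apply: measurable_funM.
Qed.

Lemma cmeasZ c u : cmeas u -> cmeas (fun x => c * u x).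
Proof. exact/cmeasM/cmeas_cst. Qed.

Lemma cmeasN u : cmeas u -> cmeas (fun x => - u x).
Proof. by move=> /(cmeasZ (-1)); under eq_fun do rewrite mulN1r. Qed.

Lemma cmeasB u v : cmeas u -> cmeas v -> cmeas (fun x => u x - v x).
Proof. by move=> mu /cmeasN; exact: cmeasD. Qed.

Lemma cmeasJ u : cmeas u -> cmeas (fun x => conjc (u x)).
Proof.
move=> [u1 u2]; split; first by under eq_fun do rewrite creJ.
by under eq_fun do rewrite cimJ; exact: measurableT_comp.
Qed.

Lemma cmeasX u k : cmeas u -> cmeas (fun x => u x ^+ k).
Proof.
move=> mu; elim: k => [|k ih]; first by under eq_fun do rewrite expr0; exact: cmeas_cst.
by under eq_fun do rewrite exprS; exact: cmeasM.
Qed.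

Lemma cmeas_prod (I : Type) (r : seq I) (F : I -> T -> R[i]) :
  (forall i, cmeas (F i)) -> cmeas (fun x => \prod_(i <- r) F i x).
Proof.
move=> mF; elim: r => [|i r ih]; first by under eq_fun do rewrite big_nil; exact: cmeas_cst.
by under eq_fun do rewrite big_cons; exact: cmeasM.
Qed.

Lemma cmeas_sum (I : Type) (r : seq I) (F : I -> T -> R[i]) :
  (forall i, cmeas (F i)) -> cmeas (fun x => \sum_(i <- r) F i x).
Proof.
move=> mF; elim: r => [|i r ih]; first by under eq_fun do rewrite big_nil; exact: cmeas_cst.
by under eq_fun do rewrite big_cons; exact: cmeasD.
Qed.

Lemma measurable_normc u : cmeas u -> measurable_fun setT (fun x => normc (u x)).
Proof.
move=> [u1 u2]; under eq_fun do rewrite normc_sqrt -powR12_sqrt ?addr_ge0 ?sqr_ge0//.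
apply: (measurableT_comp (measurable_powR _)).
by apply: measurable_funD; exact: measurable_funX.
Qed.

Lemma cmeas_cvg (v : nat -> T -> R[i]) u : (forall k, cmeas (v k)) ->
  (forall x, normc (v k x - u x) @[k --> \oo] --> (0 : R)) -> cmeas u.
Proof.
move=> mv vu.
have h (P : R[i] -> R) : (forall a b, P (a - b) = P a - P b) ->
    (forall a, `|P a| <= normc a) -> forall x, P (v k x) @[k --> \oo] --> P (u x).
  move=> PB Pn x; apply/cvgrPdist_le => e e0.
  have /cvgrPdist_le /(_ e e0) := vu x; apply: filterS => k.
  rewrite sub0r normrN ger0_norm ?normc_ge0// distrC -PB.
  by move=> h; rewrite (le_trans (Pn _)).
split; [apply: (@measurable_fun_cvg _ _ _ setT (fun k x => Re (v k x)))|
  apply: (@measurable_fun_cvg _ _ _ setT (fun k x => Im (v k x)))] => //.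
- by move=> k; have [] := mv k.
- by move=> x _; refine (h Re _ _ x) => [a b|a]; rewrite ?ReImE// Re_le_normc.
- by move=> k; have [] := mv k.
- by move=> x _; refine (h Im _ _ x) => [a b|a]; rewrite ?ReImE// Im_le_normc.
Qed.

End complex_measurable.

Lemma cmeas_comp d1 d2 (T1 : measurableType d1) (T2 : measurableType d2) (R : realType)
  (u : T2 -> R[i]) (phi : T1 -> T2) : cmeas u -> measurable_fun setT phi ->
  cmeas (fun x => u (phi x)).
Proof.
move=> [u1 u2] mp; split.
  by rewrite -[X in measurable_fun _ X]/((fun y => complex.Re (u y)) \o phi); exact: measurableT_comp.
by rewrite -[X in measurable_fun _ X]/((fun y => complex.Im (u y)) \o phi); exact: measurableT_comp.
Qed.

Section cint.
Context d (T : measurableType d) (R : realType).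
Variable m : {measure set T -> \bar R}.
Implicit Types u v : T -> R[i].
Local Notation Re := (@complex.Re R).
Local Notation Im := (@complex.Im R).
Local Notation normc := (@Normc.normc R).
Local Notation itg f := (m.-integrable setT (EFin \o f)).

Definition cint u : R[i] :=
  ((\int[m]_x Re (u x))%R +i* (\int[m]_x Im (u x))%R)%C.

Definition cintg u := cmeas u /\ itg (fun x => normc (u x)).

Lemma cintgP u : cintg u -> itg (fun x => Re (u x)) /\ itg (fun x => Im (u x)).
Proof.
move=> [[u1 u2] iu]; split; apply: (le_integrable _ _ _ iu) => //.
- exact/measurable_EFinP.
- by move=> x _ /=; rewrite lee_fin [leRHS]ger0_norm ?normc_ge0 ?Re_le_normc.
- exact/measurable_EFinP.
- by move=> x _ /=; rewrite lee_fin [leRHS]ger0_norm ?normc_ge0 ?Im_le_normc.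
Qed.

Lemma le_cintg u (b : T -> R) : cmeas u -> (forall x, normc (u x) <= b x) ->
  itg b -> cintg u.
Proof.
move=> mu ub ib; split => //; apply: (le_integrable _ _ _ ib) => //.
  by apply/measurable_EFinP; exact: measurable_normc.
by move=> x _ /=; rewrite lee_fin ger0_norm ?normc_ge0// (le_trans (ub x))// ler_norm.
Qed.

Lemma le_cintg2 u v : cmeas u -> (forall x, normc (u x) <= normc (v x)) ->
  cintg v -> cintg u.
Proof. by move=> mu uv [_ iv]; apply: le_cintg iv. Qed.

Lemma cintgD u v : cintg u -> cintg v -> cintg (fun x => u x + v x).
Proof.
move=> [mu iu] [mv iv]; apply: (@le_cintg _ (fun x => normc (u x) + normc (v x))).
- exact: cmeasD.
- by move=> x; exact: le_normcD.
- by have := integrableD measurableT iu iv.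
Qed.

Lemma cintgZ c u : cintg u -> cintg (fun x => c * u x).
Proof.
move=> [mu iu]; apply: (@le_cintg _ (fun x => normc c * normc (u x))).
- exact: cmeasZ.
- by move=> x; rewrite Normc.normcM.
- by have := integrableZl measurableT (normc c) iu.
Qed.

Lemma cintgN u : cintg u -> cintg (fun x => - u x).
Proof. by move=> /(cintgZ (-1)); under eq_fun do rewrite mulN1r. Qed.

Lemma cintgB u v : cintg u -> cintg v -> cintg (fun x => u x - v x).
Proof. by move=> mu /cintgN; exact: cintgD. Qed.

Lemma cintg0 : cintg (fun=> 0).
Proof.
split; first exact: cmeas_cst.
rewrite (_ : _ \o _ = cst 0%E); first exact: integrable0.
by apply/funext => x; congr EFin; exact: Normc.normc0.
Qed.

Lemma cintg_sum (I : Type) (r : seq I) (F : I -> T -> R[i]) :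
  (forall i, cintg (F i)) -> cintg (fun x => \sum_(i <- r) F i x).
Proof.
move=> mF; elim: r => [|i r ih]; first by under eq_fun do rewrite big_nil; exact: cintg0.
by under eq_fun do rewrite big_cons; exact: cintgD.
Qed.

Lemma cintD u v : cintg u -> cintg v ->
  cint (fun x => u x + v x) = cint u + cint v.
Proof.
move=> /cintgP[u1 u2] /cintgP[v1 v2]; rewrite /cint.
under eq_Rintegral do rewrite creD; under [X in (_ +i* X)%C]eq_Rintegral do rewrite cimD.
by rewrite !RintegralD.
Qed.

Lemma cintZ c u : cintg u -> cint (fun x => c * u x) = c * cint u.
Proof.
move=> /cintgP[u1 u2]; rewrite /cint.
under eq_Rintegral do rewrite creM; under [X in (_ +i* X)%C]eq_Rintegral do rewrite cimM.
have h (a : R) f : itg f -> itg (fun x => a * f x) by move=> /(integrableZl measurableT a).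
rewrite RintegralB ?RintegralD ?h// !RintegralZl//.
by case: c => a b.
Qed.

Lemma cintN u : cintg u -> cint (fun x => - u x) = - cint u.
Proof.
by move=> iu; rewrite -mulN1r -cintZ//; under [in RHS]eq_fun do rewrite mulN1r.
Qed.

Lemma cintB u v : cintg u -> cintg v ->
  cint (fun x => u x - v x) = cint u - cint v.
Proof. by move=> iu iv; rewrite cintD ?cintN//; exact: cintgN. Qed.

Lemma cint0 : cint (fun=> 0) = 0.
Proof. by rewrite /cint /Rintegral /= integral0. Qed.

Lemma cint_sum (I : Type) (r : seq I) (F : I -> T -> R[i]) :
  (forall i, cintg (F i)) ->
  cint (fun x => \sum_(i <- r) F i x) = \sum_(i <- r) cint (F i).
Proof.
move=> mF; elim: r => [|i r ih].
  by under eq_fun do rewrite big_nil; rewrite cint0 big_nil.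
under eq_fun do rewrite big_cons.
by rewrite cintD ?ih ?big_cons//; exact: cintg_sum.
Qed.

Lemma cintJ u : cintg u -> cint (fun x => conjc (u x)) = conjc (cint u).
Proof.
move=> /cintgP[u1 u2]; rewrite /cint /=.
under eq_Rintegral do rewrite creJ; under [X in (_ +i* X)%C]eq_Rintegral do rewrite cimJ.
rewrite -[X in (_ -i* X)%C]mul1r -mulNr -RintegralZl//.
by under [X in _ = (_ +i* X)%C]eq_Rintegral do rewrite mulN1r.
Qed.

Lemma cint_real (f : T -> R) : cint (fun x => (f x)%:C%C) = (\int[m]_x f x)%R%:C%C.
Proof. by rewrite /cint /= /Rintegral integral0. Qed.

(** The unimodular factor [l] turns the integral into its modulus, which is then the integral of the
    real part of l u. *)
Lemma normc_cint u : cintg u -> normc (cint u) <= (\int[m]_x normc (u x))%R.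
Proof.
move=> iu; have [u0|u0] := eqVneq (cint u) 0.
  by rewrite u0 Normc.normc0 Rintegral_ge0// => x _; exact: normc_ge0.
pose l := conjc (cint u) / (normc (cint u))%:C%C.
have n0 : normc (cint u) != 0 by rewrite normc_eq0.
have nl : normc l = 1.
  rewrite Normc.normcM Normc.normcV normcJ normc_real ger0_norm ?normc_ge0//.
  by rewrite divff.
have -> : normc (cint u) = Re (cint (fun x => l * u x)).
  rewrite cintZ// /l mulrAC [conjc _ * _]mulrC mulcJ -rmorphV ?unitfE// -rmorphM /=.
  by rewrite expr2 -mulrA divff// mulr1.
have [l1 _] := cintgP (cintgZ l iu).
apply: le_Rintegral => //; first by have [] := iu.
move=> x _; rewrite (le_trans (ler_norm _))// (le_trans (Re_le_normc _))//.
by rewrite Normc.normcM nl mul1r.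
Qed.

Lemma eq_cint u v : u =1 v -> cint u = cint v.
Proof. by move=> /funext ->. Qed.

Lemma ae_eq_cint u v : cmeas u -> cmeas v -> {ae m, forall x, u x = v x} -> cint u = cint v.
Proof.
move=> [u1 u2] [v1 v2] uv; rewrite /cint /Rintegral; congr ((fine _) +i* (fine _))%C.
  apply: ae_eq_integral => //; [exact/measurable_EFinP|exact/measurable_EFinP|].
  by apply: filterS uv => x -> _.
apply: ae_eq_integral => //; [exact/measurable_EFinP|exact/measurable_EFinP|].
by apply: filterS uv => x -> _.
Qed.

(** Dominated convergence for |v_k - u|, with majorant 2 b. *)
Lemma cint_dominated (v : nat -> T -> R[i]) u (b : T -> R) :
  (forall k, cmeas (v k)) -> itg b -> (forall k x, normc (v k x) <= b x) ->
  (forall x, normc (v k x - u x) @[k --> \oo] --> (0 : R)) ->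
  normc (cint (v k) - cint u) @[k --> \oo] --> (0 : R).
Proof.
move=> mv ib vb vu.
have mu : cmeas u by exact: cmeas_cvg vu.
have ub x : normc (u x) <= b x.
  apply/ler_addgt0Pr => e e0.
  have /cvgrPdist_le /(_ e e0) [k _ /(_ k (leqnn _))] := vu x.
  rewrite sub0r normrN ger0_norm ?normc_ge0// => h.
  rewrite -[u x](subrK (v k x)) addrC (le_trans (le_normcD _ _))// lerD//.
  by rewrite normcB.
have iv k : cintg (v k) by exact: (le_cintg _ (vb k)).
have iu : cintg u by exact: (le_cintg _ ub).
have i2b : itg (fun x => b x + b x) by have := integrableD measurableT ib ib.
pose g k x := (normc (v k x - u x))%:E.
have h1 k : measurable_fun setT (g k).
  by apply/measurable_EFinP/measurable_normc/cmeasB.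
have h3 : {ae m, forall x, setT x -> g ^~ x @ \oo --> 0%E}.
  by apply: aeW => x _; apply/fine_cvgP; split; [near=> k|exact: vu].
have h5 : {ae m, forall x k, setT x -> (`|g k x| <= (b x + b x)%R%:E)%E}.
  apply: aeW => x k _ /=; rewrite lee_fin ger0_norm ?normc_ge0//.
  by rewrite (le_trans (le_normcD _ _))// normcN lerD.
have [_ _] := dominated_convergence measurableT h1 (measurable_cst 0%E) h3 i2b h5.
rewrite integral0 => /fine_cvg h.
apply: (@squeeze_cvgr _ _ _ _ (fun=> 0) (fun k => (\int[m]_x normc (v k x - u x))%R)).
- apply: nearW => k; apply/andP; split; first exact: normc_ge0.
  by rewrite -cintB//; apply: normc_cint; exact: cintgB.
- exact: cvg_cst.
- exact: h.
Unshelve. all: by end_near. Qed.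

End cint.

(** * Measures with a density, and almost everywhere equality *)

Section density_measure.
Local Open Scope ereal_scope.
Context d (T : measurableType d) (R : realType).
Variable m : {measure set T -> \bar R}.
Variables (w : T -> R) (w0 : forall x, (0 <= w x)%R) (mw : measurable_fun setT w).

(** The two proofs are arguments so that the measure structure can be recovered from the term
    itself. *)
Definition mdens (_ : forall x, (0 <= w x)%R) (_ : measurable_fun setT w) (A : set T) : \bar R :=
  \int[m]_(x in A) (w x)%:E.

Let mwE A : measurable_fun A (EFin \o w).
Proof. exact/measurable_EFinP/measurable_funTS. Qed.

Let mdens_0 : mdens w0 mw set0 = 0. Proof. by rewrite /mdens integral_set0. Qed.

Let mdens_ge0 A : 0 <= mdens w0 mw A.
Proof. by apply: integral_ge0 => x _; rewrite lee_fin. Qed.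

Let mdens_sigma_additive : semi_sigma_additive (mdens w0 mw).
Proof.
move=> F mF tF mUF; rewrite /mdens ge0_integral_bigcup//.
  by apply: is_cvg_ereal_nneg_natsum_cond => n _ _; exact: mdens_ge0.
by move=> x _; rewrite lee_fin.
Qed.

HB.instance Definition _ := isMeasure.Build _ _ _ (mdens w0 mw)
  mdens_0 mdens_ge0 mdens_sigma_additive.

Import HBNNSimple.

Let integral_mdens_indic E : measurable E ->
  \int[mdens w0 mw]_x (\1_E x)%:E = \int[m]_x (\1_E x * w x)%:E.
Proof.
move=> mE; rewrite integral_indic// setIT [LHS]integral_mkcond.
apply: eq_integral => x _; rewrite patchE indicE.
by case: ifP => _; rewrite ?mul1r ?mul0r.
Qed.

Let integral_mdens_nnsfun (h : {nnsfun T >-> R}) :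
  \int[mdens w0 mw]_x (h x)%:E = \int[m]_x (h x * w x)%:E.
Proof.
under [LHS]eq_integral do rewrite fimfunE -fsumEFin//.
rewrite [LHS]ge0_integral_fsum//; last 2 first.
  - by move=> r; exact/measurable_EFinP/measurableT_comp.
  - by move=> n x _; rewrite EFinM nnfun_muleindic_ge0.
transitivity (\sum_(k \in range h) \int[m]_x (k * \1_(h @^-1` [set k]) x * w x)%:E).
  apply: eq_fsbigr => r /[!inE] -[y _ <-].
  under eq_integral do rewrite EFinM.
  rewrite ge0_integralZl//; last 2 first.
  - exact/measurable_EFinP.
  - by rewrite lee_fin.
  rewrite integral_mdens_indic// -ge0_integralZl//.
  - by apply: eq_integral => x _; rewrite -mulrA EFinM.
  - by apply/measurable_EFinP/measurable_funM.
  - by move=> x _; rewrite lee_fin mulr_ge0.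
  - by rewrite lee_fin.
rewrite -ge0_integral_fsum//.
- apply: eq_integral => x _; rewrite fsumEFin// [in RHS]fimfunE.
  by rewrite mulr_fsuml.
- by move=> r; apply/measurable_EFinP/measurable_funM => //; apply: measurable_funM.
- by move=> r x _; rewrite lee_fin mulr_ge0// -lee_fin EFinM nnfun_muleindic_ge0.
Qed.

Lemma ge0_integral_mdens (f : T -> \bar R) : measurable_fun setT f -> (forall x, 0 <= f x) ->
  \int[mdens w0 mw]_x f x = \int[m]_x (f x * (w x)%:E).
Proof.
move=> mf f0; pose f_ := nnsfun_approx measurableT mf.
transitivity (limn (fun n => \int[mdens w0 mw]_x (f_ n x)%:E)).
  rewrite -monotone_convergence//=.
  - by apply: eq_integral => x _; apply/esym/cvg_lim => //; exact: cvg_nnsfun_approx.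
  - by move=> n; exact/measurable_EFinP.
  - by move=> n x _; rewrite lee_fin.
  - by move=> x _ a b ab; rewrite lee_fin; exact/lefP/nd_nnsfun_approx.
under eq_fun do rewrite integral_mdens_nnsfun.
rewrite -monotone_convergence//=.
- apply: eq_integral => x _; apply/cvg_lim => //.
  under eq_fun do rewrite EFinM.
  by apply: cvgeZr => //; exact: cvg_nnsfun_approx.
- by move=> n; apply/measurable_EFinP/measurable_funM.
- by move=> n x _; rewrite lee_fin mulr_ge0.
- move=> x _ a b ab; rewrite lee_fin ler_wpM2r//.
  exact/lefP/nd_nnsfun_approx.
Qed.

Lemma integral_mdens (f : T -> R) : measurable_fun setT f ->
  \int[mdens w0 mw]_x (f x)%:E = \int[m]_x (f x * w x)%:E.
Proof.
move=> mf; rewrite [LHS]integralE [RHS]integralE.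
have mfE : measurable_fun setT (EFin \o f) by exact/measurable_EFinP.
congr (_ - _).
  rewrite ge0_integral_mdens//; last exact: measurable_funepos.
  apply: eq_integral => x _; rewrite !funeposE -EFin_max -EFinM -EFin_max.
  by congr EFin; rewrite maxr_pMl// mul0r.
rewrite ge0_integral_mdens//; last exact: measurable_funeneg.
apply: eq_integral => x _; rewrite !funenegE -!EFinN -EFin_max -EFinM -EFin_max.
by congr EFin; rewrite maxr_pMl// mul0r mulNr.
Qed.

Lemma mdens_eq0 A : measurable A -> (mdens w0 mw A = 0 <-> {ae m, forall x, A x -> w x = 0%R}).
Proof.
move=> mA; rewrite /mdens.
have := ae_eq_integral_abs m mA (@mwE A).
move=> h; split => [wA|wA].
  have : \int[m]_(x in A) `|(EFin \o w) x| = 0.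
    by rewrite -wA; apply: eq_integral => x _ /=; rewrite ger0_norm.
  by move=> /h; apply: filterS => x /[apply] -[].
rewrite (ae_eq_integral (cst 0)) ?integral0//.
by apply: filterS wA => x /[apply] /= ->.
Qed.

End density_measure.

Section nonmeasurable.
Local Open Scope ereal_scope.
Context d (T : measurableType d) (R : realType).
Variable m : {measure set T -> \bar R}.
Import HBNNSimple.

(** A simple function below f, set to 0 on the exceptional null set, lies below g everywhere and
    keeps its integral. The symbol g of the theorem, only almost everywhere equal to a measurable
    function, calls for this generality. *)
Let ge0_le_ae_integral (f g : T -> \bar R) :
  (forall x, 0 <= f x) -> (forall x, 0 <= g x) ->
  {ae m, forall x, f x = g x} -> \int[m]_x f x <= \int[m]_x g x.
Proof.
move=> f0 g0 [N [mN N0 Nfg]]; rewrite (ge0_integralTE _ f0) (ge0_integralTE _ g0).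
apply: ge_ereal_sup => _ [h hf <-].
have mNC : measurable (~` N) by exact: measurableC.
have sE (k : {nnsfun T >-> R}) : sintegral m k = \int[m]_x (k x)%:E.
  by rewrite integral_nnsfun// patch_setT.
apply: ereal_sup_ubound; exists (proj_nnsfun h mNC) => /=.
  move=> x; rewrite mindicE; case: (boolP (x \in ~` N)) => [/set_mem xN|_]; last by rewrite mulr0; exact: g0.
  rewrite mulr1.
  rewrite (le_trans (hf x))// le_eqVlt; apply/orP; left; apply/eqP.
  by apply: contrapT => fg; apply: xN; exact: Nfg.
rewrite !sE; apply: ge0_ae_eq_integral => //.
- exact/measurable_EFinP.
- exact/measurable_EFinP.
- by move=> x _; rewrite lee_fin.
- by move=> x _; rewrite lee_fin.
exists N; split => // x /= hx; apply: contrapT => Nx; apply: hx => _.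
by rewrite mindicE mem_set// mulr1.
Qed.

(* No measurability is assumed: the integral is a supremum over simple functions. *)
Lemma eq_integral_ae (f g : T -> \bar R) :
  {ae m, forall x, f x = g x} -> \int[m]_x f x = \int[m]_x g x.
Proof.
move=> fg; rewrite integralE [RHS]integralE; congr (_ - _); apply/eqP;
 rewrite eq_le !ge0_le_ae_integral//; apply: filterS fg => x fg;
 by rewrite ?funeposE ?funenegE fg.
Qed.

End nonmeasurable.

(** * Maps scaling a measure *)

Section scaling_maps.
Context d (T : measurableType d) (R : realType).
Implicit Types (m : {measure set T -> \bar R}).

(** The factor [c] is that of the preimage, hence the inverse of the Jacobian: multiplication by a >
    0 on the line has c = a^-1. *)
Definition scales m (c : R) (phi : T -> T) := measurable_fun setT phi /\
  forall A, measurable A -> m (phi @^-1` A) = (c%:E * m A)%E.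

Lemma scales_comp m c1 c2 phi1 phi2 : scales m c1 phi1 -> scales m c2 phi2 ->
  scales m (c1 * c2) (phi1 \o phi2).
Proof.
move=> [m1 s1] [m2 s2]; split; first exact: measurableT_comp.
move=> A mA; rewrite comp_preimage s2 ?s1 ?EFinM ?muleA 1?[(c2%:E * _)%E]muleC//.
by rewrite -[X in measurable X]setTI; exact: m1.
Qed.

Lemma ge0_integral_scales m c phi (f : T -> \bar R) : scales m c phi -> 0 <= c ->
  measurable_fun setT f -> (forall x, 0 <= f x)%E ->
  (\int[m]_x f (phi x) = c%:E * \int[m]_x f x)%E.
Proof.
move=> [mphi s] c0 mf f0.
have := @ge0_integral_pushforward _ _ _ _ _ phi mphi m setT f measurableT mf.
move=> /(_ (fun x _ => f0 x)); rewrite preimage_setT => <-.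
rewrite [LHS](eq_measure_integral (mscale (NngNum c0) m)) => [|A mA _].
  by rewrite ge0_integral_mscale.
exact: s.
Qed.

End scaling_maps.

Section lebesgue_affine.
Variable R : realType.
Local Notation mu := (@lebesgue_measure R).

Lemma lebesgue_affine (a b : R) : 0 < a ->
  scales mu a^-1 (fun x : measurableTypeR R => a * x + b).
Proof.
move=> a0.
have mphi : measurable_fun setT (fun x : measurableTypeR R => a * x + b : measurableTypeR R).
  by apply: measurable_funD => //; apply: measurable_funM.
split=> // A mA.
have ai0 : 0 <= a by exact: ltW.
pose nu : {measure set (measurableTypeR R) -> \bar R} :=
  mscale (NngNum ai0) (measure_function_pushforward__canonical__measure_function_Measure mu mphi).
have muE : forall A, measurable A -> mu A = nu A.
  apply: lebesgue_measure_unique => _ [[p q] _ <-].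
  rewrite -[RHS]/(mule a%:E (mu ((fun x : measurableTypeR R => a * x + b) @^-1` `]p, q]%classic))).
  have -> : (fun x : measurableTypeR R => a * x + b) @^-1` `]p, q]%classic =
      `](p - b) / a, (q - b) / a]%classic.
    apply/seteqP; split => x /=; rewrite !in_itv /= ltr_pdivrMr// ler_pdivlMr//;
     rewrite [x * a]mulrC; move=> /andP[h1 h2]; apply/andP; split; lra.
  rewrite !lebesgue_measure_itv /= !lte_fin ltr_pM2r ?invr_gt0// ltrD2r.
  case: ifP => _; last by rewrite mule0.
  by rewrite -!EFinD -EFinM; congr EFin; field; rewrite gt_eqF.
apply: (etrans _ (congr1 (mule a^-1%:E) (esym (muE A mA)))).
apply: (etrans _ (esym (muleA _ _ _))).
by rewrite -EFinM mulVf ?mul1e// gt_eqF.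
Qed.

End lebesgue_affine.

Section product_scaling.
Context d1 d2 (T1 : measurableType d1) (T2 : measurableType d2) (R : realType).
Variables (m1 : {sigma_finite_measure set T1 -> \bar R})
  (m2 : {sigma_finite_measure set T2 -> \bar R}).

(** A product measure is determined by its values on rectangles, where the two factors multiply. *)
Lemma scales_prod c1 c2 phi1 phi2 : 0 < c1 -> 0 < c2 ->
  scales m1 c1 phi1 -> scales m2 c2 phi2 ->
  scales (m1 \x m2)%E (c1 * c2) (fun x => (phi1 x.1, phi2 x.2)).
Proof.
move=> c10 c20 [mp1 s1] [mp2 s2].
have mphi : measurable_fun setT (fun x : T1 * T2 => (phi1 x.1, phi2 x.2)).
  by apply/measurable_fun_pair; exact: measurableT_comp.
split=> // A mA.
have ci0 : 0 <= (c1 * c2)^-1 by rewrite invr_ge0 mulr_ge0// ltW.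
pose nu : {measure set (T1 * T2) -> \bar R} :=
  mscale (NngNum ci0) (measure_function_pushforward__canonical__measure_function_Measure (m1 \x m2)%E mphi).
have muE : forall A, measurable A -> (m1 \x m2)%E A = nu A.
  apply: product_measure_unique => B C mB mC.
  transitivity ((c1 * c2)^-1%:E * (m1 \x m2) ((phi1 @^-1` B) `*` (phi2 @^-1` C)))%E => //.
  rewrite product_measure1E.
  - have e (a b : R) (x y : \bar R) : (a%:E * x * (b%:E * y) = (a * b)%:E * (x * y))%E.
      by rewrite EFinM muleACA.
    by rewrite s1// s2// e muleA -EFinM mulVf ?mul1e// mulf_neq0// gt_eqF.
  - by rewrite -[X in measurable X]setTI; exact: mp1.
  - by rewrite -[X in measurable X]setTI; exact: mp2.
apply: (etrans _ (congr1 (mule (c1 * c2)%:E) (esym (muE A mA)))).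
apply: (etrans _ (esym (muleA _ _ _))).
by rewrite -EFinM divff ?mul1e// mulf_neq0// gt_eqF.
Qed.

End product_scaling.

Section lebesgue2_maps.
Variable R : realType.
Local Notation mu2 := (@lebesgue2 R).
Local Notation P := (measurableTypeR R * measurableTypeR R)%type.

Lemma lebesgue2_dilate (a : R) : 0 < a ->
  scales mu2 (a ^- 2) (fun x : P => (a * x.1, a * x.2)).
Proof.
move=> a0; have h := lebesgue_affine 0 a0.
have i0 : 0 < a^-1 by rewrite invr_gt0.
have := scales_prod i0 i0 h h.
rewrite -expr2 -exprVn; congr scales.
by apply/funext => x; rewrite !addr0.
Qed.

(** On each vertical line the shear is a translation, so the sections keep their length. *)
Lemma lebesgue2_shear_y (k : R) :
  scales mu2 1 (fun x : P => (x.1, x.2 + k * x.1)).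
Proof.
have mphi : measurable_fun setT (fun x : P => (x.1, x.2 + k * x.1) : P).
  apply/measurable_fun_pair => //=.
  by apply: measurable_funD => //; apply: measurable_funM.
split => // A mA; rewrite mul1e /lebesgue2 /product_measure1.
apply: eq_integral => x _ /=.
have [_ s] := @lebesgue_affine R 1 (k * x) ltr01.
have := s _ (measurable_xsection x mA); rewrite invr1 mul1e => <-.
congr (lebesgue_measure _); apply/seteqP; split => y /=;
  by rewrite /xsection /= !inE /= mul1r.
Qed.

Lemma lebesgue2_swap : scales mu2 1 (fun x : P => (x.2, x.1)).
Proof.
have mphi : measurable_fun setT (fun x : P => (x.2, x.1)).
  by apply/measurable_fun_pair.
split => // A mA; rewrite mul1e.
have := @product_measure_unique _ _ _ _ R (@lebesgue_measure R) (@lebesgue_measure R)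
  (measure_function_pushforward__canonical__measure_function_Measure mu2 mphi).
move=> h; rewrite -[RHS]/((lebesgue_measure \x lebesgue_measure)%E A) h// => B C mB mC.
transitivity ((lebesgue_measure \x lebesgue_measure)%E (C `*` B)).
  by congr ((_ \x _)%E); apply/seteqP; split => x [].
by rewrite product_measure1E// muleC.
Qed.

Lemma lebesgue2_shear_x (k : R) :
  scales mu2 1 (fun x : P => (x.1 + k * x.2, x.2)).
Proof.
have := scales_comp lebesgue2_swap (scales_comp (lebesgue2_shear_y k) lebesgue2_swap).
by rewrite !mul1r; congr scales; apply/funext => x.
Qed.

(** Multiplication by [u] on C, in real coordinates. *)
Definition rotate (u : R[i]) (x : P) : P :=
  (complex.Re u * x.1 - complex.Im u * x.2, complex.Im u * x.1 + complex.Re u * x.2).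

(* A rotation of angle different from 0 and pi is a product of three shears. *)
Lemma lebesgue2_rotate (u : R[i]) : Normc.normc u = 1 -> scales mu2 1 (rotate u).
Proof.
have main (v : R[i]) : Normc.normc v = 1 -> complex.Im v != 0 -> scales mu2 1 (rotate v).
  case: v => c s /= /(congr1 (fun x => x ^+ 2)); rewrite sqr_sqrtr ?expr1n; last first.
    by rewrite addr_ge0 ?sqr_ge0.
  move=> cs s0.
  have := scales_comp (lebesgue2_shear_x ((c - 1) / s))
    (scales_comp (lebesgue2_shear_y s) (lebesgue2_shear_x ((c - 1) / s))).
  rewrite !mul1r; congr scales; apply/funext => -[x y] /=; rewrite /rotate /=.
  have c2 : c * c = 1 - s * s by rewrite -cs; ring.
  have e : s * ((c - 1) / s) = c - 1 by field.
  congr pair.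
    transitivity (x + (c - 1) / s * y + (c - 1) / s * y + (s * ((c - 1) / s)) * x +
      (s * ((c - 1) / s)) * ((c - 1) / s * y)); first by ring.
    rewrite e; apply: (mulIf s0).
    transitivity (s * x + 2 * (s * ((c - 1) / s)) * y + (c - 1) * x * s +
      (c - 1) * (s * ((c - 1) / s)) * y); first by ring.
    rewrite e.
    transitivity (s * c * x + (c * c - 1) * y); first by ring.
    by rewrite c2; ring.
  transitivity (y + s * x + (s * ((c - 1) / s)) * y); first by ring.
  by rewrite e; ring.
have [u0|u0] := eqVneq (complex.Im u) 0; last by move=> u1; exact: main.
(* A real u is the product of u i and -i, neither of which is real, so two rotations of the previous
   kind compose to it. *)
move=> u1; have i1 : Normc.normc ('i%C : R[i]) = 1.
  by rewrite /Normc.normc /= expr0n add0r expr1n sqrtr1.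
have ui : scales mu2 1 (rotate (u * 'i%C)).
  apply: main; first by rewrite Normc.normcM u1 i1 mulr1.
  rewrite ImiRe; apply/eqP => u0'; move: u1; case: u u0 u0' => a b /= -> ->.
  by rewrite expr0n addr0 sqrtr0 => /eqP; rewrite eq_sym oner_eq0.
have ni : scales mu2 1 (rotate (- 'i%C)).
  apply: main; first by rewrite normcN.
  by rewrite /= oppr_eq0 oner_eq0.
have := scales_comp ui ni; rewrite mulr1; congr scales; apply/funext => x.
by case: u {u0 u1 ui} => a b; rewrite /rotate /=; congr pair; ring.
Qed.

End lebesgue2_maps.

Section tuple_scaling.
Context d (T : measurableType d) (R : realType).
Variable m : {sigma_finite_measure set T -> \bar R}.

Definition tuple_map n (phi : 'I_n -> T -> T) (x : n.-tuple T) : n.-tuple T :=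
  [tuple phi i (tnth x i) | i < n].

Lemma scales_tuple n (c : 'I_n -> R) phi : (forall i, 0 < c i) ->
  (forall i, scales m (c i) (phi i)) ->
  scales (tuple_measure m n) (\prod_i c i) (tuple_map phi).
Proof.
move=> c0 s.
have mphi : measurable_fun setT (tuple_map phi).
  apply/measurable_fun_tnthP => i.
  rewrite (_ : _ \o _ = phi i \o (fun x => tnth x i)); last first.
    by apply/funext => x; rewrite /= tnth_mktuple.
  apply: measurableT_comp; first by have [] := s i.
  exact: measurable_tnth.
split => // A mA.
elim: n c phi c0 s mphi A mA => [|n ih] c phi c0 s mphi A mA.
  rewrite big_ord0 mul1e /=; congr (\d_ _ _); apply/seteqP; split => x /=;
    by rewrite (tuple0 x) (tuple0 (tuple_map _ _)).
have mphi' : measurable_fun setT (tuple_map (fun i => phi (lift ord0 i))).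
  apply/measurable_fun_tnthP => i.
  rewrite (_ : _ \o _ = phi (lift ord0 i) \o (fun x => tnth x i)); last first.
    by apply/funext => x; rewrite /= tnth_mktuple.
  apply: measurableT_comp; first by have [] := s (lift ord0 i).
  exact: measurable_tnth.
have st : scales (tuple_measure m n) (\prod_i c (lift ord0 i)) (tuple_map (fun i => phi (lift ord0 i))).
  by split=> //; apply: ih.
have p0 : 0 < \prod_i c (lift ord0 i) by rewrite prodr_gt0.
have [_ h] := scales_prod (c0 ord0) p0 (s ord0) st.
rewrite big_ord_recl /= /tuple_measureS /pushforward -h; last first.
  by rewrite -[X in measurable X]setTI; exact: measurable_tuple_cons.
congr ((_ \x _)%E); apply/seteqP; split => x /=;
 rewrite (_ : tuple_map phi (tuple_cons x) = tuple_cons (phi ord0 x.1,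
     tuple_map (fun i => phi (lift ord0 i)) x.2))//;
  by apply: eq_from_tnth => i; rewrite tnth_mktuple; case: (unliftP ord0 i) => [j|] ->;
   rewrite ?tnth0 ?tnthS// tnth_mktuple.
Qed.

End tuple_scaling.

(** * Uniqueness of moments *)

Section indicator_approximation.
Variable R : realType.

Lemma bernoulli_le (a : R) E : 0 <= a <= 1 -> 1 - E%:R * a <= (1 - a) ^+ E.
Proof.
move=> /andP[a0 a1]; elim: E => [|E ih]; first by rewrite mul0r subr0 expr0.
have [h|h] := leP 0 (1 - E%:R * a); last first.
  rewrite (@le_trans _ _ 0)//; last by rewrite exprn_ge0// subr_ge0.
  by rewrite -natr1 mulrDl mul1r opprD addrA subr_le0 (le_trans (ltW h)).
rewrite exprSr (le_trans _ (ler_wpM2r _ ih)) ?subr_ge0//.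
have E0 := ler0n R E; rewrite -natr1; nra.
Qed.

Lemma bernoulli_ge (h : R) k : 0 <= h -> k%:R * h <= (1 + h) ^+ k.
Proof.
move=> h0; suff : 1 + k%:R * h <= (1 + h) ^+ k by apply: le_trans; rewrite lerDr.
elim: k => [|k ih]; first by rewrite mul0r addr0 expr0.
rewrite exprSr (le_trans _ (ler_wpM2r _ ih)) ?addr_ge0//.
have k0 := ler0n R k; rewrite -natr1; nra.
Qed.

(** Polynomials in y with values in [0, 1] that tend on [0, 1] to the indicator of y < 1/2. The
    factor k in the outer exponent decides the point y = 1/2, where (1 - 2^-k)^(2^k) alone would
    tend to 1/e instead of 0. *)
Definition step_seq (k : nat) (y : R) : R := (1 - y ^+ k) ^+ (2 ^ k * k).

Lemma step_seq01 k y : 0 <= y <= 1 -> 0 <= step_seq k y <= 1.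
Proof.
move=> /andP[y0 y1]; have y2 : y ^+ k <= 1 by exact: exprn_ile1.
rewrite exprn_ge0 ?subr_ge0//= exprn_ile1 ?subr_ge0//.
by rewrite gerBl exprn_ge0.
Qed.

(* (1 - y^k)^(2^k k) is close to exp(- k (2 y)^k). *)
Lemma step_seq_cvg (y : R) : 0 <= y <= 1 ->
  step_seq k y @[k --> \oo] --> (if y < 2^-1 then 1 else 0 : R).
Proof.
move=> /[dup] y01 /andP[y0 y1]; have [yh|yh] := ltP y 2^-1.
  (* k (2 y)^k = (k s^k) s^k with s^2 = 2 y. For s = 1/(1 + h), Bernoulli's inequality bounds k s^k
     by 1/h, and the remaining s^k tends to 0. *)
  have [s [s0 s1 sy]] : exists s : R, [/\ 0 <= s, s < 1 & s ^+ 2 = 2 * y].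
    exists (Num.sqrt (2 * y)); rewrite sqrtr_ge0 sqr_sqrtr ?mulr_ge0//; split => //.
    by rewrite -[ltRHS]sqrtr1 ltr_sqrt//; move: yh; rewrite -(ltr_pM2l (ltr0n R 2)) divff// pnatr_eq0.
  have [h [h0 hs]] : exists h : R, 0 < h /\ (s != 0 -> s = (1 + h)^-1).
    have [->|sn0] := eqVneq s 0; first by exists 1; split => //; rewrite eqxx.
    have s'0 : 0 < s by rewrite lt_neqAle eq_sym sn0.
    exists (s^-1 - 1); rewrite addrCA subrr addr0 invrK; split => //.
    by rewrite subr_gt0 invf_gt1.
  have ks k : k%:R * s ^+ k <= h^-1.
    have [s00|sn0] := eqVneq s 0.
      by rewrite s00 expr0n; case: k => [|k] /=; rewrite ?mul0r ?mulr0 invr_ge0 ltW.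
    rewrite hs// exprVn ler_pdivrMr ?exprn_gt0 ?addr_gt0// mulrC ler_pdivlMr//.
    by rewrite bernoulli_ge// ltW.
  apply: (@squeeze_cvgr _ _ _ _ (fun k => 1 - h^-1 * s ^+ k) (fun=> 1)).
  - apply: nearW => k; have /andP[_ ->] := step_seq01 k y01; rewrite andbT.
    apply: le_trans (bernoulli_le _ _); last by rewrite exprn_ge0//= exprn_ile1.
    rewrite lerD2l lerN2 natrM natrX mulrAC -exprMn -sy -exprM mulnC exprM expr2.
    by rewrite mulrAC ler_wpM2r ?exprn_ge0// mulrC ks.
  - rewrite -[X in _ --> X]subr0; apply: cvgB; first exact: cvg_cst.
    rewrite -[X in _ --> X](mulr0 h^-1); apply: cvgM; first exact: cvg_cst.
    by apply: cvg_expr; rewrite ger0_norm.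
  - exact: cvg_cst.
apply: (@squeeze_cvgr _ _ _ _ (fun=> 0) (fun k => k.+1%:R^-1)).
- apply: nearW => k; have /andP[-> _] := step_seq01 k y01 => /=.
  have yk0 : 0 <= y ^+ k by rewrite exprn_ge0.
  have yk1 : y ^+ k <= 1 by rewrite exprn_ile1.
  rewrite /step_seq (@le_trans _ _ (expR (- y ^+ k) ^+ (2 ^ k * k)))//.
    by rewrite lerXn2r ?nnegrE ?subr_ge0 ?expR_ge0// expR_ge1Dx.
  rewrite -expRM_natl mulrN expRN lef_pV2 ?posrE ?expR_gt0// -natr1 addrC.
  rewrite (le_trans _ (expR_ge1Dx _))// lerD2l natrM natrX mulrAC -exprMn.
  by rewrite ler_peMl// exprn_ege1// mulrC -ler_pdivrMr// mul1r.
- exact: cvg_cst.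
- exact: cvg_harmonic.
Qed.

End indicator_approximation.
Section moment_uniqueness.
Variables (R : realType) (n : nat).
Local Notation P := (measurableTypeR R * measurableTypeR R)%type.
Local Notation X := (n.-tuple P).
Local Notation normc := (@Normc.normc R).

Definition zc (x : X) (j : 'I_n) : R[i] := ((tnth x j).1 +i* (tnth x j).2)%C.

Arguments zc : simpl never.

Definition mono (a b : 'I_n -> nat) (x : X) : R[i] :=
  \prod_j (zc x j ^+ a j * conjc (zc x j) ^+ b j).

Definition delta (j : 'I_n) : 'I_n -> nat := fun i => i == j.

Lemma mono0 x : mono (fun=> 0%N) (fun=> 0%N) x = 1.
Proof. by rewrite /mono big1// => j _; rewrite !expr0 mulr1. Qed.

Lemma monoM a b a' b' x : mono a b x * mono a' b' x =
  mono (fun j => (a j + a' j)%N) (fun j => (b j + b' j)%N) x.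
Proof.
by rewrite /mono -big_split; apply: eq_bigr => j _; rewrite !exprD mulrACA.
Qed.

Lemma mono_delta j x : mono (delta j) (fun=> 0%N) x = zc x j.
Proof.
rewrite /mono (bigD1 j)//= /delta eqxx expr1 expr0 mulr1 big1 ?mulr1// => i /negbTE.
by move=> ->; rewrite !expr0 mulr1.
Qed.

Lemma monoJ a b x : conjc (mono a b x) = mono b a x.
Proof.
rewrite /mono rmorph_prod; apply: eq_bigr => j _.
rewrite rmorphM !rmorphXn mulrC; congr (_ ^+ _ * _); exact: conjcK.
Qed.

Lemma cmeas_zc j : cmeas (zc ^~ j).
Proof.
split => /=; [rewrite (_ : (fun x => _) = fst \o (fun x : X => tnth x j))//|
  rewrite (_ : (fun x => _) = snd \o (fun x : X => tnth x j))//];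
  by apply: measurableT_comp => //; exact: measurable_tnth.
Qed.

Lemma cmeas_mono a b : cmeas (mono a b).
Proof.
apply: cmeas_prod => j; apply: cmeasM; apply: cmeasX; first exact: cmeas_zc.
exact/cmeasJ/cmeas_zc.
Qed.

Definition polydisc : set X := [set x | forall j, normc (zc x j) <= 1].

Lemma mono_le1 a b x : polydisc x -> normc (mono a b x) <= 1.
Proof.
move=> Bx; rewrite normc_prod prodr_ile1// => j _; rewrite normc_ge0 andTb.
rewrite Normc.normcM !normcX normcJ mulr_ile1 ?exprn_ge0 ?normc_ge0//;
 by rewrite exprn_ile1 ?normc_ge0 ?Bx.
Qed.

Variable nu : {measure set X -> \bar R}.
Variable v : X -> R[i].
Hypothesis iv : cintg nu v.
Hypothesis v0 : forall x, ~ polydisc x -> v x = 0.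
Hypothesis vmono : forall a b, cint nu (fun x => v x * mono a b x) = 0.

(** The functions by which v can be multiplied without making a moment nonzero. The aim is to show
    that they include the indicators of all measurable sets; the class is stable under sums,
    products with monomials and bounded limits. *)
Definition test_fun (psi : X -> R[i]) := [/\ cmeas psi,
  exists M, forall x, polydisc x -> normc (psi x) <= M &
  forall a b, cint nu (fun x => v x * psi x * mono a b x) = 0].

Let cmv : cmeas v. Proof. by case: iv. Qed.

Let vpsi_le psi (M : R) a b : (forall x, polydisc x -> normc (psi x) <= M) ->
  forall x, normc (v x * psi x * mono a b x) <= `|M| * normc (v x).
Proof.
move=> psiM x; case: (pselect (polydisc x)) => Bx; last first.
  by rewrite v0// !mul0r Normc.normc0 mulr0.
rewrite !Normc.normcM -mulrA mulrC ler_wpM2r ?normc_ge0//.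
rewrite -[leRHS]mulr1 ler_pM ?normc_ge0 ?mono_le1//.
by rewrite (le_trans (psiM x Bx))// ler_norm.
Qed.

Let iMv (M : R) : nu.-integrable setT (EFin \o (fun x => `|M| * normc (v x))).
Proof. by case: iv => _ i; have := integrableZl measurableT `|M| i. Qed.

Let ivpsi psi a b : test_fun psi -> cintg nu (fun x => v x * psi x * mono a b x).
Proof.
move=> [mpsi [M psiM] _]; apply: (le_cintg _ (vpsi_le a b psiM)) => //.
by apply: cmeasM; [exact: cmeasM|exact: cmeas_mono].
Qed.

Lemma test_fun1 : test_fun (fun=> 1).
Proof.
split; [exact: cmeas_cst|by exists 1 => x _; rewrite Normc.normc1|].
by move=> a b; under eq_cint do rewrite mulr1; exact: vmono.
Qed.

Lemma test_funD psi1 psi2 : test_fun psi1 -> test_fun psi2 ->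
  test_fun (fun x => psi1 x + psi2 x).
Proof.
move=> t1 t2; have [m1 [M1 b1] i1] := t1; have [m2 [M2 b2] i2] := t2.
split; first exact: cmeasD.
  exists (M1 + M2) => x Bx; rewrite (le_trans (le_normcD _ _))// lerD ?b1 ?b2//.
move=> a b; under eq_cint do rewrite mulrDr mulrDl.
by rewrite cintD ?i1 ?i2 ?addr0//; exact: ivpsi.
Qed.

Lemma test_funZ c psi : test_fun psi -> test_fun (fun x => c * psi x).
Proof.
move=> t1; have [m1 [M1 b1] i1] := t1.
split; first exact: cmeasZ.
  by exists (normc c * M1) => x Bx; rewrite Normc.normcM ler_wpM2l ?normc_ge0 ?b1.
move=> a b; under eq_cint do rewrite mulrCA -mulrA.
by rewrite cintZ ?i1 ?mulr0//; exact: ivpsi.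
Qed.

Lemma test_fun_mono a b psi : test_fun psi -> test_fun (fun x => mono a b x * psi x).
Proof.
move=> [m1 [M1 b1] i1]; split; first by apply: cmeasM => //; exact: cmeas_mono.
  exists M1 => x Bx; rewrite Normc.normcM (le_trans _ (b1 x Bx))//.
  by rewrite ler_piMl ?normc_ge0// mono_le1.
move=> a' b'; rewrite -(i1 (fun j => (a j + a' j)%N) (fun j => (b j + b' j)%N)).
by apply: eq_cint => x; rewrite -monoM; ring.
Qed.

(** Dominated convergence with majorant |M| |v|. As v vanishes off the polydisc, bounds and limits
    are asked for on the polydisc alone. *)
Lemma test_fun_lim (psi_ : nat -> X -> R[i]) psi (M : R) :
  (forall k, test_fun (psi_ k)) -> cmeas psi ->
  (forall k x, polydisc x -> normc (psi_ k x) <= M) ->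
  (forall x, polydisc x -> normc (psi x) <= M) ->
  (forall x, polydisc x -> normc (psi_ k x - psi x) @[k --> \oo] --> (0 : R)) ->
  test_fun psi.
Proof.
move=> t_ mpsi bM pM pl; split => //; first by exists M.
move=> a b.
have h1 k : cmeas (fun x => v x * psi_ k x * mono a b x) by have [] := ivpsi a b (t_ k).
have h3 k := vpsi_le a b (bM k).
have h4 x : normc (v x * psi_ k x * mono a b x - v x * psi x * mono a b x)
    @[k --> \oo] --> (0 : R).
  case: (pselect (polydisc x)) => Bx; last first.
    rewrite (_ : (fun k => _) = fun=> 0); first exact: cvg_cst.
    by apply/funext => k; rewrite v0// !mul0r subrr [Normc.normc _]Normc.normc0.
  have : normc (v x) * normc (mono a b x) * normc (psi_ k x - psi x) @[k --> \oo] --> (0 : R).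
    rewrite -[X in _ --> X](mulr0 (normc (v x) * normc (mono a b x))).
    by apply: cvgM; [exact: cvg_cst|exact: pl].
  apply: cvg_trans; apply: near_eq_cvg; apply: nearW => k.
  by rewrite -mulrBl -mulrBr !Normc.normcM mulrAC.
have := cint_dominated h1 (iMv M) h3 h4.
have -> : (fun k => normc (cint nu (fun x => v x * psi_ k x * mono a b x) -
   cint nu (fun x => v x * psi x * mono a b x))) =
   (fun=> normc (cint nu (fun x => v x * psi x * mono a b x))).
  by apply/funext => k; have [_ _ ->] := t_ k; rewrite sub0r normcN.
move=> /(cvg_unique (@Rhausdorff R) (cvg_cst _)) h.
by apply/eqP; rewrite -normc_eq0 h.
Qed.

Definition real_coord (t : X -> R) := [/\ measurable_fun setT t,
  forall x, polydisc x -> `|t x| <= 1 &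
  forall psi, test_fun psi -> test_fun (fun x => (t x)%:C%C * psi x)].

Lemma real_coord_Re j : real_coord (fun x => (tnth x j).1).
Proof.
split; first by have [] := cmeas_zc j.
  by move=> x /(_ j); apply: le_trans; exact: (Re_le_normc (zc x j)).
move=> psi tpsi.
have := test_funZ (2^-1) (test_funD (test_fun_mono (delta j) (fun=> 0%N) tpsi)
  (test_fun_mono (fun=> 0%N) (delta j) tpsi)).
congr test_fun; apply/funext => x; rewrite -[mono _ (delta j) x]monoJ mono_delta.
rewrite -mulrDl mulrA; congr (_ * _).
by have /= -> := ReJ_add (zc x j); rewrite mulrC.
Qed.

Lemma real_coord_Im j : real_coord (fun x => (tnth x j).2).
Proof.
split; first by have [] := cmeas_zc j.
  by move=> x /(_ j); apply: le_trans; exact: (Im_le_normc (zc x j)).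
move=> psi tpsi.
have := test_funZ (2^-1 * 'i%C) (test_funD (test_funZ (-1) (test_fun_mono (delta j) (fun=> 0%N) tpsi))
  (test_fun_mono (fun=> 0%N) (delta j) tpsi)).
congr test_fun; apply/funext => x; rewrite -[mono _ (delta j) x]monoJ mono_delta.
rewrite mulN1r -mulNr -mulrDl mulrA; congr (_ * _).
by have /= -> := ImJ_sub (zc x j); ring.
Qed.

Lemma test_fun_poly t (p : {poly R}) psi : real_coord t -> test_fun psi ->
  test_fun (fun x => (p.[t x])%:C%C * psi x).
Proof.
move=> [_ _ tt] tpsi; elim/poly_ind: p => [|p c ih].
  by have := test_funZ 0 tpsi; under eq_fun do rewrite mul0r; under [X in _ -> test_fun X]eq_fun do rewrite horner0 mul0r.
have := test_funD (tt _ ih) (test_funZ c%:C%C tpsi).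
congr test_fun; apply/funext => x.
by rewrite hornerD hornerMX hornerC rmorphD rmorphM /=; ring.
Qed.

Lemma test_fun_lt t c psi : real_coord t -> test_fun psi ->
  test_fun (fun x => (\1_[set y | t y < c] x)%:C%C * psi x).
Proof.
move=> rt tpsi; have [mt t1 _] := rt; have [mpsi [M psiM] _] := tpsi.
(* Affine, with value 1/2 at c, and mapping [-1, 1] into [0, 1]; [step_seq] of it tends to the
   indicator of t < c. *)
pose q : {poly R} := 2^-1%:P + (2 * (1 + `|c|))^-1 *: ('X - c%:P).
have c0 : 0 < 2 * (1 + `|c|) by rewrite mulr_gt0// ltr_pwDl.
have q01 x : polydisc x -> 0 <= q.[t x] <= 1.
  move=> /t1; rewrite /q !hornerE ler_norml => /andP[h1 h2].
  have c1 := ler_norm c; have c2 := lerNnormlW (lexx `|c|).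
  rewrite (_ : 2^-1 + _ = (1 + `|c| + (t x - c)) / (2 * (1 + `|c|))); last first.
    by field; rewrite gt_eqF// ltr_pwDl.
  apply/andP; split; first by apply: divr_ge0; [lra|exact: ltW].
  by rewrite ler_pdivrMr//; lra.
have qh x : (q.[t x] < 2^-1) = (t x < c).
  by rewrite /q !hornerE -ltrBrDl subrr pmulr_rlt0 ?invr_gt0// subr_lt0.
have m1 : measurable [set y | t y < c].
  have := mt measurableT `]-oo, c[%classic (measurable_itv _).
  by rewrite setTI; congr measurable; apply/seteqP; split => x; rewrite /= in_itv.
apply: (@test_fun_lim (fun k x => (step_seq k q.[t x])%:C%C * psi x) _ `|M|).
- move=> k; have := test_fun_poly ((1 - q ^+ k) ^+ (2 ^ k * k)) rt tpsi.
  by congr test_fun; apply/funext => x; rewrite /step_seq !hornerE.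
- apply: cmeasM => //; apply: cmeas_real; exact: measurable_indic.
- move=> k x Bx; rewrite Normc.normcM normc_real -[leRHS]mul1r.
  have /andP[s0 s1] := step_seq01 k (q01 x Bx).
  apply: ler_pM; rewrite ?normc_ge0//; first by rewrite ger0_norm.
  by rewrite (le_trans (psiM x Bx))// ler_norm.
- move=> x Bx; rewrite Normc.normcM normc_real -[leRHS]mul1r.
  rewrite ler_pM ?normc_ge0//; last by rewrite (le_trans (psiM x Bx))// ler_norm.
  by rewrite indicE; case: (_ \in _); rewrite ?normr1 ?normr0.
move=> x Bx.
have h := step_seq_cvg (q01 x Bx).
have : normc (psi x) * `|step_seq k q.[t x] - (if q.[t x] < 2^-1 then 1 else 0)| @[k --> \oo] --> (0 : R).
  rewrite -[X in _ --> X](mulr0 (normc (psi x))); apply: cvgM; first exact: cvg_cst.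
  set L := (if _ then _ else _) in h *.
  rewrite -(normr0 R) -(subrr L); apply: cvg_norm; apply: cvgB => //; exact: cvg_cst.
apply: cvg_trans; apply: near_eq_cvg; apply: nearW => k.
rewrite -mulrBl Normc.normcM mulrC -rmorphB normc_real qh indicE.
by rewrite (_ : (x \in _) = (t x < c)); [case: ifP|apply/idP/idP; rewrite inE].
Qed.

(** Sets whose indicator preserves the class of test functions. They form a sigma-algebra, and by
    [test_fun_lt] it contains the half-spaces given by one real coordinate. *)
Let good_set (A : set X) := measurable A /\
  forall psi, test_fun psi -> test_fun (fun x => (\1_A x)%:C%C * psi x).

Let good_setT : good_set setT.
Proof.
split=> // psi; congr test_fun; apply/funext => x.
by rewrite indicE in_setT mul1r.
Qed.

Let good_setC A : good_set A -> good_set (~` A).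
Proof.
move=> [mA gA]; split; first exact: measurableC.
move=> psi tpsi; have := test_funD tpsi (test_funZ (-1) (gA _ tpsi)).
congr test_fun; apply/funext => x; rewrite mulN1r -{1}[psi x]mul1r -mulrBl.
congr (_ * _); rewrite !indicE in_setC.
by case: (x \in A); rewrite ?subrr// subr0.
Qed.

Let good_setI A B : good_set A -> good_set B -> good_set (A `&` B).
Proof.
move=> [mA gA] [mB gB]; split; first exact: measurableI.
move=> psi /gB/gA; congr test_fun; apply/funext => x.
by rewrite mulrA -rmorphM indicI.
Qed.

(** Finite unions come from complements and intersections; their indicators tend to that of the
    whole union, so [test_fun_lim] applies. *)
Let good_bigcup (A : nat -> set X) : (forall k, good_set (A k)) -> good_set (\bigcup_k A k).
Proof.
move=> gA; pose B k := iteri k (fun i S => S `|` A i) set0.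
have gB k : good_set (B k).
  elim: k => [|k ih] /=; first by rewrite -setCT; exact: good_setC.
  by rewrite -[_ `|` _]setCK setCU; apply/good_setC/good_setI; exact: good_setC.
have BE k y : B k y <-> exists2 i, (i < k)%N & A i y.
  elim: k => [|k ih] /=; first by split=> // -[].
  split=> [ [|Ak] | [j] ]; first by move=> /ih[i ik Ai]; exists i => //; exact: ltnW.
    by exists k.
  by rewrite ltnS leq_eqVlt => /orP[/eqP <-|jk Aj]; [right|left; apply/ih; exists j].
split; first by apply: bigcupT_measurable => k; have [] := gA k.
move=> psi tpsi; have [mpsi [M psiM] _] := tpsi.
have bnd (C : set X) x : polydisc x -> normc ((\1_C x)%:C%C * psi x) <= `|M|.
  move=> Bx; rewrite Normc.normcM normc_real -[leRHS]mul1r.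
  rewrite ler_pM ?normc_ge0//; last by rewrite (le_trans (psiM x Bx))// ler_norm.
  by rewrite indicE; case: (_ \in _); rewrite ?normr1 ?normr0.
apply: (@test_fun_lim (fun k x => (\1_(B k) x)%:C%C * psi x) _ `|M|).
- by move=> k; have [_] := gB k; apply.
- apply: cmeasM => //; apply/cmeas_real/measurable_indic.
  by apply: bigcupT_measurable => k; have [] := gA k.
- by move=> k; exact: bnd.
- exact: bnd.
move=> x Bx; apply: cvg_near_cst.
case: (pselect ((\bigcup_k A k) x)) => [[N _ AN]|nA].
  exists N.+1 => // k /= Nk; rewrite !indicE !mem_set ?subrr ?[Normc.normc _]Normc.normc0//.
    by exists N.
  by apply/BE; exists N.
apply: nearW => k; rewrite !indicE !memNset ?subrr ?[Normc.normc _]Normc.normc0//.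
by move=> /BE[i _ Ai]; apply: nA; exists i.
Qed.

Let good_measurable A : measurable A -> good_set A.
Proof.
have sG : sigma_algebra setT good_set.
  split; first by rewrite -setCT; exact: good_setC.
    by move=> B gB; rewrite setTD; exact: good_setC.
  exact: good_bigcup.
(* The same space with the good sets as sigma-algebra. The real coordinates are measurable on it,
   hence so is the identity to the usual space, which says that every measurable set is good. *)
pose T' := g_sigma_algebraType good_set.
have mR (t : X -> R) : real_coord t -> measurable_fun setT (t : T' -> R).
  move=> rt; apply: (measurability _ (RGenInftyO.measurableE R)) => _ [_ [c ->] <-].
  apply: sub_sigma_algebra; rewrite setTI; split; last first.
    move=> psi tpsi; have := test_fun_lt c rt tpsi; congr test_fun.
  have [mt _ _] := rt.
  by have := mt measurableT `]-oo, c[%classic (measurable_itv _); rewrite setTI.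
have mid : measurable_fun setT (id : T' -> X).
  apply/measurable_fun_tnthP => j; apply/measurable_fun_pairP; split.
    exact: mR (real_coord_Re j).
  exact: mR (real_coord_Im j).
move=> mA; have := mid measurableT A mA; rewrite setTI preimage_id.
by rewrite -[X in X A -> _]/(<<s good_set >>) sigma_algebra_id.
Qed.

Theorem moment_uniqueness : {ae nu, forall x, v x = 0}.
Proof.
have vA A : measurable A -> cint nu (fun x => (\1_A x)%:C%C * v x) = 0.
  move=> mA; have [_ gA] := good_measurable mA.
  have [_ _ /(_ (fun=> 0%N) (fun=> 0%N)) <-] := gA _ test_fun1.
  by apply: eq_cint => x; rewrite mono0 !mulr1 mulrC.
have [iRe iIm] := cintgP iv.
have part (q : R[i] -> R) : (forall (a : R) z, q (a%:C%C * z) = a * q z) ->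
    nu.-integrable setT (EFin \o (fun x => q (v x))) ->
    (forall A, measurable A -> (\int[nu]_x q ((\1_A x)%:C%C * v x))%R = 0) ->
    {ae nu, forall x, q (v x) = 0}.
  move=> qa iq q0.
  have mq : measurable_fun setT (fun x => q (v x)).
    by apply/measurable_EFinP; exact: measurable_int iq.
  have h E : E `<=` setT -> measurable E ->
      (\int[nu]_(x in E) (q (v x))%:E = \int[nu]_(x in E) cst 0 x)%E.
    move=> _ mE; rewrite integral0.
    have fE : (\int[nu]_(x in E) (q (v x))%:E)%E \is a fin_num.
      apply: integrable_fin_num => //.
      exact: (integrableS _ _ _ iq).
    rewrite -(fineK fE); congr EFin; rewrite -[RHS](q0 E mE) /Rintegral; congr fine.
    rewrite [LHS]integral_mkcond; apply: eq_integral => x _.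
    by rewrite patchE indicE qa; case: ifP => _; rewrite ?mul1r ?mul0r.
  have := integral_ae_eq measurableT iq (measurable_cst 0%E) h.
  by apply: filterS => x /(_ I) [].
have hRe : {ae nu, forall x, complex.Re (v x) = 0}.
  apply: (part (@complex.Re R) _ iRe) => [a z|A mA]; first by rewrite creM /= mul0r subr0.
  by have := vA A mA => /(congr1 (@complex.Re R)).
have hIm : {ae nu, forall x, complex.Im (v x) = 0}.
  apply: (part (@complex.Im R) _ iIm) => [a z|A mA]; first by rewrite cimM /= mul0r addr0.
  by have := vA A mA => /(congr1 (@complex.Im R)).
apply: filterS2 hRe hIm => x h1 h2.
by apply/eqP; rewrite eq_complex h1 h2 !eqxx.
Qed.

End moment_uniqueness.

(** * The weighted measure on the ball *)

Section power_integral.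
Local Open Scope ereal_scope.
Context d (T : measurableType d) (R : realType).
Variable m : {measure set T -> \bar R}.

Lemma geometric_series_lty (u : nat -> \bar R) (C q : R) :
  (0 <= C)%R -> (0 < q < 1)%R -> (forall k, 0 <= u k <= (C * q ^+ k)%:E) ->
  \sum_(0 <= k <oo) u k < +oo.
Proof.
move=> C0 /andP[q0 q1] uC.
apply: (@le_lt_trans _ _ (C * (1 - q)^-1)%:E); last exact: ltry.
apply: lime_le.
  by apply: is_cvg_ereal_nneg_natsum => k _; have /andP[] := uC k.
apply: nearW => N.
apply: (@le_trans _ _ (\sum_(0 <= k < N) (C * q ^+ k)%:E)).
  by apply: lee_sum => k _; have /andP[] := uC k.
rewrite sumEFin lee_fin -big_distrr/= ler_wpM2l//.
rewrite big_mkord; have := subrX1 q N => e.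
rewrite -[leRHS]mul1r ler_pdivlMr ?subr_gt0//.
have := exprn_ge0 N (ltW q0); set t := (\sum_(i < N) _)%R in e *.
by nra.
Qed.

(* Dyadic decomposition along the values of tau. *)
Lemma integral_powR_lty (tau : T -> R) (D : set T) (C b : R) :
  measurable D -> measurable_fun setT tau -> (forall x, D x -> 0 < tau x <= 1)%R ->
  (0 <= C)%R -> (-1 < b)%R ->
  (forall r : R, (0 < r)%R -> m (D `&` [set x | (tau x <= r)%R]) <= (C * r)%:E) ->
  \int[m]_(x in D) (tau x `^ b)%:E < +oo.
Proof.
move=> mD mtau tau01 C0 b1 mC.
have mle r : measurable (D `&` [set x | (tau x <= r)%R]).
  apply: measurableI => //; rewrite -[X in measurable X]setTI.
  have -> : [set x | (tau x <= r)%R] = tau @^-1` `]-oo, r].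
    by apply/seteqP; split => x /=; rewrite in_itv.
  exact: mtau.
have mpow A : measurable_fun A (fun x => (tau x `^ b)%:E).
  apply/measurable_EFinP; apply: measurable_funTS.
  exact: (measurableT_comp (measurable_powR b)).
have mDC : m D <= C%:E.
  have := mC 1%R ltr01; rewrite mulr1; congr (m _ <= _); apply/seteqP; split => [x []//|x Dx].
  by split => //=; have /andP[] := tau01 x Dx.
pose h : R := (2^-1)%R; have h0 : (0 < h)%R by rewrite invr_gt0.
have h1 : (h < 1)%R by rewrite invf_lt1// ltr1n.
pose q := (h `^ (1 + b))%R.
have q0 : (0 < q)%R by rewrite powR_gt0.
have q1 : (q < 1)%R.
  have -> : (1 = 1 `^ (1 + b) :> R)%R by rewrite powR1.
  by rewrite gt0_ltr_powR// ?nnegrE ?ltW//; lra.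
pose E k := (D `&` [set x | (tau x <= h ^+ k)%R]) `\` (D `&` [set x | (tau x <= h ^+ k.+1)%R]).
have mE k : measurable (E k) by exact: measurableD.
have ED : D = \bigcup_k E k.
  apply/seteqP; split => [x Dx|x [k _ [[]]]//].
  have /andP[t0 t1] := tau01 x Dx.
  have [N hN] : exists N, (h ^+ N < tau x)%R.
    have : (h ^+ k @[k --> \oo] --> (0 : R))%R by apply: cvg_expr; rewrite ger0_norm ?ltW.
    move=> /cvgrPdist_lt /(_ _ t0)[N _ /(_ N (leqnn N))].
    rewrite sub0r normrN => hh; exists N; exact: le_lt_trans (ler_norm _) hh.
  elim: N hN => [|N ih] hN; first by move: hN; rewrite expr0 ltNge t1.
  have [hle|hgt] := leP (tau x) (h ^+ N)%R; last exact: ih.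
  exists N => //; split; first by split.
  by move=> [_ /=]; rewrite leNgt hN.
have tE : trivIset setT E.
  apply: ltn_trivIset => j i ij; rewrite -subset0 => x [[[Dx xi] ni] [[_ xj] nj]].
  apply: ni; split => //=; apply: le_trans (xj : (_ <= _)%R) _.
  by rewrite ler_wiXn2l// ltW.
rewrite [X in integral _ X _]ED ge0_integral_bigcup//; last by move=> x _; rewrite lee_fin powR_ge0.
(* On the shell h^(k+1) < tau <= h^k the power tau^b is at most (h^k)^b if b >= 0, and at most h^b
   (h^k)^b if b < 0. The shell has measure at most C h^k, so its integral is at most C B q^k with q
   = h^(1+b) < 1. *)
pose B := Num.max 1%R (h `^ b)%R.
have B0 : (0 <= B)%R by rewrite le_max ler01.
have hk0 k : (0 < h ^+ k)%R by rewrite exprn_gt0.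
have bnd k : \int[m]_(x in E k) (tau x `^ b)%:E <= (C * B * q ^+ k)%:E.
  have tb x : E k x -> (tau x `^ b <= B * (h ^+ k) `^ b)%R.
    move=> [[Dx /= xk] nx]; have /andP[t0 t1] := tau01 x Dx.
    have kt : (h ^+ k.+1 < tau x)%R.
      by rewrite ltNge; apply/negP => hh; apply: nx; split.
    have [b0|b0] := leP 0%R b.
      apply: (@le_trans _ _ ((h ^+ k) `^ b)%R).
        by rewrite ge0_ler_powR// ?nnegrE ltW.
      by rewrite ler_peMl ?powR_ge0// le_max lexx.
    apply: (@le_trans _ _ ((h ^+ k.+1) `^ b)%R).
      rewrite -(opprK b) 2!(powRN _ (- b)) lef_pV2 ?posrE ?powR_gt0//.
      by rewrite ge0_ler_powR// ?nnegrE ?ltW// oppr_gt0.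
    rewrite exprS powRM ?(ltW h0) ?(ltW (hk0 k))// ler_wpM2r ?powR_ge0//.
    by rewrite le_max lexx orbT.
  apply: (@le_trans _ _ (\int[m]_(x in E k) (B * (h ^+ k) `^ b)%:E)).
    apply: ge0_le_integral => //.
    by move=> x _; rewrite lee_fin powR_ge0.
  rewrite integral_cst//.
  apply: (@le_trans _ _ ((B * (h ^+ k) `^ b)%:E * (C * h ^+ k)%:E)).
    apply: lee_wpmul2l; first by rewrite lee_fin mulr_ge0 ?powR_ge0.
    apply: le_trans (mC _ (hk0 k)); apply: le_measure; rewrite ?inE//.
    exact: subDsetl.
  rewrite -EFinM lee_fin /q -[X in (_ * _ * X)%R]powR_mulrn ?powR_ge0//.
  rewrite -powRrM mulrC (mulrC (1 + b)%R) powRrM powR_mulrn ?(ltW h0)// powRD; last first.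
    by rewrite (gt_eqF (hk0 k)) implybT.
  by rewrite powRr1 ?(ltW (hk0 k))//; lra.
apply: (geometric_series_lty (C := C * B) (q := q)) => //.
- by rewrite mulr_ge0.
- by rewrite q0.
- move=> k; rewrite bnd andbT.
  by apply: integral_ge0 => x _; rewrite lee_fin powR_ge0.
Qed.

(** Where tau <= 1 this is [integral_powR_lty]; where tau > 1 the exponential beats every power on
    dyadic shells. It serves for the Gamma integral, with tau the identity, and for the Gaussian
    integrals, with tau = |z|^2. *)
Lemma integral_powR_expR_lty (tau : T -> R) (D : set T) (C b : R) :
  measurable D -> measurable_fun setT tau -> (forall x, D x -> 0 < tau x)%R ->
  (0 <= C)%R -> (-1 < b)%R ->
  (forall r : R, (0 < r)%R -> m (D `&` [set x | (tau x <= r)%R]) <= (C * r)%:E) ->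
  \int[m]_(x in D) (tau x `^ b * expR (- tau x))%:E < +oo.
Proof.
move=> mD mtau tau0 C0 b1 mC.
have mle r : measurable (D `&` [set x | (tau x <= r)%R]).
  apply: measurableI => //; rewrite -[X in measurable X]setTI.
  have -> : [set x | (tau x <= r)%R] = tau @^-1` `]-oo, r].
    by apply/seteqP; split => x /=; rewrite in_itv.
  exact: mtau.
have mfun A : measurable_fun A (fun x => (tau x `^ b * expR (- tau x))%:E).
  apply/measurable_EFinP; apply: measurable_funTS; apply: measurable_funM.
    exact: (measurableT_comp (measurable_powR b)).
  by apply: measurableT_comp => //; exact: measurableT_comp.
have f0 x : 0 <= (tau x `^ b * expR (- tau x))%:E.
  by rewrite lee_fin mulr_ge0 ?powR_ge0 ?expR_ge0.
pose D1 := D `&` [set x | (tau x <= 1)%R].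
have mD1 : measurable D1 by exact: mle.
have D12 : D = D1 `|` (D `\` D1).
  by rewrite setDUK//; exact: subIsetl.
rewrite [X in integral _ X _]D12.
rewrite ge0_integral_setU//; [|exact: measurableD|by apply/disj_setPS => x [? []]].
apply: lte_add_pinfty.
  apply: (@le_lt_trans _ _ (\int[m]_(x in D1) (tau x `^ b)%:E)).
    apply: ge0_le_integral => //.
    - apply/measurable_EFinP; apply: measurable_funTS.
      exact: (measurableT_comp (measurable_powR b)).
    - move=> x [Dx _]; rewrite lee_fin ler_piMr ?powR_ge0// -expR0 ler_expR.
      by rewrite oppr_le0 ltW// tau0.
  apply: (integral_powR_lty (C := C)) => //.
    by move=> x [Dx /= ->]; rewrite tau0.
  move=> r r0; apply: le_trans (mC r r0); apply: le_measure; rewrite ?inE//.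
    rewrite (_ : _ `&` _ = D1 `&` (D `&` [set x | (tau x <= r)%R])); first exact: measurableI.
    by apply/seteqP; split => x [[Dx x1]]; [move=> xr|case=> _ xr].
  by move=> x [[Dx _] xr]; split.
pose E k := (D `&` [set x | (tau x <= 2 ^+ k.+1)%R]) `\` (D `&` [set x | (tau x <= 2 ^+ k)%R]).
have mE k : measurable (E k) by exact: measurableD.
have ED : D `\` D1 = \bigcup_k E k.
  apply/seteqP; split => [x [Dx nx]|x [k _ [[Dx xk] nx]]].
    have [N hN] : exists N, (tau x <= 2 ^+ N)%R.
      exists (Num.truncn (tau x)).+1; apply: ltW; apply: lt_le_trans (Num.Theory.truncnS_gt _) _.
      by rewrite -natrX ler_nat ltnW// ltn_expl.
    elim: N hN => [|N ih] hN; first by exfalso; apply: nx; split; rewrite //= (le_trans hN)// expr0.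
    have [hle|hgt] := leP (tau x) (2 ^+ N)%R; first exact: ih.
    exists N => //; split; first by split.
    by move=> [_ /=]; rewrite leNgt hgt.
  split => // -[_ /= x1]; apply: nx; split => //=; apply: le_trans x1 _.
  by rewrite exprn_ege1// ler1n.
have tE : trivIset setT E.
  apply: ltn_trivIset => j i ij; rewrite -subset0 => x [[[Dx xi] ni] [[_ xj] nj]].
  apply: nj; split => //=; apply: le_trans (xi : (_ <= _)%R) _.
  by rewrite ler_weXn2l// ler1n.
rewrite ED ge0_integral_bigcup//.
(* As N > b and tau >= 1, tau^b <= tau^N, and exp(-tau) <= (N+2)!/tau^(N+2), so the integrand is at
   most K/tau^2. On a shell of measure at most C 2^(k+1) this leaves a multiple of 2^-k. *)
pose N := (Num.truncn b).+1; pose K : R := (N.+2)`!%:R.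
have K0 : (0 <= K)%R by rewrite ler0n.
apply: (geometric_series_lty (C := K * C * 2) (q := 2^-1)) => //.
- by rewrite !mulr_ge0.
- by rewrite invr_gt0 ltr0n invf_lt1// ltr1n.
move=> k; rewrite integral_ge0//=.
have h0 : (0 < 2 ^+ k :> R)%R by rewrite exprn_gt0.
apply: (@le_trans _ _ (\int[m]_(x in E k) (K * (2 ^+ k) ^- 2)%:E)).
  apply: ge0_le_integral => //.
  move=> x [[Dx _] nx]; rewrite lee_fin.
  have kt : (2 ^+ k < tau x)%R by rewrite ltNge; apply/negP => hh; apply: nx; split.
  have t1 : (1 <= tau x)%R by apply: le_trans (ltW kt); rewrite exprn_ege1// ler1n.
  have t0 : (0 < tau x)%R by exact: lt_le_trans t1.
  apply: (@le_trans _ _ (tau x ^+ N * (K / tau x ^+ N.+2)))%R.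
    apply: ler_pM; rewrite ?powR_ge0 ?expR_ge0//.
      rewrite -powR_mulrn ?(ltW t0)//; apply: ler_powR => //; apply: ltW; exact: Num.Theory.truncnS_gt.
    rewrite expRN -invf_div lef_pV2 ?posrE ?expR_gt0 ?divr_gt0 ?exprn_gt0 ?ltr0n ?fact_gt0//.
    apply: le_trans (expR_ge1Dxn N.+1 (ltW t0)); rewrite /K; lra.
  rewrite mulrCA ler_wpM2l// -addn2 exprD invfM mulrA divff ?expf_neq0 ?gt_eqF// mul1r.
  by rewrite lef_pV2 ?posrE ?exprn_gt0// lerXn2r ?nnegrE ?ltW.
rewrite integral_cst//.
apply: (@le_trans _ _ ((K * (2 ^+ k) ^- 2)%:E * (C * 2 ^+ k.+1)%:E)).
  apply: lee_wpmul2l; first by rewrite lee_fin mulr_ge0// invr_ge0 exprn_ge0// ltW.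
  apply: le_trans (mC _ (exprn_gt0 k.+1 (ltr0n _ 2))); apply: le_measure; rewrite ?inE//.
  exact: subDsetl.
rewrite -EFinM lee_fin exprVn (exprS 2 k); set t := (2 ^+ k)%R in h0 *.
rewrite [leLHS](_ : _ = (K * C * 2 * t^-1)%R)//.
by field; rewrite gt_eqF.
Qed.

Lemma ge0_integral_gt0 (D : set T) (f : T -> \bar R) :
  measurable D -> measurable_fun D f -> (forall x, D x -> 0 < f x) -> 0 < m D ->
  0 < \int[m]_(x in D) f x.
Proof.
move=> mD mf f0 mD0.
have i0 : 0 <= \int[m]_(x in D) f x by apply: integral_ge0 => x /f0/ltW.
rewrite lt0e i0 andbT; apply/eqP => e.
have : \int[m]_(x in D) `|f x| = 0.
  by rewrite -e; apply: eq_integral => x /set_mem/f0 fx; rewrite gee0_abs// ltW.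
move=> /(ae_eq_integral_abs m mD mf) [N [mN N0 DN]].
have : m D <= m N.
  apply: le_measure; rewrite ?inE// => x Dx; apply: DN => /= /(_ Dx) fx.
  by have := f0 x Dx; rewrite fx ltxx.
by rewrite N0 leNgt mD0.
Qed.

End power_integral.

(** * Positivity of the Gamma function *)

Section gamma.
Variable R : realType.

(** [Gamma] is the finite part of an extended integral, with value 0 at infinity, so positivity
    requires convergence as well. *)
Lemma Gamma_gt0 (a : R) : 0 < a -> 0 < Gamma a.
Proof.
move=> a0; rewrite /Gamma /Rintegral.
pose f (t : R) := t `^ (a - 1) * expR (- t).
have f0 t : `]0, +oo[%classic t -> 0 < f t.
  by rewrite /= in_itv/= andbT => t0; rewrite mulr_gt0 ?powR_gt0 ?expR_gt0.
have mf : measurable_fun (`]0, +oo[%classic : set (measurableTypeR R)) (EFin \o f).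
  apply/measurable_EFinP; apply: measurable_funTS; apply: measurable_funM.
    exact: measurable_powR.
  by apply: measurableT_comp => //; exact: measurableT_comp.
rewrite fine_gt0//; apply/andP; split.
  apply: ge0_integral_gt0 => //.
  have := lebesgue_measure_itv (`]0, +oo[ : interval R).
  by rewrite /= ltry addye// => e; rewrite [ltRHS]e ltry.
apply: (@integral_powR_expR_lty _ (measurableTypeR R) R lebesgue_measure id _ 1 (a - 1)) => //.
- by move=> t /=; rewrite in_itv/= andbT.
- by lra.
- move=> r r0; rewrite (_ : _ `&` _ = `]0, r]%classic).
    have := lebesgue_measure_itv (`]0, r] : interval R).
    by rewrite /= lte_fin r0 sube0 mul1r => e; rewrite [leLHS]e.
  by apply/seteqP; split => t /=; rewrite !in_itv/= andbT => /andP.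
Qed.

End gamma.

Section tuple_product.
Context d (T : measurableType d) (R : realType).
Variable m : {sigma_finite_measure set T -> \bar R}.

Lemma ge0_integral_tuple_prod n (f : 'I_n -> T -> R) (c : 'I_n -> R) :
  (forall i, measurable_fun setT (f i)) -> (forall i x, 0 <= f i x) ->
  (forall i, \int[m]_x (f i x)%:E = (c i)%:E)%E ->
  (\int[tuple_measure m n]_x (\prod_i f i (tnth x i))%:E = (\prod_i c i)%:E)%E.
Proof.
elim: n f c => [|n ih] f c mf f0 fc.
  under eq_integral do rewrite big_ord0.
  by rewrite /= integral_dirac// diracT mul1e big_ord0.
have mprod k (h : 'I_k -> T -> R) : (forall i, measurable_fun setT (h i)) ->
    measurable_fun setT (fun x : k.-tuple T => (\prod_i h i (tnth x i))%:E).
  move=> mh; apply/measurable_EFinP; apply: measurable_prod => i _.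
  by apply: (measurableT_comp (mh i)); exact: measurable_tnth.
have p0 k (h : 'I_k -> T -> R) (x : k.-tuple T) : (forall i y, 0 <= h i y) ->
    (0 <= (\prod_i h i (tnth x i))%:E)%E.
  by move=> h0; rewrite lee_fin prodr_ge0.
have fE x (y : n.-tuple T) : \prod_i f i (tnth (tuple_cons (x, y)) i) =
    f ord0 x * \prod_i f (lift ord0 i) (tnth y i).
  by rewrite big_ord_recl tnth0; congr (_ * _); apply: eq_bigr => i _; rewrite tnthS.
rewrite /= /tuple_measureS.
have := @ge0_integral_pushforward _ _ _ _ _ _ (@measurable_tuple_cons _ T n)
  (m \x tuple_measure m n)%E setT _ measurableT (mprod _ f mf) (fun x _ => p0 _ f x f0).
move=> -> /=; rewrite preimage_setT fubini_tonelli1//; last first.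
  by move=> x; exact: p0.
  exact: (measurableT_comp (mprod _ f mf) (@measurable_tuple_cons _ T n)).
rewrite /fubini_F/=.
under eq_integral => x _.
  under eq_integral => y _ do rewrite fE EFinM.
  rewrite ge0_integralZl//; [|exact: (mprod _ (fun i => f (lift ord0 i)))|by move=> y _; exact: (p0 _ (fun i => f (lift ord0 i)))|by rewrite lee_fin].
  rewrite (ih (fun i => f (lift ord0 i)) (fun i => c (lift ord0 i)))//.
  over.
rewrite ge0_integralZr//; [|exact/measurable_EFinP|by move=> x _; rewrite lee_fin|].
  by rewrite fc big_ord_recl EFinM.
rewrite lee_fin; apply: prodr_ge0 => i _.
by rewrite -lee_fin -fc; apply: integral_ge0 => x _; rewrite lee_fin.
Qed.

Lemma tuple_measure_box n (A : 'I_n -> set T) (c : 'I_n -> R) :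
  (forall i, measurable (A i)) -> (forall i, m (A i) = (c i)%:E) ->
  measurable [set x : n.-tuple T | forall i, A i (tnth x i)] /\
  tuple_measure m n [set x : n.-tuple T | forall i, A i (tnth x i)] = (\prod_i c i)%:E.
Proof.
move=> mA Ac; set B := [set x | _].
have mB : measurable B.
  rewrite (_ : B = \bigcap_(i in [set: 'I_n]) ((fun x : n.-tuple T => tnth x i) @^-1` A i)).
    apply: fin_bigcap_measurable => [|i _]; first exact: finite_finset.
    by rewrite -[X in measurable X]setTI; exact: measurable_tnth.
  by apply/seteqP; split => x /= h i; [move=> _; exact: h|exact: h].
split=> //.
rewrite -(@ge0_integral_tuple_prod n (fun i => \1_(A i)) c) => [|i|i x|i].
- rewrite -[in LHS](setIT B) -integral_indic//; apply: eq_integral => x _; congr EFin.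
  rewrite indicE; case: (boolP (x \in B)) => [/set_mem xB|/negP xB].
    by rewrite big1// => i _; rewrite indicE mem_set.
  apply/esym/eqP; rewrite prodf_seq_eq0; apply/hasP.
  have [i xi] : exists i, ~ A i (tnth x i).
    by apply: contrapT => h; apply: xB; apply: mem_set => i; apply: contrapT => hi; apply: h; exists i.
  by exists i; rewrite ?mem_index_enum//= indicE memNset.
- exact: measurable_indic.
- by rewrite indicE.
- rewrite integral_indic// setIT; exact: Ac.
Qed.

End tuple_product.

Lemma lebesgue_measure_centered (R : realType) (c e : R) : 0 < e ->
  lebesgue_measure `[c - e, c + e]%classic = (2 * e)%:E.
Proof.
move=> e0; rewrite lebesgue_measure_itv/= lte_fin ifT; last by lra.
by rewrite -EFinB; congr EFin; ring.
Qed.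

(** * Volumes of balls and boxes *)

Section ball_volume.
Variables (R : realType) (n : nat).
Local Notation P := (measurableTypeR R * measurableTypeR R)%type.
Local Notation X := (n.-tuple P).
Local Notation normc := Normc.normc.
Local Notation L := (lebesgueC R n).

Definition normsq (x : X) : R := \sum_j normc (zc x j) ^+ 2.

Lemma normsq_ge0 x : 0 <= normsq x.
Proof. by apply: sumr_ge0 => j _; rewrite exprn_ge0// normc_ge0. Qed.

Lemma measurable_normsq : measurable_fun setT normsq.
Proof.
apply: measurable_sum => j; apply: measurable_funX.
apply: measurable_normc; exact: cmeas_zc.
Qed.

Lemma of_coordsE (x : X) j : of_coords x ord0 j = zc x j.
Proof. by rewrite mxE. Qed.

Lemma vnormE (x : X) : vnorm (of_coords x) = Num.sqrt (normsq x).
Proof. by congr Num.sqrt; apply: eq_bigr => j _; rewrite of_coordsE. Qed.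

Lemma vnorm_sqr (x : X) : vnorm (of_coords x) ^+ 2 = normsq x.
Proof. by rewrite vnormE sqr_sqrtr// normsq_ge0. Qed.

Lemma ball_coordsE : @ball_coords R n = [set x | normsq x < 1].
Proof.
apply/seteqP; split => x; rewrite /ball_coords /unit_ball /= vnormE.
  by rewrite -{1}sqrtr1 ltr_sqrt.
by rewrite -{2}sqrtr1 ltr_sqrt.
Qed.

Lemma measurable_normsq_lt (s : R) : measurable [set x : X | normsq x < s].
Proof.
rewrite -[X in measurable X]setTI (_ : [set x | _] = normsq @^-1` `]-oo, s[).
  exact: measurable_normsq.
by apply/seteqP; split => x /=; rewrite in_itv.
Qed.

Definition dilate (s : R) : X -> X := tuple_map (fun _ p => (s * p.1, s * p.2)).

Lemma zc_dilate s x j : zc (dilate s x) j = s%:C%C * zc x j.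
Proof. by rewrite /zc /dilate tnth_mktuple; apply/eqP; rewrite eq_complex /=; apply/andP; split; apply/eqP; ring. Qed.

Lemma normsq_dilate s x : normsq (dilate s x) = s ^+ 2 * normsq x.
Proof.
rewrite /normsq big_distrr; apply: eq_bigr => j _.
by rewrite zc_dilate Normc.normcM normc_real exprMn real_normK ?num_real.
Qed.

Lemma scales_dilate (s : R) : 0 < s -> scales L ((s ^- 2) ^+ n) (dilate s).
Proof.
move=> s0; rewrite -[n in X in scales _ X]card_ord -prodr_const.
apply: scales_tuple => i; first by rewrite invr_gt0 exprn_gt0.
exact: lebesgue2_dilate.
Qed.

Definition square (p : P) (e : R) : set P :=
  `[p.1 - e, p.1 + e]%classic `*` `[p.2 - e, p.2 + e]%classic.

Lemma squareP p e q : square p e q <-> `|q.1 - p.1| <= e /\ `|q.2 - p.2| <= e.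
Proof. by rewrite /square /= !in_itv/= -!ler_distl. Qed.

Lemma lebesgue2_square (p : P) (e : R) : 0 < e ->
  measurable (square p e) /\ @lebesgue2 R (square p e) = ((2 * e) ^+ 2)%:E.
Proof.
move=> e0; split; first exact: measurableX.
rewrite /lebesgue2 product_measure1E//.
rewrite [in RHS]expr2 EFinM.
congr (_ * _)%E; exact: lebesgue_measure_centered.
Qed.

Definition box (c : X) (e : R) : set X := [set x | forall j, square (tnth c j) e (tnth x j)].

Lemma box_volume (c : X) (e : R) : 0 < e ->
  measurable (box c e) /\ L (box c e) = (((2 * e) ^+ 2) ^+ n)%:E.
Proof.
move=> e0; have sq j := lebesgue2_square (tnth c j) e0.
have := @tuple_measure_box _ _ _ (@lebesgue2 R) n (fun j => square (tnth c j) e) (fun=> _)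
  (fun j => (sq j).1) (fun j => (sq j).2).
by rewrite prodr_const card_ord.
Qed.

Definition origin : X := [tuple (0, 0) | _ < n].

Lemma box_originP (e : R) x : box origin e x <->
  forall j, `|(tnth x j).1| <= e /\ `|(tnth x j).2| <= e.
Proof.
by split => h j; have := h j; rewrite squareP tnth_mktuple /= !subr0.
Qed.

Lemma volume_lty : (L [set x | (normsq x < 1)%R] < +oo)%E.
Proof.
have [mB LB] := box_volume origin ltr01.
apply: (@le_lt_trans _ _ (((2 * 1) ^+ 2) ^+ n)%:E); last exact: ltry.
  rewrite -LB; apply: le_measure; rewrite ?inE//; first exact: measurable_normsq_lt.
  move=> x /= x1; apply/box_originP => j.
  have : normc (zc x j) <= 1.
    rewrite -(@expr_le1 _ 2)// ?normc_ge0//; apply: le_trans (ltW x1).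
    rewrite /normsq (bigD1 j)//= lerDl; apply: sumr_ge0 => i _.
    by rewrite exprn_ge0// normc_ge0.
  move=> zj; split.
    exact: le_trans (Re_le_normc (zc x j)) zj.
  exact: le_trans (Im_le_normc (zc x j)) zj.
Qed.

Lemma volume_gt0 (s : R) : 0 < s -> (0 < L [set x | (normsq x < s)%R])%E.
Proof.
move=> s0; pose e := Num.sqrt (s / (2 * n%:R + 1)).
have n0 : 0 < 2 * n%:R + 1 :> R by rewrite ltr_wpDl// mulr_ge0.
have e0 : 0 < e by rewrite sqrtr_gt0 divr_gt0.
have [mB LB] := box_volume origin e0.
apply: (@lt_le_trans _ _ (((2 * e) ^+ 2) ^+ n)%:E).
  by rewrite lte_fin !exprn_gt0// mulr_gt0.
rewrite -LB; apply: le_measure; rewrite ?inE//; first exact: measurable_normsq_lt.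
move=> x Bx; apply: (@le_lt_trans _ _ (\sum_(j < n) 2 * e ^+ 2)).
  apply: ler_sum => j _; have [h1 h2] := (box_originP _ _).1 Bx j.
  rewrite sqr_sqrtr ?addr_ge0 ?sqr_ge0// -(real_normK (num_real (tnth x j).1)) -(real_normK (num_real (tnth x j).2)).
  rewrite mulr2n mulrDl mul1r; by apply: lerD; rewrite lerXn2r ?nnegrE// ltW.
rewrite sumr_const card_ord -[ltLHS]mulr_natr /e sqr_sqrtr; last by rewrite divr_ge0// ltW.
rewrite [ltLHS](_ : _ = s * (2 * n%:R / (2 * n%:R + 1))); last by ring.
by rewrite gtr_pMr// ltr_pdivrMr// mul1r ltrDl.
Qed.

Definition volume : R := fine (L [set x | normsq x < 1]).

Lemma volumeE : L [set x | normsq x < 1] = volume%:E.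
Proof. by rewrite /volume fineK// ge0_fin_numE// volume_lty. Qed.

Lemma volume_pos : 0 < volume.
Proof. by rewrite -lte_fin -volumeE; exact: volume_gt0. Qed.

(** The ball of squared radius [s] is the dilate by the square root of [s] of the unit ball, in real
    dimension 2n. *)
Lemma volume_ball (s : R) : 0 < s -> L [set x | normsq x < s] = (s ^+ n * volume)%:E.
Proof.
move=> s0; have q0 : 0 < Num.sqrt s by rewrite sqrtr_gt0.
have [_ /(_ _ (measurable_normsq_lt s))] := scales_dilate q0.
rewrite (_ : dilate _ @^-1` _ = [set x | normsq x < 1]); last first.
  apply/seteqP; split => x /=; rewrite normsq_dilate sqr_sqrtr ?(ltW s0)//;
    by rewrite -[X in _ < X -> _]mulr1 ltr_pM2l || rewrite -[X in _ -> _ < X]mulr1 ltr_pM2l.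
rewrite sqr_sqrtr ?(ltW s0)// => /(etrans (esym volumeE)) e.
rewrite EFinM e muleA -EFinM -exprMn divff ?gt_eqF//.
by rewrite expr1n mul1e.
Qed.

(* normsq x <= normsq c + e (2 sum |c_j| + ...): continuity made explicit *)
Lemma box_subset_ball (c : X) (s : R) : normsq c < s ->
  exists2 e : R, 0 < e & forall x, box c e x -> normsq x < s.
Proof.
move=> cs; pose M : R := \sum_j (2 * (`|(tnth c j).1| + `|(tnth c j).2|) + 2).
have M0 : 0 <= M by apply: sumr_ge0 => j _; rewrite addr_ge0// mulr_ge0// addr_ge0.
pose e := Num.min 1 ((s - normsq c) / (M + 1) / 2).
have d0 : 0 < (s - normsq c) / (M + 1) by rewrite divr_gt0 ?subr_gt0// ltr_wpDl.
have e0 : 0 < e by rewrite lt_min ltr01 divr_gt0.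
exists e => // x /= Bx.
have e1 : e <= 1 by rewrite ge_min lexx.
have eM : e * M < s - normsq c.
  apply: (@le_lt_trans _ _ ((s - normsq c) / (M + 1) / 2 * M)).
    by rewrite ler_wpM2r// ge_min lexx orbT.
  have : (s - normsq c) / (M + 1) * (M + 1) = s - normsq c by rewrite divfK// gt_eqF// ltr_wpDl.
  by move: ((s - normsq c) / (M + 1)) d0 => t t0 <-; nra.
suff : normsq x <= normsq c + e * M by move=> h; apply: le_lt_trans h _; rewrite -ltrBrDl.
rewrite /normsq /M big_distrr -big_split; apply: ler_sum => j _ /=.
have /squareP[] := Bx j; rewrite !sqr_sqrtr ?addr_ge0 ?sqr_ge0//.
have aux (u v : R) : `|u - v| <= e -> u ^+ 2 <= v ^+ 2 + e * (2 * `|v| + 1).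
  move=> uv; have -> : u ^+ 2 = v ^+ 2 + ((u - v) * (u - v) + 2 * (v * (u - v))) by ring.
  rewrite lerD2l (mulrDr e) mulr1 addrC; apply: lerD; apply: le_trans (ler_norm _) _.
    by rewrite !normrM (@ger0_norm _ 2)// [leRHS]mulrC -mulrA !ler_wpM2l.
  by rewrite normrM -[leRHS]mulr1; apply: ler_pM => //; apply: le_trans uv e1.
by move=> /aux h1 /aux h2; apply: le_trans (lerD h1 h2) _; lra.
Qed.

End ball_volume.

(** * The measure nu_alpha *)

Section ball_measure.
Variables (R : realType) (n : nat) (alpha : R).
Local Notation P := (measurableTypeR R * measurableTypeR R)%type.
Local Notation X := (n.-tuple P).
Local Notation normc := Normc.normc.
Local Notation L := (lebesgueC R n).

(** The density of nu_alpha extended by 0 outside the ball, so that integrals over the ball become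
    integrals over the whole space. *)
Definition weight (x : X) : R :=
  if normsq x < 1 then c_alpha n alpha / volume R n * (1 - normsq x) `^ alpha else 0.

Lemma nu_densityE x : normsq x < 1 -> nu_density alpha (of_coords x) = weight x.
Proof.
by move=> x1; rewrite /nu_density /weight x1 vnorm_sqr ball_coordsE mulrAC.
Qed.

Lemma measurable_weight : measurable_fun setT weight.
Proof.
apply: measurable_fun_if => //.
- exact: measurable_fun_ltr (@measurable_normsq R n) _.
- apply: measurable_funTS; apply: measurable_funM => //.
  apply: (measurableT_comp (measurable_powR alpha)).
  by apply: measurable_funB => //; exact: measurable_normsq.
Qed.

Hypothesis ha : -1 < alpha.

Lemma c_alpha_gt0 : 0 < c_alpha n alpha.
Proof.
rewrite /c_alpha; have n0 : 0 <= n%:R :> R by [].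
have a0 : 0 < alpha + 1 by rewrite -ltrBlDr sub0r.
apply: divr_gt0; first by apply: Gamma_gt0; rewrite -addrA ltr_wpDl.
by apply: mulr_gt0; apply: Gamma_gt0 => //; rewrite ltr_wpDl.
Qed.

Lemma weight_ge0 x : 0 <= weight x.
Proof.
rewrite /weight; case: ifP => // _.
by rewrite mulr_ge0 ?powR_ge0// divr_ge0// ltW ?c_alpha_gt0 ?volume_pos.
Qed.

Lemma weight_gt0 x : normsq x < 1 -> 0 < weight x.
Proof.
move=> x1; rewrite /weight x1 mulr_gt0 ?powR_gt0 ?subr_gt0//.
by rewrite divr_gt0 ?c_alpha_gt0 ?volume_pos.
Qed.

Lemma weight_eq0 x : ~ (normsq x < 1) -> weight x = 0.
Proof. by rewrite /weight; case: ifP. Qed.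

End ball_measure.

Section nu_measure.
Variables (R : realType) (n : nat) (alpha : R).
Local Notation P := (measurableTypeR R * measurableTypeR R)%type.
Local Notation X := (n.-tuple P).
Local Notation normc := Normc.normc.
Local Notation L := (lebesgueC R n).

Definition nu_alpha (ha : -1 < alpha) : set X -> \bar R :=
  mdens L (weight_ge0 ha) (measurable_weight alpha).

Hypothesis ha : -1 < alpha.

HB.instance Definition _ := Measure.on (nu_alpha ha).

(** With tau = 1 - |z|^2, the part of the ball where tau <= r has volume (1 - (1 - r)^n) V <= n r V
    by Bernoulli, so the dyadic lemma applies to the exponent alpha > -1. The constant n + 1 also
    covers r >= 1 in every dimension. *)
Lemma nu_alpha_lty : (nu_alpha ha setT < +oo)%E.
Proof.
have K0 : 0 <= c_alpha n alpha / volume R n.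
  by rewrite divr_ge0// ltW ?c_alpha_gt0 ?volume_pos.
pose D := [set x : X | normsq x < 1].
have mD : measurable D by exact: measurable_normsq_lt.
have mtau : measurable_fun setT (fun x : X => 1 - normsq x).
  by apply: measurable_funB => //; exact: measurable_normsq.
rewrite /nu_alpha /mdens.
rewrite (_ : (\int[L]_x _)%E = ((c_alpha n alpha / volume R n)%:E *
    \int[L]_(x in D) ((1 - normsq x) `^ alpha)%:E)%E); last first.
  rewrite -ge0_integralZl//; last 2 first.
  - apply/measurable_EFinP; apply: measurable_funTS.
    exact: (measurableT_comp (measurable_powR alpha)).
  - by move=> x _; rewrite lee_fin powR_ge0.
  rewrite [RHS]integral_mkcond.
  apply: eq_integral => x _; rewrite patchE /weight; case: ifP => x1.
    by rewrite mem_set.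
  by case: ifP => // /set_mem; rewrite /D /= x1.
rewrite lte_mul_pinfty ?lee_fin//.
apply: (@integral_powR_lty _ _ _ L (fun x => 1 - normsq x) D (n.+1%:R * volume R n)) => //.
- by move=> x; rewrite /D /= => x1; rewrite subr_gt0 x1 gerBl normsq_ge0.
- by rewrite mulr_ge0// ltW// volume_pos.
move=> r r0; have v0 := volume_pos R n.
have [r1|r1] := leP 1 r.
  apply: (@le_trans _ _ (L D)).
    apply: le_measure; rewrite ?inE//.
    apply: measurableI => //; rewrite -[X in measurable X]setTI.
    rewrite (_ : [set x | 1 - normsq x <= r] = (fun x => 1 - normsq x) @^-1` `]-oo, r])//.
      exact: mtau.
  rewrite /D volumeE lee_fin -{1}(mul1r (volume R n)) mulrAC ler_wpM2r ?(ltW v0)//.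
  by rewrite -[leLHS]mulr1 ler_pM// ler1n.
have -> : D `&` [set x | 1 - normsq x <= r] = D `\` [set x | normsq x < 1 - r].
  apply/seteqP; split => x [Dx /= h]; split => //=; first by apply/negP; rewrite -leNgt; lra.
  by move/negP: h; rewrite -leNgt; lra.
rewrite measureD//; last 2 first.
- exact: measurable_normsq_lt.
- exact: volume_lty.
rewrite (_ : D `&` _ = [set x | normsq x < 1 - r]); last first.
  by apply/seteqP; split => x /= => [[]//|h]; split => //; apply: lt_trans h _; lra.
rewrite [X in (X - _)%E](volumeE R n) [X in (_ - X)%E]volume_ball ?subr_gt0// -EFinB lee_fin.
rewrite -{1}(mul1r (volume R n)) -mulrBl mulrAC ler_wpM2r ?(ltW v0)//.
have := @bernoulli_le R r n; rewrite (ltW r0) (ltW r1) => /(_ isT) h.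
by apply: (@le_trans _ _ (n%:R * r)); [lra|rewrite ler_wpM2r ?(ltW r0)// ler_nat].
Qed.

HB.instance Definition _ := @Measure_isFinite.Build _ _ _ (nu_alpha ha) (lty_fin_num_fun nu_alpha_lty).

Local Notation nu := (nu_alpha ha).

End nu_measure.

Section nu_facts.
Variables (R : realType) (n : nat) (alpha : R) (ha : -1 < alpha).
Local Notation P := (measurableTypeR R * measurableTypeR R)%type.
Local Notation X := (n.-tuple P).
Local Notation normc := (@Normc.normc R).
Local Notation L := (lebesgueC R n).
Local Notation nu := (@nu_alpha R n alpha ha).
Local Notation Re := (@complex.Re R).
Local Notation Im := (@complex.Im R).

(** The weight depends on |z| alone, so a map that preserves |z| and Lebesgue measure preserves
    nu_alpha. *)
Lemma weight_scales (phi : X -> X) : (forall x, normsq (phi x) = normsq x) ->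
  scales L 1 phi -> scales nu 1 phi.
Proof.
move=> nphi sL; have [mphi _] := sL; split => // A mA.
have mw : measurable_fun setT ((EFin \o weight alpha) \_ A : X -> \bar R).
  apply/(measurable_restrictT _ _).1 => //; apply/measurable_EFinP.
  by apply: measurable_funTS; exact: measurable_weight.
have := ge0_integral_scales sL ler01 mw.
have w0 x : (0 <= ((EFin \o weight alpha) \_ A : X -> \bar R) x)%E.
  by rewrite patchE; case: ifP => // _; rewrite lee_fin weight_ge0.
move=> /(_ w0); rewrite mul1e => e; rewrite mul1e /nu_alpha /mdens.
transitivity (\int[L]_x ((EFin \o weight alpha) \_ A) (phi x))%E; last first.
  by rewrite [RHS]integral_mkcond.
rewrite -[LHS]/(\int[L]_(x in phi @^-1` A) (weight alpha x)%:E)%E integral_mkcond.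
apply: eq_integral => x _; rewrite !patchE.
by rewrite -[x \in _]/(phi x \in A) /= /weight nphi.
Qed.

(** The density is positive inside the ball and 0 outside. *)
Lemma ae_nuP (Q : X -> Prop) :
  {ae nu, forall x, Q x} <-> {ae L, forall x, normsq x < 1 -> Q x}.
Proof.
split=> [[N [mN N0 QN]]|[N [mN N0 QN]]].
  have : {ae L, forall x, N x -> weight alpha x = 0}.
    exact: (mdens_eq0 L (weight_ge0 ha) (measurable_weight alpha) mN).1 N0.
  apply: filterS => x h x1; apply: contrapT => nQ.
  by have := weight_gt0 ha x1; rewrite h ?ltxx//; exact: QN.
pose D := [set x : X | normsq x < 1].
have mD : measurable D by exact: measurable_normsq_lt.
exists (N `|` ~` D); split; first by apply: measurableU => //; exact: measurableC.
  apply: (mdens_eq0 L (weight_ge0 ha) (measurable_weight alpha) _).2.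
    by apply: measurableU => //; exact: measurableC.
  exists N; split => // x /= nx; apply: contrapT => Nx; apply: nx => -[//|].
  exact: weight_eq0.
move=> x /= nQ; have [x1|x1] := pselect (D x); last by right.
by left; apply: QN => /= /(_ x1).
Qed.

Lemma nu_gt0 A : measurable A -> (forall x, A x -> normsq x < 1) -> (0 < L A)%E ->
  (0 < nu A)%E.
Proof.
move=> mA A1 LA; rewrite /nu_alpha /mdens; apply: ge0_integral_gt0 => //.
- apply/measurable_EFinP; apply: measurable_funTS; exact: measurable_weight.
- by move=> x /A1 x1; rewrite lte_fin weight_gt0.
Qed.

(** The values of u outside the ball are arbitrary; cutting them off gives a function on the whole
    coordinate space, to which integrals against nu_alpha apply directly. *)
Definition ball_ext (u : Cspace R n -> R[i]^o) (x : X) : R[i] :=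
  if normsq x < 1 then u (of_coords x) else 0.

Lemma measurable_ballP u : measurable_ball u <-> cmeas (ball_ext u).
Proof.
have mD : measurable (@ball_coords R n).
  by rewrite ball_coordsE; exact: measurable_normsq_lt.
have eD (p : R[i] -> R) : p 0 = 0 -> (fun x => p (ball_ext u x)) =
    ((fun x => p (u (of_coords x))) \_ (@ball_coords R n)).
  move=> p0; apply/funext => x; rewrite patchE ball_coordsE /ball_ext.
  case: ifP => x1; first by rewrite mem_set.
  by case: ifP => // /set_mem /=; rewrite x1.
rewrite /measurable_ball /cmeas (eD Re)// (eD Im)//.
have mr (f : X -> R) := measurable_restrictT f mD.
split => -[h1 h2].
  split; [exact: (mr _).1 h1|exact: (mr _).1 h2].
split; [exact: (mr _).2 h1|exact: (mr _).2 h2].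
Qed.

Lemma int_nuE (u : Cspace R n -> R) : int_nu alpha u =
  fine (\int[L]_x (if normsq x < 1 then u (of_coords x) * weight alpha x else 0)%:E).
Proof.
rewrite /int_nu /Rintegral integral_mkcond; congr fine; apply: eq_integral => x _.
rewrite patchE ball_coordsE; case: ifP => [x1|x1].
  by rewrite ifT ?nu_densityE//; exact: (set_mem x1).
by rewrite ifF//; apply/negP => h; move/negP: x1; apply; apply/mem_set.
Qed.

Lemma int_nu_ae (u v : Cspace R n -> R) : ae_ball (fun z => u z = v z :> R) ->
  int_nu alpha u = int_nu alpha v.
Proof.
move=> uv; rewrite !int_nuE; congr fine; apply: eq_integral_ae.
rewrite /ae_ball ball_coordsE in uv; apply: filterS uv => x uv.
by case: ifP => // /uv ->.
Qed.

Lemma int_nu_nu (u : Cspace R n -> R) :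
  measurable_fun setT (fun x => if normsq x < 1 then u (of_coords x) else 0) ->
  int_nu alpha u = (\int[nu]_x (if normsq x < 1 then u (of_coords x) else 0))%R.
Proof.
move=> mu; rewrite int_nuE /Rintegral integral_mdens//; congr fine.
by apply: eq_integral => x _; case: ifP => //; rewrite mul0r.
Qed.

Lemma ball_extM u v x : ball_ext (fun z => u z * v z) x = ball_ext u x * ball_ext v x.
Proof. by rewrite /ball_ext; case: ifP; rewrite ?mulr0. Qed.

Lemma ball_extB u v x : ball_ext (fun z => u z - v z) x = ball_ext u x - ball_ext v x.
Proof. by rewrite /ball_ext; case: ifP; rewrite ?subr0. Qed.

Lemma inner_cint u v : measurable_ball u -> measurable_ball v ->
  inner alpha u v = cint nu (fun x => ball_ext u x * conjc (ball_ext v x)).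
Proof.
move=> /measurable_ballP mu /measurable_ballP mv.
have [m1 m2] : cmeas (fun x => ball_ext u x * conjc (ball_ext v x)).
  by apply: cmeasM => //; exact: cmeasJ.
have e (p : R[i] -> R) : p 0 = 0 ->
    (fun x => if normsq x < 1 then p (u (of_coords x) * conjc (v (of_coords x))) else 0) =
    (fun x => p (ball_ext u x * conjc (ball_ext v x))).
  by move=> p0; apply/funext => x; rewrite /ball_ext; case: ifP; rewrite ?mul0r ?p0.
rewrite /inner /cint !int_nu_nu ?(e Re)// ?(e Im)//.
Qed.

Lemma inner_ae (u u' v v' : Cspace R n -> R[i]^o) : ae_ball (fun z => u z = u' z) -> ae_ball (fun z => v z = v' z) ->
  inner alpha u v = inner alpha u' v'.
Proof.
move=> uu vv; rewrite /inner; congr (_ +i* _)%C; apply: int_nu_ae;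
 rewrite /ae_ball in uu vv *; apply: filterS2 uu vv => x h1 h2 x1; by rewrite h1// h2.
Qed.

Definition sq_integrable (u : X -> R[i]) := cmeas u /\
  nu.-integrable setT (fun x => (normc (u x) ^+ 2)%:E).

Lemma L2P u : L2 alpha u <-> sq_integrable (ball_ext u).
Proof.
have eI : cmeas (ball_ext u) -> (\int[L]_(x in @ball_coords R n)
    (normc (u (of_coords x)) ^+ 2 * nu_density alpha (of_coords x))%:E =
    \int[nu]_x (normc (ball_ext u x) ^+ 2)%:E)%E.
  move=> mu; rewrite [RHS]ge0_integral_mdens//; last 2 first.
  - by apply/measurable_EFinP; apply: measurable_funX; exact: measurable_normc.
  - by move=> x; rewrite lee_fin exprn_ge0// normc_ge0.
  rewrite [LHS]integral_mkcond ball_coordsE; apply: eq_integral => x _.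
  rewrite patchE /ball_ext; case: ifPn => [/set_mem/= x1|/negP x1].
    by rewrite x1 nu_densityE// EFinM.
  rewrite ifF ?normc0 ?expr0n ?mul0e//; last by apply/negP => h; apply: x1; apply/mem_set.
  by rewrite [Normc.normc _]Normc.normc0 expr0n mul0e.
rewrite /L2 /sq_integrable; split => -[/measurable_ballP mu h]; split => //.
- apply/integrableP; split.
    by apply/measurable_EFinP; apply: measurable_funX; exact: measurable_normc.
  move: h; rewrite eI//; congr (_ < _)%E; apply: eq_integral => x _.
  by rewrite gee0_abs// lee_fin exprn_ge0// normc_ge0.
- move/measurable_ballP: (mu) => {}mu; rewrite eI//; have := integrable_lty measurableT h.
  done.
Qed.

End nu_facts.

(** * Circle means of holomorphic functions *)

Section goursat.
Variable R : realType.
Local Notation mu := (@lebesgue_measure R).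

Lemma midpoint_seg (p q : R) : p <= q -> p <= (p + q) / 2 /\ (p + q) / 2 <= q.
Proof. by split; lra. Qed.

Lemma dist_seg (p q x u : R) : p <= x -> x <= q -> p <= u <= q -> `|u - x| <= q - p.
Proof. by move=> px xq /andP[pu uq]; rewrite ler_norml; apply/andP; split; lra. Qed.

(** Goursat's argument for an abstract function of rectangles. By additivity some quarter carries at
    least 1/4 of |Phi|, so |Phi| >= K/4^k on the k-th rectangle; its squared size also shrinks like
    4^-k, and the local bound at the common point of all rectangles contradicts this. *)
Lemma rectangle_bisection (Phi : R -> R -> R -> R -> R) (a b c d : R) :
  a <= b -> c <= d ->
  (forall p m q r s, a <= p -> p <= m -> m <= q -> q <= b -> c <= r -> r <= s -> s <= d ->
    Phi p q r s = Phi p m r s + Phi m q r s) ->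
  (forall p q r m s, a <= p -> p <= q -> q <= b -> c <= r -> r <= m -> m <= s -> s <= d ->
    Phi p q r s = Phi p q r m + Phi p q m s) ->
  (forall x y, a <= x <= b -> c <= y <= d -> forall e, 0 < e -> exists2 dl, 0 < dl &
    forall p q r s, a <= p -> p <= x -> x <= q -> q <= b -> c <= r -> r <= y ->
      y <= s -> s <= d -> q - p + (s - r) < dl ->
      `|Phi p q r s| <= e * (q - p + (s - r)) ^+ 2) ->
  Phi a b c d = 0.
Proof.
move=> ab cd addx addy loc; apply: contrapT => /eqP Phi0.
pose K := `|Phi a b c d|; have K0 : 0 < K by rewrite normr_gt0.
pose P4 := ((R * R) * (R * R))%type.
pose valid (t : P4) := [/\ a <= t.1.1, t.1.1 <= t.1.2, t.1.2 <= b &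
  [/\ c <= t.2.1, t.2.1 <= t.2.2 & t.2.2 <= d]].
pose F (t : P4) := Phi t.1.1 t.1.2 t.2.1 t.2.2.
pose sub (t t' : P4) := [/\ t.1.1 <= t'.1.1, t'.1.2 <= t.1.2, t.2.1 <= t'.2.1 & t'.2.2 <= t.2.2].
pose len (t : P4) := t.1.2 - t.1.1 + (t.2.2 - t.2.1).
have step (t : P4) : exists t' : P4, valid t ->
    [/\ valid t', sub t t', len t' = len t / 2 & `|F t| <= 4 * `|F t'|].
  case: (pselect (valid t)) => [|nv]; last by exists t.
  case: t => -[p q] [r s] [/= ap pq qb [cr rs sd]].
  pose x := (p + q) / 2; pose y := (r + s) / 2.
  have [px xq] : p <= x /\ x <= q := midpoint_seg pq.
  have [ry ys] : r <= y /\ y <= s := midpoint_seg rs.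
  have [xb ax cy yd] : [/\ x <= b, a <= x, c <= y & y <= d].
    by split; [exact: le_trans qb|exact: le_trans px|exact: le_trans ry|exact: le_trans sd].
  have FE : F ((p, q), (r, s)) = F ((p, x), (r, y)) + F ((p, x), (y, s)) +
      (F ((x, q), (r, y)) + F ((x, q), (y, s))).
    by rewrite /F /= (addx p x q r s)// (addy p x r y s)// (addy x q r y s).
  pose good t' := `|F ((p, q), (r, s))| <= 4 * `|F t'|.
  have : [\/ good ((p, x), (r, y)), good ((p, x), (y, s)), good ((x, q), (r, y)) |
      good ((x, q), (y, s))].
    apply: contrapT => h.
    have [[h1 h2] [h3 h4]] : (~ good ((p, x), (r, y)) /\ ~ good ((p, x), (y, s))) /\
        (~ good ((x, q), (r, y)) /\ ~ good ((x, q), (y, s))).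
      by split; split => g; apply: h; [constructor 1|constructor 2|constructor 3|constructor 4].
    move: h1 h2 h3 h4; rewrite /good.
    do 4![move=> /negP; rewrite -ltNge => ?].
    have := FE; set f := F _; set f1 := F _; set f2 := F _; set f3 := F _; set f4 := F _ => fE.
    have : `|f| <= `|f1| + `|f2| + (`|f3| + `|f4|).
      rewrite fE (le_trans (ler_normD _ _))// lerD// ler_normD//.
    lra.
  case=> g.
  - exists ((p, x), (r, y)) => _; split; last exact: g.
    + by split => //; split.
    + by split => /=.
    + by rewrite /len /= /x /y; field.
  - exists ((p, x), (y, s)) => _; split; last exact: g.
    + by split => //; split.
    + by split => /=.
    + by rewrite /len /= /x /y; field.
  - exists ((x, q), (r, y)) => _; split; last exact: g.
    + by split => //; split.
    + by split => /=.
    + by rewrite /len /= /x /y; field.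
  - exists ((x, q), (y, s)) => _; split; last exact: g.
    + by split => //; split.
    + by split => /=.
    + by rewrite /len /= /x /y; field.
have [next nextP] := choice step.
pose T k := iter k next ((a, b), (c, d)).
have vT k : valid (T k).
  elim: k => [|k /nextP[]//]; by split => //=; split.
have subT k : sub (T k) (T k.+1) by have [] := nextP _ (vT k).
have lenT k : len (T k) = len (T 0%N) / 2 ^+ k.
  elim: k => [|k ih]; first by rewrite expr0 divr1.
  by have [_ _ -> _] := nextP _ (vT k); rewrite ih exprS invfM mulrCA mulrC.
have FT k : K <= 4 ^+ k * `|F (T k)|.
  elim: k => [|k ih]; first by rewrite expr0 mul1r.
  have [_ _ _ h] := nextP _ (vT k); rewrite (le_trans ih)// exprSr -mulrA ler_wpM2l// exprn_ge0.
have mono k j : (k <= j)%N -> sub (T k) (T j).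
  move=> /subnK <-; elim: (j - k)%N => [|i [i1 i2 i3 i4]]; first by split.
  have [j1 j2 j3 j4] := subT (i + k)%N; rewrite addSn.
  by split; [exact: le_trans j1|exact: le_trans i2|exact: le_trans j3|exact: le_trans i4].
have cross k j : (T k).1.1 <= (T j).1.2 /\ (T k).2.1 <= (T j).2.2.
  have [k1 k2 k3 k4] := mono _ _ (leq_maxl k j); have [j1 j2 j3 j4] := mono _ _ (leq_maxr k j).
  have [_ v1 _ [_ v2 _]] := vT (maxn k j).
  by split; [exact: le_trans (le_trans k1 v1) j2|exact: le_trans (le_trans k3 v2) j4].
pose x := sup (range (fun k => (T k).1.1)); pose y := sup (range (fun k => (T k).2.1)).
have xl k : (T k).1.1 <= x.
  apply: ub_le_sup; last by exists k.
  by exists ((T 0%N).1.2) => _ [j _ <-]; have [] := cross j 0%N.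
have yl k : (T k).2.1 <= y.
  apply: ub_le_sup; last by exists k.
  by exists ((T 0%N).2.2) => _ [j _ <-]; have [] := cross j 0%N.
have xu k : x <= (T k).1.2.
  apply: ge_sup; first by exists ((T 0%N).1.1), 0%N.
  by move=> _ [j _ <-]; have [] := cross j k.
have yu k : y <= (T k).2.2.
  apply: ge_sup; first by exists ((T 0%N).2.1), 0%N.
  by move=> _ [j _ <-]; have [] := cross j k.
pose L := len (T 0%N).
have L0 : 0 <= L by have [_ v1 _ [_ v2 _]] := vT 0%N; rewrite /L /len; lra.
have xI : a <= x <= b by have /= -> := xl 0%N; have /= -> := xu 0%N.
have yI : c <= y <= d by have /= -> := yl 0%N; have /= -> := yu 0%N.
(* L is the size of the first rectangle: with e = K/(L^2 + 1) the local bound on the k-th rectangle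
   falls below K/4^k. *)
have [|dl dl0 dlP] := loc x y xI yI (K / (L ^+ 2 + 1)).
  by rewrite divr_gt0// ltr_wpDl// sqr_ge0.
have [k kdl] : exists k, L / 2 ^+ k < dl.
  have : L * (2^-1) ^+ k @[k --> \oo] --> (0 : R).
    rewrite -[X in _ --> X](mulr0 L); apply: cvgM; first exact: cvg_cst.
    by apply: cvg_expr; rewrite ger0_norm// invf_lt1// ltr1n.
  move=> /cvgrPdist_lt /(_ dl dl0)[k _ /(_ k (leqnn k))].
  rewrite sub0r normrN => h; exists k; rewrite -exprVn (le_lt_trans _ h)//.
  exact: ler_norm.
have [v1 v2 v3 [v4 v5 v6]] := vT k.
have := dlP _ _ _ _ v1 (xl k) (xu k) v3 v4 (yl k) (yu k) v6.
rewrite -/(len (T k)) lenT => /(_ kdl); rewrite -/(F (T k)) -/L => h.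
have := FT k; apply/negP; rewrite -ltNge.
have k4 : (0 : R) < 4 ^+ k by rewrite exprn_gt0.
rewrite mulrC -ltr_pdivlMr// (le_lt_trans h)//.
rewrite exprMn exprVn -exprM mulnC exprM -[2 ^+ 2]/(2 * 2 : R).
rewrite (_ : 2 * 2 = 4 :> R); last by lra.
rewrite mulrA ltr_pM2r ?invr_gt0// -mulrA gtr_pMr// mulrC ltr_pdivrMr ?mul1r ?ltrDl//.
by rewrite ltr_wpDl// sqr_ge0.
Qed.

Definition segint (f : R -> R) (a b : R) : R := (\int[mu]_(x in `[a, b]) f x)%R.

Definition seg_integrable (f : R -> R) (a b : R) := mu.-integrable `[a, b] (EFin \o f).

Lemma segintD (f : R -> R) a m b : a <= m -> m <= b -> seg_integrable f a b ->
  segint f a b = segint f a m + segint f m b.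
Proof.
move=> am mb fi; have := @Rintegral_itvB R f (BLeft a) (BRight b) m fi.
rewrite !bnd_simp => /(_ am mb) h.
rewrite /segint [X in _ + X](_ : _ = (\int[mu]_(x in `]m, b]) f x)%R).
  by rewrite -h addrC subrK.
apply/esym/Rintegral_itv_obnd_cbnd; apply: integrableS fi => //.
by apply: subset_itvr; rewrite bnd_simp.
Qed.

Lemma seg_integrableB (f g : R -> R) a b : seg_integrable f a b ->
  seg_integrable g a b -> seg_integrable (fun x => f x - g x) a b.
Proof. by move=> fi gi; exact: (integrableB _ fi gi). Qed.

Lemma seg_integrable_cst (r a b : R) : seg_integrable (fun=> r) a b.
Proof.
apply: (@continuous_compact_integrable R (fun=> r)); first exact: segment_compact.
exact/continuous_subspaceT/cst_continuous.
Qed.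

Lemma segint_le (f : R -> R) a b (k e : R) : a <= b -> seg_integrable f a b ->
  (forall x, a <= x <= b -> `|f x - k| <= e) ->
  `|segint f a b - k * (b - a)| <= e * (b - a).
Proof.
move=> ab fi fe.
have cst (r : R) : segint (fun=> r) a b = r * (b - a).
  rewrite /segint Rintegral_cst//= lebesgue_measure_itv /= lte_fin.
  case: ifPn => [_|]; first by rewrite -EFinB.
  by rewrite -leNgt => ba; rewrite (_ : b = a) ?subrr//; apply/eqP; rewrite eq_le ba.
have fki := seg_integrableB fi (seg_integrable_cst k a b).
rewrite -cst -cst /segint -RintegralB//; last exact: seg_integrable_cst.
apply: (le_trans (le_normr_Rintegral _ fki)) => //.
apply: le_Rintegral => //; first exact: integrable_norm.
exact: seg_integrable_cst.
Qed.

(* Goursat's lemma for the form P dx + S dy, which is closed in the pointwise sense. *)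
Theorem goursat (P S : R -> R -> R) (a b c d : R) : a <= b -> c <= d ->
  (forall y, c <= y <= d -> seg_integrable (P ^~ y) a b) ->
  (forall x, a <= x <= b -> seg_integrable (S x) c d) ->
  (forall x y, a <= x <= b -> c <= y <= d -> exists p k s : R,
    forall e, 0 < e -> exists2 dl, 0 < dl & forall u v, `|u - x| < dl -> `|v - y| < dl ->
      `|P u v - P x y - (u - x) * p - (v - y) * k| <= e * (`|u - x| + `|v - y|) /\
      `|S u v - S x y - (u - x) * k - (v - y) * s| <= e * (`|u - x| + `|v - y|)) ->
  segint (P ^~ c) a b - segint (P ^~ d) a b + (segint (S b) c d - segint (S a) c d) = 0.
Proof.
move=> ab cd iP iS dPS.
(* The integral of P dx + S dy around the boundary of [p, q] x [r, s]. *)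
pose Phi p q r s := segint (P ^~ r) p q - segint (P ^~ s) p q + (segint (S q) r s - segint (S p) r s).
have iPs y p q : c <= y <= d -> a <= p -> q <= b -> seg_integrable (P ^~ y) p q.
  move=> ycd ap qb; apply: integrableS (iP y ycd) => //.
  by move=> t /=; rewrite !in_itv /= => /andP[pt tq]; rewrite (le_trans ap)//= (le_trans tq).
have iSs x r s : a <= x <= b -> c <= r -> s <= d -> seg_integrable (S x) r s.
  move=> xab cr sd; apply: integrableS (iS x xab) => //.
  by move=> t /=; rewrite !in_itv /= => /andP[pt tq]; rewrite (le_trans cr)//= (le_trans tq).
apply: (@rectangle_bisection Phi a b c d) => //.
- move=> p m q r s ap pm mq qb cr rs sd; rewrite /Phi.
  have [h1 h2] : c <= r <= d /\ c <= s <= d by split; lra.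
  rewrite (segintD pm mq (iPs r p q h1 ap qb)) (segintD pm mq (iPs s p q h2 ap qb)).
  by ring.
- move=> p q r m s ap pq qb cr rm ms sd; rewrite /Phi.
  have [h1 h2] : a <= p <= b /\ a <= q <= b by split; lra.
  rewrite (segintD rm ms (iSs p r s h1 cr sd)) (segintD rm ms (iSs q r s h2 cr sd)).
  by ring.
move=> x y xab ycd e e0.
have [p1 [k [s2 dP]]] := dPS x y xab ycd.
have e4 : 0 < e / 4 by rewrite divr_gt0.
have [dl dl0 dlP] := dP _ e4; exists dl => // p q r s ap px xq qb cr ry ys sd sm.
set l := q - p + (s - r) in sm *.
have pq : p <= q := le_trans px xq.
have rs : r <= s := le_trans ry ys.
have hx u : p <= u <= q -> `|u - x| <= l /\ `|u - x| < dl.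
  move=> uI; suff : `|u - x| <= l by move=> h; split => //; exact: le_lt_trans sm.
  by rewrite (le_trans (dist_seg px xq uI))// lerDl subr_ge0.
have hy v : r <= v <= s -> `|v - y| <= l /\ `|v - y| < dl.
  move=> vI; suff : `|v - y| <= l by move=> h; split => //; exact: le_lt_trans sm.
  by rewrite (le_trans (dist_seg ry ys vI))// lerDr subr_ge0.
have hl u v : p <= u <= q -> r <= v <= s -> `|u - x| + `|v - y| <= l.
  by move=> uI vI; apply: lerD; exact: dist_seg.
have rr : r <= r <= s by rewrite lexx.
have ss : r <= s <= s by rewrite lexx rs.
have pp : p <= p <= q by rewrite lexx.
have qq : p <= q <= q by rewrite lexx pq.
have EP u : p <= u <= q -> `|(P u r - P u s) - k * (r - s)| <= e / 2 * l.
  move=> uI; have [_ hu] := hx u uI.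
  have [h1 _] := dlP u r hu (hy r rr).2; have [h2 _] := dlP u s hu (hy s ss).2.
  have h3 := hl u r uI rr; have h4 := hl u s uI ss.
  rewrite (_ : _ - _ = (P u r - P x y - (u - x) * p1 - (r - y) * k) -
    (P u s - P x y - (u - x) * p1 - (s - y) * k)); last by ring.
  rewrite (le_trans (ler_normB _ _))// (le_trans (lerD h1 h2))//.
  rewrite -mulrDr (le_trans (ler_wpM2l (ltW e4) (lerD h3 h4)))//.
  by rewrite (_ : e / 4 * (l + l) = e / 2 * l)//; field.
have ES v : r <= v <= s -> `|(S q v - S p v) - k * (q - p)| <= e / 2 * l.
  move=> vI; have [_ hv] := hy v vI.
  have [_ h1] := dlP q v (hx q qq).2 hv; have [_ h2] := dlP p v (hx p pp).2 hv.
  have h3 := hl q v qq vI; have h4 := hl p v pp vI.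
  rewrite (_ : _ - _ = (S q v - S x y - (q - x) * k - (v - y) * s2) -
    (S p v - S x y - (p - x) * k - (v - y) * s2)); last by ring.
  rewrite (le_trans (ler_normB _ _))// (le_trans (lerD h1 h2))//.
  rewrite -mulrDr (le_trans (ler_wpM2l (ltW e4) (lerD h3 h4)))//.
  by rewrite (_ : e / 4 * (l + l) = e / 2 * l)//; field.
have rI : c <= r <= d by rewrite cr (le_trans rs sd).
have sI : c <= s <= d by rewrite (le_trans cr rs) sd.
have pI : a <= p <= b by rewrite ap (le_trans pq qb).
have qI : a <= q <= b by rewrite (le_trans ap pq) qb.
have iPr := iPs r p q rI ap qb; have iPs' := iPs s p q sI ap qb.
have iSp := iSs p r s pI cr sd; have iSq := iSs q r s qI cr sd.
have BP := segint_le pq (seg_integrableB iPr iPs') EP.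
have BS := segint_le rs (seg_integrableB iSq iSp) ES.
rewrite /Phi -!RintegralB//.
rewrite -/(segint (fun t => P t r - P t s) p q) -/(segint (fun t => S q t - S p t) r s).
set A := segint _ p q in BP *; set B := segint _ r s in BS *.
(* The two subtracted terms cancel, because the y-derivative of P and the x-derivative of S at (x,
   y) are the same k. *)
rewrite (_ : A + B = (A - k * (r - s) * (q - p)) + (B - k * (q - p) * (s - r))); last by ring.
rewrite (le_trans (ler_normD _ _))// (le_trans (lerD BP BS))//.
have l0 : 0 <= l by rewrite addr_ge0 ?subr_ge0.
have el : 0 <= e / 2 * l by rewrite mulr_ge0// divr_ge0// ltW.
rewrite -mulrDr -/l (_ : e / 2 * l * l = e * l ^+ 2 / 2); last by field.
by rewrite ler_pdivrMr// ler_peMr ?ler1n// mulr_ge0 ?sqr_ge0// ltW.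
Qed.

Local Notation normc := (@Normc.normc R).
Local Notation Re := (@complex.Re R).
Local Notation Im := (@complex.Im R).

(** Real differentiability of F at (x, y), with partial derivatives A and B. *)
Definition frechet2 (F : R -> R -> R[i]) (x y : R) (A B : R[i]) :=
  forall e, 0 < e -> exists2 dl, 0 < dl & forall u v, `|u - x| < dl -> `|v - y| < dl ->
    normc (F u v - F x y - (u - x)%:C%C * A - (v - y)%:C%C * B) <= e * (`|u - x| + `|v - y|).

Lemma frechet2_lip F x y A B : frechet2 F x y A B ->
  exists2 dl, 0 < dl & forall u v, `|u - x| < dl -> `|v - y| < dl ->
    normc (F u v - F x y) <= (normc A + normc B + 1) * (`|u - x| + `|v - y|).
Proof.
move=> /(_ 1 ltr01)[dl dl0 h]; exists dl => // u v ux vy; have := h u v ux vy.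
set D := F u v - F x y => h1.
rewrite (_ : D = (D - (u - x)%:C%C * A - (v - y)%:C%C * B) +
   ((u - x)%:C%C * A + (v - y)%:C%C * B)); last by ring.
rewrite (le_trans (le_normcD _ _))// [leRHS]mulrDl addrC lerD//.
rewrite (le_trans (le_normcD _ _))// !Normc.normcM !normc_real.
have := normc_ge0 A; have := normc_ge0 B.
set a := normc A; set b := normc B; have := normr_ge0 (u - x); have := normr_ge0 (v - y).
by nra.
Qed.

Lemma frechet2M F G x y A B C D : frechet2 F x y A B -> frechet2 G x y C D ->
  frechet2 (fun u v => F u v * G u v) x y
    (A * G x y + F x y * C) (B * G x y + F x y * D).
Proof.
move=> dF dG e e0.
have [dl3 dl30 h3] := frechet2_lip dG.
pose M := normc C + normc D + 1.
have M1 : 1 <= M by rewrite lerDr addr_ge0 ?normc_ge0.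
pose K := normc (F x y) + (normc (G x y) + M) + (normc A + normc B) * M + 1.
have K1 : 1 <= K by rewrite lerDr !addr_ge0 ?mulr_ge0 ?addr_ge0 ?normc_ge0//; lra.
have K0 : 0 < K by lra.
pose e' := Num.min 1 (e / K).
have e'0 : 0 < e' by rewrite lt_min ltr01 divr_gt0.
have [dl1 dl10 h1] := dF e' e'0; have [dl2 dl20 h2] := dG e' e'0.
pose dl := Num.min (Num.min dl1 dl2) (Num.min dl3 (e' / 2)).
exists dl; first by rewrite !lt_min dl10 dl20 dl30 divr_gt0.
move=> u v; rewrite !lt_min => /andP[/andP[u1 u2] /andP[u3 u4]] /andP[/andP[v1 v2] /andP[v3 v4]].
have := h1 u v u1 v1; have := h2 u v u2 v2; have := h3 u v u3 v3; rewrite -/M.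
set s := `|u - x| + `|v - y|.
have s0 : 0 <= s by rewrite addr_ge0.
have se : s <= e' by rewrite [e']splitr lerD// ltW.
set a := (u - x)%:C%C; set b := (v - y)%:C%C.
set f := F u v; set f0 := F x y; set g := G u v; set g0 := G x y => g3 g2 g1.
have dFs : normc (a * A + b * B) <= (normc A + normc B) * s.
  rewrite (le_trans (le_normcD _ _))// !Normc.normcM !normc_real mulrDl /s.
  rewrite ![normc _ * _]mulrC lerD// ler_wpM2r ?normc_ge0// ?lerDl ?lerDr//.
rewrite (_ : f * g - f0 * g0 - a * (A * g0 + f0 * C) - b * (B * g0 + f0 * D) =
  f0 * (g - g0 - a * C - b * D) + (f - f0 - a * A - b * B) * g + (a * A + b * B) * (g - g0)); last by ring.
have gM : normc g <= normc g0 + M.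
  rewrite -[g](subrK g0) addrC (le_trans (le_normcD _ _))// lerD2l (le_trans g3)//.
  by rewrite ler_piMr//; [lra|rewrite (le_trans se)// /e' ge_min lexx].
have ek : K * e' <= e by rewrite mulrC -ler_pdivlMr// /e' ge_min lexx orbT.
apply: (@le_trans _ _ (K * e' * s)); last by rewrite ler_wpM2r.
apply: (@le_trans _ _ (normc f0 * (e' * s) + (e' * s) * (normc g0 + M) +
   (normc A + normc B) * s * (M * e'))); last first.
  rewrite /K -/f0 -/g0; have := mulr_ge0 (ltW e'0) s0; lra.
rewrite (le_trans (le_normcD _ _))// lerD//.
  rewrite (le_trans (le_normcD _ _))// !Normc.normcM lerD//.
    by rewrite ler_wpM2l ?normc_ge0.
  by rewrite ler_pM ?normc_ge0.
rewrite Normc.normcM ler_pM ?normc_ge0// (le_trans g3)// ler_wpM2l//; lra.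
Qed.

Lemma frechet2_comp (Psi : R[i] -> R[i]) (Psi' : R[i]) F x y A B :
  (forall e, 0 < e -> exists2 dl, 0 < dl & forall h, normc h < dl ->
    normc (Psi (h + F x y) - Psi (F x y) - h * Psi') <= e * normc h) ->
  frechet2 F x y A B ->
  frechet2 (fun u v => Psi (F u v)) x y (Psi' * A) (Psi' * B).
Proof.
move=> dPsi dF e e0.
have [dl1 dl10 h1] := frechet2_lip dF.
set M := normc A + normc B + 1 in h1.
have M1 : 1 <= M by rewrite lerDr addr_ge0 ?normc_ge0.
have M0 : 0 < M by lra.
have N0 : 0 < normc Psi' + 1 by rewrite ltr_wpDl ?normc_ge0.
have [|dl2 dl20 h2] := dPsi (e / 2 / M); first by rewrite !divr_gt0.
have [|dl3 dl30 h3] := dF (e / 2 / (normc Psi' + 1)); first by rewrite !divr_gt0.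
pose dl := Num.min dl1 (Num.min dl3 (dl2 / M / 2)).
exists dl; first by rewrite !lt_min dl10 dl30 !divr_gt0.
move=> u v; rewrite !lt_min => /andP[u1 /andP[u3 u2]] /andP[v1 /andP[v3 v2]].
have := h1 u v u1 v1; have := h3 u v u3 v3.
set s := `|u - x| + `|v - y|.
have s0 : 0 <= s by rewrite addr_ge0.
have sM : M * s < dl2 by rewrite mulrC -ltr_pdivlMr// [ltRHS]splitr ltrD.
set a := (u - x)%:C%C; set b := (v - y)%:C%C; set f := F u v; set f0 := F x y => g3 g1.
have := h2 (f - f0) (le_lt_trans g1 sM); rewrite -/f0 subrK => g2.
rewrite (_ : _ - _ = (Psi f - Psi f0 - (f - f0) * Psi') +
  Psi' * (f - f0 - a * A - b * B)); last by ring.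
rewrite (le_trans (le_normcD _ _))// [leRHS](_ : _ = e / 2 * s + e / 2 * s); last by rewrite -mulrDl -splitr.
rewrite lerD//.
  rewrite (le_trans g2)// (le_trans (ler_wpM2l _ g1))//; first by rewrite !divr_ge0// ltW.
  by rewrite mulrA divfK// gt_eqF.
rewrite Normc.normcM (le_trans (ler_wpM2l (normc_ge0 _) g3))//.
rewrite mulrA ler_wpM2r// mulrCA ler_piMr//; first by rewrite divr_ge0// ltW.
by rewrite ler_pdivrMr// mul1r lerDl.
Qed.

Lemma derivable_eps (K : numFieldType) (f : K^o -> K^o) (x : K) : derivable f x 1 ->
  forall e, 0 < e -> exists2 dl, 0 < dl & forall h, `|h| < dl ->
    `|f (h + x) - f x - h * 'D_1 f x| <= e * `|h|.
Proof.
move=> df e e0; have : (fun h => h^-1 *: (f (h *: (1 : K^o) + x) - f x)) @ 0^' --> 'D_1 f x by exact: df.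
move=> /cvgrPdist_le /(_ e e0) [dl /= dl0 H]; exists dl => // h hdl.
have [->|h0] := eqVneq h 0; first by rewrite add0r subrr mul0r subr0 !normr0 mulr0.
have := H h; rewrite /ball_ /= sub0r normrN => /(_ hdl h0) H1.
rewrite -ler_pdivrMr ?normr_gt0// -normfV -normrM mulrC mulrBr mulKf//.
by rewrite -normrN opprB; move: H1; rewrite [h *: _]mulr1.
Qed.

Lemma frechet2_expR x y : frechet2 (fun u _ => (expR u)%:C%C) x y (expR x)%:C%C 0.
Proof.
move=> e e0; have [|dl dl0 H] := @derivable_eps R expR x _ e e0.
  by have [] := is_derive_expR x.
exists dl => // u v ux vy; rewrite mulr0 subr0 -!rmorphB -rmorphM -rmorphB normc_real.
have := H (u - x) ux; have [_ ->] := is_derive_expR x; rewrite subrK => /le_trans; apply.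
by rewrite ler_wpM2l ?lerDl// ltW.
Qed.

Lemma frechet2_expi x y : frechet2 (fun _ v => expi v) x y 0 ('i%C * expi y).
Proof.
move=> e e0; have e2 : 0 < e / 2 by rewrite divr_gt0.
have [|dl1 dl10 H1] := @derivable_eps R cos y _ _ e2; first by have [] := is_derive_cos y.
have [|dl2 dl20 H2] := @derivable_eps R sin y _ _ e2; first by have [] := is_derive_sin y.
exists (Num.min dl1 dl2); first by rewrite lt_min dl10.
move=> u v _; rewrite lt_min => /andP[v1 v2].
have := H1 _ v1; have := H2 _ v2; rewrite !subrK.
have [_ ->] := is_derive_cos y; have [_ ->] := is_derive_sin y => h2 h1.
rewrite mulr0 subr0 (le_trans (normc_le_ReIm _))//.
apply: (@le_trans _ _ (e * `|v - y|)); last by rewrite ler_wpM2l ?lerDr// ltW.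
rewrite [e]splitr mulrDl lerD//.
  by move: h1; congr (`|_| <= _); rewrite /= ; ring.
by move: h2; congr (`|_| <= _); rewrite /= ; ring.
Qed.

Lemma normc_expi t : normc (expi t) = 1.
Proof. by rewrite /Normc.normc /expi cos2Dsin2 sqrtr1. Qed.

Lemma frechet2_continuous (q : R[i] -> R) G x y A B :
  (forall z w, q (z - w) = q z - q w) -> (forall z, `|q z| <= normc z) ->
  frechet2 G x y A B ->
  {for x, continuous (fun u => q (G u y))} /\ {for y, continuous (fun v => q (G x v))}.
Proof.
move=> qB qn /frechet2_lip[dl dl0].
set M := normc A + normc B + 1 => H.
have M0 : 0 < M by rewrite ltr_wpDl ?addr_ge0 ?normc_ge0.
have xx (t : R) : `|t - t| < dl by rewrite subrr normr0.
split; apply/cvgrPdist_le => e e0.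
  near=> u; have ux : `|u - x| < dl by rewrite distrC; near: u; exact: cvgr_dist_lt.
  rewrite -qB (le_trans (qn _))// normcB (le_trans (H u y ux (xx y)))//.
  rewrite subrr normr0 addr0 mulrC -ler_pdivlMr// distrC.
  by near: u; apply: cvgr_dist_le => //; rewrite divr_gt0.
near=> v; have vy : `|v - y| < dl by rewrite distrC; near: v; exact: cvgr_dist_lt.
rewrite -qB (le_trans (qn _))// normcB (le_trans (H x v (xx x) vy))//.
rewrite subrr normr0 add0r mulrC -ler_pdivlMr// distrC.
by near: v; apply: cvgr_dist_le => //; rewrite divr_gt0.
Unshelve. all: by end_near. Qed.

Lemma continuous_seg_integrable (f : R -> R) a b :
  (forall x, a <= x <= b -> {for x, continuous f}) -> seg_integrable f a b.
Proof.
move=> cf; apply: (@continuous_compact_integrable R f); first exact: segment_compact.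
apply: continuous_in_subspaceT => x; rewrite inE /= in_itv /=; exact: cf.
Qed.

Definition circle_int (Psi : R[i] -> R[i]) (r : R) : R[i] :=
  (segint (fun t => Re (Psi (r%:C%C * expi t))) 0 (2 * pi) +i*
   segint (fun t => Im (Psi (r%:C%C * expi t))) 0 (2 * pi))%C.

Lemma circle_int_cst (Psi : R[i] -> R[i]) (r1 r2 : R) : 0 < r1 -> r1 <= r2 ->
  (forall z, r1 <= normc z <= r2 -> derivable (Psi : R[i]^o -> R[i]^o) z 1) ->
  circle_int Psi r1 = circle_int Psi r2.
Proof.
move=> r10 r12 dPsi.
pose F (u v : R) : R[i] := (expR u)%:C%C * expi v.
have nF u v : normc (F u v) = expR u.
  by rewrite Normc.normcM normc_real ger0_norm ?expR_ge0// normc_expi mulr1.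
have r20 : 0 < r2 by exact: lt_le_trans r12.
pose a := ln r1; pose b := ln r2.
have ab : a <= b by rewrite ler_ln ?posrE.
have dG x y : a <= x <= b -> exists A, frechet2 (fun u v => Psi (F u v)) x y A ('i%C * A).
  move=> /andP[ax xb].
  have zr : r1 <= normc (F x y) <= r2.
    rewrite nF; apply/andP; split; first by rewrite -(@lnK R r1) ?posrE// ler_expR.
    by rewrite -(@lnK R r2) ?posrE// ler_expR.
  have dF := frechet2M (frechet2_expR x y) (frechet2_expi x y).
  have dP e : 0 < e -> exists2 dl, 0 < dl & forall h, normc h < dl ->
      normc (Psi (h + F x y) - Psi (F x y) - h * 'D_1 (Psi : R[i]^o -> R[i]^o) (F x y)) <= e * normc h.
    move=> e0; have ec0 : 0 < e%:C%C by rewrite -[0]/(0%:C%C) ltcR.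
    have [dl dl0 H] := derivable_eps (dPsi _ zr) ec0.
    have [dlE dlR] : dl = (Re dl)%:C%C /\ 0 < Re dl.
      move: dl0; rewrite ltcE => /andP[/eqP dI dR]; split => //.
      by apply/eqP; rewrite eq_complex /= eqxx; apply/eqP; rewrite -[RHS]dI.
    exists (Re dl) => // h hdl; rewrite -lecR rmorphM /= -!normcE; apply: H.
    by rewrite dlE normcE ltcR.
  have := frechet2_comp dP dF; rewrite mulr0 addr0 mul0r add0r => dd.
  exists ('D_1 (Psi : R[i]^o -> R[i]^o) (F x y) * ((expR x)%:C%C * expi y)).
  by move: dd; congr frechet2; ring.
have reE z w : Re (z - w) = Re z - Re w by rewrite creD creN.
have imE z w : Im (z - w) = Im z - Im w by rewrite cimD cimN.
have pi0 : (0 : R) <= 2 * pi by rewrite mulr_ge0// pi_ge0.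
have cRe x y : a <= x <= b -> {for x, continuous (fun u => Re (Psi (F u y)))} /\
   {for y, continuous (fun v => Re (Psi (F x v)))}.
  by move=> xI; have [A dA] := dG x y xI; exact: (frechet2_continuous reE (@Re_le_normc R) dA).
have cIm x y : a <= x <= b -> {for x, continuous (fun u => Im (Psi (F u y)))} /\
   {for y, continuous (fun v => Im (Psi (F x v)))}.
  by move=> xI; have [A dA] := dG x y xI; exact: (frechet2_continuous imE (@Im_le_normc R) dA).
have F2pi u : F u (2 * pi) = F u 0.
  by rewrite /F /expi mulr_natl cos2pi sin2pi cos0 sin0.
have FE1 v : F a v = r1%:C%C * expi v by rewrite /F lnK ?posrE.
have FE2 v : F b v = r2%:C%C * expi v by rewrite /F lnK ?posrE.
have aI : a <= a <= b by rewrite lexx.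
have bI : a <= b <= b by rewrite lexx ab.
have key (P S : R -> R -> R) :
    (forall x y, a <= x <= b -> {for x, continuous (P ^~ y)}) ->
    (forall x y, a <= x <= b -> {for y, continuous (S x)}) ->
    (forall x y, a <= x <= b -> exists p k s : R, forall e, 0 < e ->
      exists2 dl, 0 < dl & forall u v, `|u - x| < dl -> `|v - y| < dl ->
      `|P u v - P x y - (u - x) * p - (v - y) * k| <= e * (`|u - x| + `|v - y|) /\
      `|S u v - S x y - (u - x) * k - (v - y) * s| <= e * (`|u - x| + `|v - y|)) ->
    P ^~ (2 * pi) = P ^~ 0 -> segint (S a) 0 (2 * pi) = segint (S b) 0 (2 * pi).
  move=> cP cS dPS P2; apply/eqP; rewrite eq_sym -subr_eq0; apply/eqP.
  have /= := @goursat P S a b 0 (2 * pi) ab pi0; rewrite P2 subrr add0r; apply.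
  - by move=> y _; apply: continuous_seg_integrable => x xI; exact: cP.
  - by move=> x xI; apply: continuous_seg_integrable => y yI; exact: cS.
  - by move=> x y xI yI; exact: dPS.
rewrite /circle_int; congr (_ +i* _)%C.
  transitivity (segint (fun v => Re (Psi (F a v))) 0 (2 * pi)).
    by apply: eq_Rintegral => v _; rewrite FE1.
  transitivity (segint (fun v => Re (Psi (F b v))) 0 (2 * pi)); last first.
    by apply: eq_Rintegral => v _; rewrite FE2.
  apply: (key (fun u v => Im (Psi (F u v))) (fun u v => Re (Psi (F u v)))).
  - by move=> x y xI; have [] := cIm x y xI.
  - by move=> x y xI; have [] := cRe x y xI.
  - move=> x y xI; have [A dA] := dG x y xI.
    exists (Im A), (Re A), (- Im A) => e /dA[dl dl0 H].
    exists dl => // u v ux vy; have {H} := H u v ux vy; set z := (X in normc X) => H.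
    split; apply: le_trans H.
      apply: le_trans (Im_le_normc z); rewrite le_eqVlt; apply/orP; left; apply/eqP.
      by congr `|_|; rewrite /z !ReImE /=; ring.
    apply: le_trans (Re_le_normc z); rewrite le_eqVlt; apply/orP; left; apply/eqP.
    by congr `|_|; rewrite /z !ReImE /=; ring.
  - by apply/funext => u; rewrite F2pi.
transitivity (segint (fun v => Im (Psi (F a v))) 0 (2 * pi)).
  by apply: eq_Rintegral => v _; rewrite FE1.
transitivity (segint (fun v => Im (Psi (F b v))) 0 (2 * pi)); last first.
  by apply: eq_Rintegral => v _; rewrite FE2.
apply: (key (fun u v => - Re (Psi (F u v))) (fun u v => Im (Psi (F u v)))).
- by move=> x y xI; have [h _] := cRe x y xI; apply: continuousN.
- by move=> x y xI; have [] := cIm x y xI.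
- move=> x y xI; have [A dA] := dG x y xI.
  exists (- Re A), (Im A), (Re A) => e /dA[dl dl0 H].
  exists dl => // u v ux vy; have {H} := H u v ux vy; set z := (X in normc X) => H.
  split; apply: le_trans H.
    apply: le_trans (Re_le_normc z); rewrite le_eqVlt; apply/orP; left; apply/eqP.
    by rewrite -normrN; congr `|_|; rewrite /z !ReImE /=; ring.
  apply: le_trans (Im_le_normc z); rewrite le_eqVlt; apply/orP; left; apply/eqP.
  by congr `|_|; rewrite /z !ReImE /=; ring.
by apply/funext => u; rewrite F2pi.
Qed.

End goursat.

(** * Averages over the torus *)

Section restricted_measure.
Context d (T : measurableType d) (R : realType).
Variable m : {measure set T -> \bar R}.

Let indic_ge0 (D : set T) x : 0 <= \1_D x :> R. Proof. by rewrite indicE. Qed.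

Definition mrest (D : set T) (mD : measurable D) : set T -> \bar R :=
  mdens m (@indic_ge0 D) (measurable_indic mD).

HB.instance Definition _ D mD := Measure.on (@mrest D mD).

Lemma mrestE D mD A : measurable A -> @mrest D mD A = m (A `&` D).
Proof.
by move=> mA; rewrite /mrest /mdens integral_indic// setIC.
Qed.

Lemma Rintegral_mrest D (mD : measurable D) (f : T -> R) : measurable_fun setT f ->
  (\int[mrest mD]_x f x = \int[m]_(x in D) f x)%R.
Proof.
move=> mf; rewrite /Rintegral integral_mdens// [in RHS]integral_mkcond.
congr fine; apply: eq_integral => x _; rewrite patchE indicE.
by case: ifP; rewrite ?mulr1 ?mulr0.
Qed.

End restricted_measure.

Section finite_restriction.
Context d (T : measurableType d) (R : realType).
Variable m : {finite_measure set T -> \bar R}.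
Variables (D : set T) (mD : measurable D).

Let mrest_fin : fin_num_fun (mrest m mD).
Proof. by move=> A mA; rewrite mrestE//; apply: fin_num_measure; exact: measurableI. Qed.

HB.instance Definition _ := @Measure_isFinite.Build _ _ _ (mrest m mD) mrest_fin.

End finite_restriction.

Section complex_integral_more.
Context d (T : measurableType d) (R : realType).
Variable m : {measure set T -> \bar R}.
Local Notation Re := (@complex.Re R).
Local Notation Im := (@complex.Im R).
Local Notation normc := (@Normc.normc R).

Lemma scales1_integrable phi (f : T -> R) : scales m 1 phi ->
  m.-integrable setT (EFin \o f) -> m.-integrable setT (EFin \o (f \o phi)).
Proof.
move=> s /integrableP[/measurable_EFinP mf fi].
have [mphi _] := s; apply/integrableP; split.
  by apply/measurable_EFinP; exact: measurableT_comp.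
have mn : measurable_fun setT (fun x => `|(f x)%:E|%E).
  by apply: measurableT_comp => //; exact/measurable_EFinP.
by have := ge0_integral_scales s ler01 mn (fun=> abse_ge0 _); rewrite mul1e => ->.
Qed.

Lemma scales1_Rintegral phi (f : T -> R) : scales m 1 phi ->
  measurable_fun setT f -> (\int[m]_x f (phi x) = \int[m]_x f x)%R.
Proof.
move=> s mf; have [mphi _] := s.
rewrite /Rintegral integralE [in RHS]integralE; congr (fine (_ - _)%E).
  have := ge0_integral_scales s ler01 (measurable_funepos ((measurable_EFinP _ _).2 mf)) (fun=> funepos_ge0 _ _).
  by rewrite mul1e => <-; apply: eq_integral => x _; rewrite !funeposE.
have := ge0_integral_scales s ler01 (measurable_funeneg ((measurable_EFinP _ _).2 mf)) (fun=> funeneg_ge0 _ _).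
by rewrite mul1e => <-; apply: eq_integral => x _; rewrite !funenegE.
Qed.

Lemma cintg_scales phi u : scales m 1 phi -> cintg m u -> cintg m (u \o phi).
Proof.
move=> s [mu iu]; split; first by have [mphi _] := s; exact: (cmeas_comp mu mphi).
exact: (scales1_integrable s iu).
Qed.

Lemma cint_scales phi u : scales m 1 phi -> cmeas u -> cint m (u \o phi) = cint m u.
Proof.
move=> s [m1 m2]; rewrite /cint; congr (_ +i* _)%C.
  exact: (scales1_Rintegral s m1).
exact: (scales1_Rintegral s m2).
Qed.

End complex_integral_more.

Section complex_fubini.
Context d1 d2 (T1 : measurableType d1) (T2 : measurableType d2) (R : realType).
Variables (m1 : {sigma_finite_measure set T1 -> \bar R})
  (m2 : {sigma_finite_measure set T2 -> \bar R}).
Local Notation Re := (@complex.Re R).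
Local Notation Im := (@complex.Im R).
Local Notation normc := (@Normc.normc R).

Lemma Rintegral_fubini (f : T1 * T2 -> R) :
  (m1 \x m2)%E.-integrable setT (EFin \o f) ->
  (forall y, m1.-integrable setT (fun x => (f (x, y))%:E)) ->
  (\int[m1]_x \int[m2]_y f (x, y) = \int[m2]_y \int[m1]_x f (x, y))%R.
Proof.
move=> fi f1; have := Fubini fi => /= e.
rewrite /Rintegral; congr fine.
transitivity (\int[m1]_x \int[m2]_y (f (x, y))%:E)%E.
  apply: eq_integral_ae; have := integrable_ae measurableT (integrable_fubini_F fi).
  by apply: filterS => x /(_ I) h; rewrite fineK.
by rewrite e; apply: eq_integral => x _; rewrite fineK// integrable_fin_num.
Qed.

Lemma ae_cintg_slice (u : T1 * T2 -> R[i]) : cintg (m1 \x m2)%E u ->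
  {ae m1, forall x, cintg m2 (fun y => u (x, y))}.
Proof.
move=> [mu iu]; have := integrable_ae measurableT (integrable_fubini_F iu).
apply: filterS => x /(_ I) h.
have mx : cmeas (fun y => u (x, y)) by exact: (cmeas_comp mu (measurable_pair1 x)).
split=> //; apply/integrableP; split; first by apply/measurable_EFinP; exact: measurable_normc.
rewrite -ge0_fin_numE; last by apply: integral_ge0.
rewrite (_ : (\int[m2]_y _)%E = fubini_F m2 (EFin \o (fun z => normc (u z))) x)//.
by apply: eq_integral => y _ /=; rewrite ger0_norm// normc_ge0.
Qed.

Lemma cint_fubini (u : T1 * T2 -> R[i]) : cintg (m1 \x m2)%E u ->
  (forall y, cintg m1 (fun x => u (x, y))) ->
  cint m1 (fun x => cint m2 (fun y => u (x, y))) =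
  cint m2 (fun y => cint m1 (fun x => u (x, y))).
Proof.
move=> ui u1; have [r i] := cintgP ui.
rewrite /cint /=; congr (_ +i* _)%C; [apply: (Rintegral_fubini (f := fun z => Re (u z)))|apply: (Rintegral_fubini (f := fun z => Im (u z)))] => // x.
- by have [] := cintgP (u1 x).
- by have [] := cintgP (u1 x).
Qed.

End complex_fubini.

(** * Bounds on closed polydiscs *)

Section complex_topology.
Variable R : realType.
Local Notation normc := (@Normc.normc R).

Lemma posC_normc (e : R[i]) : 0 < e -> exists2 r : R, 0 < r & e = r%:C%C.
Proof. by case: e => a b; rewrite ltcE /= => /andP[/eqP -> a0]; exists a. Qed.

Lemma normC_normc (z : R[i]) : `|z| = (normc z)%:C%C.
Proof. by []. Qed.

Lemma dist_normc (z w : R[i]) : `|normc z - normc w| <= normc (z - w).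
Proof.
have := ler_dist_dist z w.
by rewrite !normC_normc -rmorphB lecR normc_real.
Qed.

Lemma continuous_normc : continuous (normc : R[i]^o -> R).
Proof.
move=> y; apply/(cvgrPdist_lt (F := nbhs y)) => e e0; near=> x.
apply: le_lt_trans (dist_normc y x) _; rewrite -ltcR -normC_normc.
by near: x; apply: (@cvgr_dist_lt _ _ _ _ _ id) => //; rewrite ltcR.
Unshelve. all: by end_near. Qed.

Lemma continuous_complex : continuous (fun p : R * R => (p.1 +i* p.2)%C : R[i]^o).
Proof.
move=> p; apply/cvgrPdist_lt => _ /posC_normc[e e0 ->].
have e2 : 0 < e / 2 by rewrite divr_gt0.
near=> q.
have h1 : `|p.1 - q.1| < e / 2.
  by near: q; apply: (@cvgr_dist_lt _ _ _ _ _ fst) => //; exact: cvg_fst.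
have h2 : `|p.2 - q.2| < e / 2.
  by near: q; apply: (@cvgr_dist_lt _ _ _ _ _ snd) => //; exact: cvg_snd.
rewrite normC_normc ltcR; apply: le_lt_trans (normc_le_ReIm _) _ => /=.
by rewrite [e]splitr; apply: ltrD.
Unshelve. all: by end_near. Qed.

Lemma compact_disc (r : R) : 0 <= r -> compact [set z : R[i]^o | normc z <= r].
Proof.
move=> r0; pose B := [set p : R * R | p.1 ^+ 2 + p.2 ^+ 2 <= r ^+ 2].
have BE : [set z : R[i]^o | normc z <= r] = (fun p : R * R => (p.1 +i* p.2)%C : R[i]^o) @` B.
  have nB a b : (normc (a +i* b)%C <= r) = (a ^+ 2 + b ^+ 2 <= r ^+ 2).
    rewrite -(@ler_sqr _ (normc _)) ?nnegrE ?normc_ge0//.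
    by rewrite sqr_sqrtr// addr_ge0 ?sqr_ge0.
  apply/seteqP; split => [[a b] /= h|_ [[a b] /= h <-]]; last by rewrite nB.
  by exists (a, b) => //; rewrite /B /= -nB.
rewrite BE; apply: continuous_compact.
  by apply: continuous_subspaceT; exact: continuous_complex.
apply: (@subclosed_compact _ _ (`[- r, r]%classic `*` `[- r, r]%classic)).
- apply: (@closed_comp _ _ (fun p : R * R => p.1 ^+ 2 + p.2 ^+ 2) [set x | x <= r ^+ 2]); last exact: closed_le.
  move=> p _; apply: cvgD; rewrite expr2.
    by apply: cvgM; exact: cvg_fst.
  by apply: cvgM; exact: cvg_snd.
- by apply: compact_setX; exact: segment_compact.
- move=> [a b] /= h; rewrite !in_itv/= -!ler_norml -!(@ler_sqr _ `|_| r) ?nnegrE// !real_normK ?num_real//.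
  split; apply: le_trans h; rewrite ?lerDl ?lerDr sqr_ge0//.
Qed.

Lemma polydisc_bounded n (q : Cspace R n -> R[i]^o) (rho : 'I_n -> R) :
  (forall i, 0 <= rho i) ->
  (forall z : Cspace R n, (forall i, normc (z ord0 i) <= rho i) -> {for z, continuous q}) ->
  exists B : R, forall z : Cspace R n, (forall i, normc (z ord0 i) <= rho i) -> normc (q z) <= B.
Proof.
move=> rho0 cq; pose K := [set z : Cspace R n | forall i, normc (z ord0 i) <= rho i].
have cK : compact K.
  exact: (@rV_compact _ n (fun i => [set z : R[i]^o | normc z <= rho i]) (fun i => compact_disc (rho0 i))).
have cf : {within K, continuous (fun z => normc (q z))}.
  suff h (z : Cspace R n) : K z -> normc (q w) @[w --> z] --> normc (q z).
    by apply: continuous_in_subspaceT => z /set_mem; exact: h.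
  by move=> Kz; exact: (cvg_comp _ _ (cq z Kz) (@continuous_normc _)).
have /compact_bounded[M [_ HM]] := continuous_compact cf cK.
exists (M + 1) => z Kz; have := HM (M + 1); rewrite ltrDl ltr01 => /(_ isT (normc (q z))).
move=> /(_ (ex_intro2 _ _ z Kz erefl)); rewrite /= ger0_norm ?normc_ge0//.
Qed.

End complex_topology.

(** * Coordinates and the action of the torus *)

Section coordinates.
Variables (R : realType) (n : nat).
Local Notation P := (measurableTypeR R * measurableTypeR R)%type.
Local Notation X := (n.-tuple P).
Local Notation normc := (@Normc.normc R).
Local Notation L := (lebesgueC R n).
Local Notation Re := (@complex.Re R).
Local Notation Im := (@complex.Im R).
Implicit Types (c u : 'I_n -> R[i]) (x w : X).

Definition pt c : X := [tuple (Re (c j), Im (c j)) | j < n].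

Lemma zc_pt c j : zc (pt c) j = c j.
Proof. by rewrite /zc /pt tnth_mktuple /=; case: (c j). Qed.

Lemma pt_zc x : pt (zc x) = x.
Proof. by apply: eq_from_tnth => j; rewrite tnth_mktuple /zc /=; case: (tnth x j). Qed.

Lemma eq_pt c1 c2 : c1 =1 c2 -> pt c1 = pt c2.
Proof. by move=> /funext ->. Qed.

Lemma eq_zc x y : zc x =1 zc y -> x = y.
Proof. by move=> h; rewrite -(pt_zc x) (eq_pt h) pt_zc. Qed.

Lemma of_coords_pt c : of_coords (pt c) = \row_j c j :> Cspace R n.
Proof. by apply/rowP => j; rewrite !mxE -[RHS]zc_pt. Qed.

Lemma normsq_pt c : normsq (pt c) = \sum_j normc (c j) ^+ 2.
Proof. by apply: eq_bigr => j _; rewrite zc_pt. Qed.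

Lemma measurable_pt d (T : measurableType d) (c : T -> 'I_n -> R[i]) :
  (forall j, cmeas (c ^~ j)) -> measurable_fun setT (fun t => pt (c t)).
Proof.
move=> mc; apply/measurable_fun_tnthP => j.
rewrite (_ : _ \o _ = fun t => (Re (c t j), Im (c t j))); last first.
  by apply/funext => t; rewrite /= tnth_mktuple.
have [m1 m2] := mc j.
exact: measurable_fun_pair.
Qed.

Definition cmul u x : X := tuple_map (fun j => rotate (u j)) x.

Lemma zc_cmul u x j : zc (cmul u x) j = u j * zc x j.
Proof. rewrite /zc /cmul tnth_mktuple /rotate /=; case: (u j) => a b.
by apply/eqP; rewrite eq_complex /=; apply/andP; split; apply/eqP; ring. Qed.

Lemma cmul_pt u c : cmul u (pt c) = pt (fun j => u j * c j).
Proof. by apply: eq_zc => j; rewrite zc_cmul !zc_pt. Qed.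

Definition unimodular u := forall j, normc (u j) = 1.

Lemma normsq_cmul u x : unimodular u -> normsq (cmul u x) = normsq x.
Proof. by move=> u1; apply: eq_bigr => j _; rewrite zc_cmul Normc.normcM u1 mul1r. Qed.

Lemma scales_cmul u : unimodular u -> scales L 1 (cmul u).
Proof.
move=> u1; have := @scales_tuple _ _ _ (@lebesgue2 R) n (fun=> 1) (fun j => rotate (u j)).
by rewrite big1//; apply => // j; exact: lebesgue2_rotate.
Qed.

Lemma scales_nu_cmul alpha (ha : -1 < alpha) u : unimodular u ->
  scales (@nu_alpha R n alpha ha) 1 (cmul u).
Proof.
move=> u1; apply: weight_scales; first by move=> x; exact: normsq_cmul.
exact: scales_cmul.
Qed.

(** The phases of the coordinates of w, with 1 in place of an undefined phase so that [sg w] is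
    unimodular everywhere. When w is distributed by nu_alpha, which is invariant under the torus,
    the phases are uniform up to the total mass: integrals over w serve as averages over the
    torus. *)
Definition sg w (j : 'I_n) : R[i] :=
  if zc w j == 0 then 1 else zc w j / (normc (zc w j))%:C%C.

Lemma sg_unimodular w : unimodular (sg w).
Proof.
move=> j; rewrite /sg; case: eqP => [_|/eqP z0]; first exact: Normc.normc1.
have n0 : normc (zc w j) != 0 by rewrite normc_eq0.
by rewrite Normc.normcM -fmorphV normc_real ger0_norm ?invr_ge0 ?normc_ge0// divff.
Qed.

Lemma sgE w j : zc w j = (normc (zc w j))%:C%C * sg w j.
Proof.
rewrite /sg; case: eqP => [->|/eqP z0]; first by rewrite [normc _]Normc.normc0 mul0r.
rewrite mulrCA divff ?mulr1//; rewrite -normc_eq0 normc_real normr_eq0 normc_eq0.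
exact: z0.
Qed.

Lemma sg_cmul u w j : unimodular u -> zc w j != 0 -> sg (cmul u w) j = u j * sg w j.
Proof.
move=> u1 z0; rewrite /sg zc_cmul mulf_eq0 (negbTE z0) orbF.
by rewrite -normc_eq0 u1 oner_eq0 Normc.normcM u1 mul1r mulrA.
Qed.

Lemma cmeas_sg j : cmeas (sg ^~ j).
Proof.
have [h1 h2] : cmeas (fun w : X => zc w j * (normc (zc w j))^-1%:C%C).
  apply: cmeasM; first exact: cmeas_zc.
  apply: cmeas_real.
  rewrite (_ : (fun w => _) = (fun w => normc (zc w j) `^ (-1))).
    apply: (measurableT_comp (measurable_powR (-1))); apply: measurable_normc; exact: cmeas_zc.
  by apply/funext => w; rewrite powR_inv1 ?normc_ge0.
have mb : measurable_fun setT (fun w : X => zc w j == 0).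
  under eq_fun do rewrite -normc_eq0.
  by apply: measurable_fun_eqr => //; apply: measurable_normc; exact: cmeas_zc.
have E (p : R[i] -> R) : (fun w : X => p (sg w j)) = fun w => if zc w j == 0 then p 1
    else p (zc w j * (normc (zc w j))^-1%:C%C).
  by apply/funext => w; rewrite /sg; case: ifP => //; rewrite -fmorphV.
by split; [rewrite (E Re)|rewrite (E Im)]; apply: measurable_fun_ifT.
Qed.

Lemma ae_nu_neq0 alpha (ha : -1 < alpha) :
  {ae (@nu_alpha R n alpha ha), forall x, forall j, zc x j != 0}.
Proof.
have hyper j : {ae (@nu_alpha R n alpha ha), forall x, zc x j != 0}.
  apply/ae_nuP.
  (* Inside the ball, the hyperplane z_j = 0 lies in a box with one factor reduced to a point, which
     has volume 0. *)
  pose A i : set P := if i == j then [set (0, 0)] else square (0, 0) 1.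
  have [sq1 sq2] := lebesgue2_square (0, 0) (@ltr01 R).
  have P1 : measurable [set ((0, 0) : P)] /\ @lebesgue2 R [set (0, 0)] = 0%:E.
    have -> : [set ((0, 0) : P)] = [set 0] `*` [set 0].
      by apply/seteqP; split => -[a b] /= [-> ->].
    split; first exact: measurableX.
    rewrite /lebesgue2 product_measure1E//.
    have e := lebesgue_measure_set1 (0 : R).
    by rewrite [X in (X * _)%E]e mul0e.
  have [||mB LB] := @tuple_measure_box _ _ _ (@lebesgue2 R) n A
     (fun i => if i == j then 0 else (2 * 1) ^+ 2).
  - by move=> i; rewrite /A; case: ifP => // _; have [] := P1.
  - by move=> i; rewrite /A; case: ifP => // _; have [] := P1.
  exists [set x | forall i, A i (tnth x i)]; split => //.
    by rewrite LB (bigD1 j)//= eqxx mul0r.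
  move=> x /=; apply: contra_notP => nA x1; apply/eqP => xj; apply: nA => i.
  rewrite /A; case: eqP => [->|_].
    by move: xj; rewrite /zc; case: (tnth x j) => a b [/= -> ->].
  have : normc (zc x i) <= 1.
    rewrite -(@expr_le1 _ 2)// ?normc_ge0//; apply: le_trans (ltW x1).
    rewrite /normsq (bigD1 i)//= lerDl; apply: sumr_ge0 => k _.
    by rewrite exprn_ge0// normc_ge0.
  move=> zj; apply/squareP; rewrite /= !subr0; split.
    exact: le_trans (Re_le_normc (zc x i)) zj.
  exact: le_trans (Im_le_normc (zc x i)) zj.
exact: (@filter_forall _ _ (fun j x => zc x j != 0) _ _ hyper).
Qed.

Lemma normsq_lt1_pt c (rho : 'I_n -> R) : (forall i, normc (c i) <= rho i) ->
  \sum_i rho i ^+ 2 < 1 -> normsq (pt c) < 1.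
Proof.
move=> cr; apply: le_lt_trans; rewrite normsq_pt; apply: ler_sum => i _.
by rewrite lerXn2r ?nnegrE ?normc_ge0//; apply: le_trans (cr i); exact: normc_ge0.
Qed.

Lemma unit_ballP (z : Cspace R n) : unit_ball z <-> \sum_j normc (z ord0 j) ^+ 2 < 1.
Proof.
have s0 : 0 <= \sum_j normc (z ord0 j) ^+ 2.
  by apply: sumr_ge0 => j _; rewrite exprn_ge0// normc_ge0.
by rewrite /unit_ball /= /vnorm -[X in _ < X]sqrtr1 ltr_sqrt.
Qed.

End coordinates.

Lemma rcM (R : realType) (x y : R) : (x * y)%:C%C = x%:C%C * y%:C%C :> R[i].
Proof. exact: rmorphM. Qed.

Lemma rcX (R : realType) (x : R) k : (x ^+ k)%:C%C = x%:C%C ^+ k :> R[i].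
Proof. exact: rmorphXn. Qed.

Lemma sqr_le (R : realType) (x y : R) : 0 <= x -> x <= y -> x ^+ 2 <= y ^+ 2.
Proof. by move=> x0 xy; rewrite lerXn2r ?nnegrE//; exact: le_trans xy. Qed.

Lemma invc_unimodular (R : realType) (u : R[i]) : Normc.normc u = 1 -> u^-1 = conjc u.
Proof.
move=> u1; have u0 : u != 0 by rewrite -normc_eq0 u1 oner_eq0.
by apply: (mulfI u0); rewrite mulfV// mulcJ u1 expr1n.
Qed.

Section finite_cint.
Context d (T : measurableType d) (R : realType).
Variable m : {finite_measure set T -> \bar R}.
Local Notation normc := (@Normc.normc R).

Lemma cintg_bounded (u : T -> R[i]) (B : R) : cmeas u -> (forall x, normc (u x) <= B) -> cintg m u.
Proof.
move=> mu uB; apply: (le_cintg (b := fun=> B)) => //.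
exact: finite_measure_integrable_cst.
Qed.

Lemma cint_cst (c : R[i]) : cint m (fun=> c) = (fine (m setT))%:C%C * c.
Proof.
rewrite /cint !Rintegral_cst//; case: c => x y /=.
by apply/eqP; rewrite eq_complex /=; apply/andP; split; apply/eqP; ring.
Qed.

End finite_cint.

Section bounded_fubini.
Context d1 d2 (T1 : measurableType d1) (T2 : measurableType d2) (R : realType).
Variables (m1 : {finite_measure set T1 -> \bar R})
  (m2 : {finite_measure set T2 -> \bar R}).
Local Notation normc := (@Normc.normc R).

Lemma cint_fubini_bounded (u : T1 * T2 -> R[i]) (B : R) : cmeas u ->
  (forall z, normc (u z) <= B) ->
  cint m1 (fun x => cint m2 (fun y => u (x, y))) =
  cint m2 (fun y => cint m1 (fun x => u (x, y))).
Proof.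
move=> mu uB; apply: cint_fubini.
- split => //; have mn : measurable_fun setT (fun z => (normc (u z))%:E).
    by apply/measurable_EFinP; exact: measurable_normc.
  apply/(integrable12ltyP m1 m2 mn).
  have B0 x : (0 <= normc (u x))%R by exact: normc_ge0.
  apply: (@le_lt_trans _ _ (\int[m1]_x \int[m2]_y B%:E)%E).
    have n0 z : (0 <= `|(normc (u z))%:E|)%E by [].
    have ma : measurable_fun setT (fun z => `|(normc (u z))%:E|%E) by exact: measurableT_comp.
    apply: ge0_le_integral => //.
    - by move=> x _; exact: integral_ge0.
    - exact: (measurable_fun_fubini_tonelli_F _ ma n0).
    move=> x _; apply: ge0_le_integral => //.
    - exact: (measurableT_comp ma (measurable_pair1 x)).
    - by move=> y _; rewrite lee_fin ger0_norm.
  have [c1 e1] : exists c, m1 setT = c%:E.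
    by exists (fine (m1 setT)); rewrite fineK// fin_num_measure.
  have [c2 e2] : exists c, m2 setT = c%:E.
    by exists (fine (m2 setT)); rewrite fineK// fin_num_measure.
  have -> : (\int[m2]_y B%:E = (B * c2)%:E)%E by rewrite integral_cst// [X in (_ * X)%E]e2.
  by rewrite integral_cst// [X in (_ * X)%E]e1 -EFinM ltry.
- move=> y; apply: (@cintg_bounded _ _ _ m1 _ B) => //; exact: (cmeas_comp mu (measurable_pair2 y)).
Qed.

End bounded_fubini.

Section cint_section.
Context d1 d2 (T1 : measurableType d1) (T2 : measurableType d2) (R : realType).
Variables (m1 : {sigma_finite_measure set T1 -> \bar R})
  (m2 : {sigma_finite_measure set T2 -> \bar R}).

Lemma cmeas_cint (u : T1 * T2 -> R[i]) : cintg (m1 \x m2)%E u ->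
  cmeas (fun x => cint m2 (fun y => u (x, y))).
Proof.
move=> ui; have [r i] := cintgP ui; rewrite /cint; split => /=.
  exact: (measurableT_comp (fine_measurable measurableT) (measurable_fubini_F r)).
exact: (measurableT_comp (fine_measurable measurableT) (measurable_fubini_F i)).
Qed.

End cint_section.

Section mono_facts.
Variables (R : realType) (n : nat).
Local Notation normc := (@Normc.normc R).
Implicit Types (a b : 'I_n -> nat) (c u : 'I_n -> R[i]).

Lemma monoE a b c : mono a b (pt c) = \prod_j (c j ^+ a j * conjc (c j) ^+ b j).
Proof. by apply: eq_bigr => j _; rewrite zc_pt. Qed.

Lemma mono_ptM a b c1 c2 : mono a b (pt (fun j => c1 j * c2 j)) = mono a b (pt c1) * mono a b (pt c2).
Proof.
rewrite !monoE -big_split; apply: eq_bigr => j _ /=.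
by rewrite rmorphM !exprMn mulrACA.
Qed.

Lemma mono_cmul a b u (x : n.-tuple _) : mono a b (cmul u x) = mono a b (pt u) * mono a b x.
Proof. by rewrite -{1}(pt_zc x) cmul_pt mono_ptM pt_zc. Qed.

Lemma cmeas_mono_pt d (T : measurableType d) a b (c : T -> 'I_n -> R[i]) :
  (forall j, cmeas (c ^~ j)) -> cmeas (fun t => mono a b (pt (c t))).
Proof.
move=> mc; under eq_fun do rewrite monoE.
by apply: cmeas_prod => j; apply: cmeasM; apply: cmeasX => //; exact: cmeasJ.
Qed.

Lemma normc_mono_unimodular a b u : unimodular u -> normc (mono a b (pt u)) = 1.
Proof.
move=> u1; rewrite monoE normc_prod big1// => j _.
by rewrite Normc.normcM !normcX normcJ u1 !expr1n mulr1.
Qed.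

Lemma mono_real a b (rho : 'I_n -> R) :
  mono a b (pt (fun j => (rho j)%:C%C)) = (\prod_j rho j ^+ (a j + b j))%:C%C.
Proof.
rewrite monoE rmorph_prod; apply: eq_bigr => j _ /=.
by rewrite rmorphXn exprD; congr (_ * _ ^+ _); rewrite /= oppr0.
Qed.

End mono_facts.

Section slices.
Variables (R : realType) (n : nat).
Local Notation normc := (@Normc.normc R).

Lemma slice_derivable (q : Cspace R n -> R[i]^o) (c : 'I_n -> R[i]) (s : R[i]) (j : 'I_n)
    (A := fun z : R[i] => (\row_i (if i == j then z * s else c i)) : Cspace R n) (z : R[i]^o) :
  differentiable q (A z) -> derivable (fun z : R[i]^o => q (A z)) z 1.
Proof.
move=> dq; have := @diff_derivable _ _ _ q (A z) (s *: delta_mx ord0 j) dq.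
rewrite /derivable.
set F := (fun h => _) => cF; set G := (fun h => _); suff <- : F = G by [].
apply/funext => h; rewrite /F /G /=.
congr (_ *: (q _ - _)); apply/rowP => i; rewrite !mxE eqxx /= [i == j]eq_sym.
case: eqVneq => [_|]; last by rewrite !mulr0 add0r.
by rewrite mulr1 [h *: (1 : R[i]^o)]mulr1 mulrDl.
Qed.

Lemma slice_monomial_derivable (f : R[i]^o -> R[i]^o) (k l : nat) (z : R[i]^o) : z != 0 ->
  derivable f z 1 -> derivable (fun z : R[i]^o => f z * (z ^+ k * z^-1 ^+ l)) z 1.
Proof.
move=> z0 df; have did : derivable (id : R[i]^o -> R[i]^o) z 1 by exact: derivable_id.
have dV : derivable (fun z : R[i]^o => z^-1 : R[i]^o) z 1 by exact: derivableV.
have dX (g : R[i]^o -> R[i]^o) e : derivable g z 1 -> derivable (fun y : R[i]^o => g y ^+ e : R[i]^o) z 1.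
  by move=> /(derivableX (n := e)); rewrite (_ : g ^+ e = fun y => g y ^+ e)// fctE.
exact: (derivableM df (derivableM (dX _ k did) (dX _ l dV))).
Qed.

End slices.

Section circle_measure.
Variable R : realType.
Local Notation mu := (@lebesgue_measure R).

Lemma cmeas_expi : cmeas (fun t : measurableTypeR R => expi t).
Proof. by split => /=; apply: continuous_measurable_fun; [exact: continuous_cos|exact: continuous_sin]. Qed.

Definition circle_itv : set (measurableTypeR R) := `[0, 2 * pi]%classic.

Lemma measurable_circle_itv : measurable circle_itv.
Proof. exact: measurable_itv. Qed.

Definition circle_measure : set (measurableTypeR R) -> \bar R :=
  mrest mu measurable_circle_itv.

HB.instance Definition _ := Measure.on circle_measure.

Lemma circle_measureT : circle_measure setT = (2 * pi)%:E.
Proof.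
rewrite /circle_measure mrestE// setTI.
have := lebesgue_measure_itv (`[0, 2 * pi] : interval R).
by rewrite /= lte_fin mulr_gt0 ?pi_gt0// sube0.
Qed.

Let circle_measure_lty : (circle_measure setT < +oo)%E.
Proof. by rewrite circle_measureT ltry. Qed.

HB.instance Definition _ := @Measure_isFinite.Build _ _ _ circle_measure
  (lty_fin_num_fun circle_measure_lty).

Lemma cint_circle (f : measurableTypeR R -> R[i]) : cmeas f -> cint circle_measure f =
  (segint (fun t => complex.Re (f t)) 0 (2 * pi) +i*
   segint (fun t => complex.Im (f t)) 0 (2 * pi))%C.
Proof.
move=> [m1 m2]; rewrite /cint /segint; congr (_ +i* _)%C.
  exact: (Rintegral_mrest mu measurable_circle_itv m1).
exact: (Rintegral_mrest mu measurable_circle_itv m2).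
Qed.

End circle_measure.

(** * Torus means of a holomorphic function *)

Section torus.
Variables (R : realType) (n : nat) (alpha : R) (ha : -1 < alpha).
Local Notation P := (measurableTypeR R * measurableTypeR R)%type.
Local Notation X := (n.-tuple P).
Local Notation normc := (@Normc.normc R).
Local Notation nu := (@nu_alpha R n alpha ha).
Local Notation mu := (@lebesgue_measure R).

Lemma ae_nu_ball : {ae nu, forall x, normsq x < 1}.
Proof. by apply/ae_nuP; apply: nearW. Qed.

Variable q : Cspace R n -> R[i]^o.
Hypotheses (aq : analytic_ball q) (mq : cmeas (ball_ext q)).
Variables a b : 'I_n -> nat.
Local Notation Q := (ball_ext q).
Implicit Types (rho sigma : 'I_n -> R) (w x : X).

Lemma ball_ext_pt c rho : (forall i, normc (c i) <= rho i) -> \sum_i rho i ^+ 2 < 1 ->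
  Q (pt c) = q (\row_i c i).
Proof. by move=> cr r1; rewrite /ball_ext (normsq_lt1_pt cr r1) of_coords_pt. Qed.

Lemma row_unit_ball (z : Cspace R n) rho : (forall i, normc (z ord0 i) <= rho i) ->
  \sum_i rho i ^+ 2 < 1 -> unit_ball z.
Proof.
move=> zr r1; apply/unit_ballP; apply: le_lt_trans r1; apply: ler_sum => i _.
by rewrite lerXn2r ?nnegrE ?normc_ge0//; apply: le_trans (zr i); exact: normc_ge0.
Qed.

Lemma ball_ext_bounded rho : (forall i, 0 <= rho i) -> \sum_i rho i ^+ 2 < 1 ->
  exists B : R, forall c, (forall i, normc (c i) <= rho i) -> normc (Q (pt c)) <= B.
Proof.
move=> r0 r1; have [|B HB] := @polydisc_bounded R n q rho r0.
  move=> z zr; apply: differentiable_continuous; apply: aq.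
  exact: row_unit_ball r1.
exists B => c cr; rewrite (ball_ext_pt cr r1); apply: HB => i; rewrite mxE; exact: cr.
Qed.

(** For q the sum of c_k z^k this is c_(a - b) rho^(a - b) times the total mass. Its dependence on
    rho is found below without expanding q. *)
Definition torus_mean rho : R[i] :=
  cint nu (fun w => Q (pt (fun i => (rho i)%:C%C * sg w i)) * mono b a (pt (sg w))).

Lemma cmeas_sg_mono : cmeas (fun w : X => mono b a (pt (sg w))).
Proof. by apply: cmeas_mono_pt => j; exact: cmeas_sg. Qed.

Lemma normc_rho_sg rho (c : 'I_n -> R[i]) : (forall i, 0 <= rho i) -> unimodular c ->
  forall i, normc ((rho i)%:C%C * c i) <= rho i.
Proof. by move=> r0 c1 i; rewrite Normc.normcM c1 mulr1 normc_real ger0_norm. Qed.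

Let torus_integrand rho (u : 'I_n -> R[i]) w : R[i] :=
  Q (pt (fun i => (rho i)%:C%C * (u i * sg w i))) * mono b a (pt (fun i => u i * sg w i)).

Lemma torus_mean_rotate rho u : unimodular u ->
  cint nu (torus_integrand rho u) = torus_mean rho.
Proof.
move=> u1; rewrite /torus_mean; set f := (fun w => _ * _).
have mf : cmeas f.
  apply: cmeasM; last exact: cmeas_sg_mono.
  apply: (cmeas_comp mq); apply: measurable_pt => j; apply: cmeasZ; exact: cmeas_sg.
transitivity (cint nu (f \o cmul u)); last exact: (cint_scales (scales_nu_cmul ha u1) mf).
apply: ae_eq_cint.
- apply: cmeasM.
    apply: (cmeas_comp mq); apply: measurable_pt => j.
    by do 2 apply: cmeasZ; exact: cmeas_sg.
  by apply: cmeas_mono_pt => j; apply: cmeasZ; exact: cmeas_sg.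
- by apply: cmeas_comp mf _; have [] := scales_nu_cmul ha u1.
apply: filterS (ae_nu_neq0 n ha) => w w0; rewrite /f /torus_integrand /=.
by congr (Q (pt _) * mono b a (pt _)); apply/funext => i; rewrite sg_cmul.
Qed.

Let tt (j : 'I_n) (t : R) (i : 'I_n) : R[i] := if i == j then expi t else 1.

Let tt_unimodular j t : unimodular (tt j t).
Proof. by move=> i; rewrite /tt; case: ifP => _; rewrite ?normc_expi ?Normc.normc1. Qed.

(** q along the j-th coordinate, the others being fixed with the phases of w and moduli rho_i, times
    z^(b_j - a_j). There may be a pole at 0, as a_j may exceed b_j. *)
Definition torus_slice rho (j : 'I_n) w (z : R[i]^o) : R[i]^o :=
  q (\row_i (if i == j then z * sg w i else (rho i)%:C%C * sg w i)) * (z ^+ b j * z^-1 ^+ a j).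

(** Rotating the j-th phase by e^(it) does not change the torus mean. Averaging over t and
    exchanging the two integrals exhibits it as a mean of circle integrals in the j-th variable; the
    power of rho_j is the modulus of z^(b_j - a_j) on the circle. *)
Lemma torus_mean_circle rho (j : 'I_n) : (forall i, 0 < rho i) -> \sum_i rho i ^+ 2 < 1 ->
  (2 * pi * (rho j ^+ b j * (rho j)^-1 ^+ a j))%:C%C * torus_mean rho =
  cint nu (fun w => mono b a (pt (sg w)) *
    circle_int (torus_slice rho j w) (rho j)).
Proof.
move=> r0 r1; have r0' i : 0 <= rho i by exact: ltW.
pose K : R[i] := (rho j ^+ b j * (rho j)^-1 ^+ a j)%:C%C.
have [B HB] := ball_ext_bounded r0' r1.
have uB t w : normc (torus_integrand rho (tt j t) w) <= B.
  rewrite Normc.normcM normc_mono_unimodular ?mulr1; last first.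
    by move=> i; rewrite Normc.normcM tt_unimodular sg_unimodular mulr1.
  apply: HB => i; apply: (@normc_rho_sg rho (fun i => tt j t i * sg w i)) => // k.
  by rewrite Normc.normcM tt_unimodular sg_unimodular mulr1.
have mtt i : cmeas (fun z : measurableTypeR R * X => tt j z.1 i).
  rewrite /tt; case: (i == j); last exact: cmeas_cst.
  exact: (cmeas_comp (@cmeas_expi R) measurable_fst).
have msg i : cmeas (fun z : measurableTypeR R * X => sg z.2 i).
  exact: (cmeas_comp (@cmeas_sg R n i) measurable_snd).
have mu2 : cmeas (fun z : measurableTypeR R * X => torus_integrand rho (tt j z.1) z.2).
  apply: cmeasM; last by apply: cmeas_mono_pt => i; apply: cmeasM.
  have mp : measurable_fun setT (fun z : measurableTypeR R * X =>
      pt (fun i => (rho i)%:C%C * (tt j z.1 i * sg z.2 i))).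
    by apply: measurable_pt => i; apply: cmeasZ; apply: cmeasM.
  exact: (cmeas_comp mq mp).
pose I := @circle_measure R.
pose Psi := torus_slice rho j.
have PsiE t w : K * torus_integrand rho (tt j t) w =
    mono b a (pt (sg w)) * Psi w ((rho j)%:C%C * expi t).
  rewrite /torus_integrand.
  have -> : Q (pt (fun i => (rho i)%:C%C * (tt j t i * sg w i))) =
      q (\row_i (if i == j then (rho j)%:C%C * expi t * sg w i else (rho i)%:C%C * sg w i)).
    rewrite (@ball_ext_pt _ rho)//; last first.
      move=> i; apply: (@normc_rho_sg rho (fun i => tt j t i * sg w i)) => // k.
      by rewrite Normc.normcM tt_unimodular sg_unimodular mulr1.
    congr (q _); apply/rowP => i; rewrite !mxE /tt; case: eqVneq => [->|_]; first by rewrite mulrA.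
    by rewrite mul1r.
  rewrite mono_ptM (_ : mono b a (pt (tt j t)) = expi t ^+ b j * conjc (expi t) ^+ a j); last first.
    rewrite monoE (bigD1 j)//= {1 2}/tt eqxx big1 ?mulr1// => i /negbTE ij.
    by rewrite /tt ij rmorph1 !expr1n mulr1.
  rewrite /Psi /torus_slice invfM (invc_unimodular (normc_expi t)) !exprMn -fmorphV -!rmorphXn.
  rewrite /K rmorphM; ring.
have KB t w : normc (K * torus_integrand rho (tt j t) w) <= normc K * B.
  by rewrite Normc.normcM ler_wpM2l ?normc_ge0.
have <- : cint I (fun t => cint nu (fun w => K * torus_integrand rho (tt j t) w)) =
    (2 * pi * (rho j ^+ b j * (rho j)^-1 ^+ a j))%:C%C * torus_mean rho.
  transitivity (cint I (fun=> K * torus_mean rho)); last first.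
    rewrite cint_cst (_ : fine (I setT) = 2 * pi); last exact: (congr1 fine (circle_measureT R)).
    by rewrite (rcM (2 * pi)) mulrA.
  apply: eq_cint => t; rewrite -(torus_mean_rotate _ (tt_unimodular j t)) cintZ//.
  by apply: (@cintg_bounded _ _ _ nu _ B) => //; exact: (cmeas_comp mu2 (measurable_pair1 t)).
have <- : cint nu (fun w => cint I (fun t => K * torus_integrand rho (tt j t) w)) =
    cint nu (fun w => mono b a (pt (sg w)) * circle_int (Psi w) (rho j)).
  apply: eq_cint => w; pose m := mono b a (pt (sg w)).
  have m1 : normc m = 1 by apply: normc_mono_unimodular; exact: sg_unimodular.
  have m0 : m != 0 by rewrite -normc_eq0 m1 oner_eq0.
  have PE : (fun t => Psi w ((rho j)%:C%C * expi t)) =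
      (fun t => m^-1 * (K * torus_integrand rho (tt j t) w)).
    by apply/funext => t; rewrite PsiE -/m mulKf.
  have gP : cintg I (fun t => Psi w ((rho j)%:C%C * expi t)).
    rewrite PE; apply: cintgZ; apply: (@cintg_bounded _ _ _ I _ (normc K * B)) => //.
    by apply: cmeasZ; exact: (cmeas_comp mu2 (measurable_pair2 w)).
  rewrite /circle_int -(cint_circle gP.1) -cintZ//.
  by apply: eq_cint => t; rewrite PsiE.
apply: (@cint_fubini_bounded _ _ _ _ _ I nu
  (fun z => K * torus_integrand rho (tt j z.1) z.2) (normc K * B)) => //.
exact: cmeasZ.
Qed.

#[local] Opaque torus_mean cint circle_int.

(** The slice is holomorphic away from 0, so its circle integrals at the radii r and rho_j agree. *)
Lemma torus_mean_step rho (j : 'I_n) r : (forall i, 0 < rho i) -> \sum_i rho i ^+ 2 < 1 ->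
  0 < r -> r <= rho j -> let rho' := fun i => if i == j then r else rho i in
  (rho j ^+ b j * (rho j)^-1 ^+ a j)%:C%C * torus_mean rho =
  (r ^+ b j * r^-1 ^+ a j)%:C%C * torus_mean rho'.
Proof.
move=> r0 r1 rp rj rho'.
have rho'_gt0 i : 0 < rho' i by rewrite /rho'; case: ifP.
have rho'_le i : rho' i <= rho i by rewrite /rho'; case: eqP => [->|].
have rho'1 : \sum_i rho' i ^+ 2 < 1.
  by apply: le_lt_trans r1; apply: ler_sum => i _; apply: sqr_le => //; exact: ltW.
have p0 : (2 * pi)%:C%C != 0 :> R[i].
  by apply/eqP => -[/eqP]; rewrite mulf_eq0 pnatr_eq0/= gt_eqF ?pi_gt0.
have := torus_mean_circle j r0 r1; have := torus_mean_circle j rho'_gt0 rho'1.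
have -> : rho' j = r by rewrite /rho' eqxx.
rewrite !(rcM (2 * pi)) -!mulrA => e1 e2; apply: (mulfI p0).
apply: (etrans e2); apply: (etrans _ (esym e1)); apply: eq_cint => w.
apply: (congr1 (fun z => mono b a (pt (sg w)) * z)).
have -> : torus_slice rho' j w = torus_slice rho j w.
  apply/funext => z; congr (q _ * _); apply/rowP => i; rewrite !mxE /rho'.
  by case: (i == j).
apply/esym/circle_int_cst => // z /andP[rz zr].
have z0 : z != 0 by rewrite -normc_gt0 (lt_le_trans rp).
apply: (@slice_monomial_derivable R
  (fun z => q (\row_i (if i == j then z * sg w i else (rho i)%:C%C * sg w i)))) => //.
rewrite (_ : (fun z => _) = fun z : R[i]^o => q (\row_i (if i == j then z * sg w j else (rho i)%:C%C * sg w i))).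
  apply: slice_derivable; apply: aq; apply: row_unit_ball r1 => i; rewrite mxE.
  rewrite -/(sg w j); case: eqP => [->|_]; last exact: normc_rho_sg (fun i => ltW (r0 i)) (sg_unimodular w) i.
  by rewrite Normc.normcM sg_unimodular mulr1.
apply/funext => z'; congr q; apply/rowP => i; rewrite !mxE; case: eqP => [->|]//.
Qed.

Let cf rho : R := \prod_i (rho i ^+ b i * (rho i)^-1 ^+ a i).

(** The radii are changed one at a time; every intermediate polyradius lies between [sigma] and
    [rho], hence inside the ball. *)
Lemma torus_mean_le rho sigma : (forall i, 0 < sigma i <= rho i) -> \sum_i rho i ^+ 2 < 1 ->
  (cf rho)%:C%C * torus_mean rho = (cf sigma)%:C%C * torus_mean sigma.
Proof.
move=> sr r1.
pose mix (s : seq 'I_n) i := if i \in s then sigma i else rho i.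
have mix0 s i : 0 < mix s i.
  by have /andP[h1 h2] := sr i; rewrite /mix; case: ifP => // _; exact: lt_le_trans h2.
have mix1 s : \sum_i mix s i ^+ 2 < 1.
  apply: le_lt_trans r1; apply: ler_sum => i _; have /andP[h1 h2] := sr i.
  by apply: sqr_le; [exact: ltW|rewrite /mix; case: ifP].
suff main s : (cf rho)%:C%C * torus_mean rho = (cf (mix s))%:C%C * torus_mean (mix s).
  have -> : sigma = mix (enum 'I_n) by apply/funext => i; rewrite /mix mem_enum.
  exact: main.
elim: s => [|j s ih]; first by rewrite (_ : mix [::] = rho).
rewrite {}ih.
pose c := \prod_(i | i != j) (mix s i ^+ b i * (mix s i)^-1 ^+ a i).
have := @torus_mean_step (mix s) j (mix (j :: s) j) (mix0 s) (mix1 s) (mix0 _ _).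
have jj : mix (j :: s) j = sigma j by rewrite /mix mem_head.
have jle : mix (j :: s) j <= mix s j.
  by rewrite jj; have /andP[? ?] := sr j; rewrite /mix; case: ifP.
move=> /(_ jle); rewrite jj /=.
rewrite (_ : (fun i => _) = mix (j :: s)); last first.
  by apply/funext => i; rewrite /mix inE; case: eqP => [->|].
move: (torus_mean (mix s)) (torus_mean (mix (j :: s))) => T1 T2 e.
have c1 : cf (mix s) = (mix s j ^+ b j * (mix s j)^-1 ^+ a j) * c.
  by rewrite /cf (bigD1 j).
have c2 : cf (mix (j :: s)) = (sigma j ^+ b j * (sigma j)^-1 ^+ a j) * c.
  rewrite /cf (bigD1 j)//= jj; congr (_ * _).
  by apply: eq_bigr => i /negbTE ij; rewrite /mix inE ij.
by rewrite c1 c2 ![in LHS]rcM ![in RHS]rcM mulrAC [RHS]mulrAC -rcM e -rcM.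
Qed.

End torus.

Section normc_cint_bound.
Context d (T : measurableType d) (R : realType).
Variable m : {finite_measure set T -> \bar R}.
Local Notation normc := (@Normc.normc R).

Lemma normc_cint_le (u : T -> R[i]) (B : R) : cmeas u -> (forall x, normc (u x) <= B) ->
  normc (cint m u) <= B * fine (m setT).
Proof.
move=> mu uB; have iu := cintg_bounded m mu uB.
apply: le_trans (normc_cint iu) _; rewrite -Rintegral_cst//.
apply: le_Rintegral => //; [exact: iu.2|exact: finite_measure_integrable_cst].
Qed.

End normc_cint_bound.

Section nu_bounded.
Variables (R : realType) (n : nat) (alpha : R) (ha : -1 < alpha).
Local Notation P := (measurableTypeR R * measurableTypeR R)%type.
Local Notation X := (n.-tuple P).
Local Notation normc := (@Normc.normc R).
Local Notation nu := (@nu_alpha R n alpha ha).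

Lemma cintg_nu_bounded (u : X -> R[i]) (B : R) : cmeas u ->
  (forall x, normsq x < 1 -> normc (u x) <= B) -> cintg nu u.
Proof.
move=> mu uB; split => //.
have mn : measurable_fun setT (fun x => (normc (u x))%:E).
  by apply/measurable_EFinP; exact: measurable_normc.
have /integrableP[_ iB] : nu.-integrable setT (EFin \o cst `|B|) by exact: finite_measure_integrable_cst.
apply/integrableP; split => //; apply: le_lt_trans iB.
rewrite !ge0_integral_mdens//; last exact: measurableT_comp.
apply: ge0_le_integral => //.
- by move=> x _; rewrite mule_ge0// lee_fin; exact: weight_ge0.
- by apply: emeasurable_funM; [exact: measurableT_comp|apply/measurable_EFinP; exact: measurable_weight].
- apply: (eq_measurable_fun (EFin \o (fun x => `|B| * weight alpha x))).
    by move=> x _; rewrite /= normr_id.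
  by apply/measurable_EFinP; apply: measurable_funM => //; exact: measurable_weight.
- move=> x _; have [x1|x1] := boolP (normsq x < 1).
    rewrite lee_wpmul2r ?lee_fin ?weight_ge0// normr_id ger0_norm ?normc_ge0//.
    by apply: le_trans (uB x x1) _; exact: ler_norm.
  by rewrite weight_eq0 ?mule0//; exact/negP.
by apply: measurableT_comp => //; exact/measurable_EFinP.
Qed.

Lemma ball_polydisc x : normsq x < 1 -> @polydisc R n x.
Proof.
move=> x1 j; rewrite -(@expr_le1 _ 2)// ?normc_ge0//; apply: le_trans (ltW x1).
rewrite /normsq (bigD1 j)//= lerDl; apply: sumr_ge0 => k _.
by rewrite exprn_ge0// normc_ge0.
Qed.

Lemma mono_diag (a : 'I_n -> nat) (x : X) :
  mono a a x = (\prod_j normc (zc x j) ^+ a j ^+ 2)%:C%C.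
Proof.
rewrite /mono rmorph_prod; apply: eq_bigr => j _ /=.
by rewrite -exprMn mulcJ exprAC -rcX.
Qed.

Lemma cintg_mono a b : cintg nu (mono a b).
Proof.
apply: (cintg_nu_bounded (B := 1)); first exact: cmeas_mono.
by move=> x /ball_polydisc; exact: mono_le1.
Qed.

Lemma measurable_cmul (r : X -> 'I_n -> R[i]) : (forall j, cmeas (r ^~ j)) ->
  measurable_fun setT (fun z : X * X => cmul (r z.2) z.1).
Proof.
move=> mr; rewrite (_ : (fun z => _) = fun z : X * X => pt (fun j => r z.2 j * zc z.1 j)).
  apply: measurable_pt => j; apply: cmeasM.
    exact: (cmeas_comp (mr j) measurable_snd).
  exact: (cmeas_comp (@cmeas_zc R n j) measurable_fst).
by apply/funext => z; rewrite -{1}(pt_zc z.1) cmul_pt.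
Qed.

(** Every rotation preserves the integral of |F|, so Tonelli gives the total mass times that
    integral. *)
Lemma cintg_rotations (F : X -> R[i]) (r : X -> 'I_n -> R[i]) : cintg nu F ->
  (forall j, cmeas (r ^~ j)) -> (forall w, unimodular (r w)) ->
  cintg (nu \x nu)%E (fun z => F (cmul (r z.2) z.1)).
Proof.
move=> iF mr r1; have sc w := scales_nu_cmul ha (r1 w).
have mu : cmeas (fun z : X * X => F (cmul (r z.2) z.1)) by exact: (cmeas_comp iF.1 (measurable_cmul mr)).
split => //; have mn : measurable_fun setT (fun z : X * X => (normc (F (cmul (r z.2) z.1)))%:E).
  by apply/measurable_EFinP; exact: measurable_normc.
apply/(integrable21ltyP nu nu mn).
have mnF : measurable_fun setT (fun x => `|(normc (F x))%:E|%E).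
  by apply: measurableT_comp => //; apply/measurable_EFinP; apply: measurable_normc; exact: iF.1.
rewrite (eq_integral (fun=> \int[nu]_x `|(normc (F x))%:E|)%E); last first.
  move=> w _; have := ge0_integral_scales (sc w) ler01 mnF (fun=> abse_ge0 _).
  by rewrite mul1e.
have /integrableP[_ iFn] := iF.2.
have [c ec] : exists c, (\int[nu]_x `|(normc (F x))%:E|)%E = c%:E.
  exists (fine (\int[nu]_x `|(normc (F x))%:E|)%E); rewrite fineK// ge0_fin_numE//.
  exact: integral_ge0.
have [c' ec'] : exists c, nu setT = c%:E.
  by exists (fine (nu setT)); rewrite fineK// fin_num_measure.
by rewrite ec integral_cst// [X in (_ * X)%E]ec' -EFinM ltry.
Qed.

End nu_bounded.

#[local] Opaque torus_mean cint circle_int.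

Section torus_coefficient.
Variables (R : realType) (n : nat) (alpha : R) (ha : -1 < alpha).
Local Notation P := (measurableTypeR R * measurableTypeR R)%type.
Local Notation X := (n.-tuple P).
Local Notation normc := (@Normc.normc R).
Local Notation nu := (@nu_alpha R n alpha ha).
Variable q : Cspace R n -> R[i]^o.
Hypotheses (aq : analytic_ball q) (mq : cmeas (ball_ext q)).
Variables a b : 'I_n -> nat.
Local Notation Q := (ball_ext q).
Local Notation G := (torus_mean ha q a b).
Implicit Types (rho sigma : 'I_n -> R) (w x : X).

Let cf rho : R := \prod_i (rho i ^+ b i * (rho i)^-1 ^+ a i).

Let rho0 : 'I_n -> R := fun=> n.+1%:R^-1.

Let rho0_gt0 i : 0 < rho0 i. Proof. by rewrite invr_gt0 ltr0n. Qed.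

Let rho0_lt1 : \sum_i rho0 i ^+ 2 < 1.
Proof.
rewrite (eq_bigr (fun=> n.+1%:R^-1 ^+ 2))// sumr_const card_ord -[ltLHS]mulr_natr.
have n0 : 0 < n.+1%:R :> R by rewrite ltr0n.
rewrite expr2 -mulrA -ltr_pdivlMl ?invr_gt0// invrK mulr1.
rewrite ltr_pdivrMl// -natrM ltr_nat; lia.
Qed.

Let cf_ab rho : (forall i, 0 < rho i) -> \prod_i rho i ^+ b i = cf rho * \prod_i rho i ^+ a i.
Proof.
move=> r0; rewrite /cf -big_split; apply: eq_bigr => i _ /=.
by rewrite exprVn mulfVK// expf_neq0// gt_eqF.
Qed.

Lemma torus_mean_bounded : exists B : R, forall rho, (forall i, 0 <= rho i <= rho0 i) ->
  normc (G rho) <= B.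
Proof.
have [B HB] := ball_ext_bounded aq (fun i => ltW (rho0_gt0 i)) rho0_lt1.
exists (B * fine (nu setT)) => rho r0; apply: normc_cint_le => [|w].
  apply: cmeasM; last exact: cmeas_sg_mono.
  by apply: (cmeas_comp mq); apply: measurable_pt => j; apply: cmeasZ; exact: cmeas_sg.
rewrite Normc.normcM normc_mono_unimodular ?mulr1; last exact: sg_unimodular.
apply: HB => i; have /andP[h1 h2] := r0 i.
by rewrite Normc.normcM sg_unimodular mulr1 normc_real ger0_norm.
Qed.

(** rho^(b - a) times the torus mean has the same value at any two polyradii, by comparison with
    their minimum. The mean is bounded near the origin, so if a_j < b_j the factor rho_j^(b_j - a_j)
    forces that value to be 0: a holomorphic function has no negative powers. *)
Lemma torus_coef : exists kappa : R[i],
  (forall rho, (forall i, 0 < rho i) -> \sum_i rho i ^+ 2 < 1 ->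
    (\prod_i rho i ^+ b i)%:C%C * G rho = kappa * (\prod_i rho i ^+ a i)%:C%C) /\
  (forall j, (a j < b j)%N -> kappa = 0).
Proof.
pose kappa := (cf rho0)%:C%C * G rho0.
have cst rho : (forall i, 0 < rho i) -> \sum_i rho i ^+ 2 < 1 -> (cf rho)%:C%C * G rho = kappa.
  move=> r0 r1; pose sigma i := Num.min (rho i) (rho0 i).
  have s0 i : 0 < sigma i by rewrite lt_min r0 rho0_gt0.
  have s1 i : 0 < sigma i <= rho i by rewrite s0 ge_min lexx.
  have s2 i : 0 < sigma i <= rho0 i by rewrite s0 ge_min lexx orbT.
  have e1 := @torus_mean_le R n alpha ha q aq mq a b rho sigma s1 r1.
  have e2 := @torus_mean_le R n alpha ha q aq mq a b rho0 sigma s2 rho0_lt1.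
  exact: (etrans e1 (esym e2)).
exists kappa; split=> [rho r0 r1|j ab].
  by rewrite cf_ab// rcM mulrAC cst.
have [B HB] := torus_mean_bounded.
pose C : R := \prod_(i | i != j) (rho0 i ^+ b i * (rho0 i)^-1 ^+ a i).
have C0 : 0 <= C.
  by apply: prodr_ge0 => i _; rewrite mulr_ge0// exprn_ge0// ?invr_ge0 ltW.
have kle r : 0 < r <= rho0 j -> normc kappa <= r * (C * `|B|).
  move=> /andP[rp rle]; pose rho i := if i == j then r else rho0 i.
  have r0 i : 0 < rho i <= rho0 i.
    by rewrite /rho; case: eqP => [->|_]; rewrite ?rp// rho0_gt0 lexx.
  have r0' i : 0 < rho i by have /andP[] := r0 i.
  have r1 : \sum_i rho i ^+ 2 < 1.
    apply: le_lt_trans rho0_lt1; apply: ler_sum => i _; have /andP[? ?] := r0 i.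
    by apply: sqr_le => //; exact: ltW.
  rewrite -(cst rho r0' r1) Normc.normcM normc_real.
  have cfE : cf rho = r ^+ (b j - a j) * C.
    rewrite /cf (bigD1 j)//= /rho eqxx; congr (_ * _); last first.
      by apply: eq_bigr => i /negbTE ->.
    rewrite -{1}(subnK (ltnW ab)) exprD exprVn mulfK// expf_neq0// gt_eqF//.
  rewrite cfE ger0_norm; last by rewrite mulr_ge0// exprn_ge0// ltW.
  rewrite mulrA; apply: ler_pM; rewrite ?normc_ge0//.
  - by rewrite mulr_ge0// exprn_ge0// ltW.
  - rewrite ler_wpM2r// -[leRHS]expr1 ler_wiXn2l ?(ltW rp) ?subn_gt0//.
    by apply: le_trans rle _; rewrite invf_le1 ?ler1n ?ltr0n.
  - apply: le_trans (ler_norm B); apply: HB => i; have /andP[h1 h2] := r0 i.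
    by rewrite ltW.
apply/eqP; rewrite -normc_eq0 eq_le normc_ge0 andbT leNgt; apply/negP => k0.
pose D := C * `|B| + 1.
have D0 : 0 < D by rewrite ltr_wpDl// mulr_ge0.
have := kle (Num.min (rho0 j) (normc kappa / D / 2)).
rewrite ge_min lexx lt_min rho0_gt0 !divr_gt0// => /(_ isT) h.
have : normc kappa <= normc kappa / D / 2 * (C * `|B|).
  by apply: le_trans h _; rewrite ler_wpM2r ?mulr_ge0// ge_min lexx orbT.
have : normc kappa / D * D = normc kappa by rewrite divfK// gt_eqF.
have : 0 < normc kappa / D by rewrite divr_gt0.
have : 0 <= C * `|B| by rewrite mulr_ge0.
move: (normc kappa / D) => t; rewrite /D; move: (C * `|B|) (normc kappa) => y k y0 t0 <- h'.
have := mulr_ge0 (ltW t0) y0; lra.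
Qed.

(* At z, averaging q over the torus through z gives kappa z^a / z^b. *)
Lemma torus_mean_point kappa :
  (forall rho, (forall i, 0 < rho i) -> \sum_i rho i ^+ 2 < 1 ->
    (\prod_i rho i ^+ b i)%:C%C * G rho = kappa * (\prod_i rho i ^+ a i)%:C%C) ->
  forall x : X, normsq x < 1 -> (forall j, zc x j != 0) ->
  cint nu (fun w => Q (cmul (sg w) x) * mono b a (pt (sg w))) * mono b a x =
  kappa * mono a a x.
Proof.
move=> kG x x1 x0; rewrite mono_diag; pose rho j := normc (zc x j); pose u := sg x.
have r0 j : 0 < rho j by rewrite normc_gt0.
have u1 : unimodular u := sg_unimodular x.
have xE : x = pt (fun j => (rho j)%:C%C * u j).
  by apply: eq_zc => j; rewrite zc_pt -sgE.
have -> : mono b a x = mono b a (pt u) * (\prod_j rho j ^+ (b j + a j))%:C%C.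
  by rewrite {1}xE mono_ptM mono_real mulrC.
have rot := torus_mean_rotate ha mq a b rho u1.
rewrite mulrA.
have -> : cint nu (fun w => Q (cmul (sg w) x) * mono b a (pt (sg w))) * mono b a (pt u) = G rho.
  rewrite -rot mulrC -cintZ.
    apply: eq_cint => w; rewrite mono_ptM {1}xE cmul_pt.
    rewrite (@eq_pt _ _ (fun j => sg w j * ((rho j)%:C%C * u j)) (fun j => (rho j)%:C%C * (u j * sg w j))).
      by rewrite [RHS]mulrCA [mono b a (pt u) * _]mulrC.
    by move=> j; rewrite mulrCA [sg w j * _]mulrC.
  have [B HB] := ball_ext_bounded aq (fun i => ltW (r0 i)) x1.
  apply: (@cintg_bounded _ _ _ nu _ B) => [|w].
    apply: cmeasM; last exact: cmeas_sg_mono.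
    rewrite (_ : (fun w => _) = fun w : X => Q (pt (fun j => sg w j * zc x j))); last first.
      by apply/funext => w; rewrite -{1}(pt_zc x) cmul_pt.
    apply: (cmeas_comp mq); apply: measurable_pt => j; apply: cmeasM; last exact: cmeas_cst.
    exact: cmeas_sg.
  rewrite Normc.normcM normc_mono_unimodular ?mulr1; last exact: sg_unimodular.
  rewrite -(pt_zc x) cmul_pt; apply: HB => i.
  by rewrite Normc.normcM sg_unimodular mul1r.
have -> : \prod_j rho j ^+ (b j + a j) = \prod_j rho j ^+ b j * \prod_j rho j ^+ a j.
  by rewrite -big_split; apply: eq_bigr => j _; rewrite exprD.
have -> : \prod_j normc (zc x j) ^+ a j ^+ 2 = \prod_j rho j ^+ a j * \prod_j rho j ^+ a j.
  by rewrite -big_split; apply: eq_bigr => j _; rewrite expr2.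
have := kG rho r0 x1; move: (G rho) (\prod_j rho j ^+ b j) (\prod_j rho j ^+ a j) => g y z e.
by rewrite !rcM !mulrA (mulrC g) e.
Qed.

(* Averages the integrand over the rotations by sgn w, w distributed by nu. *)
Lemma radial_pairing kappa (phi : X -> R[i]) (M : R) :
  (forall rho, (forall i, 0 < rho i) -> \sum_i rho i ^+ 2 < 1 ->
    (\prod_i rho i ^+ b i)%:C%C * G rho = kappa * (\prod_i rho i ^+ a i)%:C%C) ->
  cintg nu Q -> cmeas phi -> (forall x, normc (phi x) <= M) ->
  (forall u x, unimodular u -> phi (cmul u x) = phi x) ->
  (fine (nu setT))%:C%C * cint nu (fun x => Q x * mono b a x * phi x) =
  kappa * cint nu (fun x => phi x * mono a a x).
Proof.
move=> kG iQ mphi phiM phiu.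
have mmono : cmeas (mono b a : X -> _) by exact: cmeas_mono.
pose F x := Q x * mono b a x * phi x.
have mF : cmeas F by apply: cmeasM => //; apply: cmeasM.
have M0 : 0 <= M by apply: le_trans (phiM (pt (fun=> 0))); exact: normc_ge0.
have FM x : normc (F x) <= M * normc (Q x).
  rewrite /F /ball_ext; case: ifPn => x1; last by rewrite !mul0r [normc _]Normc.normc0 mulr0.
  rewrite !Normc.normcM mulrC; apply: ler_pM; rewrite ?mulr_ge0 ?normc_ge0//.
  by rewrite ler_piMr ?normc_ge0//; apply: mono_le1; exact: ball_polydisc.
have iF : cintg nu F.
  apply: (le_cintg2 mF _ (cintgZ M%:C%C iQ)) => x.
  by rewrite [leRHS]Normc.normcM normc_real ger0_norm.
pose u (z : X * X) := F (cmul (sg z.2) z.1).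
have mcm := measurable_cmul (@cmeas_sg R n).
have mu : cmeas u by exact: (cmeas_comp mF mcm).
have sc w := scales_nu_cmul ha (sg_unimodular w).
have u1 w : cintg nu (fun x => u (x, w)) by exact: (cintg_scales (sc w) iF).
have uQ x w : u (x, w) = phi x * mono b a x * (Q (cmul (sg w) x) * mono b a (pt (sg w))).
  rewrite /u /F /= mono_cmul phiu; last exact: sg_unimodular.
  move: (phi x) (mono b a x) (Q _) (mono b a _) => p1 p2 p3 p4; ring.
have gQ x : cintg nu (fun w => Q (cmul (sg w) x) * mono b a (pt (sg w))).
  have mg : cmeas (fun w : X => Q (cmul (sg w) x) * mono b a (pt (sg w))).
    apply: cmeasM; last exact: cmeas_sg_mono.
    exact: (cmeas_comp mq (measurableT_comp mcm (measurable_pair1 x))).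
  have [x1|x1] := boolP (normsq x < 1); last first.
    apply: (@cintg_bounded _ _ _ nu _ 0) => // w.
    by rewrite /ball_ext normsq_cmul ?(negbTE x1) ?mul0r ?[normc _]Normc.normc0//; exact: sg_unimodular.
  have [B HB] := ball_ext_bounded aq (fun i => normc_ge0 (zc x i)) x1.
  apply: (@cintg_bounded _ _ _ nu _ B) => // w.
  rewrite Normc.normcM normc_mono_unimodular ?mulr1; last exact: sg_unimodular.
  rewrite -(pt_zc x) cmul_pt; apply: HB => i.
  by rewrite Normc.normcM sg_unimodular mul1r.
have iu : cintg (nu \x nu)%E u.
  by have := cintg_rotations (r := @sg R n) iF (@cmeas_sg R n) (@sg_unimodular R n).
have := cint_fubini iu u1.
rewrite [RHS](_ : _ = (fine (nu setT))%:C%C * cint nu F); last first.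
  rewrite -cint_cst; apply: eq_cint => w; exact: (cint_scales (sc w) mF).
move=> <-; rewrite -cintZ; last first.
  apply: (@cintg_nu_bounded _ _ _ _ _ M) => [|x x1]; first by apply: cmeasM => //; exact: cmeas_mono.
  rewrite Normc.normcM -[leRHS]mulr1; apply: ler_pM; rewrite ?normc_ge0//.
  by apply: mono_le1; exact: ball_polydisc.
apply: ae_eq_cint.
- exact: (cmeas_cint iu).
- by apply: cmeasZ; apply: cmeasM => //; exact: cmeas_mono.
apply: filterS2 (ae_nu_ball n ha) (ae_nu_neq0 n ha) => x x1 x0.
have E := torus_mean_point kG x1 x0.
transitivity (phi x * mono b a x * cint nu (fun w => Q (cmul (sg w) x) * mono b a (pt (sg w)))).
  by rewrite -(cintZ _ (gQ x)); apply: eq_cint => w; exact: uQ.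
by rewrite -mulrA [mono b a x * _]mulrC E mulrCA.
Qed.

End torus_coefficient.

(** * Orthogonal expansions *)

#[local] Transparent torus_mean cint circle_int.

Section conj_facts.
Variable R : realType.
Implicit Types u v : R[i].

Lemma cjM u v : conjc (u * v) = conjc u * conjc v. Proof. exact: rmorphM. Qed.
Lemma cjB u v : conjc (u - v) = conjc u - conjc v. Proof. exact: rmorphB. Qed.
Lemma rc_sum (I : Type) (r : seq I) (F : I -> R) :
  (\sum_(i <- r) F i)%:C%C = \sum_(i <- r) (F i)%:C%C :> R[i].
Proof. exact: rmorph_sum. Qed.
Lemma cj_sum (I : Type) (r : seq I) (F : I -> R[i]) :
  conjc (\sum_(i <- r) F i) = \sum_(i <- r) conjc (F i).
Proof. exact: rmorph_sum. Qed.

End conj_facts.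

Section square_integrable.
Context d (T : measurableType d) (R : realType).
Variable m : {finite_measure set T -> \bar R}.
Local Notation normc := (@Normc.normc R).
Local Notation Re := (@complex.Re R).
Implicit Types u v w : T -> R[i].

Definition sqi u := cmeas u /\ m.-integrable setT (fun x => (normc (u x) ^+ 2)%:E).

Definition ip u v : R[i] := cint m (fun x => u x * conjc (v x)).

Definition nrm2 u : R := (\int[m]_x (normc (u x) ^+ 2))%R.

Lemma ip_cint u v : ip u v = cint m (fun x => u x * conjc (v x)).
Proof. by []. Qed.

Lemma nrm2_Rintegral u : nrm2 u = (\int[m]_x (normc (u x) ^+ 2))%R.
Proof. by []. Qed.

Lemma sqi_le u v (B : R) : cmeas u -> sqi v -> (forall x, normc (u x) <= B * normc (v x)) -> sqi u.
Proof.
move=> mu [mv iv] uv; split=> //.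
have iB : m.-integrable setT (fun x => (B ^+ 2 * normc (v x) ^+ 2)%:E).
  under eq_fun do rewrite EFinM; exact: integrableZl.
apply: (le_integrable measurableT _ _ iB).
  by apply/measurable_EFinP; apply: measurable_funX; exact: measurable_normc.
move=> x _ /=; rewrite lee_fin !ger0_norm ?exprn_ge0 ?normc_ge0//; last first.
  by apply: mulr_ge0; [exact: sqr_ge0|rewrite exprn_ge0// normc_ge0].
by rewrite -exprMn; apply: sqr_le; rewrite ?normc_ge0.
Qed.

Lemma sqi_bounded u (B : R) : cmeas u -> (forall x, normc (u x) <= B) -> sqi u.
Proof.
move=> mu uB; split=> //; apply: (@le_integrable _ _ _ m _ _ _ (EFin \o cst (B ^+ 2))) => //.
- by apply/measurable_EFinP; apply: measurable_funX; exact: measurable_normc.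
- move=> x _ /=; have B0 : 0 <= B := le_trans (normc_ge0 _) (uB x).
  rewrite lee_fin !ger0_norm ?exprn_ge0 ?normc_ge0//.
  by apply: sqr_le; [exact: normc_ge0|exact: uB].
- exact: finite_measure_integrable_cst.
Qed.

Lemma sqi_mul u v : sqi u -> sqi v -> cintg m (fun x => u x * conjc (v x)).
Proof.
move=> [mu iu] [mv iv]; have iuv := integrableD measurableT iu iv.
apply: le_cintg iuv; first by apply: cmeasM => //; exact: cmeasJ.
move=> x; rewrite Normc.normcM normcJ.
by have := sqr_ge0 (normc (u x) - normc (v x)); have := normc_ge0 (u x); have := normc_ge0 (v x); nra.
Qed.

Lemma sqi_cintg u : sqi u -> cintg m u.
Proof.
move=> su; have s1 : sqi (fun=> 1).
  by apply: (@sqi_bounded _ 1) => [|x]; [exact: cmeas_cst|rewrite [normc _]Normc.normc1].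
have := sqi_mul su s1; congr (cintg m); apply/funext => x.
by rewrite [conjc _]rmorph1 mulr1.
Qed.

Lemma sqiD u v : sqi u -> sqi v -> sqi (fun x => u x + v x).
Proof.
move=> [mu iu] [mv iv]; split; first exact: cmeasD.
have i2 : m.-integrable setT (fun x => (2 * normc (u x) ^+ 2 + 2 * normc (v x) ^+ 2)%:E).
  have h w : m.-integrable setT (fun x => (normc (w x) ^+ 2)%:E) ->
      m.-integrable setT (fun x => (2 * normc (w x) ^+ 2)%:E).
    by move=> iw; under eq_fun do rewrite EFinM; exact: integrableZl.
  exact: (integrableD measurableT (h _ iu) (h _ iv)).
apply: (le_integrable measurableT _ _ i2).
  by apply/measurable_EFinP; apply: measurable_funX; apply: measurable_normc; exact: cmeasD.
move=> x _ /=; rewrite lee_fin !ger0_norm ?addr_ge0 ?mulr_ge0 ?exprn_ge0 ?normc_ge0//.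
apply: (@le_trans _ _ ((normc (u x) + normc (v x)) ^+ 2)).
  by apply: sqr_le; [exact: normc_ge0|exact: le_normcD].
by have := sqr_ge0 (normc (u x) - normc (v x)); nra.
Qed.

Lemma sqiZ c u : sqi u -> sqi (fun x => c * u x).
Proof.
move=> su; apply: (@sqi_le _ u (normc c)) => //; first by apply: cmeasZ; case: su.
by move=> x; rewrite Normc.normcM.
Qed.

Lemma sqiB u v : sqi u -> sqi v -> sqi (fun x => u x - v x).
Proof.
move=> su sv; have := sqiD su (sqiZ (-1) sv); congr sqi; apply/funext => x.
by rewrite mulN1r.
Qed.

Lemma sqi0 : sqi (fun=> 0).
Proof. by apply: (@sqi_bounded _ 0) => [|x]; [exact: cmeas_cst|rewrite [normc _]Normc.normc0]. Qed.

Lemma sqi_sum (I : Type) (r : seq I) (F : I -> T -> R[i]) : (forall i, sqi (F i)) ->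
  sqi (fun x => \sum_(i <- r) F i x).
Proof.
move=> sF; elim: r => [|i r ih].
  by under eq_fun do rewrite big_nil; exact: sqi0.
by under eq_fun do rewrite big_cons; exact: sqiD.
Qed.

Lemma ipE u : ip u u = (nrm2 u)%:C%C.
Proof.
rewrite /ip /nrm2 -cint_real; apply: eq_cint => x; exact: mulcJ.
Qed.

Lemma nrm2_ge0 u : 0 <= nrm2 u.
Proof. by apply: Rintegral_ge0 => x _; rewrite exprn_ge0// normc_ge0. Qed.

Lemma ipJ u v : sqi u -> sqi v -> ip v u = conjc (ip u v).
Proof.
move=> su sv; rewrite /ip -cintJ; last exact: sqi_mul.
by apply: eq_cint => x; rewrite cjM conjcK mulrC.
Qed.

Lemma ipDl u v w : sqi u -> sqi v -> sqi w -> ip (fun x => u x + v x) w = ip u w + ip v w.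
Proof.
move=> su sv sw; rewrite /ip -cintD; [|exact: sqi_mul..].
by apply: eq_cint => x; rewrite mulrDl.
Qed.

Lemma ipZl c u w : sqi u -> sqi w -> ip (fun x => c * u x) w = c * ip u w.
Proof.
move=> su sw; rewrite /ip -cintZ; last exact: sqi_mul.
by apply: eq_cint => x; rewrite mulrA.
Qed.

Lemma ipBl u v w : sqi u -> sqi v -> sqi w -> ip (fun x => u x - v x) w = ip u w - ip v w.
Proof.
move=> su sv sw; rewrite /ip -cintB; [|exact: sqi_mul..].
by apply: eq_cint => x; rewrite mulrBl.
Qed.

Lemma ip_suml (I : Type) (r : seq I) (F : I -> T -> R[i]) w : (forall i, sqi (F i)) -> sqi w ->
  ip (fun x => \sum_(i <- r) F i x) w = \sum_(i <- r) ip (F i) w.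
Proof.
move=> sF sw; elim: r => [|i r ih].
  rewrite big_nil /ip -[RHS](@cint0 _ _ _ m); apply: eq_cint => x.
  by rewrite big_nil mul0r.
rewrite big_cons -ih -ipDl//; last exact: sqi_sum.
by apply: eq_cint => x; rewrite big_cons.
Qed.

Lemma ipBr u v w : sqi u -> sqi v -> sqi w -> ip w (fun x => u x - v x) = ip w u - ip w v.
Proof.
by move=> su sv sw; rewrite (ipJ (sqiB su sv) sw) ipBl// cjB -!ipJ.
Qed.

Lemma ip_sumr (I : Type) (r : seq I) (F : I -> T -> R[i]) w : (forall i, sqi (F i)) -> sqi w ->
  ip w (fun x => \sum_(i <- r) F i x) = \sum_(i <- r) ip w (F i).
Proof.
move=> sF sw; rewrite (ipJ (sqi_sum _ sF) sw) ip_suml// cj_sum.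
by apply: eq_bigr => i _; rewrite -ipJ.
Qed.

Lemma ipZr c u w : sqi u -> sqi w -> ip w (fun x => c * u x) = conjc c * ip w u.
Proof.
by move=> su sw; rewrite (ipJ (sqiZ c su) sw) ipZl// cjM -ipJ.
Qed.

(** The inequality x y <= e x^2 + y^2/e in the role of Cauchy-Schwarz, with a parameter e left free
    for limit arguments. *)
Lemma normc_ip_le u v (e : R) : 0 < e -> sqi u -> sqi v ->
  normc (ip u v) <= e * nrm2 u + e^-1 * nrm2 v.
Proof.
move=> e0 su sv; have [mu iu] := su; have [mv iv] := sv.
apply: le_trans (normc_cint (sqi_mul su sv)) _.
have iZ c w : m.-integrable setT (fun x => (normc (w x) ^+ 2)%:E) ->
    m.-integrable setT (EFin \o (fun x => c * normc (w x) ^+ 2)).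
  by move=> iw; rewrite (_ : EFin \o _ = fun x => c%:E * (normc (w x) ^+ 2)%:E)%E//; exact: integrableZl.
rewrite /nrm2 -!RintegralZl// -RintegralD//; [|exact: iZ..].
apply: le_Rintegral => //.
- exact: (sqi_mul su sv).2.
- exact: (integrableD measurableT (iZ e _ iu) (iZ e^-1 _ iv)).
move=> x _; rewrite Normc.normcM normcJ.
have := normc_ge0 (u x); have := normc_ge0 (v x).
move: (normc (u x)) (normc (v x)) => p r r0 p0.
have ei : e * e^-1 = 1 by rewrite divff// gt_eqF.
have i0 : 0 < e^-1 by rewrite invr_gt0.
have := mulr_ge0 (ltW i0) (sqr_ge0 (e * p - r)); move: ei i0; move: (e^-1) => f ei f0.
have -> : f * (e * p - r) ^+ 2 = (e * f) * (e * p ^+ 2) - 2 * (e * f) * (p * r) + f * r ^+ 2 by ring.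
by rewrite ei; have := mulr_ge0 p0 r0; lra.
Qed.

Lemma nrm2_fatou (u_ : nat -> T -> R[i]) u (B : R) : (forall k, sqi (u_ k)) -> (forall k, nrm2 (u_ k) <= B) ->
  (forall x, normc (u_ k x - u x) @[k --> \oo] --> (0 : R)) -> sqi u /\ nrm2 u <= B.
Proof.
move=> su uB uu.
have mu : cmeas u by apply: (cmeas_cvg _ uu) => k; case: (su k).
have nu2 k : (\int[m]_x (normc (u_ k x) ^+ 2)%:E)%E = (nrm2 (u_ k))%:E.
  rewrite /nrm2 /Rintegral fineK//; apply: integrable_fin_num => //; exact: (su k).2.
have mn v : cmeas v -> measurable_fun setT (fun x => (normc (v x) ^+ 2)%:E).
  by move=> mv; apply/measurable_EFinP; apply: measurable_funX; exact: measurable_normc.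
have cv x : ((normc (u_ k x) ^+ 2)%:E @[k --> \oo] --> (normc (u x) ^+ 2)%:E)%E.
  apply/fine_cvgP; split; first exact: nearW.
  have h : normc (u_ k x) @[k --> \oo] --> normc (u x).
    apply/cvgrPdist_le => e e0; have /cvgrPdist_le /(_ e e0) := uu x.
    apply: filterS => k; rewrite sub0r normrN ger0_norm ?normc_ge0// => h.
    by rewrite distrC; apply: le_trans (dist_normc _ _) h.
  rewrite expr2 (_ : fine \o _ = fun k => normc (u_ k x) * normc (u_ k x)); first exact: cvgM.
  by apply/funext => k /=; rewrite expr2.
have fat : (\int[m]_x (normc (u x) ^+ 2)%:E <= B%:E)%E.
  have f0 k x : setT x -> (0 <= (normc (u_ k x) ^+ 2)%:E)%E.
    by move=> _; rewrite lee_fin exprn_ge0// normc_ge0.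
  have := @fatou _ _ _ m setT measurableT (fun k x => (normc (u_ k x) ^+ 2)%:E) (fun k => mn _ (su k).1) f0.
  rewrite (eq_integral (fun x => (normc (u x) ^+ 2)%:E)); last first.
    by move=> x _; rewrite is_cvg_limn_einfE; [exact: (cvg_lim (@ereal_hausdorff R) (cv x))|apply/cvg_ex; exists (normc (u x) ^+ 2)%:E; exact: cv].
  move=> h; apply: le_trans h _; rewrite limn_einf_lim; apply: lime_le; first exact: is_cvg_einfs.
  apply: nearW => N; apply: (@le_trans _ _ (\int[m]_x (normc (u_ N x) ^+ 2)%:E)%E).
    by apply: ereal_inf_lbound; exists N => /=.
  by rewrite nu2 lee_fin.
have f0 : (0 <= \int[m]_x (normc (u x) ^+ 2)%:E)%E.
  by apply: integral_ge0 => x _; rewrite lee_fin exprn_ge0// normc_ge0.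
split; first split => //.
  apply/integrableP; split; first exact: mn.
  rewrite (eq_integral (fun x => (normc (u x) ^+ 2)%:E)); last first.
    by move=> x _; rewrite gee0_abs// lee_fin exprn_ge0// normc_ge0.
  exact: le_lt_trans fat (ltry _).
rewrite /nrm2 /Rintegral -lee_fin fineK// ge0_fin_numE//.
exact: le_lt_trans fat (ltry _).
Qed.

(** In [normc_ip_le] the parameter is first made small to control the term of v, then k is taken
    large to control that of [w_ k]. *)
Lemma ip_lim0 (w_ : nat -> T -> R[i]) v (c : R[i]) (t : nat -> R) : sqi v -> (forall k, sqi (w_ k)) ->
  (forall k, nrm2 (w_ k) <= t k) -> t k @[k --> \oo] --> 0 ->
  (\forall k \near \oo, ip v (w_ k) = c) -> c = 0.
Proof.
move=> sv sw wt t0 vc; apply/eqP; rewrite -normc_eq0 eq_le normc_ge0 andbT.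
apply/ler_addgt0Pr => e e0; rewrite add0r.
pose e1 := e / 2 / (nrm2 v + 1).
have n1 : 0 < nrm2 v + 1 by rewrite ltr_wpDl// nrm2_ge0.
have e10 : 0 < e1 by rewrite !divr_gt0.
have h : 0 < e / 2 * e1 by rewrite mulr_gt0// divr_gt0.
have /cvgrPdist_le /(_ _ h) tk := t0.
have [k [kc kt]] := filter_ex (filterI vc tk).
have := normc_ip_le e10 sv (sw k); rewrite kc => /le_trans; apply.
rewrite [leRHS]splitr; apply: lerD.
  by rewrite /e1 mulrAC -mulrA ler_piMr// ?divr_ge0 ?ltW// ltr_pdivrMr// mul1r ltrDl.
rewrite ler_pdivrMl//; apply: le_trans (wt k) _; rewrite mulrC.
by apply: le_trans kt; rewrite sub0r normrN ler_norm.
Qed.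

End square_integrable.

Section orthogonal_series.
Context d (T : measurableType d) (R : realType).
Variable m : {finite_measure set T -> \bar R}.
Local Notation normc := (@Normc.normc R).
Local Notation ip := (ip m).
Local Notation sqi := (sqi m).
Local Notation nrm2 := (nrm2 m).
Variables (Z : nat -> T -> R[i]) (u : T -> R[i]).
Hypotheses (sZ : forall k, sqi (Z k)) (su : sqi u).
Hypothesis Z_orth : forall k l, k != l -> ip (Z k) (Z l) = 0.
(** The family may contain null vectors, such as the zero function at an index that encodes no
    monomial; the Fourier quotient is then 0/0 = 0. *)
Hypothesis Z_null : forall k w, sqi w -> nrm2 (Z k) = 0 -> ip w (Z k) = 0.

Definition fourier k : R[i] := ip u (Z k) / ip (Z k) (Z k).

Definition fourier_sum (M N : nat) (x : T) : R[i] := \sum_(M <= k < N) fourier k * Z k x.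

Lemma sqi_fourier_sum M N : sqi (fourier_sum M N).
Proof. by apply: sqi_sum => k; exact: sqiZ. Qed.

Lemma ip_fourier_sum M N l : ip (fourier_sum M N) (Z l) = if (M <= l < N)%N then ip u (Z l) else 0.
Proof.
rewrite /fourier_sum ip_suml//; last by move=> k; exact: sqiZ.
have e k : ip (fun x => fourier k * Z k x) (Z l) = if k == l then ip u (Z l) else 0.
  rewrite ipZl//; case: eqVneq => [->|kl]; last by rewrite Z_orth ?mulr0.
  rewrite /fourier ipE; have [n0|n0] := eqVneq (nrm2 (Z l)) 0; first by rewrite Z_null ?mul0r.
  by rewrite divfK//; apply/eqP => -[/eqP]; exact/negP.
under eq_bigr do rewrite e.
case: ifP => Ml; last first.
  rewrite big_nat_cond big1// => k /andP[/andP[Mk kN] _]; case: eqVneq => // kl.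
  by move: Ml; rewrite -kl Mk kN.
rewrite (bigD1_seq l) ?mem_index_iota ?iota_uniq//= eqxx big1 ?addr0// => k /negbTE ->.
by [].
Qed.

Lemma nrm2_fourier_sum M N :
  nrm2 (fourier_sum M N) = \sum_(M <= k < N) normc (fourier k) ^+ 2 * nrm2 (Z k).
Proof.
have : (nrm2 (fourier_sum M N))%:C%C = (\sum_(M <= k < N) normc (fourier k) ^+ 2 * nrm2 (Z k))%:C%C.
  rewrite -ipE {2}/fourier_sum ip_sumr; [|by move=> k; exact: sqiZ|exact: sqi_fourier_sum].
  rewrite rc_sum; apply: eq_big_nat => k Mk.
  rewrite ipZr// ?ip_fourier_sum ?Mk; last exact: sqi_fourier_sum.
  rewrite rcM -mulcJ -ipE mulrC; have [n0|n0] := eqVneq (nrm2 (Z k)) 0.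
    by rewrite ipE n0 mulr0 Z_null ?mul0r.
  rewrite -mulrA [_ * ip _ _]mulrC mulrA /fourier divfK// ipE.
  by apply/eqP => -[/eqP]; exact/negP.
by case.
Qed.

Lemma bessel N : \sum_(0 <= k < N) normc (fourier k) ^+ 2 * nrm2 (Z k) <= nrm2 u.
Proof.
pose S := fourier_sum 0 N; have sS : sqi S := sqi_fourier_sum 0 N.
have uS : ip u S = ip S S.
  rewrite /S {1 3}/fourier_sum !ip_sumr//; [|by move=> k; exact: sqiZ..].
  apply: eq_big_nat => k kN; rewrite !ipZr//.
  by rewrite ip_fourier_sum kN.
have : ip (fun x => u x - S x) (fun x => u x - S x) = (nrm2 u)%:C%C - ip S S.
  rewrite ipBr// ?ipBl//; last exact: sqiB.
  rewrite [ip S u]ipJ// uS ipE ipE -[in X in _ - _ - X]ipE.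
  by rewrite (_ : conjc (nrm2 S)%:C%C = (nrm2 S)%:C%C) ?ipE ?subrr ?subr0//= oppr0.
rewrite !ipE -rmorphB => -[e]; rewrite -nrm2_fourier_sum -/S.
by have := nrm2_ge0 m (fun x => u x - S x); rewrite e subr_ge0.
Qed.

Variable p : T -> R[i].
Hypothesis pS : forall x, normc (fourier_sum 0 k x - p x) @[k --> \oo] --> (0 : R).

Let tail M : R := limn (fun N => \sum_(0 <= k < N) normc (fourier k) ^+ 2 * nrm2 (Z k)) -
  \sum_(0 <= k < M) normc (fourier k) ^+ 2 * nrm2 (Z k).

Let partial_cvg : cvgn (fun N => \sum_(0 <= k < N) normc (fourier k) ^+ 2 * nrm2 (Z k)).
Proof.
apply: nondecreasing_is_cvgn; last by exists (nrm2 u) => _ [N _ <-]; exact: bessel.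
move=> M N MN; rewrite (@big_cat_nat _ _ _ M 0 N)//= lerDl; apply: sumr_ge0 => k _.
by rewrite mulr_ge0 ?nrm2_ge0// exprn_ge0// normc_ge0.
Qed.

Let tail0 : tail k @[k --> \oo] --> 0.
Proof.
rewrite /tail; set l := limn _.
have h := cvgB (cvg_cst l) partial_cvg; rewrite subrr in h; exact: h.
Qed.

(** Fatou's lemma: the sums over M <= k < N tend pointwise to p minus its M-th partial sum, and
    their squared norms are bounded by the remainder of the Bessel series. *)
Lemma fourier_tail M : sqi (fun x => p x - fourier_sum 0 M x) /\
  nrm2 (fun x => p x - fourier_sum 0 M x) <= tail M.
Proof.
apply: (@nrm2_fatou _ _ _ _ (fun N => fourier_sum M (N + M))) => [N|N|x].
- exact: sqi_fourier_sum.
- rewrite nrm2_fourier_sum /tail lerBrDr addrC -big_cat_nat ?leq_addl//.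
  apply: nondecreasing_cvgn_le; last exact: partial_cvg.
  move=> A B AB; rewrite (@big_cat_nat _ _ _ A 0 B)//= lerDl; apply: sumr_ge0 => k _.
  by rewrite mulr_ge0 ?nrm2_ge0// exprn_ge0// normc_ge0.
- have := pS x; rewrite -(cvg_shiftn M); apply: cvg_trans; apply: near_eq_cvg.
  apply: nearW => N /=; congr normc.
  by rewrite /fourier_sum (@big_cat_nat _ _ _ M 0 (N + M))//= ?leq_addl//; ring.
Qed.

(** Pointwise convergence has become convergence in norm, so p is the orthogonal projection of u
    onto the closed span of the [Z k]: the relevant pairings with p minus its partial sums are
    eventually constant and tend to 0. *)
Lemma fourier_limit : [/\ sqi p, forall k, ip (fun x => u x - p x) (Z k) = 0 &
  forall v, sqi v -> (forall k, ip v (Z k) = 0) -> ip v p = 0].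
Proof.
have sp : sqi p.
  have [h _] := fourier_tail 0.
  suff -> : p = (fun x => p x - fourier_sum 0 0 x) by [].
  apply/funext => x; by rewrite /fourier_sum big_geq// subr0.
split => // [k|v sv vZ].
- have sup : sqi (fun x => u x - p x) by exact: sqiB.
  have : ip (Z k) (fun x => u x - p x) = 0.
    apply/eqP; rewrite -oppr_eq0; apply/eqP.
    apply: (@ip_lim0 _ _ _ m (fun M x => p x - fourier_sum 0 M x) (Z k) _ tail (sZ k)) => //.
    + by move=> M; have [] := fourier_tail M.
    + by move=> M; have [] := fourier_tail M.
    exists k.+1 => // M /= kM; have sS := sqi_fourier_sum 0 M.
    rewrite !ipBr// opprB; congr (_ - _).
    by rewrite [RHS]ipJ// [LHS]ipJ// ip_fourier_sum kM.
  by move=> h; rewrite ipJ// h rmorph0.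
- apply: (@ip_lim0 _ _ _ m (fun M x => p x - fourier_sum 0 M x) v _ tail sv) => //.
  + by move=> M; have [] := fourier_tail M.
  + by move=> M; have [] := fourier_tail M.
  apply: nearW => M; rewrite ipBr//; last exact: sqi_fourier_sum.
  rewrite ip_sumr//; last by move=> k; exact: sqiZ.
  by rewrite big1 ?subr0// => k _; rewrite ipZr// vZ mulr0.
Qed.

End orthogonal_series.

(** * Power series *)

Section complex_limits.
Variable R : realType.
Local Notation normc := (@Normc.normc R).
Local Notation Re := (@complex.Re R).
Local Notation Im := (@complex.Im R).
Implicit Types (v : nat -> R[i]) (l c : R[i]).

Definition ccvg v l := normc (v k - l) @[k --> \oo] --> (0 : R).

Lemma ccvgP v l : ccvg v l <-> forall e : R, 0 < e -> \forall k \near \oo, normc (v k - l) <= e.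
Proof.
split=> [h e e0|h]; last first.
  apply/cvgrPdist_le => e e0; apply: filterS (h e e0) => k.
  by rewrite sub0r normrN ger0_norm ?normc_ge0.
have /cvgrPdist_le/(_ e e0) := h; apply: filterS => k.
by rewrite sub0r normrN ger0_norm ?normc_ge0.
Qed.

Lemma ccvg_cst c : ccvg (fun=> c) c.
Proof. by apply/ccvgP => e e0; apply: nearW => k; rewrite subrr [normc _]Normc.normc0 ltW. Qed.

Lemma ccvgD v w l c : ccvg v l -> ccvg w c -> ccvg (fun k => v k + w k) (l + c).
Proof.
move=> /ccvgP vl /ccvgP wc; apply/ccvgP => e e0; have e2 : 0 < e / 2 by rewrite divr_gt0.
apply: filterS2 (vl _ e2) (wc _ e2) => k h1 h2.
rewrite (_ : _ - _ = (v k - l) + (w k - c)); last by ring.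
by apply: le_trans (le_normcD _ _) _; rewrite [e]splitr lerD.
Qed.

Lemma ccvgZ a v l : ccvg v l -> ccvg (fun k => a * v k) (a * l).
Proof.
move=> /ccvgP vl; apply/ccvgP => e e0; have a1 : 0 < normc a + 1 by rewrite ltr_wpDl// normc_ge0.
apply: filterS (vl _ (divr_gt0 e0 a1)) => k h.
rewrite -mulrBr Normc.normcM; apply: (@le_trans _ _ ((normc a + 1) * (e / (normc a + 1)))).
  by apply: ler_pM; rewrite ?normc_ge0// lerDl.
by rewrite mulrCA divff ?mulr1// gt_eqF.
Qed.

Lemma ccvgB v w l c : ccvg v l -> ccvg w c -> ccvg (fun k => v k - w k) (l - c).
Proof.
move=> vl wc; have := ccvgD vl (ccvgZ (-1) wc); rewrite mulN1r.
by congr ccvg; apply/funext => k; rewrite mulN1r.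
Qed.

Lemma ccvg_sum (I : Type) (r : seq I) (v : I -> nat -> R[i]) (l : I -> R[i]) :
  (forall i, ccvg (v i) (l i)) -> ccvg (fun k => \sum_(i <- r) v i k) (\sum_(i <- r) l i).
Proof.
move=> vl; elim: r => [|i r ih].
  by under eq_fun do rewrite big_nil; rewrite big_nil; exact: ccvg_cst.
by under eq_fun do rewrite big_cons; rewrite big_cons; exact: ccvgD.
Qed.

Lemma ccvg_unique v l c : ccvg v l -> ccvg v c -> l = c.
Proof.
move=> vl vc; have := ccvgB vl vc; under eq_fun do rewrite subrr.
move=> /ccvgP h; apply/eqP; rewrite eq_sym -subr_eq0 -normc_eq0 eq_le normc_ge0 andbT.
apply/ler_addgt0Pr => e e0; rewrite add0r; have [k _ /(_ k (leqnn _))] := h e e0.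
by rewrite sub0r opprB.
Qed.

Lemma ccvg_le v l (C : R) : ccvg v l -> (forall k, normc (v k) <= C) -> normc l <= C.
Proof.
move=> /ccvgP h vC; apply/ler_addgt0Pr => e e0; have [k _ /(_ k (leqnn _)) vl] := h e e0.
rewrite -[l](subrK (v k)) addrC; apply: le_trans (le_normcD _ _) _.
by apply: lerD => //; rewrite normcB.
Qed.

Lemma cseries_lim (f : nat -> R[i]) (B : R) : (forall N, \sum_(0 <= k < N) normc (f k) <= B) ->
  exists2 l, ccvg (fun N => \sum_(0 <= k < N) f k) l & normc l <= B.
Proof.
move=> fB.
have cv (p : R[i] -> R) : (forall z, `|p z| <= normc z) -> cvgn (series (fun k => p (f k))).
  move=> pn; apply: normed_cvg; apply: nondecreasing_is_cvgn.
    move=> M N MN; rewrite -[leRHS]/(\sum_(0 <= k < N) `|p (f k)|) -[leLHS]/(\sum_(0 <= k < M) `|p (f k)|).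
    by rewrite (@big_cat_nat _ _ _ M 0 N)//= lerDl; exact: sumr_ge0.
  exists B => _ [N _ <-]; apply: le_trans (fB N); apply: ler_sum => k _; exact: pn.
have cr := cv Re (@Re_le_normc R); have ci := cv Im (@Im_le_normc R).
pose l := (limn (series (fun k => Re (f k))) +i* limn (series (fun k => Im (f k))))%C.
have ReS N : Re (\sum_(0 <= k < N) f k) = series (fun k => Re (f k)) N.
  by rewrite /series /=; elim/big_rec2: _ => //= k y z _ <-; rewrite creD.
have ImS N : Im (\sum_(0 <= k < N) f k) = series (fun k => Im (f k)) N.
  by rewrite /series /=; elim/big_rec2: _ => //= k y z _ <-; rewrite cimD.
have Sl : ccvg (fun N => \sum_(0 <= k < N) f k) l.
  apply/ccvgP => e e0; have e2 : 0 < e / 2 by rewrite divr_gt0.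
  have /cvgrPdist_le/(_ _ e2) h1 : series (fun k => Re (f k)) @ \oo --> Re l := cr.
  have /cvgrPdist_le/(_ _ e2) h2 : series (fun k => Im (f k)) @ \oo --> Im l := ci.
  apply: filterS2 h1 h2 => N h1 h2; apply: le_trans (normc_le_ReIm _) _.
  rewrite !ReImE ReS ImS [e]splitr; apply: lerD; by rewrite distrC.
exists l => //; apply: ccvg_le Sl _ => N; apply: le_trans (fB N).
elim/big_ind2: _ => // [|a b c d h1 h2]; first by rewrite [normc _]Normc.normc0.
by apply: le_trans (le_normcD _ _) (lerD _ _).
Qed.

End complex_limits.

Section multi_series.
Variables (R : realType) (n : nat).
Local Notation K := {ffun 'I_n -> nat}.

Definition mpow (r : 'I_n -> R) (m : K) : R := \prod_j r j ^+ m j.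

(* The box {0..B}^n gives a product of n finite geometric sums. *)
Lemma sum_multi (r : 'I_n -> R) N : (forall j, 0 <= r j < 1) ->
  \sum_(0 <= k < N) (if pickle_inv k is Some m then mpow r m else 0) <= \prod_j (1 - r j)^-1.
Proof.
move=> r01; have r0 j : 0 <= r j by have /andP[] := r01 j.
have mp0 m : 0 <= mpow r m by apply: prodr_ge0 => j _; rewrite exprn_ge0.
pose s : seq K := pmap (@pickle_inv K) (iota 0 N).
have sE : \sum_(0 <= k < N) (if pickle_inv k is Some m then mpow r m else 0) =
    \sum_(m <- s) mpow r m.
  rewrite /s /index_iota subn0; elim: (iota 0 N) => [|k t ih]; first by rewrite !big_nil.
  by rewrite big_cons ih /=; case: pickle_inv => [m|] /=; rewrite ?big_cons ?add0r.
have us : uniq s.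
  apply: (@pmap_uniq _ _ _ (@pickle K)); last exact: iota_uniq.
  exact: pickle_invK.
pose B := \max_(m <- s) \max_j m j.
have sB m j : m \in s -> (m j <= B)%N.
  move=> ms; apply: (@leq_trans (\max_j m j)); first exact: leq_bigmax.
  by rewrite /B (big_rem m)//= leq_maxl.
pose up (f : {ffun 'I_n -> 'I_B.+1}) : K := [ffun j => f j : nat].
have up_inj : injective up.
  by move=> f g /ffunP fg; apply/ffunP => j; apply: val_inj; have := fg j; rewrite !ffunE.
pose t := map up (enum {ffun 'I_n -> 'I_B.+1}).
have ut : uniq t by rewrite map_inj_uniq// enum_uniq.
have st : {subset s <= t}.
  move=> m ms; apply/mapP; exists [ffun j => inord (m j)]; first by rewrite mem_enum.
  by apply/ffunP => j; rewrite !ffunE inordK// ltnS sB.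
have pst : perm_eq s [seq x <- t | x \in s].
  apply: uniq_perm => //; first exact: filter_uniq.
  move=> x; rewrite mem_filter; case: (boolP (x \in s)) => // /st ->.
  by [].
rewrite sE (perm_big _ pst)/= big_filter.
apply: (@le_trans _ _ (\sum_(m <- t) mpow r m)).
  by rewrite big_mkcond; apply: ler_sum => m _; case: ifP.
rewrite big_map big_enum/= (eq_bigr (fun f : {ffun 'I_n -> 'I_B.+1} => \prod_j r j ^+ f j)); last first.
  by move=> f _; apply: eq_bigr => j _; rewrite ffunE.
rewrite -(bigA_distr_bigA (fun j (i : 'I_B.+1) => r j ^+ i)).
apply: ler_prod => j _; have /andP[rj0 rj1] := r01 j; rewrite sumr_ge0/= => [|i _]; last by rewrite exprn_ge0.
rewrite -[leRHS]mul1r ler_pdivlMr ?subr_gt0//.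
have := subrX1 (r j) B.+1; have := exprn_ge0 B.+1 rj0.
set S := \sum_(i < B.+1) _; lra.
Qed.

End multi_series.

(** * Second-order expansions of monomials *)

Section jets.
Variables (R : realType) (n : nat) (z0 : Cspace R n) (tau : R).
Hypothesis tau0 : 0 < tau.
Local Notation normc := (@Normc.normc R).

Definition lin_form (lam : 'I_n -> R[i]) (h : Cspace R n) : R[i]^o := \sum_j lam j * h ord0 j.

Definition small (s : R) (h : Cspace R n) := 0 <= s /\ forall j, normc (h ord0 j) <= s.

(* A second-order expansion at z0 valid for |h| <= tau; c bounds a weighted
   norm of its coefficients which is submultiplicative. *)
Definition jet (phi : Cspace R n -> R[i]^o) (c : R) := exists a l e (lam : 'I_n -> R[i]),
  [/\ [/\ 0 <= a, 0 <= l, 0 <= e & a + l * tau + e * tau ^+ 2 <= c],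
      normc (phi z0) <= a, \sum_j normc (lam j) <= l &
      forall h s, small s h -> s <= tau ->
        normc (phi (z0 + h) - phi z0 - lin_form lam h) <= e * s ^+ 2].

Lemma lin_form_le lam h s : small s h -> normc (lin_form lam h) <= (\sum_j normc (lam j)) * s.
Proof.
move=> [s0 hs]; rewrite mulr_suml; apply: le_trans (normc_sum _ _ _) _.
by apply: ler_sum => j _; rewrite Normc.normcM ler_wpM2l ?normc_ge0.
Qed.

Lemma jet_cst1 : jet (fun=> 1) 1.
Proof.
exists 1, 0, 0, (fun=> 0); split.
- by split => //; rewrite !mul0r !addr0.
- by rewrite [normc _]Normc.normc1.
- by rewrite big1// => j _; exact: Normc.normc0.
- move=> h s _ _; rewrite subrr /lin_form big1 ?subr0 ?[normc _]Normc.normc0 ?mul0r// => j _.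
  by rewrite mul0r.
Qed.

Lemma jet_coord j : jet (fun z => z ord0 j) (normc (z0 ord0 j) + tau).
Proof.
exists (normc (z0 ord0 j)), 1, 0, (fun i => (i == j)%:R); split.
- by split; rewrite ?normc_ge0// mul1r mul0r addr0.
- by [].
- rewrite (bigD1 j)//= eqxx big1 ?addr0 ?[normc _]Normc.normc1// => i /negbTE ->.
  exact: Normc.normc0.
- move=> h s _ _; rewrite /lin_form (bigD1 j)//= eqxx mul1r big1 ?addr0; last first.
    by move=> i /negbTE ->; rewrite mul0r.
  by rewrite mxE [_ + h _ _]addrC addrK subrr [normc _]Normc.normc0 mul0r.
Qed.

Lemma jetM phi psi c d : jet phi c -> jet psi d -> jet (fun z => phi z * psi z) (c * d).
Proof.
move=> [a [l [e [lam [[a0 l0 e0 ac] pa ll H]]]]] [a' [l' [e' [lam' [[a0' l0' e0' ac'] pa' ll' H']]]]].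
exists (a * a'), (a * l' + a' * l), (a * e' + a' * e + l * l' + (l * e' + e * l') * tau + e * e' * tau ^+ 2),
  (fun j => phi z0 * lam' j + psi z0 * lam j); split.
- split; rewrite ?addr_ge0 ?mulr_ge0 ?addr_ge0 ?mulr_ge0 ?exprn_ge0//; try exact: ltW.
  rewrite [leLHS](_ : _ = (a + l * tau + e * tau ^+ 2) * (a' + l' * tau + e' * tau ^+ 2)); last by ring.
  by apply: ler_pM => //; rewrite !addr_ge0 ?mulr_ge0 ?exprn_ge0// ltW.
- by rewrite Normc.normcM; apply: ler_pM; rewrite ?normc_ge0.
- apply: (@le_trans _ _ (\sum_j (normc (phi z0) * normc (lam' j) + normc (psi z0) * normc (lam j)))).
    by apply: ler_sum => j _; apply: le_trans (le_normcD _ _) _; rewrite !Normc.normcM.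
  rewrite big_split -!mulr_sumr; apply: lerD.
    by apply: ler_pM; rewrite ?normc_ge0// sumr_ge0// => j _; exact: normc_ge0.
  by apply: ler_pM; rewrite ?normc_ge0// sumr_ge0// => j _; exact: normc_ge0.
move=> h s hs st; have s0 := hs.1.
have -> : lin_form (fun j => phi z0 * lam' j + psi z0 * lam j) h =
    phi z0 * lin_form lam' h + psi z0 * lin_form lam h.
  rewrite /lin_form !mulr_sumr -big_split; apply: eq_bigr => j _ /=.
  by rewrite mulrDl !mulrA.
have := H h s hs st; have := H' h s hs st.
have Ll : normc (lin_form lam h) <= l * s.
  by apply: le_trans (lin_form_le lam hs) _; rewrite ler_wpM2r.
have Ll' : normc (lin_form lam' h) <= l' * s.
  by apply: le_trans (lin_form_le lam' hs) _; rewrite ler_wpM2r.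
move: pa pa' Ll Ll'; move: (phi z0) (psi z0) (lin_form lam h) (lin_form lam' h) => p q L L' pa pa' Ll Ll'.
set E' := psi _ - _ - _; set E := phi _ - _ - _ => E's Es.
have -> : phi (z0 + h) = p + L + E by rewrite /E; ring.
have -> : psi (z0 + h) = q + L' + E' by rewrite /E'; ring.
have nM x y X Y : normc x <= X -> normc y <= Y -> normc (x * y) <= X * Y.
  by move=> h1 h2; rewrite Normc.normcM; apply: ler_pM; rewrite ?normc_ge0.
have nD x y X Y : normc x <= X -> normc y <= Y -> normc (x + y) <= X + Y.
  by move=> h1 h2; apply: le_trans (le_normcD _ _) (lerD h1 h2).
have -> : (p + L + E) * (q + L' + E') - p * q - (p * L' + q * L) =
    p * E' + (q * E + (L * L' + (L * E' + (E * L' + E * E')))) by ring.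
apply: le_trans (nD _ _ _ _ (nM _ _ _ _ pa E's) (nD _ _ _ _ (nM _ _ _ _ pa' Es)
  (nD _ _ _ _ (nM _ _ _ _ Ll Ll') (nD _ _ _ _ (nM _ _ _ _ Ll E's)
  (nD _ _ _ _ (nM _ _ _ _ Es Ll') (nM _ _ _ _ Es E's)))))) _.
have -> : a * (e' * s ^+ 2) + (a' * (e * s ^+ 2) + (l * s * (l' * s) + (l * s * (e' * s ^+ 2) +
    (e * s ^+ 2 * (l' * s) + e * s ^+ 2 * (e' * s ^+ 2))))) =
    (a * e' + a' * e + l * l' + (l * e' + e * l') * s + e * e' * s ^+ 2) * s ^+ 2 by ring.
rewrite ler_wpM2r ?exprn_ge0//; apply: lerD; first apply: lerD => //.
  by rewrite ler_wpM2l// addr_ge0// mulr_ge0.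
by rewrite ler_wpM2l ?mulr_ge0//; apply: sqr_le.
Qed.

Definition zmon (m : {ffun 'I_n -> nat}) : Cspace R n -> R[i]^o := fun z => \prod_j z ord0 j ^+ m j.

Lemma jet_zmon m : jet (zmon m) (mpow (fun j => normc (z0 ord0 j) + tau) m).
Proof.
have jX phi c k : jet phi c -> jet (fun z => phi z ^+ k) (c ^+ k).
  move=> jp; elim: k => [|k ih].
    by rewrite expr0; under eq_fun do rewrite expr0; exact: jet_cst1.
  by rewrite exprS; under eq_fun do rewrite exprS; exact: jetM.
rewrite /mpow /zmon; elim: (index_enum _) => [|j s ih].
  by rewrite big_nil; under eq_fun do rewrite big_nil; exact: jet_cst1.
rewrite big_cons; under eq_fun do rewrite big_cons; apply: jetM => //; apply: jX; exact: jet_coord.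
Qed.

(** Read off from the weighted bound a + l tau + e tau^2 <= c of a jet. Both bounds are proportional
    to the monomial of the radii |z_j| + tau at the point [z0], so they can be summed against the
    coefficients of a power series. *)
Lemma zmon_expansion m : exists lam : 'I_n -> R[i],
  let c := mpow (fun j => normc (z0 ord0 j) + tau) m in
  (forall j, normc (lam j) <= c / tau) /\
  forall h s, small s h -> s <= tau ->
    normc (zmon m (z0 + h) - zmon m z0 - lin_form lam h) <= c / tau ^+ 2 * s ^+ 2.
Proof.
have [a [l [e [lam [[a0 l0 e0 ac] pa ll H]]]]] := jet_zmon m.
exists lam; move: ac; set c := mpow _ _ => ac; have et0 : 0 <= e * tau ^+ 2 by rewrite mulr_ge0// exprn_ge0// ltW.
have lt0 : 0 <= l * tau by rewrite mulr_ge0// ltW.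
split => [j|h s hs st].
  rewrite ler_pdivlMr//; apply: (@le_trans _ _ (l * tau)); last by lra.
  rewrite ler_wpM2r ?(ltW tau0)//; apply: le_trans ll; rewrite (bigD1 j)//= lerDl.
  by apply: sumr_ge0 => i _; exact: normc_ge0.
apply: le_trans (H h s hs st) _; rewrite ler_wpM2r ?exprn_ge0//; first by case: hs.
by rewrite ler_pdivlMr ?exprn_gt0//; lra.
Qed.

End jets.

(** * Sums of power series are holomorphic *)

Section holomorphy.
Variables (R : realType) (n : nat).
Local Notation normc := (@Normc.normc R).

Section linear_form.
Variable lam : 'I_n -> R[i].

Let lin_form_linear : linear (lin_form lam).
Proof.
move=> a x y; rewrite /lin_form scaler_sumr -big_split; apply: eq_bigr => j _ /=.
by rewrite !mxE mulrDr mulrCA.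
Qed.

HB.instance Definition _ := @GRing.isLinear.Build R[i] (Cspace R n) R[i]^o *:%R
  (lin_form lam) lin_form_linear.

End linear_form.

Lemma small_norm (h : Cspace R n) : exists2 s : R, `|h| = s%:C%C & small s h.
Proof.
have h0 : 0 <= `|h| by [].
have [s hs] : exists s : R, `|h| = s%:C%C.
  by move: h0; case: `|h| => x y; rewrite lecE /= => /andP[/eqP -> _]; exists x.
exists s => //; split; first by move: h0; rewrite hs lecR.
move=> j; rewrite -lecR -hs -normC_normc.
rewrite -[leRHS]/(mx_norm h) mx_normE; set M := (X in X%:num).
have : M <= M by [].
rewrite {1}/M; by move=> /bigmax_leP[_ /(_ (ord0, j) isT)]; rewrite -num_le.
Qed.

Lemma quad_differentiable (f : Cspace R n -> R[i]^o) (z0 : Cspace R n) lam (tau D : R) : 0 < tau -> 0 <= D ->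
  (forall h s, small s h -> s <= tau -> normc (f (z0 + h) - f z0 - lin_form lam h) <= D * s ^+ 2) ->
  differentiable f z0.
Proof.
move=> tau0 D0 H.
have cl : continuous (lin_form lam : Cspace R n -> R[i]^o).
  move=> x; apply/(cvgrPdist_le (F := nbhs x)) => _ /posC_normc[e e0 ->].
  pose M := \sum_j normc (lam j) + 1; have M0 : 0 < M by rewrite ltr_wpDl// sumr_ge0// => j _; exact: normc_ge0.
  have eM : 0 < (e / M)%:C%C :> R[i] by rewrite ltcR divr_gt0.
  near=> y; have : `|x - y| <= (e / M)%:C%C by near: y; apply: (@cvgr_dist_le _ _ _ _ _ id) => //.
  have [s -> ss] := small_norm (x - y); rewrite lecR => sM.
  rewrite -raddfB normC_normc lecR; apply: le_trans (lin_form_le lam ss) _.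
  apply: (@le_trans _ _ (M * (e / M))); last by rewrite mulrCA divff ?mulr1// gt_eqF.
  by apply: ler_pM => //; [apply: sumr_ge0 => j _; exact: normc_ge0|case: ss|rewrite lerDl].
move: (@diff_unique _ _ _ f (lin_form lam) z0 cl).
set eo_type := (X in (X -> _) -> _) => du; have eo : eo_type.
  apply/eqaddoP => _ /posC_normc[e e0 ->].
  have t0 : 0 < Num.min tau (e / (D + 1)) by rewrite lt_min tau0 divr_gt0// ltr_wpDl.
  have t0' : 0 < (Num.min tau (e / (D + 1)))%:C%C :> R[i] by rewrite ltcR.
  near=> h; have : `|h| <= (Num.min tau (e / (D + 1)))%:C%C.
    rewrite -[h]subr0 distrC; near: h; apply: (@cvgr_dist_le _ _ _ _ _ id) => //.
  have [s hs ss] := small_norm h; rewrite hs lecR le_min => /andP[st sD].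
  rewrite -[X in `|X|]/(f (h + z0) - (f z0 + lin_form lam h)) -rcM normC_normc lecR [h + z0]addrC.
  have := H h s ss st; rewrite opprD addrA => /le_trans; apply.
  rewrite expr2 mulrA; apply: ler_wpM2r; first by case: ss.
  apply: (@le_trans _ _ ((D + 1) * (e / (D + 1)))); last by rewrite mulrCA divff ?mulr1// gt_eqF// ltr_wpDl.
  by apply: ler_pM => //; [case: ss|rewrite lerDl].
by apply/diff_locallyP; rewrite (du eo).
Unshelve. all: by end_near. Qed.

Local Notation K := {ffun 'I_n -> nat}.

Definition zmon_seq (k : nat) : Cspace R n -> R[i]^o :=
  if pickle_inv k is Some m then zmon m else fun=> 0.

Lemma ball_room (c : Cspace R n) : unit_ball c ->
  exists2 e : R, 0 < e & \sum_j (normc (c ord0 j) + e) ^+ 2 < 1.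
Proof.
move=> /unit_ballP c1; pose x : n.-tuple _ := pt (fun j => (normc (c ord0 j))%:C%C).
have [|e e0 H] := @box_subset_ball R n x 1.
  by rewrite normsq_pt (eq_bigr (fun j => normc (c ord0 j) ^+ 2))// => j _; rewrite normc_real ger0_norm ?normc_ge0.
exists e => //; have := H (pt (fun j => (normc (c ord0 j) + e)%:C%C)).
rewrite normsq_pt (eq_bigr (fun j => (normc (c ord0 j) + e) ^+ 2)); last first.
  by move=> j _; rewrite normc_real ger0_norm// addr_ge0 ?normc_ge0// ltW.
apply=> j; apply/squareP; rewrite !tnth_mktuple /= subrr normr0 [_ + e]addrC addrK ger0_norm ?(ltW e0)//.
Qed.

Variable A : nat -> R[i].
(** Cauchy estimates on every polydisc inside the ball. *)
Hypothesis A_bound : forall rho : 'I_n -> R, (forall j, 0 < rho j) -> \sum_j rho j ^+ 2 < 1 ->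
  exists C : R, forall k m, pickle_inv k = Some m -> normc (A k) * mpow rho m <= C.

Lemma abs_series_bound (r rho : 'I_n -> R) : (forall j, 0 <= r j < rho j) -> \sum_j rho j ^+ 2 < 1 ->
  exists B : R, forall N, \sum_(0 <= k < N) normc (A k) *
    (if pickle_inv k is Some m then mpow r m else 0) <= B.
Proof.
move=> r0 r1; have rho0 j : 0 < rho j by have /andP[h1 h2] := r0 j; exact: le_lt_trans h1 h2.
have [C HC] := A_bound rho0 r1.
pose q j := r j / rho j.
have q01 j : 0 <= q j < 1.
  by have /andP[h1 h2] := r0 j; rewrite divr_ge0 ?(ltW (rho0 j))//= ltr_pdivrMr// mul1r.
exists (`|C| * \prod_j (1 - q j)^-1) => N; apply: le_trans (ler_wpM2l (normr_ge0 C) (sum_multi N q01)).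
rewrite mulr_sumr; apply: ler_sum => k _; case e : pickle_inv => [m|]; last by rewrite !mulr0.
have -> : mpow r m = mpow rho m * mpow q m.
  rewrite /mpow -big_split; apply: eq_bigr => j _ /=.
  by rewrite -exprMn /q mulrCA divff ?mulr1// gt_eqF.
rewrite mulrA ler_wpM2r//; last by apply: le_trans (HC k m e) (ler_norm _).
by apply: prodr_ge0 => j _; rewrite exprn_ge0//; have /andP[] := q01 j.
Qed.

(** The first-order expansions of the monomials are summed term by term. Their quadratic remainders
    have a convergent sum, so the sum of the linear parts is the complex derivative. *)
Lemma power_series : exists2 p : Cspace R n -> R[i]^o, analytic_ball p &
  forall z, unit_ball z -> ccvg (fun N => \sum_(0 <= k < N) A k * zmon_seq k z) (p z).
Proof.
have lim1 (z : Cspace R n) : exists l, unit_ball z ->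
    ccvg (fun N => \sum_(0 <= k < N) A k * zmon_seq k z) l.
  have [zb|nzb] := pselect (unit_ball z); last by exists 0.
  have [e e0 He] := ball_room zb.
  have [||B HB] := @abs_series_bound (fun j => normc (z ord0 j)) (fun j => normc (z ord0 j) + e).
  - by move=> j; rewrite normc_ge0 ltrDl.
  - exact: He.
  have [|l Sl _] := @cseries_lim R (fun k => A k * zmon_seq k z) B.
    move=> N; apply: le_trans (HB N); apply: ler_sum => k _; rewrite Normc.normcM ler_wpM2l ?normc_ge0//.
    rewrite /zmon_seq; case: pickle_inv => [m|]; last by rewrite [normc _]Normc.normc0.
    by rewrite /zmon normc_prod; apply: ler_prod => j _; rewrite normcX exprn_ge0 ?normc_ge0/=.
  by exists l.
have [p Hp] := choice lim1; exists p => // z0 z0b.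
(* Half of the room around z0: the other half separates the radii r_j from a larger polyradius
   inside the ball, as geometric convergence requires. *)
have [e e0 He] := ball_room z0b; pose tau := e / 2.
have tau0 : 0 < tau by rewrite divr_gt0.
pose r j := normc (z0 ord0 j) + tau.
have [||B HB] := @abs_series_bound r (fun j => normc (z0 ord0 j) + e).
- by move=> j; rewrite /r addr_ge0 ?normc_ge0 ?ltW//= ltrD2l /tau; lra.
- exact: He.
have B0 : 0 <= B by have := HB 0; rewrite big_geq.
pose c k := if pickle_inv k is Some m then mpow r m else 0.
have exp k : exists lam : 'I_n -> R[i], (forall j, normc (lam j) <= c k / tau) /\
    forall h s, small s h -> s <= tau ->
    normc (zmon_seq k (z0 + h) - zmon_seq k z0 - lin_form lam h) <= c k / tau ^+ 2 * s ^+ 2.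
  rewrite /zmon_seq /c; case: pickle_inv => [m|]; first exact: zmon_expansion.
  exists (fun=> 0); split=> [j|h s _ _]; first by rewrite mul0r [normc _]Normc.normc0.
  by rewrite subrr /lin_form big1 ?subr0 ?mul0r ?[normc _]Normc.normc0// => j _; rewrite mul0r.
have [lam Hlam] := choice exp.
have limL j : exists l, ccvg (fun N => \sum_(0 <= k < N) A k * lam k j) l.
  have [|l Sl _] := @cseries_lim R (fun k => A k * lam k j) (B / tau); last by exists l.
  move=> N; rewrite ler_pdivlMr// mulr_suml; apply: le_trans (HB N); apply: ler_sum => k _.
  by rewrite Normc.normcM -mulrA ler_wpM2l ?normc_ge0// -ler_pdivlMr//; exact: (Hlam k).1.
have [Lam HLam] := choice limL.
apply: (@quad_differentiable p z0 Lam tau (B / tau ^+ 2)) => //.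
  by rewrite divr_ge0// exprn_ge0// ltW.
move=> h s hs st; have s0 := hs.1.
have [|l Sl lB] := @cseries_lim R (fun k => A k * (zmon_seq k (z0 + h) - zmon_seq k z0 - lin_form (lam k) h))
    (B / tau ^+ 2 * s ^+ 2).
  move=> N; rewrite mulrAC ler_pdivlMr ?exprn_gt0// mulr_suml.
  apply: (@le_trans _ _ (\sum_(0 <= k < N) (normc (A k) * c k * s ^+ 2))); last first.
    by rewrite -mulr_suml ler_wpM2r ?exprn_ge0//; exact: HB.
  apply: ler_sum => k _; rewrite Normc.normcM -!mulrA ler_wpM2l ?normc_ge0//.
  rewrite -ler_pdivlMr ?exprn_gt0// mulrAC; exact: (Hlam k).2.
suff -> : p (z0 + h) - p z0 - lin_form Lam h = l by [].
have z0hb : unit_ball (z0 + h).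
  apply/unit_ballP; apply: le_lt_trans He; apply: ler_sum => j _; apply: sqr_le; first exact: normc_ge0.
  rewrite mxE; apply: le_trans (le_normcD _ _) _; rewrite lerD2l; apply: le_trans (hs.2 j) (le_trans st _).
  by rewrite /tau; lra.
apply: ccvg_unique Sl; rewrite /lin_form.
have hL : ccvg (fun N => \sum_j (\sum_(0 <= k < N) A k * lam k j) * h ord0 j) (\sum_j Lam j * h ord0 j).
  apply: ccvg_sum => j; rewrite [Lam j * _]mulrC; under eq_fun do rewrite mulrC; exact: ccvgZ.
have := ccvgB (ccvgB (Hp _ z0hb) (Hp _ z0b)) hL; congr ccvg; apply/funext => N.
rewrite [RHS](eq_bigr (fun k => A k * zmon_seq k (z0 + h) - A k * zmon_seq k z0 -
   A k * \sum_j lam k j * h ord0 j)); last by move=> k _; rewrite !mulrBr.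
rewrite !sumrB; congr (_ - _).
under eq_bigr do rewrite mulr_suml; rewrite exchange_big; apply: eq_bigr => k _ /=.
by rewrite mulr_sumr; apply: eq_bigr => j _; rewrite mulrA.
Qed.

End holomorphy.

(** * The Bergman projection *)

#[local] Opaque torus_mean cint circle_int.

Section expi_facts.
Variable R : realType.
Local Notation normc := (@Normc.normc R).

Lemma expiD (s t : R) : expi (s + t) = expi s * expi t.
Proof. by apply/eqP; rewrite eq_complex /= cosD sinD; apply/andP; split; apply/eqP; ring. Qed.

Lemma expiMn (t : R) k : expi t ^+ k = expi (k%:R * t).
Proof.
elim: k => [|k ih]; first by rewrite mul0r expr0 /expi cos0 sin0.
by rewrite exprS ih -expiD -natr1; congr expi; ring.
Qed.

Lemma expi_exp_neq1 (a b : nat) (t : R) : a != b -> 0 < t -> (a + b)%:R * t < pi ->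
  expi t ^+ a * conjc (expi t) ^+ b != 1.
Proof.
move=> ab t0 tpi.
have e1 : expi t * conjc (expi t) = 1 :> R[i] by rewrite mulcJ normc_expi expr1n.
have Im_neq0 d : (0 < d <= a + b)%N -> sin (d%:R * t) != 0 :> R.
  move=> /andP[d0 dab]; rewrite gt_eqF// sin_gt0_pi// mulr_gt0 ?ltr0n//=.
  by apply: le_lt_trans tpi; rewrite ler_wpM2r ?(ltW t0)// ler_nat.
move: ab; rewrite neq_ltn => /orP[ab|ba].
  rewrite -(subnK (ltnW ab)) exprD mulrCA mulrC -exprMn e1 expr1n mul1r.
  have -> : conjc (expi t) ^+ (b - a) = conjc (expi t ^+ (b - a)).
    by rewrite (rmorphXn (@conjc R)).
  have := Im_neq0 (b - a)%N; rewrite expiMn; set d := (b - a)%N => /(_ ltac:(rewrite /d; lia)) h.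
  by apply: contra h; rewrite eq_complex /= oppr_eq0 => /andP[].
have := Im_neq0 (a - b)%N => /(_ ltac:(lia)) h.
rewrite -(subnK (ltnW ba)) exprD -mulrA -exprMn e1 expr1n mulr1 expiMn.
by apply: contra h; rewrite eq_complex /= => /andP[].
Qed.

Lemma exists_expi_exp_neq1 (a b : nat) : a != b -> exists t : R, expi t ^+ a * conjc (expi t) ^+ b != 1.
Proof.
move=> ab; have q0 : 0 < (a + b).+1%:R :> R by rewrite ltr0n.
exists (pi / (a + b).+1%:R); apply: expi_exp_neq1 => //; first by rewrite divr_gt0// pi_gt0.
by rewrite mulrCA gtr_pMr ?pi_gt0// ltr_pdivrMr// mul1r ltr_nat.
Qed.

End expi_facts.

(** * Orthogonality and norms of the monomials *)

Section monomials.
Variables (R : realType) (n : nat) (alpha : R) (ha : -1 < alpha).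
Local Notation P := (measurableTypeR R * measurableTypeR R)%type.
Local Notation X := (n.-tuple P).
Local Notation normc := (@Normc.normc R).
Local Notation nu := (@nu_alpha R n alpha ha).
Local Notation ip := (ip nu).
Local Notation sqi := (sqi nu).
Local Notation nrm2 := (nrm2 nu).
Local Notation K := {ffun 'I_n -> nat}.

Definition rot1 (j : 'I_n) (c : R[i]) (i : 'I_n) : R[i] := if i == j then c else 1.

Lemma rot1_unimodular j c : normc c = 1 -> unimodular (rot1 j c).
Proof. by move=> c1 i; rewrite /rot1; case: ifP => _ //; exact: Normc.normc1. Qed.

Lemma mono_rot1 (a b : 'I_n -> nat) j c :
  mono a b (pt (rot1 j c)) = c ^+ a j * conjc c ^+ b j.
Proof.
rewrite monoE (bigD1 j)//= {1 2}/rot1 eqxx big1 ?mulr1// => i /negbTE ij.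
by rewrite /rot1 ij [conjc _]rmorph1 !expr1n mulr1.
Qed.

(** The invariance of nu_alpha gives I = c I for the integral I. *)
Lemma cint_rot0 u c (v : X -> R[i]) : unimodular u -> cintg nu v ->
  (forall x, v (cmul u x) = c * v x) -> c != 1 -> cint nu v = 0.
Proof.
move=> u1 iv vu c1; have := cint_scales (scales_nu_cmul ha u1) iv.1.
rewrite (_ : v \o cmul u = fun x => c * v x); last by apply/funext => x; exact: vu.
rewrite cintZ// => /eqP; rewrite -subr_eq0 -[X in _ - X]mul1r -mulrBl mulf_eq0 subr_eq0 (negbTE c1).
by move=> /eqP.
Qed.

Definition zmX (m : K) : X -> R[i] := ball_ext (zmon m).

Lemma zmon_mono (m : K) (x : X) : zmon m (of_coords x) = mono m (fun=> 0%N) x.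
Proof. by apply: eq_bigr => j _; rewrite of_coordsE expr0 mulr1. Qed.

Lemma zmXE m x : zmX m x = if normsq x < 1 then mono m (fun=> 0%N) x else 0.
Proof. by rewrite /zmX /ball_ext zmon_mono. Qed.

Lemma cmeas_ball (u : X -> R[i]) : cmeas u -> cmeas (fun x => if normsq x < 1 then u x else 0).
Proof.
move=> [m1 m2].
have mb : measurable_fun setT (fun x : X => normsq x < 1).
  by apply: measurable_fun_ltr => //; exact: measurable_normsq.
have E (p : R[i] -> R) : p 0 = 0 -> (fun x => p (if normsq x < 1 then u x else 0)) =
    (fun x => if normsq x < 1 then p (u x) else 0).
  by move=> p0; apply/funext => x; case: ifP.
by split; [rewrite (E (@complex.Re R))|rewrite (E (@complex.Im R))] => //; apply: measurable_fun_ifT.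
Qed.

Lemma cmeas_zmX m : cmeas (zmX m).
Proof.
rewrite (_ : zmX m = fun x => if normsq x < 1 then mono m (fun=> 0%N) x else 0).
  by apply: cmeas_ball; exact: cmeas_mono.
by apply/funext => x; exact: zmXE.
Qed.

Lemma zmX_le1 m x : normc (zmX m x) <= 1.
Proof.
rewrite zmXE; case: ifP => [x1|_]; last by rewrite [normc _]Normc.normc0.
exact/mono_le1/ball_polydisc.
Qed.

Lemma sqi_zmX m : sqi (zmX m).
Proof. exact: (sqi_bounded nu (cmeas_zmX m) (zmX_le1 m)). Qed.

Lemma zmXM m k x : zmX m x * conjc (zmX k x) = if normsq x < 1 then mono m k x else 0.
Proof.
rewrite !zmXE; case: ifP => _; last by rewrite mul0r.
rewrite monoJ monoM; congr (mono _ _ x); apply/funext => j; by rewrite ?addn0.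
Qed.

Lemma zmX_orth m k : m != k -> ip (zmX m) (zmX k) = 0.
Proof.
move=> mk; have [j jmk] : exists j, m j != k j.
  by apply: contrapT => h; move/eqP: mk; apply; apply/ffunP => j; apply/eqP/negPn/negP => hj; apply: h; exists j.
have [t ht] := exists_expi_exp_neq1 R jmk.
have t1 := rot1_unimodular j (normc_expi t).
apply: (cint_rot0 t1 _ _ ht); first exact: sqi_mul (sqi_zmX m) (sqi_zmX k).
move=> x; rewrite !zmXM normsq_cmul//.
by case: ifP => _; [rewrite mono_cmul mono_rot1|rewrite mulr0].
Qed.

Lemma inner_box (rho : 'I_n -> R) : (forall j, 0 < rho j) -> \sum_j rho j ^+ 2 < 1 ->
  exists (c : X) (e : R), 0 < e /\
    forall x, box c e x -> normsq x < 1 /\ forall j, rho j <= normc (zc x j).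
Proof.
move=> r0 r1; pose x0 : X := pt (fun j => (rho j)%:C%C).
have [|e e0 He] := @box_subset_ball R n x0 1.
  by rewrite normsq_pt (eq_bigr (fun j => rho j ^+ 2))// => j _; rewrite normc_real ger0_norm// ltW.
pose x1 : X := pt (fun j => (rho j + e / 2)%:C%C).
have e2 : 0 < e / 2 by rewrite divr_gt0.
exists x1, (e / 2); split=> // x Bx; split.
  apply: He => j; have /squareP[] := Bx j; rewrite /x1 /x0 tnth_mktuple /= subr0 => h1 h2.
  apply/squareP; rewrite tnth_mktuple /= subr0; split; last by apply: le_trans h2 _; lra.
  rewrite (_ : _ - _ = ((tnth x j).1 - (rho j + e / 2)) + e / 2); last by ring.
  apply: le_trans (ler_normD _ _) _; rewrite [e in leRHS]splitr; apply: lerD => //; by rewrite ger0_norm// (ltW e2).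
move=> j; have /squareP[] := Bx j; rewrite /x1 tnth_mktuple /= => h1 _.
apply: le_trans (Re_le_normc (zc x j)); apply: le_trans (ler_norm _).
move: h1; rewrite ler_distl => /andP[]; rewrite /zc /=; lra.
Qed.

Lemma inner_radius : exists rho : 'I_n -> R, (forall j, 0 < rho j) /\ \sum_j rho j ^+ 2 < 1.
Proof.
clear ha; exists (fun=> n.+1%:R^-1); split=> [j|]; first by rewrite invr_gt0 ltr0n.
rewrite sumr_const card_ord -[ltLHS]mulr_natr.
have n0 : 0 < n.+1%:R :> R by rewrite ltr0n.
rewrite expr2 -mulrA -ltr_pdivlMl ?invr_gt0// invrK mulr1.
rewrite ltr_pdivrMl// -natrM ltr_nat; lia.
Qed.

(** Some box inside the ball has |z_j| >= rho_j throughout, and c is its measure. Together with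
    Bessel's inequality this lower bound yields the Cauchy estimates for Fourier coefficients. *)
Lemma nrm2_zmX_ge (rho : 'I_n -> R) : (forall j, 0 < rho j) -> \sum_j rho j ^+ 2 < 1 ->
  exists2 c : R, 0 < c & forall m, c * mpow rho m ^+ 2 <= nrm2 (zmX m).
Proof.
move=> r0 r1; have [x1 [e2 [e0 B1]]] := inner_box r0 r1.
have [mB LB] := box_volume x1 e0.
have nB : (0 < nu (box x1 e2))%E.
  apply: nu_gt0 => //; first by move=> x /B1[].
  by rewrite LB lte_fin !exprn_gt0// mulr_gt0.
have [c cE] : exists c, nu (box x1 e2) = c%:E.
  by exists (fine (nu (box x1 e2))); rewrite fineK// fin_num_measure.
exists c; first by rewrite -lte_fin -cE.
move=> m; have p0 : 0 <= mpow rho m by apply: prodr_ge0 => j _; rewrite exprn_ge0// ltW.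
have mn : measurable_fun setT (fun x => (normc (zmX m x) ^+ 2)%:E).
  by apply/measurable_EFinP; apply: measurable_funX; apply: measurable_normc; exact: cmeas_zmX.
have fin : (\int[nu]_x (normc (zmX m x) ^+ 2)%:E)%E \is a fin_num.
  by apply: integrable_fin_num => //; exact: (sqi_zmX m).2.
rewrite nrm2_Rintegral /Rintegral -lee_fin fineK//.
apply: (@le_trans _ _ (\int[nu]_(x in box x1 e2) (mpow rho m ^+ 2)%:E)%E).
  by rewrite integral_cst// [X in (_ * X)%E]cE -EFinM mulrC.
apply: (@le_trans _ _ (\int[nu]_(x in box x1 e2) (normc (zmX m x) ^+ 2)%:E)%E); last first.
  by apply: ge0_subset_integral => // x _; rewrite lee_fin exprn_ge0// normc_ge0.
apply: ge0_le_integral => //.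
- by move=> x _; rewrite lee_fin exprn_ge0.
- exact: measurable_funTS.
move=> x /B1[x_lt xr]; rewrite lee_fin; apply: sqr_le => //.
rewrite zmXE x_lt /mono normc_prod; apply: ler_prod => j _.
rewrite expr0 mulr1 normcX exprn_ge0 ?(ltW (r0 j))//=.
by rewrite lerXn2r ?nnegrE ?normc_ge0 ?(ltW (r0 j)).
Qed.

Lemma nrm2_zmX_gt0 m : 0 < nrm2 (zmX m).
Proof.
have [rho [r0 r1]] := inner_radius.
have [c c0 H] := nrm2_zmX_ge r0 r1; apply: lt_le_trans (H m).
by rewrite mulr_gt0// exprn_gt0// prodr_gt0// => j _; rewrite exprn_gt0.
Qed.

End monomials.

Section projection.
Variables (R : realType) (n : nat) (alpha : R) (ha : -1 < alpha).
Local Notation P := (measurableTypeR R * measurableTypeR R)%type.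
Local Notation X := (n.-tuple P).
Local Notation normc := (@Normc.normc R).
Local Notation nu := (@nu_alpha R n alpha ha).
Local Notation ip := (ip nu).
Local Notation sqi := (sqi nu).
Local Notation nrm2 := (nrm2 nu).
Local Notation K := {ffun 'I_n -> nat}.

Let Z (k : nat) : X -> R[i] := ball_ext (zmon_seq k).

Let ZE k : Z k = if pickle_inv k is Some m then zmX m else fun=> 0.
Proof.
rewrite /Z /zmon_seq; case: pickle_inv => // ; apply/funext => x.
by rewrite /ball_ext; case: ifP.
Qed.

Let sZ k : sqi (Z k).
Proof. by rewrite ZE; case: pickle_inv => [m|]; [exact: sqi_zmX|exact: sqi0]. Qed.

Let ip0l v : ip (fun=> 0) v = 0.
Proof. by rewrite ip_cint -[RHS](@cint0 _ _ _ nu); apply: eq_cint => x; rewrite mul0r. Qed.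

Let ip0r v : ip v (fun=> 0) = 0.
Proof. by rewrite ip_cint -[RHS](@cint0 _ _ _ nu); apply: eq_cint => x; rewrite [conjc _]rmorph0 mulr0. Qed.

Let Z_orth k l : k != l -> ip (Z k) (Z l) = 0.
Proof.
move=> kl; rewrite !ZE; case ek : (pickle_inv k) => [m|]; last exact: ip0l.
case el : (pickle_inv l) => [m'|]; last exact: ip0r.
apply: zmX_orth; apply: contraNN kl => /eqP mm.
have := @pickle_invK K k; have := @pickle_invK K l; rewrite ek el /= mm => <- <-.
by [].
Qed.

Let Z_null k w : sqi w -> nrm2 (Z k) = 0 -> ip w (Z k) = 0.
Proof.
rewrite ZE; case: pickle_inv => [m|] sw; last by rewrite ip0r.
by move=> h; have := nrm2_zmX_gt0 ha m; rewrite h ltxx.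
Qed.

(** The Fourier coefficients of u satisfy the Cauchy estimates, so the series converges in the ball
    to an analytic p, and [fourier_limit] identifies p as the projection. *)
Lemma projection_exists (u : X -> R[i]) : sqi u -> exists p : Cspace R n -> R[i]^o,
  [/\ analytic_ball p, sqi (ball_ext p), forall m, ip (fun x => u x - ball_ext p x) (zmX m) = 0 &
  forall v, sqi v -> (forall m, ip v (zmX m) = 0) -> ip v (ball_ext p) = 0].
Proof.
move=> su; pose A := fourier nu Z u.
have A_bound (rho : 'I_n -> R) : (forall j, 0 < rho j) -> \sum_j rho j ^+ 2 < 1 ->
    exists C : R, forall k (m : K), pickle_inv k = Some m -> normc (A k) * mpow rho m <= C.
  move=> r0 r1; have [c c0 H] := nrm2_zmX_ge ha r0 r1.
  (* The bound is obtained for the square, and x^2 <= y implies x <= y + 1. *)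
  exists (nrm2 u / c + 1) => k m km.
  have := bessel sZ su Z_orth Z_null k.+1; rewrite big_nat_recr//= => hb.
  have {}hb : normc (A k) ^+ 2 * nrm2 (Z k) <= nrm2 u.
    apply: le_trans hb; rewrite lerDr; apply: sumr_ge0 => i _.
    by rewrite mulr_ge0 ?nrm2_ge0// exprn_ge0// normc_ge0.
  have {hb} : (normc (A k) * mpow rho m) ^+ 2 <= nrm2 u / c.
    rewrite ler_pdivlMr//; apply: le_trans hb; rewrite ZE km exprMn -mulrA.
    by rewrite ler_wpM2l ?exprn_ge0 ?normc_ge0// mulrC.
  by move: (normc (A k) * _) (nrm2 u / c) => x y; have := sqr_ge0 (x - 1); nra.
have [p ap Sp] := power_series A_bound.
have pS x : normc (fourier_sum nu Z u 0 k x - ball_ext p x) @[k --> \oo] --> (0 : R).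
  rewrite /ball_ext; case: ifPn => x1.
    have xb : unit_ball (of_coords x) by apply/unit_ballP; under eq_bigr do rewrite of_coordsE.
    rewrite (_ : (fun k => _) = fun N => normc (\sum_(0 <= k < N) A k * zmon_seq k (of_coords x) -
      p (of_coords x))); first exact: (Sp _ xb).
    apply/funext => N; congr (normc (_ - _)).
    by apply: eq_bigr => k _; rewrite /Z /ball_ext x1.
  rewrite (_ : (fun k => _) = fun=> 0); first exact: cvg_cst.
  apply/funext => N; rewrite /fourier_sum big1 ?subrr ?[normc _]Normc.normc0// => k _.
  by rewrite /Z /ball_ext (negbTE x1) mulr0.
have [sp h1 h2] := fourier_limit sZ su Z_orth Z_null pS.
have Zm m : Z (pickle m) = zmX m by rewrite ZE pickleK_inv.
exists p; split => // [m|v sv vm].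
- by have := h1 (pickle m); rewrite Zm.
- apply: h2 => // k; rewrite ZE; case: pickle_inv => [m|]; [exact: vm|exact: ip0r].
Qed.

Lemma nu_setT_neq0 : (fine (nu setT))%:C%C != 0 :> R[i].
Proof.
apply/eqP => -[n0]; have h0 := nrm2_zmX_gt0 ha ([ffun=> 0%N] : K).
suff : nrm2 (zmX ([ffun=> 0%N] : K)) <= 0 by rewrite leNgt h0.
rewrite -[leRHS]mul1r -[X in _ * X]n0 -Rintegral_cst//; apply: le_Rintegral => //.
- exact: (sqi_zmX ha _).2.
- exact: finite_measure_integrable_cst.
- by move=> x _; rewrite exprn_ile1 ?normc_ge0// zmX_le1.
Qed.

(** All mixed moments of r vanish. Averaged over tori, the moment against z^a conj(z)^b involves
    only the coefficient of degree b - a; this is 0 if b - a has a negative entry, and is otherwise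
    0 because r is orthogonal to z^(b - a), whose norm is positive. *)
Lemma analytic_perp_eq0 (r : Cspace R n -> R[i]^o) : analytic_ball r -> sqi (ball_ext r) ->
  (forall m, ip (ball_ext r) (zmX m) = 0) -> {ae nu, forall x, ball_ext r x = 0}.
Proof.
move=> ar sr rm; have ir := sqi_cintg sr.
apply: moment_uniqueness => // [x|a b].
  by move=> nx; rewrite /ball_ext; case: ifP => // /ball_polydisc.
have [kappa [kG k0]] := torus_coef ha ar ir.1 b a.
apply: (mulfI nu_setT_neq0); rewrite mulr0.
have [[j jb]|nab] := pselect (exists j, (b j < a j)%N).
  have c1 (x : X) : normc ((fun=> 1) x) <= 1 by rewrite [normc _]Normc.normc1.
  have := radial_pairing ar ir.1 kG ir (@cmeas_cst _ _ _ 1) c1 (fun u x _ => erefl).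
  rewrite (k0 j jb) mul0r => <-.
  by congr (_ * _); apply: eq_cint => x; rewrite mulr1.
pose d : K := [ffun j => (b j - a j)%N].
have abd j : (a j + d j)%N = b j.
  by rewrite ffunE subnKC// leqNgt; apply/negP => h; apply: nab; exists j.
have [kappa' [kG' _]] := torus_coef ha ar ir.1 d (fun=> 0%N).
(* z^a conj(z)^b is |z^a|^2 times the conjugate of z^(b - a); the first factor, cut off to the ball,
   is a bounded multiplier invariant under the torus. *)
pose phi (x : X) : R[i] := if normsq x < 1 then mono a a x else 0.
have mphi : cmeas phi by apply: cmeas_ball; exact: cmeas_mono.
have phi1 x : normc (phi x) <= 1.
  by rewrite /phi; case: ifP => [/ball_polydisc/mono_le1//|_]; rewrite [normc _]Normc.normc0.
have phiu u x : unimodular u -> phi (cmul u x) = phi x.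
  move=> u1; rewrite /phi (normsq_cmul _ u1); case: ifP => [_|_]; last by [].
  rewrite mono_cmul -[RHS]mul1r.
  apply: (congr1 (fun c => c * mono a a x)); rewrite monoE big1// => j _.
  by rewrite -exprMn mulcJ u1 !expr1n.
have kappa'0 : kappa' = 0.
  have c1 (x : X) : normc ((fun=> 1) x) <= 1 by rewrite [normc _]Normc.normc1.
  have := radial_pairing ar ir.1 kG' ir (@cmeas_cst _ _ _ 1) c1 (fun u x _ => erefl).
  rewrite (_ : cint nu _ = ip (ball_ext r) (zmX d)); last first.
    apply: eq_cint => x; rewrite zmXE /ball_ext; case: ifP => _; last by rewrite !mul0r.
    by rewrite mulr1 monoJ.
  rewrite rm mulr0 => /esym/eqP; rewrite mulf_eq0 => /orP[/eqP//|/eqP h].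
  have := nrm2_zmX_gt0 ha d; suff -> : nrm2 (zmX d) = 0 by rewrite ltxx.
  have : (nrm2 (zmX d))%:C%C = 0 :> R[i]; last by case.
  rewrite -ipE -h; apply: ae_eq_cint.
  - by apply: cmeasM; [exact: cmeas_zmX|apply: cmeasJ; exact: cmeas_zmX].
  - by apply: cmeasM; [exact: cmeas_cst|exact: cmeas_mono].
  by apply: filterS (ae_nu_ball n ha) => x x1; rewrite zmXM x1 mul1r.
have := radial_pairing ar ir.1 kG' ir mphi phi1 phiu.
rewrite kappa'0 mul0r => <-; congr (_ * _); apply: eq_cint => x.
rewrite /phi /ball_ext; case: ifP => _; last by rewrite !mul0r.
rewrite -mulrA monoM; congr (_ * mono _ _ x); apply/funext => j.
by rewrite addnC abd.
Qed.

(** The projection p of q has the same inner products with monomials as q, hence equals q almost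
    everywhere, and v is orthogonal to p. *)
Lemma perp_analytic (v : X -> R[i]) : sqi v -> (forall m, ip v (zmX m) = 0) ->
  forall q, analytic_ball q -> sqi (ball_ext q) -> ip v (ball_ext q) = 0.
Proof.
move=> sv vm q aq sq; have [p [ap sp pm pv]] := projection_exists sq.
rewrite -(pv v sv vm); apply: ae_eq_cint.
- by apply: cmeasM; [exact: sv.1|apply: cmeasJ; exact: sq.1].
- by apply: cmeasM; [exact: sv.1|apply: cmeasJ; exact: sp.1].
have ar : analytic_ball (fun z => q z - p z).
  by move=> z zb; apply: differentiableB; [exact: aq|exact: ap].
have rE : ball_ext (fun z => q z - p z) = fun x => ball_ext q x - ball_ext p x.
  by apply/funext => x; exact: ball_extB.
have := analytic_perp_eq0 ar; rewrite rE => /(_ (sqiB sq sp) pm).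
by apply: filterS => x /eqP; rewrite subr_eq0 => /eqP ->.
Qed.

(** By continuity a nonzero value persists on a small box, and boxes inside the ball have positive
    measure. *)
Lemma analytic_ae_eq0 (d : Cspace R n -> R[i]^o) : analytic_ball d ->
  {ae nu, forall x, ball_ext d x = 0} -> forall z, unit_ball z -> d z = 0.
Proof.
move=> ad d0 z zb; apply: contrapT => /eqP dz.
have e0 : 0 < (normc (d z))%:C%C :> R[i] by rewrite ltcR normc_gt0.
have cd : d w @[w --> z] --> d z := differentiable_continuous (ad z zb).
have /(cvgrPdist_lt (F := nbhs z))/(_ _ e0) := cd.
move=> /nbhs_ballP[_ /= /posC_normc[e ep ->] He].
pose x := pt (fun j => z ord0 j).
have x1 : normsq x < 1 by rewrite normsq_pt; exact/unit_ballP.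
have [e1 e10 Hb] := box_subset_ball x1.
pose s := Num.min e1 (e / 3).
have s0 : 0 < s by rewrite lt_min e10 divr_gt0.
have [mB LB] := box_volume x s0.
have Bb y : box x s y -> normsq y < 1.
  move=> By; apply: Hb => j; have /squareP[h1 h2] := By j; apply/squareP.
  by split; [apply: le_trans h1 _|apply: le_trans h2 _]; rewrite /s ge_min lexx.
have nB : (0 < nu (box x s))%E.
  by apply: nu_gt0 => //; rewrite LB lte_fin !exprn_gt0// mulr_gt0.
have [N [mN N0 NP]] := d0.
suff BN : box x s `<=` N.
  have : (nu (box x s) <= nu N)%E by apply: le_measure; rewrite ?inE.
  by rewrite [leRHS]N0 leNgt nB.
move=> y By; apply: NP => /=; rewrite /ball_ext (Bb y By) => dy0.
have /He : ball z e%:C%C (of_coords y).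
  split; first by rewrite ltcR.
  move=> i j; rewrite ord1 /ball/= mxE normC_normc ltcR.
  have /squareP[h1 h2] := By j; apply: le_lt_trans (normc_le_ReIm _) _.
  move: h1 h2; rewrite tnth_mktuple /= => h1 h2.
  have s3 : s <= e / 3 by rewrite /s ge_min lexx orbT.
  rewrite -[ltLHS]/(`|complex.Re (z ord0 j - _)| + `|complex.Im (z ord0 j - _)|) !ReImE /=.
  rewrite distrC [X in _ + X]distrC; apply: le_lt_trans (lerD h1 h2) _; lra.
by rewrite /= dy0 subr0 normC_normc ltcR ltxx.
Qed.

End projection.

(** * Toeplitz operators with radial symbols *)

Section bergman_projection.
Variables (R : realType) (n : nat) (alpha : R) (ha : -1 < alpha).
Local Notation P := (measurableTypeR R * measurableTypeR R)%type.
Local Notation X := (n.-tuple P).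
Local Notation normc := (@Normc.normc R).
Local Notation L := (lebesgueC R n).
Local Notation nu := (@nu_alpha R n alpha ha).
Local Notation ip := (ip nu).
Local Notation sqi := (sqi nu).
Local Notation K := {ffun 'I_n -> nat}.
Local Notation A2 := (@A2 R n alpha).
Local Notation L2 := (@L2 R n alpha).
Local Notation bp := (@bergman_proj R n alpha).
Implicit Types (u v p q f : Cspace R n -> R[i]^o) (m k : K).

Definition coef u k : R[i] := ip (ball_ext u) (zmX k).

Lemma L2_sqi u : L2 u <-> sqi (ball_ext u).
Proof. exact: L2P. Qed.

Lemma zmon_analytic m : analytic_ball (@zmon R n m).
Proof.
move=> z0 _; have [lam [_ H]] := @zmon_expansion R n z0 1 ltr01 m.
apply: (quad_differentiable ltr01 _ H); rewrite expr1n divr1.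
by apply: prodr_ge0 => j _; rewrite exprn_ge0// addr_ge0 ?normc_ge0.
Qed.

Lemma A2_zmon m : A2 (zmon m).
Proof. by split; [apply/L2_sqi; exact: sqi_zmX|exact: zmon_analytic]. Qed.

Lemma A2_sum (I : Type) (r : seq I) (c : I -> R[i]) (F : I -> Cspace R n -> R[i]^o) :
  (forall i, A2 (F i)) -> A2 (fun z => \sum_(i <- r) c i * F i z).
Proof.
move=> AF; split.
  apply/L2_sqi; rewrite (_ : ball_ext _ = fun x => \sum_(i <- r) c i * ball_ext (F i) x).
    by apply: sqi_sum => i; apply: sqiZ; apply/L2_sqi; case: (AF i).
  apply/funext => x; rewrite /ball_ext; case: ifP => // _.
  by rewrite big1// => i _; rewrite mulr0.
move=> z zb; elim: r => [|i r ih].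
  by under eq_fun do rewrite big_nil; exact: differentiable_cst.
under eq_fun do rewrite big_cons; apply: differentiableD => //.
by have := differentiableZ (c i) ((AF i).2 z zb).
Qed.

Lemma coef_sum (I : Type) (r : seq I) (c : I -> R[i]) (F : I -> Cspace R n -> R[i]^o) k :
  (forall i, L2 (F i)) -> coef (fun z => \sum_(i <- r) c i * F i z) k = \sum_(i <- r) c i * coef (F i) k.
Proof.
move=> LF; rewrite /coef (_ : ball_ext _ = fun x => \sum_(i <- r) c i * ball_ext (F i) x).
  rewrite ip_suml; last exact: sqi_zmX.
    by apply: eq_bigr => i _; rewrite ipZl//; [apply/L2_sqi|exact: sqi_zmX].
  by move=> i; apply: sqiZ; apply/L2_sqi.
apply/funext => x; rewrite /ball_ext; case: ifP => // _.
by rewrite big1// => i _; rewrite mulr0.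
Qed.

Lemma A2_coef_inj p q : A2 p -> A2 q -> (forall k, coef p k = coef q k) ->
  forall z, unit_ball z -> p z = q z.
Proof.
move=> [/L2_sqi sp ap] [/L2_sqi sq aq] pq z zb.
apply/eqP; rewrite -subr_eq0; apply/eqP.
have rE : ball_ext (fun z => p z - q z) = fun x => ball_ext p x - ball_ext q x.
  by apply/funext => x; exact: ball_extB.
have ar : analytic_ball (fun z => p z - q z).
  by move=> w wb; apply: differentiableB; [exact: ap|exact: aq].
apply: (analytic_ae_eq0 (ha := ha) ar _ zb); apply: analytic_perp_eq0 => //.
  by rewrite rE; exact: sqiB.
move=> k; rewrite rE ipBl//; last exact: sqi_zmX.
by rewrite [X in X - _](pq k) subrr.
Qed.

(** [xget] returns some function with the defining property, since [projection_exists] provides one;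
    orthogonality to the monomials fixes the coefficients whichever function is chosen. *)
Lemma bergman_projP u : L2 u -> A2 (bp u) /\ forall k, coef (bp u) k = coef u k.
Proof.
move=> /L2_sqi su.
have innerE p q : L2 p -> L2 q ->
    inner alpha (fun z => u z - p z) q = ip (fun x => ball_ext u x - ball_ext p x) (ball_ext q).
  move=> /L2_sqi sp /L2_sqi sq; have uB : ball_ext (fun z => u z - p z) = fun x => ball_ext u x - ball_ext p x.
    by apply/funext => x; exact: ball_extB.
  rewrite (@inner_cint _ _ _ ha) ?uB//; apply/measurable_ballP.
    by rewrite uB; exact: (sqiB su sp).1.
  exact: sq.1.
have ex : exists p, [set p | A2 p /\ forall q, A2 q -> inner alpha (fun z => u z - p z) q = 0] p.
  have [p [ap sp pm pv]] := projection_exists su; exists p; split.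
    by split=> //; apply/L2_sqi.
  move=> q [Lq aq]; rewrite innerE//; last by apply/L2_sqi.
  have sq := (L2_sqi q).1 Lq.
  by apply: perp_analytic => //; exact: sqiB.
have [[/L2_sqi sb ab] orth] := xgetPex (fun=> 0) ex; split.
  by split=> //; apply/L2_sqi.
move=> k; have := orth _ (A2_zmon k).
rewrite innerE ?ipBl//; [|exact: sqi_zmX|exact/L2_sqi|by case: (A2_zmon k)].
by move/eqP; rewrite subr_eq0 => /eqP.
Qed.

(** The sets from which [xget] chooses coincide, so the chosen functions are equal, outside the ball
    as well. *)
Lemma bergman_proj_ae u v : ae_ball (fun z => u z = v z) -> bp u = bp v.
Proof.
move=> uv; rewrite /bergman_proj; congr xget; apply/predeqP => p.
have e q : inner alpha (fun z => u z - p z) q = inner alpha (fun z => v z - p z) q.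
  apply: inner_ae; last by apply: aeW.
  by rewrite /ae_ball in uv *; apply: filterS uv => x h x1; rewrite h.
by split=> -[Ap H]; split=> // q Aq; [rewrite -e|rewrite e]; exact: H.
Qed.

Lemma toeplitz_ae f f' u v : ae_ball (fun z => f z = f' z) -> (forall z, unit_ball z -> u z = v z) ->
  toeplitz alpha f u = toeplitz alpha f' v.
Proof.
move=> ff uv; apply: bergman_proj_ae; rewrite /ae_ball in ff *.
by apply: filterS ff => x h x1; rewrite h// uv.
Qed.

Lemma L2_mul_bounded f u (B : R) : L2 f -> cmeas (ball_ext u) -> (forall x, normc (ball_ext u x) <= B) ->
  L2 (fun z => f z * u z).
Proof.
move=> /L2_sqi sf mu uB; apply/L2_sqi; apply: (sqi_le (B := B) _ sf).
  rewrite (_ : ball_ext _ = fun x => ball_ext f x * ball_ext u x).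
    by apply: cmeasM => //; exact: sf.1.
  by apply/funext => x; exact: ball_extM.
by move=> x; rewrite ball_extM Normc.normcM mulrC ler_wpM2r// normc_ge0.
Qed.

Section commutation.
Variables (f g g0 : Cspace R n -> R[i]^o) (M : R).
Hypothesis L2f : L2 f.
Hypothesis gg0 : ae_ball (fun z => g z = g0 z).
Hypothesis mg0 : cmeas (ball_ext g0).
Hypothesis g0M : forall x, normc (ball_ext g0 x) <= M.
Hypothesis g0_rot : forall (u : 'I_n -> R[i]) x, unimodular u -> ball_ext g0 (cmul u x) = ball_ext g0 x.

Definition eigenval k : R[i] :=
  cint nu (fun x => ball_ext g0 x * mono k k x) / cint nu (mono k k).

Lemma cint_mono_nrm2 k : cint nu (mono k k) = (nrm2 nu (zmX k))%:C%C.
Proof.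
rewrite -ipE; apply: ae_eq_cint.
- exact: cmeas_mono.
- by apply: cmeasM; [exact: cmeas_zmX|apply: cmeasJ; exact: cmeas_zmX].
by apply: filterS (ae_nu_ball n ha) => x x1; rewrite zmXM x1.
Qed.

Lemma cint_mono_neq0 k : cint nu (mono k k) != 0.
Proof.
rewrite cint_mono_nrm2; have h := nrm2_zmX_gt0 ha k; apply/eqP => -[h0].
by rewrite h0 ltxx in h.
Qed.

(** [radial_pairing] is applied to g0 minus the eigenvalue, whose integral against |z^k|^2 is 0 by
    the choice of the eigenvalue. So g0 q and the eigenvalue times q have the same k-th
    coefficient. *)
Lemma coef_toeplitz_radial q k : A2 q -> coef (toeplitz alpha g q) k = eigenval k * coef q k.
Proof.
move=> [/L2_sqi sq aq].
rewrite (@toeplitz_ae g g0 q q)// /toeplitz.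
have Lgq : L2 (fun z => g0 z * q z).
  under eq_fun do rewrite mulrC.
  by apply: (L2_mul_bounded _ mg0 g0M); apply/L2_sqi.
rewrite (bergman_projP Lgq).2.
have [kappa [kG _]] := torus_coef ha aq sq.1 k (fun=> 0%N).
pose phi (x : X) : R[i] := ball_ext g0 x - eigenval k.
have mphi : cmeas phi by apply: cmeasB => //; exact: cmeas_cst.
have phiM x : normc (phi x) <= M + normc (eigenval k).
  by apply: le_trans (le_normcD _ _) _; rewrite normcN lerD2r.
have phiu (u : 'I_n -> R[i]) x : unimodular u -> phi (cmul u x) = phi x by move=> u1; rewrite /phi g0_rot.
have iGm : cintg nu (fun x => ball_ext g0 x * mono k k x).
  have mGm : cmeas (fun x => ball_ext g0 x * mono k k x) by apply: cmeasM => //; exact: cmeas_mono.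
  apply: (@cintg_nu_bounded _ _ _ ha _ M) => // x x1.
  rewrite Normc.normcM -[M]mulr1; apply: ler_pM; rewrite ?normc_ge0//.
  exact/mono_le1/ball_polydisc.
have := radial_pairing aq sq.1 kG (sqi_cintg sq) mphi phiM phiu.
rewrite (_ : cint nu (fun x => phi x * mono k k x) = 0); last first.
  have e x : phi x * mono k k x = ball_ext g0 x * mono k k x - eigenval k * mono k k x.
    by rewrite /phi mulrBl.
  rewrite (eq_cint nu e).
  rewrite cintB//; last by apply: cintgZ; exact: cintg_mono.
  rewrite cintZ; last exact: cintg_mono.
  by rewrite /eigenval mulfVK ?subrr// cint_mono_neq0.
rewrite mulr0 => /eqP; rewrite mulf_eq0 => /orP[|/eqP].
  by rewrite (negbTE (nu_setT_neq0 n ha)).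
have iQ v : sqi (ball_ext v) -> cintg nu (fun x => ball_ext v x * mono (fun=> 0%N) k x).
  move=> sv; have := sqi_mul sv (sqi_zmX ha k); congr cintg; apply/funext => x.
  by rewrite zmXE /ball_ext; case: ifP => _; [rewrite monoJ|rewrite !mul0r].
have coefE v : coef v k = cint nu (fun x => ball_ext v x * mono (fun=> 0%N) k x).
  apply: eq_cint => x; rewrite zmXE /ball_ext.
  by case: ifP => _; [rewrite monoJ|rewrite !mul0r].
move=> h; rewrite !coefE -cintZ; last exact: iQ.
apply/eqP; rewrite -subr_eq0 -cintB; last 2 first.
- by apply: iQ; exact/L2_sqi.
- by apply: cintgZ; exact: iQ.
rewrite -[X in _ == X]h; apply/eqP; apply: eq_cint => x.
by rewrite ball_extM /phi; ring.
Qed.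

Lemma A2_toeplitz_radial q : A2 q -> A2 (toeplitz alpha g q).
Proof.
move=> [Lq _]; rewrite (toeplitz_ae gg0 (fun z _ => erefl (q z))).
apply: (bergman_projP _).1; under eq_fun do rewrite mulrC.
exact: (L2_mul_bounded Lq mg0 g0M).
Qed.

Lemma analytic_poly_zmon (p : mpoly.mpoly n R[i]) :
  analytic_poly p = fun z => \sum_(a <- mpoly.msupp p) mpoly.mcoeff a p * zmon [ffun j => mpoly.fun_of_multinom a j] z.
Proof.
apply/funext => z; rewrite /analytic_poly mpoly.mevalE; apply: eq_bigr => a _.
by congr (_ * _); apply: eq_bigr => j _; rewrite ffunE.
Qed.

(** Functions of the Bergman space are determined in the ball by their coefficients, so the two
    compositions are compared coefficientwise; general polynomials follow from monomials by
    linearity. *)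
Lemma toeplitz_commute_coef :
  (forall (p : mpoly.mpoly n R[i]) z, unit_ball z ->
     toeplitz alpha f (toeplitz alpha g (analytic_poly p)) z =
     toeplitz alpha g (toeplitz alpha f (analytic_poly p)) z) <->
  forall m k, (eigenval m - eigenval k) * cint nu (fun x => ball_ext f x * mono m k x) = 0.
Proof.
have Lfz m : L2 (fun z => f z * zmon m z).
  by apply: (@L2_mul_bounded f (zmon m) 1 L2f); [exact: (cmeas_zmX R m)|move=> x; exact: (zmX_le1 m x)].
have Gm m k : coef (fun z => f z * zmon m z) k = cint nu (fun x => ball_ext f x * mono m k x).
  apply: eq_cint => x; rewrite ball_extM -[ball_ext (zmon m) x]/(zmX m x) -mulrA zmXM /ball_ext.
  by case: ifP => // _; rewrite !mul0r.
have Tg (I : Type) (r : seq I) (c : I -> R[i]) (a : I -> K) z : unit_ball z ->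
    toeplitz alpha g (fun z => \sum_(i <- r) c i * zmon (a i) z) z =
    \sum_(i <- r) (c i * eigenval (a i)) * zmon (a i) z.
  have Ap := A2_sum r c (fun i => A2_zmon (a i)).
  apply: (@A2_coef_inj (toeplitz alpha g (fun z => \sum_(i <- r) c i * zmon (a i) z))
    (fun z => \sum_(i <- r) (c i * eigenval (a i)) * zmon (a i) z)).
  - exact: A2_toeplitz_radial.
  - exact: (A2_sum r _ (fun i => A2_zmon (a i))).
  move=> k; rewrite coef_toeplitz_radial// !coef_sum; try by move=> i; case: (A2_zmon (a i)).
  rewrite mulr_sumr; apply: eq_bigr => i _; have [->|ik] := eqVneq (a i) k; first by ring.
  by rewrite /coef zmX_orth// !mulr0.
have Tf (I : Type) (r : seq I) (c : I -> R[i]) (a : I -> K) :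
    let q := toeplitz alpha f (fun z => \sum_(i <- r) c i * zmon (a i) z) in
    A2 q /\ forall k, coef q k = \sum_(i <- r) c i * cint nu (fun x => ball_ext f x * mono (a i) k x).
  have E : (fun z => f z * (\sum_(i <- r) c i * zmon (a i) z)) =
      (fun z => \sum_(i <- r) c i * (f z * zmon (a i) z)).
    by apply/funext => z; rewrite mulr_sumr; apply: eq_bigr => i _; rewrite mulrCA.
  have Ls : L2 (fun z => \sum_(i <- r) c i * (f z * zmon (a i) z)).
    apply/L2_sqi; rewrite (_ : ball_ext _ = fun x => \sum_(i <- r) c i * ball_ext (fun z => f z * zmon (a i) z) x).
      by apply: sqi_sum => i; apply: sqiZ; apply/L2_sqi.
    apply/funext => x; rewrite /ball_ext; case: ifP => // _.
    by rewrite big1// => i _; rewrite mulr0.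
  rewrite /toeplitz E; have [h1 h2] := bergman_projP Ls; split=> // k.
  by rewrite h2 coef_sum//; apply: eq_bigr => i _; rewrite Gm.
have com (I : Type) (r : seq I) (c : I -> R[i]) (a : I -> K) :
    let p := fun z => \sum_(i <- r) c i * zmon (a i) z in
    (forall z, unit_ball z -> toeplitz alpha f (toeplitz alpha g p) z = toeplitz alpha g (toeplitz alpha f p) z) <->
    (forall k, \sum_(i <- r) c i * eigenval (a i) * cint nu (fun x => ball_ext f x * mono (a i) k x) =
      eigenval k * \sum_(i <- r) c i * cint nu (fun x => ball_ext f x * mono (a i) k x)).
  move=> p; have [Ap cp] := Tf _ r c a.
  have fg : toeplitz alpha f (toeplitz alpha g p) = toeplitz alpha f (fun z => \sum_(i <- r) (c i * eigenval (a i)) * zmon (a i) z).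
    by apply: toeplitz_ae; [exact: aeW|move=> z; exact: Tg].
  have [Afg cfg] := Tf _ r (fun i => c i * eigenval (a i)) a.
  have Agf := A2_toeplitz_radial Ap.
  rewrite fg; split=> [h k|h].
    apply: etrans (esym (cfg k)) _; apply: etrans (congr1 (fun w => eigenval k * w) (cp k)).
    apply: etrans (coef_toeplitz_radial k Ap); apply: eq_cint => x.
    apply: (congr1 (fun w => w * _)); rewrite /ball_ext; case: ifP => [x1|_]; last by [].
    by apply: h; apply/unit_ballP; under eq_bigr do rewrite of_coordsE.
  apply: (A2_coef_inj Afg Agf) => k; apply: etrans (cfg k) _; apply: etrans (h k) _.
  apply: etrans (congr1 (fun w => eigenval k * w) (esym (cp k))) _.
  by apply: esym; exact: coef_toeplitz_radial.
split=> [H m k|H p z zb].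
  have pE : analytic_poly (mpoly.mpolyX _ (mpoly.Multinom [tuple m j | j < n])) =
      fun z => \sum_(i <- [:: tt]) 1 * @zmon R n m z.
    apply/funext => w; rewrite big_seq1 mul1r /analytic_poly mpoly.mevalX.
    by apply: eq_bigr => j _; rewrite mpoly.multinomE tnth_mktuple.
  have h := H (mpoly.mpolyX _ (mpoly.Multinom [tuple m j | j < n])); rewrite pE in h.
  have := (com _ [:: tt] (fun=> 1) (fun=> m)).1 h k; rewrite !big_seq1 !mul1r.
  by move: (cint nu _) => c e; rewrite mulrBl e subrr.
rewrite analytic_poly_zmon; move: z zb; apply/com => k.
rewrite mulr_sumr; apply: eq_bigr => a _.
have /eqP := H [ffun j => mpoly.fun_of_multinom a j] k; rewrite mulrBl subr_eq0 => /eqP e.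
by rewrite -mulrA e mulrCA.
Qed.

End commutation.
End bergman_projection.

(** * Gaussian moments and homogeneity *)

Section gaussian_moment.
Variable R : realType.
Local Notation P := (measurableTypeR R * measurableTypeR R)%type.
Local Notation mu := (@lebesgue2 R).

Definition sqn (p : P) : R := p.1 ^+ 2 + p.2 ^+ 2.

Lemma sqn_ge0 p : 0 <= sqn p. Proof. by rewrite addr_ge0// sqr_ge0. Qed.

Lemma measurable_sqn : measurable_fun setT sqn.
Proof.
apply: measurable_funD; apply: measurable_funX; first exact: measurable_fst.
exact: measurable_snd.
Qed.

Definition gauss (a : R) (p : P) : R := sqn p `^ a * expR (- sqn p).

Lemma gauss_ge0 a p : 0 <= gauss a p.
Proof. by rewrite mulr_ge0 ?powR_ge0// expR_ge0. Qed.

Lemma measurable_expR_sqn (c : R) : measurable_fun setT (fun p => expR (- (c * sqn p))).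
Proof.
apply: measurableT_comp => //; apply: measurableT_comp => //.
by apply: measurable_funM => //; exact: measurable_sqn.
Qed.

Lemma measurable_sqn_powR (a : R) : measurable_fun setT (fun p => sqn p `^ a).
Proof. exact: (measurableT_comp (measurable_powR a) measurable_sqn). Qed.

Lemma measurable_gauss a : measurable_fun setT (gauss a).
Proof.
apply: measurable_funM; first exact: measurable_sqn_powR.
by have := measurable_expR_sqn 1; under eq_fun do rewrite mul1r.
Qed.

Let sub_square r : 0 < r -> [set p | sqn p <= r] `<=` square (0, 0) (Num.sqrt r).
Proof.
move=> r0 p /= pr; have sr := sqr_sqrtr (ltW r0).
have h (x : R) : x ^+ 2 <= r -> `|x| <= Num.sqrt r.
  move=> xr; rewrite -(@ler_pXn2r _ 2)// ?nnegrE ?sqrtr_ge0//.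
  by rewrite sr real_normK ?num_real.
apply/squareP; rewrite /= !subr0; move: pr; rewrite /sqn => pr.
have := sqr_ge0 p.1; have := sqr_ge0 p.2; move=> h1 h2.
by split; apply: h; lra.
Qed.

Let mle r : measurable [set p | sqn p <= r].
Proof. by rewrite -[X in measurable X]setTI; apply: measurable_fun_le => //; exact: measurable_sqn. Qed.

Lemma gauss_lty a : 0 <= a -> (\int[mu]_p (gauss a p)%:E < +oo)%E.
Proof.
move=> a0; pose D := [set p : P | 0 < sqn p].
have mD : measurable D.
  rewrite (_ : D = ~` [set p | sqn p <= 0]); first exact: measurableC.
  by apply/seteqP; split => p /=; rewrite /D /= ltNge => /negP.
have mg (E : set P) : measurable_fun E (fun p => (gauss a p)%:E).
  by apply/measurable_EFinP; apply: measurable_funTS; exact: measurable_gauss.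
have mle4 r : 0 < r -> (mu [set p | (sqn p <= r)%R] <= (4 * r)%:E)%E.
  move=> r0; have q0 : 0 < Num.sqrt r by rewrite sqrtr_gt0.
  have [mS LS] := lebesgue2_square (0, 0) q0.
  apply: (@le_trans _ _ (mu (square (0, 0) (Num.sqrt r)))).
    by apply: le_measure; rewrite ?inE//; exact: sub_square.
  by rewrite [leLHS]LS lee_fin exprMn sqr_sqrtr ?(ltW r0)// expr2; lra.
have g0 (p : P) : (D `|` ~` D) p -> (0 <= (gauss a p)%:E)%E by rewrite lee_fin gauss_ge0.
have dD : [disjoint D & ~` D] by apply/disj_setPRL => p.
rewrite -(setUv D) (ge0_integral_setU _ mD (measurableC mD) (mg _) g0 dD).
apply: lte_add_pinfty.
  apply: (integral_powR_expR_lty (C := 4) mD measurable_sqn) => //; first lra.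
  move=> r r0; apply: le_trans (mle4 r r0); apply: le_measure; rewrite ?inE//.
  exact: measurableI.
apply: (@le_lt_trans _ _ (\int[mu]_(p in ~` D) (cst 1%:E p)))%E.
  apply: ge0_le_integral => //; first exact: measurableC.
  - by move=> p _; rewrite lee_fin gauss_ge0.
  - by move=> p /= /negP; rewrite -leNgt => p0; rewrite lee_fin /gauss
      (_ : sqn p = 0) ?oppr0 ?expR0 ?mulr1 /powR ?eqxx ?lern1 ?leq_b1//;
      apply/eqP; rewrite eq_le p0 sqn_ge0.
rewrite integral_cst; last exact: measurableC.
rewrite mul1e; apply: (@le_lt_trans _ _ (mu [set p | (sqn p <= 1)%R])).
  apply: le_measure; rewrite ?inE//; first exact: measurableC.
  by move=> p /= /negP; rewrite -leNgt => /le_trans; apply.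
by apply: le_lt_trans (mle4 1 ltr01) _; rewrite ltry.
Qed.

Lemma integrable_gauss a : 0 <= a -> mu.-integrable setT (EFin \o gauss a).
Proof.
move=> a0; apply/integrableP; split; first by apply/measurable_EFinP; exact: measurable_gauss.
apply: le_lt_trans (gauss_lty a0); rewrite le_eqVlt; apply/orP; left; apply/eqP.
by apply: eq_integral => p _ /=; rewrite ger0_norm// gauss_ge0.
Qed.

(** Equal to pi Gamma(a + 1). *)
Definition gauss_moment (a : R) : R := (\int[mu]_p gauss a p)%R.

Lemma gauss_momentE a : 0 <= a -> (\int[mu]_p (gauss a p)%:E)%E = (gauss_moment a)%:E.
Proof.
by move=> a0; rewrite /gauss_moment /Rintegral fineK//; apply: integrable_fin_num => //; exact: integrable_gauss.
Qed.

Lemma gauss_moment_gt0 a : 0 <= a -> 0 < gauss_moment a.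
Proof.
move=> a0; rewrite -lte_fin -gauss_momentE//.
pose c : P := (2, 0).
have [mS LS] := lebesgue2_square c (@ltr01 R).
have h1 : (0 < \int[mu]_(p in square c 1) (gauss a p)%:E)%E.
  apply: ge0_integral_gt0 => //.
  - by apply/measurable_EFinP; apply: measurable_funTS; exact: measurable_gauss.
  - move=> p /squareP[/= h _]; rewrite lte_fin mulr_gt0 ?expR_gt0// powR_gt0//.
    move: h; rewrite ler_distl => /andP[h _]; rewrite /sqn ltr_wpDr ?sqr_ge0// exprn_gt0//; lra.
  - by rewrite [ltRHS]LS lte_fin exprn_gt0// mulr1.
apply: (lt_le_trans h1); apply: ge0_subset_integral => //.
- by apply/measurable_EFinP; exact: measurable_gauss.
- by move=> p _; rewrite lee_fin gauss_ge0.
Qed.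

Lemma gauss_dilate a s : 0 <= a -> 0 < s ->
  (\int[mu]_p (sqn p `^ a * expR (- (s ^+ 2 * sqn p)))%:E)%E = ((s ^+ 2) `^ (- (a + 1)) * gauss_moment a)%:E.
Proof.
move=> a0 s0; have s20 : 0 < s ^+ 2 by rewrite exprn_gt0.
have := @ge0_integral_scales _ _ _ mu _ _ (fun p => (gauss a p)%:E) (lebesgue2_dilate s0).
move=> /(_ _ _ _) e; rewrite gauss_momentE// in e.
have {}e := e _ _ _.
transitivity (((s ^+ 2) `^ (- a))%:E * \int[mu]_p (gauss a (s * p.1, s * p.2))%:E)%E.
  rewrite -ge0_integralZl//; last 3 first.
  - apply/measurable_EFinP; apply: (measurableT_comp (measurable_gauss a)).
    by have [] := lebesgue2_dilate s0.
  - by move=> p _; rewrite lee_fin gauss_ge0.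
  - by rewrite lee_fin powR_ge0.
  apply: eq_integral => p _; rewrite -EFinM; congr EFin.
  rewrite /gauss (_ : sqn (s * p.1, s * p.2) = s ^+ 2 * sqn p); last by rewrite /sqn /=; ring.
  rewrite (powRM a (ltW s20) (sqn_ge0 p)) !mulrA -powRD ?addNr ?powRr0 ?mul1r//.
  by rewrite (gt_eqF s20) implybT.
rewrite e; last 3 first.
- by rewrite invr_ge0 ltW.
- by apply/measurable_EFinP; exact: measurable_gauss.
- by move=> p; rewrite lee_fin gauss_ge0.
have -> : (s ^+ 2) `^ (- (a + 1)) = (s ^+ 2) `^ (- a) * s ^- 2.
  by rewrite opprD powRD ?(gt_eqF s20) ?implybT// powR_inv1// ltW.
by rewrite -!EFinM mulrA.
Qed.

(** In place of integration by parts: exp(-t) <= exp(-c t) + (c - 1) t exp(-t), integrated against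
    |z|^(2a) with t = |z|^2, gives G0 <= c^(-(a+1)) G0 + (c - 1) G1 for all c > 0, with equality at
    c = 1. The derivative of the right side at c = 1 is therefore 0. *)
Lemma gauss_moment_rec a : 0 <= a -> gauss_moment (a + 1) = (a + 1) * gauss_moment a.
Proof.
move=> a0; have a10 : 0 <= a + 1 by rewrite addr_ge0.
set G0 := gauss_moment a; set G1 := gauss_moment (a + 1).
pose phi (c : R) := c `^ (- (a + 1)) * G0 + (c - 1) * G1.
have phi_min (c : R) : 0 < c -> G0 <= phi c.
  move=> c0; pose s := Num.sqrt c; have s0 : 0 < s by rewrite sqrtr_gt0.
  have sc : s ^+ 2 = c by rewrite sqr_sqrtr// ltW.
  pose k p := sqn p `^ a * expR (- (c * sqn p)).
  have kE : (\int[mu]_p (k p)%:E)%E = (c `^ (- (a + 1)) * G0)%:E.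
    by have := gauss_dilate a0 s0; rewrite sc.
  have k0 p : 0 <= k p by rewrite mulr_ge0 ?powR_ge0// expR_ge0.
  have ik : mu.-integrable setT (EFin \o k).
    apply/integrableP; split.
      apply/measurable_EFinP; apply: measurable_funM; first exact: measurable_sqn_powR.
      exact: measurable_expR_sqn.
    rewrite (_ : (\int[mu]_x _)%E = (c `^ (- (a + 1)) * G0)%:E) ?ltry// -kE.
    by apply: eq_integral => p _ /=; rewrite ger0_norm.
  have ig1 := integrable_gauss a10.
  have ig1' : mu.-integrable setT (EFin \o (fun p => (c - 1) * gauss (a + 1) p)).
    by have := integrableZl measurableT (c - 1) ig1.
  have -> : phi c = (\int[mu]_p (k p + (c - 1) * gauss (a + 1) p))%R.
    rewrite RintegralD// RintegralZl//; congr (_ + _).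
    by rewrite /Rintegral kE.
  apply: le_Rintegral => //; first exact: integrable_gauss.
    by have := integrableD measurableT ik ig1'.
  move=> p _; rewrite /gauss /k.
  have -> : sqn p `^ (a + 1) = sqn p `^ a * sqn p.
    have [->|p0] := eqVneq (sqn p) 0.
      by rewrite mulr0 powR0// gt_eqF// ltr_wpDl.
    by rewrite powRD ?p0 ?implybT// powRr1// sqn_ge0.
  have -> : expR (- (c * sqn p)) = expR (- sqn p) * expR (- ((c - 1) * sqn p)).
    by rewrite -expRD; congr expR; ring.
  have := expR_ge1Dx (- ((c - 1) * sqn p)).
  have : 0 <= sqn p `^ a * expR (- sqn p) by rewrite mulr_ge0 ?powR_ge0// expR_ge0.
  have key (x y z t : R) : 0 <= x * y -> 1 - (c - 1) * t <= z ->
      x * y <= x * (y * z) + (c - 1) * (x * t * y).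
    move=> h1 h2; have : 0 <= x * y * (z - (1 - (c - 1) * t)) by rewrite mulr_ge0// subr_ge0.
    nra.
  exact: key.
have phi1 : phi 1 = G0 by rewrite /phi subrr mul0r addr0 powR1 mul1r.
have dphi (c : R) : 0 < c -> is_derive c 1 phi (- (a + 1) * c `^ (- (a + 1) - 1) * G0 + G1).
  move=> c0; have d1 := is_derive1_powR (- (a + 1)) c0.
  rewrite /phi; apply: is_derive_eq.
  by rewrite /GRing.scale /=; ring.
have : is_derive (1 : R) 1 phi 0.
  apply: (@derive1_at_min R phi 0 2 1) => //.
  - by move=> t; rewrite in_itv/= => /andP[t0 _]; have [] := dphi t t0.
  - by rewrite in_itv/= ltr01 ltr1n.
  - by move=> t; rewrite in_itv/= => /andP[t0 _]; rewrite phi1 phi_min.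
have [_ e1] := dphi 1 ltr01; move=> [_ e0]; move: e1; rewrite e0 powR1 => /eqP.
by rewrite eq_sym addrC mulr1 mulNr subr_eq0 => /eqP.
Qed.

End gaussian_moment.

Section radial_measure.
Variables (R : realType) (n : nat).
Local Notation P := (measurableTypeR R * measurableTypeR R)%type.
Local Notation X := (n.-tuple P).
Local Notation normc := (@Normc.normc R).
Local Notation L := (lebesgueC R n).
Implicit Types (a b : 'I_n -> R) (x : X).

Definition pw a x : R := \prod_j sqn (tnth x j) `^ a j.

Lemma sqn_zc x j : sqn (tnth x j) = normc (zc x j) ^+ 2.
Proof. by rewrite /zc /sqn /= sqr_sqrtr// addr_ge0 ?sqr_ge0. Qed.

Lemma normsqE x : normsq x = \sum_j sqn (tnth x j).
Proof. by apply: eq_bigr => j _; rewrite sqn_zc. Qed.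

Lemma pw_ge0 a x : 0 <= pw a x.
Proof. by apply: prodr_ge0 => j _; exact: powR_ge0. Qed.

Lemma measurable_pw a : measurable_fun setT (pw a).
Proof.
rewrite /pw; under eq_fun do rewrite -big_enum.
apply: measurable_prod => j _.
exact: (measurableT_comp (measurable_sqn_powR (a j)) (measurable_tnth j)).
Qed.

Lemma pw_le1 a x : (forall j, 0 <= a j) -> normsq x <= 1 -> pw a x <= 1.
Proof.
move=> a0 x1; apply: prodr_ile1 => j _; rewrite powR_ge0/=.
have s1 : sqn (tnth x j) <= 1.
  apply: le_trans x1; rewrite normsqE (bigD1 j)//= lerDl.
  by apply: sumr_ge0 => i _; exact: sqn_ge0.
have <- : 1 `^ a j = 1 by rewrite powR1.
by apply: ge0_ler_powR; rewrite ?nnegrE ?sqn_ge0.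
Qed.

Lemma pw_dilate a x s : 0 < s -> (forall j, 0 <= a j) ->
  pw a (dilate s x) = (s ^+ 2) `^ (\sum_j a j) * pw a x.
Proof.
move=> s0 a0; have s20 : 0 < s ^+ 2 by rewrite exprn_gt0.
have -> : (s ^+ 2) `^ (\sum_j a j) = \prod_j (s ^+ 2) `^ a j.
  elim/big_rec2: _ => [|j y z _ <-]; first by rewrite powRr0.
  by rewrite powRD// (gt_eqF s20) implybT.
rewrite -big_split; apply: eq_bigr => j _ /=.
rewrite -powRM ?(ltW s20) ?sqn_ge0//; congr (_ `^ _).
by rewrite !sqn_zc zc_dilate Normc.normcM normc_real exprMn real_normK ?num_real.
Qed.

Definition pw_ball a : R := fine (\int[L]_(x in [set x | normsq x < 1]) (pw a x)%:E).

Let mpw a (D : set X) : measurable_fun D (fun x => (pw a x)%:E).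
Proof. by apply/measurable_EFinP; apply: measurable_funTS; exact: measurable_pw. Qed.

Lemma pw_ball_fin a : (forall j, 0 <= a j) ->
  (\int[L]_(x in [set x | (normsq x < 1)%R]) (pw a x)%:E = (pw_ball a)%:E)%E.
Proof.
move=> a0; rewrite /pw_ball fineK// ge0_fin_numE; last first.
  by apply: integral_ge0 => x _; rewrite lee_fin pw_ge0.
apply: le_lt_trans (volume_lty R n); rewrite -[leRHS]mul1e -integral_cst; last exact: measurable_normsq_lt.
apply: ge0_le_integral => //; first exact: measurable_normsq_lt.
- by move=> x _; rewrite lee_fin pw_ge0.
- by move=> x /= x1; rewrite lee_fin pw_le1// ltW.
Qed.

Lemma pw_ball_gt0 a : (forall j, 0 <= a j) -> 0 < pw_ball a.
Proof.
move=> a0; rewrite -lte_fin -pw_ball_fin//.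
have [rho [r0 r1]] : exists rho : 'I_n -> R, (forall j, 0 < rho j) /\ \sum_j rho j ^+ 2 < 1.
  exact: inner_radius.
have [c [e [e0 H]]] := inner_box r0 r1.
have [mB LB] := box_volume c e0.
have h1 : (0 < \int[L]_(x in box c e) (pw a x)%:E)%E.
  apply: ge0_integral_gt0 => //.
  - move=> x /H[_ h]; rewrite lte_fin; apply: prodr_gt0 => j _; apply: powR_gt0.
    by rewrite sqn_zc exprn_gt0//; apply: lt_le_trans (h j).
  - by rewrite [ltRHS]LB lte_fin !exprn_gt0// mulr_gt0.
apply: (lt_le_trans h1); apply: ge0_subset_integral => //.
- exact: measurable_normsq_lt.
- by move=> x _; rewrite lee_fin pw_ge0.
- by move=> x /H[].
Qed.

Lemma pw_ball_scale a r : 0 < r -> (forall j, 0 <= a j) ->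
  (\int[L]_(x in [set x | (normsq x < r)%R]) (pw a x)%:E =
    (r ^+ n * r `^ (\sum_j a j))%:E * (pw_ball a)%:E)%E.
Proof.
move=> r0 a0; pose s := Num.sqrt r; have s0 : 0 < s by rewrite sqrtr_gt0.
have sr : s ^+ 2 = r by rewrite sqr_sqrtr// ltW.
pose D := [set x : X | normsq x < r].
have mD : measurable D by exact: measurable_normsq_lt.
have mf : measurable_fun setT ((fun x => (pw a x)%:E) \_ D).
  by apply/(measurable_restrictT _ _).1.
have f0 x : (0 <= ((fun x => (pw a x)%:E) \_ D) x)%E.
  by rewrite patchE; case: ifP => // _; rewrite lee_fin pw_ge0.
have c0 : 0 <= (s ^- 2) ^+ n by rewrite exprn_ge0// invr_ge0 exprn_ge0// ltW.
have E : (\int[L]_x ((fun x => (pw a x)%:E) \_ D) (dilate s x) =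
    (r `^ (\sum_j a j))%:E * (pw_ball a)%:E)%E.
  rewrite -pw_ball_fin// -ge0_integralZl//; last 3 first.
  - exact: measurable_normsq_lt.
  - by move=> x _; rewrite lee_fin pw_ge0.
  - by rewrite lee_fin powR_ge0.
  rewrite [RHS]integral_mkcond; apply: eq_integral => x _.
  rewrite !patchE; have -> : (dilate s x \in D) = (x \in [set x : X | normsq x < 1]).
    have e : (normsq (dilate s x) < r) = (normsq x < 1).
      by rewrite normsq_dilate sr -[ltRHS]mulr1 ltr_pM2l.
    by apply/idP/idP => /set_mem h; apply/mem_set; move: h; rewrite /D /= e.
  by case: ifP => // _; rewrite pw_dilate// sr EFinM.
have := ge0_integral_scales (@scales_dilate R n s s0) c0 mf f0.
rewrite E -integral_mkcond.
rewrite sr => e; rewrite EFinM -muleA [X in (_ * X)%E]e muleA -EFinM -exprMn divff ?gt_eqF//.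
by rewrite expr1n mul1e.
Qed.

Definition pw_dist a : {measure set R -> \bar R} :=
  measure_function_pushforward__canonical__measure_function_Measure
    (mdens L (pw_ge0 a) (measurable_pw a)) (@measurable_normsq R n).

Lemma ge0_integral_pw_dist a (rho : R -> R) : measurable_fun setT rho -> (forall t, 0 <= rho t) ->
  (\int[pw_dist a]_t (rho t)%:E = \int[L]_x (pw a x * rho (normsq x))%:E)%E.
Proof.
move=> mr r0.
have mrn : measurable_fun setT (fun x : X => (rho (normsq x))%:E).
  by apply/measurable_EFinP; exact: (measurableT_comp mr (@measurable_normsq R n)).
rewrite /pw_dist ge0_integral_pushforward//; last 3 first.
- exact: measurable_normsq.
- by apply/measurable_EFinP.
- by move=> t _; rewrite lee_fin.
rewrite preimage_setT ge0_integral_mdens//; last by move=> x; rewrite lee_fin.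
by apply: eq_integral => x _; rewrite -EFinM mulrC.
Qed.

(* By homogeneity the law of |z|^2 under |z^a|^2 dz depends on a only through its degree. *)
Lemma pw_dist_degree a b A : (forall j, 0 <= a j) -> (forall j, 0 <= b j) ->
  \sum_j a j = \sum_j b j -> measurable A ->
  ((pw_ball b)%:E * pw_dist a A = (pw_ball a)%:E * pw_dist b A)%E.
Proof.
move=> a0 b0 ab mA.
have distE (c : 'I_n -> R) (r : R) : (forall j, 0 <= c j) -> pw_dist c `]-oo, r[%classic =
    (if (0 < r)%R then (r ^+ n * r `^ (\sum_j c j))%:E * (pw_ball c)%:E else 0)%E.
  move=> c0; rewrite -[LHS]/(\int[L]_(x in @normsq R n @^-1` `]-oo, r[%classic) (pw c x)%:E)%E.
  rewrite (_ : _ @^-1` _ = [set x | normsq x < r]); last first.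
    by apply/seteqP; split => x /=; rewrite in_itv.
  case: ifP => [r0|/negbT]; first by rewrite pw_ball_scale.
  rewrite -leNgt => r0; rewrite (_ : [set x | _] = set0) ?integral_set0//.
  by apply/seteqP; split => x //= /lt_le_trans/(_ r0); rewrite ltNge normsq_ge0.
pose ka := NngNum (ltW (pw_ball_gt0 a0)); pose kb := NngNum (ltW (pw_ball_gt0 b0)).
rewrite -[LHS]/(mscale kb (pw_dist a) A) -[RHS]/(mscale ka (pw_dist b) A).
apply: (@measure_unique _ _ _ (@RGenInftyO.G R) (fun k => `]-oo, k%:R[%classic)).
- exact: RGenInftyO.measurableE.
- move=> _ _ [r ->] [s ->]; exists (Num.min r s).
  by apply/seteqP; split => t /=; rewrite !in_itv/= lt_min => /andP.
- by move=> k; exists k%:R.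
- apply/seteqP; split => // t _; exists (Num.bound `|t|) => //=.
  by rewrite in_itv/=; apply: le_lt_trans (ler_norm t) (archi_boundP (normr_ge0 t)).
- move=> _ [r ->]; rewrite -[LHS]/((pw_ball b)%:E * pw_dist a _)%E -[RHS]/((pw_ball a)%:E * pw_dist b _)%E.
  rewrite (distE a r a0) (distE b r b0) ab; case: ifP => _; last by rewrite !mule0.
  by rewrite -!EFinM; congr EFin; ring.
- move=> k; rewrite -[ltLHS]/((pw_ball b)%:E * pw_dist a _)%E (distE _ _ a0).
  by case: ifP => _; [rewrite -!EFinM ltry|rewrite mule0 ltry].
- exact: mA.
Qed.

Lemma pw_radial a b (rho : R -> R) : (forall j, 0 <= a j) -> (forall j, 0 <= b j) ->
  \sum_j a j = \sum_j b j -> measurable_fun setT rho -> (forall t, 0 <= rho t) ->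
  ((pw_ball b)%:E * \int[L]_x (pw a x * rho (normsq x))%:E =
   (pw_ball a)%:E * \int[L]_x (pw b x * rho (normsq x))%:E)%E.
Proof.
move=> a0 b0 ab mr r0; rewrite -(ge0_integral_pw_dist a mr r0) -(ge0_integral_pw_dist b mr r0).
pose ka := NngNum (ltW (pw_ball_gt0 a0)); pose kb := NngNum (ltW (pw_ball_gt0 b0)).
have mrE : measurable_fun setT (fun t => (rho t)%:E) by apply/measurable_EFinP.
have rE (t : R) : setT t -> (0 <= (rho t)%:E)%E by rewrite lee_fin.
have := ge0_integral_mscale (pw_dist a) measurableT kb mrE rE.
have := ge0_integral_mscale (pw_dist b) measurableT ka mrE rE.
move=> /= <- <-; apply: eq_measure_integral => A mA _.
exact: pw_dist_degree.
Qed.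

Definition gauss_prod a : R := \prod_j gauss_moment (a j).

Lemma gauss_prodE a : (forall j, 0 <= a j) ->
  (\int[L]_x (pw a x * expR (- normsq x))%:E = (gauss_prod a)%:E)%E.
Proof.
move=> a0; have := ge0_integral_tuple_prod (m := @lebesgue2 R)
  (fun j => measurable_gauss (a j)) (fun j p => gauss_ge0 (a j) p) (fun j => gauss_momentE (a0 j)).
move=> <-; apply: eq_integral => x _; congr EFin.
by rewrite /pw normsqE -sumrN expR_sum -big_split.
Qed.

(** [pw_radial] is applied to rho and to exp(-t), and the integrals over the ball are eliminated. So
    two radial integrals of equal degree are in the ratio of the products of Gaussian moments. *)
Lemma gauss_prod_radial a b (rho : R -> R) (I J : R) : (forall j, 0 <= a j) -> (forall j, 0 <= b j) ->
  \sum_j a j = \sum_j b j -> measurable_fun setT rho -> (forall t, 0 <= rho t) ->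
  (\int[L]_x (pw a x * rho (normsq x))%:E = I%:E)%E ->
  (\int[L]_x (pw b x * rho (normsq x))%:E = J%:E)%E ->
  I * gauss_prod b = J * gauss_prod a.
Proof.
move=> a0 b0 ab mr r0 eI eJ.
have := pw_radial a0 b0 ab mr r0; rewrite eI eJ -!EFinM => -[e1].
have me : measurable_fun setT (fun t : R => expR (- t)) by exact: measurableT_comp.
have := pw_radial a0 b0 ab me (fun t => expR_ge0 _).
rewrite (gauss_prodE a0) (gauss_prodE b0) -!EFinM => -[e2].
have Va := pw_ball_gt0 a0; have Vb := pw_ball_gt0 b0.
apply: (mulfI (lt0r_neq0 Va)); apply: (mulfI (lt0r_neq0 Vb)).
move: e1 e2; move: (pw_ball a) (pw_ball b) (gauss_prod a) (gauss_prod b) => u v p q e1 e2.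
transitivity ((v * I) * (u * q)); first by ring.
by rewrite e1 -e2; ring.
Qed.

End radial_measure.

(** * Rigidity of the eigenvalues *)

Section several_variables.
Variables (R : realType) (n : nat).
Implicit Types (l m : 'I_n -> nat) (G H : ('I_n -> nat) -> R[i]).

Definition upd l (j : 'I_n) (i : nat) : 'I_n -> nat := fun k => if k == j then i else l k.

(* Replacing the coordinates of l0 and l1 one at a time by common ones keeps both functions nonzero. *)
Lemma multi_moment_seq_mul0 G H : (forall l j, moment_seq (fun i => G (upd l j i))) ->
  (forall l j, moment_seq (fun i => H (upd l j i))) ->
  (forall l, (forall j, (0 < l j)%N) -> G l * H l = 0) ->
  (forall l, (forall j, (0 < l j)%N) -> G l = 0) \/ (forall l, (forall j, (0 < l j)%N) -> H l = 0).
Proof.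
move=> mG mH GH; apply: contrapT => /not_orP[].
move=> /existsNP[l0 /not_implyP[l0p /eqP G0]] /existsNP[l1 /not_implyP[l1p /eqP H1]].
pose mix (x l : 'I_n -> nat) (k : nat) : 'I_n -> nat := fun j => if (j < k)%N then x j else l j.
have step k : (k <= n)%N -> exists x, [/\ forall j, (0 < x j)%N, G (mix x l0 k) != 0 & H (mix x l1 k) != 0].
  elim: k => [_|k ih kn]; first by exists l0.
  have [x [xp Gx Hx]] := ih (ltnW kn); pose j := Ordinal kn.
  have mixE l i : mix (upd x j i) l k.+1 = upd (mix x l k) j i.
    apply/funext => t; rewrite /mix /upd ltnS leq_eqVlt.
    have [->|tj] := eqVneq t j; first by rewrite eqxx.
    by rewrite (_ : (t == k :> nat) = false)//; apply: contraNF tj => /eqP tk; apply/eqP/val_inj.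
  have mixK l : mix x l k = upd (mix x l k) j (l j).
    by apply/funext => t; rewrite /mix /upd; case: eqP => [->|//]; rewrite ltnn.
  have [i [i0 GHi]] : exists i, (0 < i)%N /\ G (upd (mix x l0 k) j i) * H (upd (mix x l1 k) j i) != 0.
    apply: contrapT => h.
    have hz i : (0 < i)%N -> G (upd (mix x l0 k) j i) * H (upd (mix x l1 k) j i) = 0.
      by move=> i0; apply: contrapT => /eqP e; apply: h; exists i.
    have [z|z] := moment_seq_mul0 (mG (mix x l0 k) j) (mH (mix x l1 k) j) hz.
      by move/eqP: Gx; apply; rewrite mixK; exact: z.
    by move/eqP: Hx; apply; rewrite mixK; exact: z.
  move: GHi; rewrite mulf_eq0 negb_or => /andP[g h].
  exists (upd x j i); split; rewrite ?mixE// => t.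
  by rewrite /upd; case: eqP.
have [x [xp Gx Hx]] := step n (leqnn n).
have mixn l : mix x l n = x by apply/funext => j; rewrite /mix ltn_ord.
by move: Gx Hx; rewrite !mixn => Gx Hx; have /eqP := GH x xp; rewrite mulf_eq0 (negbTE Gx) (negbTE Hx).
Qed.

End several_variables.

Section ratio_rigidity.
Variable R : realFieldType.
Implicit Types u v p w s t : R.

(** The equations say that s (v - u) w (p + t) = t (p - w) u (v + s), and the same after u, v are
    raised and p, w lowered by 1. If u < v, both sides are positive, and the change lowers the left
    one and raises the right one. Exchanging roles excludes v < u. *)
Lemma shifted_ratio_eq u v p w s t : 0 < s -> 0 <= t -> 0 < u -> 0 < v -> 1 < p -> 1 < w ->
  (u + s) * (p + t) * v * w = (v + s) * (w + t) * u * p ->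
  (u + 1 + s) * (p - 1 + t) * (v + 1) * (w - 1) = (v + 1 + s) * (w - 1 + t) * (u + 1) * (p - 1) ->
  u = v.
Proof.
have main u' v' p' w' : 0 < s -> 0 <= t -> 0 < u' -> 0 < v' -> 1 < p' -> 1 < w' ->
    s * (v' - u') * (w' * (p' + t)) = t * (p' - w') * (u' * (v' + s)) ->
    s * (v' - u') * ((w' - 1) * (p' - 1 + t)) = t * (p' - w') * ((u' + 1) * (v' + 1 + s)) ->
    v' <= u'.
  move=> s0 t0 u0 v0 p1 w1 e1 e2; rewrite leNgt; apply/negP => uv.
  have a0 : 0 < s * (v' - u') by rewrite mulr_gt0// subr_gt0.
  have X : (w' - 1) * (p' - 1 + t) < w' * (p' + t) by nra.
  have Y : u' * (v' + s) < (u' + 1) * (v' + 1 + s) by nra.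
  have b0 : 0 < t * (p' - w').
    rewrite -(pmulr_lgt0 _ (_ : 0 < u' * (v' + s))); last by rewrite mulr_gt0// addr_gt0.
    by rewrite -e1 mulr_gt0// mulr_gt0//; lra.
  have := ltr_pM2l a0 ((w' - 1) * (p' - 1 + t)) (w' * (p' + t)); rewrite X e1 e2 ltr_pM2l//.
  by rewrite ltNge (ltW Y).
move=> s0 t0 u0 v0 p1 w1 e1 e2; apply/eqP; rewrite eq_le.
have d1 : s * (v - u) * (w * (p + t)) = t * (p - w) * (u * (v + s)).
  apply/eqP; rewrite -subr_eq0; apply/eqP.
  transitivity ((u + s) * (p + t) * v * w - (v + s) * (w + t) * u * p); first by ring.
  by rewrite e1 subrr.
have d2 : s * (v - u) * ((w - 1) * (p - 1 + t)) = t * (p - w) * ((u + 1) * (v + 1 + s)).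
  apply/eqP; rewrite -subr_eq0; apply/eqP.
  transitivity ((u + 1 + s) * (p - 1 + t) * (v + 1) * (w - 1) - (v + 1 + s) * (w - 1 + t) * (u + 1) * (p - 1)); first by ring.
  by rewrite e2 subrr.
apply/andP; split; last exact: (main u v p w).
apply: (main v u w p) => //.
  apply/eqP; rewrite -subr_eq0; apply/eqP.
  transitivity (- ((u + s) * (p + t) * v * w - (v + s) * (w + t) * u * p)); first by ring.
  by rewrite e1 subrr oppr0.
apply/eqP; rewrite -subr_eq0; apply/eqP.
transitivity (- ((u + 1 + s) * (p - 1 + t) * (v + 1) * (w - 1) - (v + 1 + s) * (w - 1 + t) * (u + 1) * (p - 1))); first by ring.
by rewrite e2 subrr oppr0.
Qed.

End ratio_rigidity.

Section gauss_ratio.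
Variables (R : realType) (s : R) (s0 : 0 <= s).

(** Gamma(x + s + 1) / Gamma(x + 1). *)
Definition gauss_ratio (x : nat) : R := gauss_moment (x%:R + s) / gauss_moment x%:R.

Lemma gauss_ratio_gt0 x : 0 < gauss_ratio x.
Proof. by rewrite divr_gt0// gauss_moment_gt0// addr_ge0. Qed.

Lemma gauss_ratioS x : gauss_ratio x.+1 = gauss_ratio x * ((x.+1%:R + s) / x.+1%:R).
Proof.
rewrite /gauss_ratio -natr1 (_ : x%:R + 1 + s = x%:R + s + 1); last by ring.
rewrite !gauss_moment_rec// ?addr_ge0//.
have h : gauss_moment x%:R != 0 :> R by rewrite gt_eqF// gauss_moment_gt0.
have h' : (x%:R + 1 : R) != 0 by rewrite natr1 pnatr_eq0.
by field; rewrite h h'.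
Qed.

Lemma gauss_ratio_le x y : (x <= y)%N -> gauss_ratio x <= gauss_ratio y.
Proof.
move=> /subnK <-; elim: (y - x)%N => [//|k ih]; rewrite addSn; apply: le_trans ih _.
rewrite gauss_ratioS ler_peMr ?(ltW (gauss_ratio_gt0 _))//.
by rewrite ler_pdivlMr ?ltr0n// mul1r lerDl.
Qed.

(** The ratio is its value at 0 times a product of factors 1 + s/i, which is at least 1 + s times a
    harmonic sum. *)
Lemma gauss_ratio_unbounded (B : R) : 0 < s -> exists x, B < gauss_ratio x.
Proof.
move=> sp; have low N : gauss_ratio 0 * (1 + s * \sum_(i < N) (i.+1%:R)^-1) <= gauss_ratio N.
  elim: N => [|N ih]; first by rewrite big_ord0 mulr0 addr0 mulr1.
  have w0 := gauss_ratio_gt0 0.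
  have : gauss_ratio 0 <= gauss_ratio N by exact: gauss_ratio_le.
  rewrite big_ord_recr /= gauss_ratioS mulrDl divff ?pnatr_eq0//.
  have : 0 <= s * N.+1%:R^-1 by rewrite mulr_ge0// invr_ge0.
  have key (a b S q : R) : a * (1 + s * S) <= b -> 0 <= s * q -> a <= b ->
      a * (1 + s * (S + q)) <= b * (1 + s * q).
    move=> h1 h2 h3; have : 0 <= (b - a) * (s * q) by rewrite mulr_ge0// subr_ge0.
    by nra.
  by move=> h1 h2; exact: key.
have w0 := gauss_ratio_gt0 0.
have [N HN] := @thickT R (`|B| / gauss_ratio 0 / s).
exists N.+1; apply: (@lt_le_trans _ _ (gauss_ratio 0 * (1 + s * \sum_(i < N) (i.+1%:R)^-1))); last first.
  by apply: le_trans (low N) _; exact: gauss_ratio_le.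
have {}HN : `|B| / gauss_ratio 0 <= s * \sum_(i < N) (i.+1%:R)^-1.
  rewrite [leRHS]mulrC -ler_pdivrMr//; apply: le_trans HN _.
  rewrite (eq_bigl xpredT); last by move=> i; rewrite asboolT.
  case: N {low} => [|N]; first by rewrite !big_ord0.
  rewrite big_ord_recl invr0 add0r [leRHS]big_ord_recr /= ler_wpDr ?invr_ge0//.
rewrite -ltr_pdivrMl// mulrC; apply: (le_lt_trans (y := `|B| / gauss_ratio 0)).
  by rewrite ler_pM2r ?invr_gt0// ler_norm.
lra.
Qed.

End gauss_ratio.

(** * Eigenvalues that agree under all positive shifts *)

Section eigenvalue_rigidity.
Variables (R : realType) (n : nat) (s : 'I_n -> R) (s0 : forall j, 0 <= s j).
Local Notation normc := (@Normc.normc R).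
Implicit Types (l m k : 'I_n -> nat).
(** These stand for the integrals of g |z^m|^2 and of |z^m|^2, of which the hypotheses below collect
    the relevant properties. *)
Variables (Num Den : ('I_n -> nat) -> R[i]) (M : R).

Definition deg m : nat := \sum_j m j.
Definition addm m l : 'I_n -> nat := fun j => (m j + l j)%N.
Definition gshift m : R := \prod_j gauss_moment ((m j)%:R + s j).
Definition gbase m : R := \prod_j gauss_moment (m j)%:R.

Hypothesis Num_deg : forall m k, deg m = deg k -> Num m * (gshift k)%:C%C = Num k * (gshift m)%:C%C.
Hypothesis Den_deg : forall m k, deg m = deg k -> Den m * (gbase k)%:C%C = Den k * (gbase m)%:C%C.
Hypothesis Den_neq0 : forall m, Den m != 0.
Hypothesis Num_le : forall m, normc (Num m / Den m) <= M.
Hypothesis Num_moment : forall l j, moment_seq (fun i => Num (upd l j i)).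
Hypothesis Den_moment : forall l j, moment_seq (fun i => Den (upd l j i)).
Hypothesis not_constant : forall c, ~ (forall m, (0 < deg m)%N -> Num m = c * Den m).

Let ev m := Num m / Den m.
Let Om m : R := \prod_j gauss_ratio (s j) (m j).

Let Om_gt0 m : 0 < Om m.
Proof. by apply: prodr_gt0 => j _; exact: gauss_ratio_gt0. Qed.

Let gbase_gt0 m : 0 < gbase m.
Proof. by apply: prodr_gt0 => j _; exact: gauss_moment_gt0. Qed.

Let OmE m : Om m * gbase m = gshift m.
Proof.
rewrite /Om /gbase -big_split; apply: eq_bigr => j _ /=.
by rewrite /gauss_ratio mulfVK// gt_eqF// gauss_moment_gt0.
Qed.

Let rc0 (x : R) : 0 < x -> x%:C%C != 0 :> R[i].
Proof. by move=> x0; apply/eqP => -[e]; rewrite e ltxx in x0. Qed.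

(** Dividing the relations for [Num] and [Den] leaves a statement about the radial factor Theta, the
    eigenvalue over [Om m]: it depends on the degree alone. *)
Lemma eigenvalue_deg m k : deg m = deg k -> ev m * (Om k)%:C%C = ev k * (Om m)%:C%C.
Proof.
move=> mk; have := Num_deg mk; have := Den_deg mk; rewrite -!OmE !rcM /ev.
have gm := rc0 (gbase_gt0 m); have gk := rc0 (gbase_gt0 k).
have dm := Den_neq0 m; have dk := Den_neq0 k.
move: (Num m) (Num k) (Den m) (Den k) gm gk dm dk.
move: ((gbase m)%:C%C) ((gbase k)%:C%C) ((Om m)%:C%C) ((Om k)%:C%C).
move=> p q x y a b c d p0 q0 c0 d0 e1 e2.
have cE : c = d * p / q by rewrite -e1 mulfK.
apply: (mulfI c0); apply: (mulfI d0); apply: (mulfI q0).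
transitivity (a * (y * q) * d); first by field.
rewrite e2 cE; field; first by rewrite ?d0 ?q0 ?p0.
Qed.

Lemma Om_eq m k : (forall j, s j != 0 -> m j = k j) -> Om m = Om k.
Proof.
move=> mk; apply: eq_bigr => j _; have [sj|/mk ->//] := eqVneq (s j) 0.
by rewrite /gauss_ratio sj !addr0 !divff// gt_eqF// gauss_moment_gt0.
Qed.

Lemma eigenvalue_eq m k : deg m = deg k -> (forall j, s j != 0 -> m j = k j) -> ev m = ev k.
Proof.
move=> mk /Om_eq e; have := eigenvalue_deg mk; rewrite e; apply: mulIf; exact: rc0.
Qed.

Let single (j : 'I_n) N := upd (fun=> 0%N) j N.

Let deg_single j N : deg (single j N) = N.
Proof.
rewrite /deg (bigD1 j)//= big1 ?addn0 /single /upd ?eqxx// => i /negbTE.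
by rewrite eq_sym => ->.
Qed.

(** The case in which eigenvalues depend on the degree alone; it arises when all s_j are 0, and
    always in dimension 1. *)
Let flat := forall m k, deg m = deg k -> ev m = ev k.

(* Muntz: the eigenvalues on an arithmetic progression of multiples of e_j determine the others. *)
Lemma progression_contra (j : 'I_n) c a b : (0 < b)%N -> c = 0 \/ flat ->
  (forall i, ev (single j (a + i * b)) = c) -> False.
Proof.
move=> b0 cf H.
have Z N : (0 < N)%N -> Num (single j N) - c * Den (single j N) = 0.
  apply: (@muntz R (fun N => Num (single j N) - c * Den (single j N))
    (fun N => exists i, N = (a + i * b)%N)).
  - by apply: moment_seqB; [exact: Num_moment|apply: moment_seqZ; exact: Den_moment].
  - by apply: (thick_arith b0) => i; exists i.
  - by move=> _ [i ->]; rewrite -(H i) /ev mulfVK ?Den_neq0// subrr.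
have Zev N : (0 < N)%N -> ev (single j N) = c.
  by move=> /Z/eqP; rewrite subr_eq0 => /eqP e; rewrite /ev e mulfK.
apply: (not_constant (c := c)) => m m0.
suff : ev m = c by move=> <-; rewrite /ev mulfVK.
have dm : deg m = deg (single j (deg m)) by rewrite deg_single.
(* From the multiples of e_j to any m of the same degree: directly if the eigenvalues depend on the
   degree alone, and through [eigenvalue_deg] if c = 0. *)
have [c0|/(_ _ _ dm) ->] := cf; last exact: Zev.
have := eigenvalue_deg dm; rewrite (Zev _ m0) c0 mul0r => /eqP.
by rewrite mulf_eq0 (negbTE (rc0 (Om_gt0 _))) orbF => /eqP.
Qed.

Let exists_nonzero (j : 'I_n) a : exists2 N, (a <= N)%N & ev (single j N) != 0.
Proof.
apply: contrapT => h; apply: (@progression_contra j 0 a 1) => //; first by left.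
move=> i; rewrite muln1; apply: contrapT => /eqP e; apply: h; exists (a + i)%N => //.
exact: leq_addr.
Qed.

Section shift_invariance.
Variables m k : 'I_n -> nat.
Hypothesis mk : forall l, (forall j, (0 < l j)%N) -> ev (addm m l) = ev (addm k l).

Let deg_addm l : deg (addm m l) = (deg m + deg l)%N.
Proof. exact: big_split. Qed.

(* Varying l with fixed degree cancels the radial factor. *)
Lemma shift_exponents i j : i != j -> s j != 0 -> m j = k j.
Proof.
move=> ij sj; have sjp : 0 < s j by rewrite lt_neqAle eq_sym sj s0.
(* Two exponents vary, x in place j and y in place i, with x + y fixed; the others are 1 because
   shifts must be positive. *)
pose l x y : 'I_n -> nat := fun t => if t == j then x else if t == i then y else 1%N.
have [C degl] : exists C, forall x y, deg (l x y) = (x + y + C)%N.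
  exists (\sum_(t | (t != j) && (t != i)) 1)%N => x y; rewrite /deg (bigD1 j)//= (bigD1 i)//= /l eqxx (negbTE ij) eqxx addnA; congr (_ + _)%N.
  by apply: eq_bigr => t /andP[/negbTE -> /negbTE ->].
have lpos x y : (0 < x)%N -> (0 < y)%N -> forall t, (0 < l x y t)%N.
  by move=> x0 y0 t; rewrite /l; case: eqP => // _; case: eqP.
(* A degree at which Theta does not vanish, so large that the shifts with x + y = Y + 3 lead from m
   to it with Y > 1. *)
have [N NC N0] := exists_nonzero j (deg m + 5 + C).
pose Y := (N - deg m - C - 3)%N.
have Y0 : (1 < Y)%N by rewrite /Y; lia.
have ev_neq0 x y : (x + y = Y.+3)%N -> ev (addm m (l x y)) != 0.
  move=> xy; have dN : deg (addm m (l x y)) = deg (single j N).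
    by rewrite deg_addm degl deg_single xy /Y; lia.
  have := eigenvalue_deg dN => e; apply/eqP => e0; move/eqP: e; rewrite e0 mul0r eq_sym mulf_eq0.
  by rewrite (negbTE N0) (negbTE (rc0 (Om_gt0 _))).
have proportional (p q : R[i]) (w w' v v' : R) : p != 0 -> q != 0 ->
    p * w'%:C%C = q * w%:C%C -> p * v'%:C%C = q * v%:C%C -> w * v' = v * w'.
  move=> p0 q0 e1 e2; suff : (w * v')%:C%C = (v * w')%:C%C :> R[i] by case.
  rewrite !rcM; apply: (mulfI p0); apply: (mulfI q0).
  move: e1 e2; move: (w%:C%C) (w'%:C%C) (v%:C%C) (v'%:C%C) => z1 z2 z3 z4 e1 e2.
  transitivity ((q * z1) * (p * z4)); first by ring.
  by rewrite -e1 e2; ring.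
(* The eigenvalues at m and at k agree after either shift, so the quotient of the values of [Om] at
   two shifts of equal degree is the same for m as for k. *)
have cross x y x' y' : (x + y = Y.+3)%N -> (x' + y' = Y.+3)%N ->
    (0 < x)%N -> (0 < y)%N -> (0 < x')%N -> (0 < y')%N ->
    Om (addm m (l x y)) * Om (addm k (l x' y')) = Om (addm k (l x y)) * Om (addm m (l x' y')).
  move=> xy xy' x0 y0 x0' y0'.
  have dl : deg (l x y) = deg (l x' y') by rewrite !degl xy xy'.
  have e1 : ev (addm m (l x y)) * (Om (addm m (l x' y')))%:C%C = ev (addm m (l x' y')) * (Om (addm m (l x y)))%:C%C.
    by apply: eigenvalue_deg; rewrite !deg_addm dl.
  have e2 : ev (addm k (l x y)) * (Om (addm k (l x' y')))%:C%C = ev (addm k (l x' y')) * (Om (addm k (l x y)))%:C%C.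
    by apply: eigenvalue_deg; rewrite /deg !big_split /= -/(deg (l x y)) dl.
  move: e1 e2; rewrite -(mk (lpos _ _ x0 y0)) -(mk (lpos _ _ x0' y0')).
  exact: proportional (ev_neq0 _ _ xy) (ev_neq0 _ _ xy').
have Om_split q x y : Om (addm q (l x y)) = gauss_ratio (s j) (q j + x) * gauss_ratio (s i) (q i + y) *
    \prod_(t | (t != j) && (t != i)) gauss_ratio (s t) (q t + 1).
  rewrite /Om (bigD1 j isT) /= (bigD1 i ij) /= mulrA /addm /l eqxx (negbTE ij) eqxx.
  apply: (congr1 (fun z => gauss_ratio (s j) (q j + x) * gauss_ratio (s i) (q i + y) * z)).
  by apply: eq_bigr => t /andP[/negbTE -> /negbTE ->].
have cancel (a b c d p q b1 b2 b3 b4 S T : R) : a != 0 -> b != 0 -> c != 0 -> d != 0 -> p != 0 -> q != 0 ->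
    b1 != 0 -> b2 != 0 -> b3 != 0 -> b4 != 0 ->
    a * ((b1 + S) / b1) * b * p * (c * (d * ((b4 + T) / b4)) * q) =
    c * ((b2 + S) / b2) * d * q * (a * (b * ((b3 + T) / b3)) * p) ->
    (b1 + S) * (b4 + T) * b2 * b3 = (b2 + S) * (b3 + T) * b1 * b4.
  move=> a0 c0 d0 e0 p0 q0 h1 h2 h3 h4 e.
  have k0 : a * b * c * d * p * q / (b1 * b2 * b3 * b4) != 0.
    by rewrite mulf_neq0 ?invr_neq0// !mulf_neq0.
  apply: (mulfI k0); transitivity (a * ((b1 + S) / b1) * b * p * (c * (d * ((b4 + T) / b4)) * q)).
    by field; rewrite h1 h2 h3 h4.
  by rewrite e; field; rewrite h1 h2 h3 h4.
(* For the neighbours (x + 1, y) and (x, y + 1) all but one factor of each Gamma ratio cancels. The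
   identities for x = 1 and x = 2 are the two hypotheses of [shifted_ratio_eq]. *)
have ratio x y : (x + y = Y.+2)%N -> (0 < x)%N -> (0 < y)%N ->
    ((m j + x).+1%:R + s j) * ((k i + y).+1%:R + s i) * (k j + x).+1%:R * (m i + y).+1%:R =
    ((k j + x).+1%:R + s j) * ((m i + y).+1%:R + s i) * (m j + x).+1%:R * (k i + y).+1%:R.
  move=> xy x0 y0; have := cross x.+1 y x y.+1.
  rewrite !addSn !addnS !xy => /(_ erefl erefl isT y0 x0 isT).
  rewrite !Om_split !addnS !gauss_ratioS//.
  have P0 q : 0 < \prod_(t | (t != j) && (t != i)) gauss_ratio (s t) (q t + 1) :> R.
    by apply: prodr_gt0 => t _; exact: gauss_ratio_gt0.
  by apply: cancel; rewrite ?pnatr_eq0//; apply: lt0r_neq0 => //; exact: gauss_ratio_gt0.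
have r1 := ratio 1%N Y.+1 erefl isT isT.
have r2 := ratio 2%N Y erefl isT (ltnW Y0).
have big q : 1 < (q + Y.+1).+1%:R :> R by rewrite ltr1n; lia.
have e1 q : ((q + 1).+1%:R + 1 : R) = (q + 2).+1%:R by rewrite natr1 !addnS.
have e2 q : ((q + Y.+1).+1%:R - 1 : R) = (q + Y).+1%:R by rewrite -[(q + Y.+1).+1]addn1 natrD addrK addnS.
have := @shifted_ratio_eq R ((m j + 1).+1%:R) ((k j + 1).+1%:R) ((k i + Y.+1).+1%:R) ((m i + Y.+1).+1%:R) (s j) (s i) sjp (s0 i).
rewrite !e1 !e2 !ltr0n => /(_ isT isT (big _) (big _) r1 r2)/eqP.
by rewrite eqr_nat => /eqP; lia.
Qed.

End shift_invariance.

Let deg_positive (j : 'I_n) N : (n <= N)%N -> exists2 l, (forall t, (0 < l t)%N) & deg l = N.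
Proof.
move=> nN; exists (fun t => if t == j then (N - n).+1 else 1%N) => [t|]; first by case: eqP.
rewrite /deg (bigD1 j)//= eqxx (eq_bigr (fun=> 1%N)); last by move=> t /negbTE ->.
rewrite sum1_card (cardC1 j) card_ord; have := ltn_ord j; lia.
Qed.

Let periodic (f : nat -> R[i]) a b : (a < b)%N -> (forall N, (n <= N)%N -> f (a + N)%N = f (b + N)%N) ->
  forall i, f (a + n + i * (b - a))%N = f (a + n)%N.
Proof.
move=> ab H; elim=> [|i ih]; first by rewrite mul0n addn0.
rewrite -{}ih mulSn (_ : a + n + _ = b + (n + i * (b - a)))%N; last by lia.
by rewrite -H ?leq_addr// addnA.
Qed.

Let deg_unique t m : (forall i : 'I_n, i = t) -> deg m = m t.
Proof. by move=> all_t; rewrite /deg (bigD1 t)//= big1 ?addn0// => i; rewrite (all_t i) eqxx. Qed.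

(** If the degrees differed, shifts of all large degrees would make the eigenvalues at multiples of
    e_j, or the radial factors Theta once [Om] has cancelled, periodic in the degree. Constant
    eigenvalues along a progression are excluded by Muntz when they depend on the degree alone or
    are 0; a constant nonzero Theta is excluded because [Om] is unbounded while the eigenvalues are
    bounded. *)
Lemma shift_invariant_deg m k :
  (forall l, (forall j, (0 < l j)%N) -> ev (addm m l) = ev (addm k l)) ->
  deg m = deg k /\ (forall j, s j != 0 -> m j = k j).
Proof.
move=> mk; have [[j _]|no] := pselect (exists j : 'I_n, True); last first.
  by rewrite (_ : m = k)//; apply/funext => j; exfalso; apply: no; exists j.
have km l : (forall j, (0 < l j)%N) -> ev (addm k l) = ev (addm m l) by move=> h; rewrite mk.
have deg_add q l : deg (addm q l) = (deg q + deg l)%N by exact: big_split.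
(* Without two distinct indices one of which has s_j nonzero, either all s_j vanish or the dimension
   is 1. *)
have [[i0 [j0 [ij sj]]]|single_index] := pselect (exists i j : 'I_n, i != j /\ s j != 0); last first.
  have fl : flat.
    move=> q r qr; apply: eigenvalue_eq => // t st.
    have all_t i : i = t by apply: contrapT => /eqP it; apply: single_index; exists i, t.
    by rewrite -(@deg_unique t q all_t) qr (@deg_unique t r all_t).
  have no_shift q r : (forall l, (forall j, (0 < l j)%N) -> ev (addm q l) = ev (addm r l)) ->
      ~ (deg q < deg r)%N.
    move=> qr lt_qr; apply: (@progression_contra j (ev (single j (deg q + n))) (deg q + n) (deg r - deg q)).
    - by rewrite subn_gt0.
    - by right.
    apply: (periodic (f := fun N => ev (single j N)) lt_qr) => N nN.
    have [l lp dl] := deg_positive j nN.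
    have := qr l lp; rewrite (fl (addm q l) (single j (deg q + N))) ?deg_single ?deg_add ?dl//.
    by rewrite (fl (addm r l) (single j (deg r + N))) ?deg_single ?deg_add ?dl.
  have dmk : deg m = deg k by have := no_shift _ _ mk; have := no_shift _ _ km; lia.
  split=> // t st.
  have all_t i : i = t by apply: contrapT => /eqP it; apply: single_index; exists i, t.
  by rewrite -(@deg_unique t m all_t) dmk (@deg_unique t k all_t).
have exps t : s t != 0 -> m t = k t.
  move=> st; have [tj|tj] := eqVneq t j0; first by apply: (shift_exponents mk (i := i0)); rewrite ?tj.
  by apply: (shift_exponents mk (i := j0)); rewrite // eq_sym.
(* The radial factor Theta, read off at the multiples of e_j0. *)
split=> //; pose Th N := ev (single j0 N) / (Om (single j0 N))%:C%C.
have evE q : ev q = Th (deg q) * (Om q)%:C%C.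
  have h0 := rc0 (Om_gt0 (single j0 (deg q))).
  have := @eigenvalue_deg q (single j0 (deg q)); rewrite deg_single => /(_ erefl) e.
  by apply: (mulIf h0); rewrite e /Th [RHS]mulrAC (mulfVK h0).
have no_shift q r : (forall t, s t != 0 -> q t = r t) ->
    (forall l, (forall j, (0 < l j)%N) -> ev (addm q l) = ev (addm r l)) -> ~ (deg q < deg r)%N.
  move=> eqr qr lt_qr; have per : forall i, Th (deg q + n + i * (deg r - deg q))%N = Th (deg q + n)%N.
    apply: (periodic lt_qr) => N nN; have [l lp dl] := deg_positive j nN.
    have := qr l lp; rewrite !evE !deg_add dl (@Om_eq (addm q l) (addm r l)); last first.
      by move=> t st; rewrite /addm eqr.
    by apply: mulIf; exact: rc0.
  have [th0|th0] := eqVneq (Th (deg q + n)%N) 0.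
    apply: (@progression_contra j 0 (deg q + n) (deg r - deg q)); first by rewrite subn_gt0.
      by left.
    by move=> i; rewrite evE deg_single per th0 mul0r.
  pose C0 : R := \prod_(t | t != j0) gauss_ratio (s t) 0.
  have OmS N : Om (single j0 N) = gauss_ratio (s j0) N * C0.
    rewrite /Om (bigD1 j0)//= /single /upd eqxx; congr (_ * _).
    by apply: eq_bigr => t /negbTE ->.
  have C00 : 0 < C0 by apply: prodr_gt0 => t _; exact: gauss_ratio_gt0.
  have nt : 0 < normc (Th (deg q + n)%N) by rewrite normc_gt0.
  have sj0 : 0 < s j0 by rewrite lt_neqAle eq_sym sj s0.
  (* An x beyond which |Theta| times [Om] exceeds the bound M; [C0] is the part of [Om] that comes
     from the other coordinates. *)
  have [x Hx] := gauss_ratio_unbounded (s0 j0) (M / (normc (Th (deg q + n)%N) * C0)) sj0.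
  pose N := (deg q + n + x * (deg r - deg q))%N.
  have xN : (x <= N)%N by rewrite /N; nia.
  have := Num_le (single j0 N); rewrite -/(ev _) evE deg_single per Normc.normcM normc_real.
  rewrite ger0_norm ?(ltW (Om_gt0 _))// OmS leNgt => /negP; apply.
  have := lt_le_trans Hx (gauss_ratio_le (s0 j0) xN).
  by rewrite ltr_pdivrMr ?mulr_gt0//; congr (_ < _); ring.
have := no_shift _ _ exps mk; have := no_shift _ _ (fun t st => esym (exps t st)) km; lia.
Qed.

End eigenvalue_rigidity.

(** * Moments on the ball *)

#[local] Transparent torus_mean cint circle_int.

Section radial_moments.
Variables (R : realType) (n : nat) (alpha : R) (ha : -1 < alpha).
Local Notation P := (measurableTypeR R * measurableTypeR R)%type.
Local Notation X := (n.-tuple P).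
Local Notation normc := (@Normc.normc R).
Local Notation L := (lebesgueC R n).
Local Notation nu := (@nu_alpha R n alpha ha).
Local Notation Re := (@complex.Re R).
Local Notation Im := (@complex.Im R).
Implicit Types (a b : 'I_n -> R) (x : X) (m k l : 'I_n -> nat).

Lemma pwD a b x : (forall j, 0 <= a j) -> (forall j, 0 <= b j) ->
  pw (fun j => a j + b j) x = pw a x * pw b x.
Proof.
move=> a0 b0; rewrite /pw -big_split; apply: eq_bigr => j _ /=.
have [->|bj] := eqVneq (b j) 0; first by rewrite addr0 powRr0 mulr1.
rewrite powRD//; apply/implyP => /eqP e; exfalso; move/eqP: bj; apply.
by have := a0 j; have := b0 j; lra.
Qed.

Lemma pw_nat m x : pw (fun j => (m j)%:R) x = \prod_j sqn (tnth x j) ^+ m j.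
Proof. by apply: eq_bigr => j _; rewrite powR_mulrn// sqn_ge0. Qed.

Lemma mono_pw m x : mono m m x = (pw (fun j => (m j)%:R) x)%:C%C.
Proof.
rewrite pw_nat mono_diag; congr (_ %:C)%C; apply: eq_bigr => j _.
by rewrite sqn_zc exprAC.
Qed.

Let itg_real a (rho : R -> R) (M : R) : (forall j, 0 <= a j) -> measurable_fun setT rho ->
  (forall t, `|rho t| <= M) -> nu.-integrable setT (EFin \o (fun x => pw a x * rho (normsq x))).
Proof.
move=> a0 mr rM.
have mrn : measurable_fun setT (fun x : X => rho (normsq x)).
  exact: (measurableT_comp mr (@measurable_normsq R n)).
have iu : cintg nu (fun x => (pw a x * rho (normsq x))%:C%C).
  apply: (@cintg_nu_bounded R n alpha ha _ M).
    by apply: cmeas_real; apply: measurable_funM => //; exact: measurable_pw.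
  move=> x x1; rewrite normc_real normrM -[M]mul1r; apply: ler_pM => //.
  by rewrite ger0_norm ?pw_ge0//; apply: pw_le1 => //; exact: ltW.
by have [ir _] := cintgP iu.
Qed.

(** The weight of nu_alpha is itself a function of |z|^2 and is absorbed in rho. *)
Let ratio_ge0 a b (rho : R -> R) (M : R) : (forall j, 0 <= a j) -> (forall j, 0 <= b j) ->
  \sum_j a j = \sum_j b j -> measurable_fun setT rho -> (forall t, 0 <= rho t <= M) ->
  (\int[nu]_x (pw a x * rho (normsq x)))%R * gauss_prod b =
  (\int[nu]_x (pw b x * rho (normsq x)))%R * gauss_prod a.
Proof.
move=> a0 b0 ab mr rM; have r0 t : 0 <= rho t by have /andP[] := rM t.
have rM' t : `|rho t| <= M by rewrite ger0_norm//; have /andP[] := rM t.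
pose wt (t : R) : R := if t < 1 then c_alpha n alpha / volume R n * (1 - t) `^ alpha else 0.
have mwt : measurable_fun setT wt.
  apply: measurable_fun_ifT => //; first exact: measurable_fun_ltr.
  apply: measurable_funM => //.
  by apply: (measurableT_comp (measurable_powR alpha)); exact: measurable_funB.
have wt0 t : 0 <= wt t.
  rewrite /wt; case: ifP => // _; apply: mulr_ge0; last exact: powR_ge0.
  by apply: divr_ge0; apply: ltW; [exact: c_alpha_gt0|exact: volume_pos].
have E c : (forall j, 0 <= c j) -> (\int[L]_x (pw c x * (rho (normsq x) * wt (normsq x)))%:E =
    (\int[nu]_x (pw c x * rho (normsq x)))%R%:E)%E.
  move=> c0; rewrite /Rintegral fineK; last first.
    by apply: integrable_fin_num => //; exact: itg_real rM'.
  rewrite integral_mdens; last first.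
    apply: measurable_funM; first exact: measurable_pw.
    exact: (measurableT_comp mr (@measurable_normsq R n)).
  by apply: eq_integral => x _; rewrite mulrA.
apply: (gauss_prod_radial (rho := fun t => rho t * wt t) a0 b0 ab _ _ (E a a0) (E b b0)).
  exact: measurable_funM.
by move=> t; rewrite mulr_ge0.
Qed.

(** rho is the difference of the nonnegative functions rho + M and M. *)
Let ratio_real a b (rho : R -> R) (M : R) : (forall j, 0 <= a j) -> (forall j, 0 <= b j) ->
  \sum_j a j = \sum_j b j -> measurable_fun setT rho -> (forall t, `|rho t| <= M) ->
  (\int[nu]_x (pw a x * rho (normsq x)))%R * gauss_prod b =
  (\int[nu]_x (pw b x * rho (normsq x)))%R * gauss_prod a.
Proof.
move=> a0 b0 ab mr rM; have M0 : 0 <= M by apply: le_trans (rM 0).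
have mrD : measurable_fun setT (fun t => rho t + M) by exact: measurable_funD.
have split c : (forall j, 0 <= c j) -> (\int[nu]_x (pw c x * rho (normsq x)))%R =
    (\int[nu]_x (pw c x * (rho (normsq x) + M)))%R - (\int[nu]_x (pw c x * (cst M (normsq x))))%R.
  move=> c0; rewrite -RintegralB//.
  - by apply: eq_Rintegral => x _; rewrite /=; ring.
  - apply: (itg_real (M := M + M) c0 mrD) => t.
    by apply: le_trans (ler_normD _ _) _; rewrite lerD// ger0_norm.
  - apply: (itg_real (M := M) (rho := cst M) c0) => // t.
    by rewrite /= ger0_norm.
have e1 : (\int[nu]_x (pw a x * (rho (normsq x) + M)))%R * gauss_prod b =
    (\int[nu]_x (pw b x * (rho (normsq x) + M)))%R * gauss_prod a.
  apply: (ratio_ge0 (M := M + M) a0 b0 ab mrD) => t.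
  by have := rM t; rewrite ler_norml => /andP[h1 h2]; apply/andP; split; lra.
have e2 : (\int[nu]_x (pw a x * (cst M (normsq x))))%R * gauss_prod b =
    (\int[nu]_x (pw b x * (cst M (normsq x))))%R * gauss_prod a.
  by apply: (ratio_ge0 (rho := cst M) (M := M) a0 b0 ab) => // t; rewrite /= M0 lexx.
by rewrite (split a a0) (split b b0) !mulrBl e1 e2.
Qed.

Definition pw_mean (phi : R -> R[i]) a : R[i] := cint nu (fun x => (pw a x)%:C%C * phi (normsq x)).

Lemma pw_mean_degree a b (phi : R -> R[i]) (M : R) : (forall j, 0 <= a j) -> (forall j, 0 <= b j) ->
  \sum_j a j = \sum_j b j -> cmeas phi -> (forall t, normc (phi t) <= M) ->
  pw_mean phi a * (gauss_prod b)%:C%C = pw_mean phi b * (gauss_prod a)%:C%C.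
Proof.
move=> a0 b0 ab [m1 m2] pM.
have cE c : pw_mean phi c = ((\int[nu]_x (pw c x * Re (phi (normsq x))))%R +i*
    (\int[nu]_x (pw c x * Im (phi (normsq x))))%R)%C.
  rewrite /pw_mean /cint; congr (_ +i* _)%C; apply: eq_Rintegral => x _;
    by case: (phi _) => u v /=; rewrite mul0r ?subr0 ?addr0.
have key (p q r t v w : R) : p * v = r * w -> q * v = t * w ->
    (p +i* q)%C * v%:C%C = (r +i* t)%C * w%:C%C :> R[i].
  move=> h1 h2; apply/eqP; rewrite eq_complex /= !mulr0 !subr0 !add0r h1 h2 !eqxx//.
have e1 := ratio_real a0 b0 ab m1 (fun t => le_trans (Re_le_normc _) (pM t)).
have e2 := ratio_real a0 b0 ab m2 (fun t => le_trans (Im_le_normc _) (pM t)).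
rewrite !cE; apply: key; [exact: e1|exact: e2].
Qed.

#[local] Opaque torus_mean cint circle_int.

Definition mom (F : X -> R[i]) m k : R[i] := cint nu (fun x => F x * mono m k x).

Lemma momE F m k : mom F m k = cint nu (fun x => F x * mono m k x).
Proof. by []. Qed.

Lemma cintg_mom F m k : cintg nu F -> (forall x, ~~ (normsq x < 1) -> F x = 0) ->
  cintg nu (fun x => F x * mono m k x).
Proof.
move=> iF F0; apply: (le_cintg2 _ _ iF).
  by apply: cmeasM; [exact: iF.1|exact: cmeas_mono].
move=> x; rewrite Normc.normcM; have [x1|/F0 ->] := boolP (normsq x < 1).
  by rewrite ler_piMr ?normc_ge0//; apply/mono_le1/ball_polydisc.
by rewrite [normc 0]Normc.normc0 mul0r.
Qed.

Let mono_upd m k l j i x : mono (addm m (upd l j i)) (addm k (upd l j i)) x =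
  mono (addm m (upd l j 0)) (addm k (upd l j 0)) x * (sqn (tnth x j) ^+ i)%:C%C.
Proof.
pose f i t : R[i] := zc x t ^+ addm m (upd l j i) t * conjc (zc x t) ^+ addm k (upd l j i) t.
have fj : f i j = f 0%N j * (sqn (tnth x j) ^+ i)%:C%C.
  rewrite sqn_zc rcX -mulcJ exprMn /f /addm /upd eqxx !addn0 !exprD.
  exact: mulrACA.
have ft t : t != j -> f i t = f 0%N t by rewrite /f /addm /upd => /negbTE ->.
rewrite -[LHS]/(\prod_t f i t) -[X in _ = X * _]/(\prod_t f 0%N t).
by rewrite (bigD1 j isT) [in RHS](bigD1 j isT) /= fj mulrAC (eq_bigr _ ft).
Qed.

(** Raising the j-th exponents by i multiplies the integrand by |z_j|^(2i), so a polynomial p pairs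
    to an integral containing p(|z_j|^2), where |z_j|^2 lies in [0, 1]. The constant is the integral
    of |F|. *)
Lemma moment_seq_mom F m k l j : cintg nu F -> (forall x, ~~ (normsq x < 1) -> F x = 0) ->
  moment_seq (fun i => mom F (addm m (upd l j i)) (addm k (upd l j i))).
Proof.
move=> iF F0; exists (\int[nu]_x normc (F x))%R.
  by apply: Rintegral_ge0 => x _; exact: normc_ge0.
move=> p B B0 pB.
have B0' (x : X) : normsq x < 1 -> normc p.[(sqn (tnth x j))%:C%C] <= B.
  move=> x1; apply: pB; rewrite sqn_ge0/=; apply: le_trans (ltW x1).
  rewrite normsqE (bigD1 j)//= lerDl.
  by apply: sumr_ge0 => i _; exact: sqn_ge0.
pose w x := F x * mono (addm m (upd l j 0)) (addm k (upd l j 0)) x.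
have iw : cintg nu w by exact: cintg_mom.
have iwp i : cintg nu (fun x => p`_i * (F x * mono (addm m (upd l j i)) (addm k (upd l j i)) x)).
  by apply: cintgZ; exact: cintg_mom.
have E : poly_pair (fun i => mom F (addm m (upd l j i)) (addm k (upd l j i))) p =
    cint nu (fun x => w x * p.[(sqn (tnth x j))%:C%C]).
  rewrite /poly_pair (eq_bigr (fun i : 'I_(size p) => cint nu (fun x => p`_i * (F x * mono (addm m (upd l j i)) (addm k (upd l j i)) x)))).
    rewrite -cint_sum//; apply: eq_cint => x; rewrite horner_coef mulr_sumr.
    by apply: eq_bigr => i _; rewrite mono_upd /w rcX; move: (mono _ _ x) => z; ring.
  by move=> i _; rewrite cintZ//; exact: cintg_mom.
have wpB x : normc (w x * p.[(sqn (tnth x j))%:C%C]) <= normc (B%:C%C * F x).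
  rewrite /w; have [x1|/F0 ->] := boolP (normsq x < 1); last first.
    by rewrite !mul0r mulr0.
  rewrite [leRHS]Normc.normcM normc_real (ger0_norm B0) mulrC Normc.normcM.
  apply: ler_pM; rewrite ?normc_ge0//; first exact: B0'.
  by rewrite Normc.normcM ler_piMr ?normc_ge0//; apply/mono_le1/ball_polydisc.
have iwpj : cintg nu (fun x => w x * p.[(sqn (tnth x j))%:C%C]).
  apply: (le_cintg2 _ wpB); last exact: cintgZ.
  apply: cmeasM; first exact: iw.1.
  rewrite (_ : (fun x => _) = fun x => \sum_(i < size p) p`_i * (sqn (tnth x j) ^+ i)%:C%C); last first.
    by apply/funext => x; rewrite horner_coef; apply: eq_bigr => i _; rewrite rcX.
  apply: cmeas_sum => i; apply: cmeasZ; apply: cmeas_real; apply: measurable_funX.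
  exact: (measurableT_comp (@measurable_sqn R) (measurable_tnth j)).
rewrite E; apply: le_trans (normc_cint iwpj) _.
have := normc_cint (cintgZ B%:C%C iF).
have [_ i1] := iwpj; have [_ i2] := cintgZ B%:C%C iF; have [_ i3] := iF.
move=> _; rewrite mulrC -RintegralZl//.
apply: le_Rintegral => //; first exact: (integrableZl measurableT B i3).
move=> x _; apply: le_trans (wpB x) _.
by rewrite Normc.normcM normc_real ger0_norm.
Qed.

Lemma mom_rot0 F m k : cintg nu F -> (forall x, ~~ (normsq x < 1) -> F x = 0) ->
  (forall (u : 'I_n -> R[i]) x, unimodular u -> F (cmul u x) = F x) ->
  (exists j, m j != k j) -> mom F m k = 0.
Proof.
move=> iF F0 Fu [j jmk]; have [t ht] := exists_expi_exp_neq1 R jmk.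
have t1 := rot1_unimodular j (normc_expi t).
apply: (cint_rot0 t1 _ _ ht); first exact: cintg_mom.
by move=> x; rewrite Fu// mono_cmul mono_rot1 mulrCA.
Qed.

(** By hypothesis all moments of F |z^l|^2 vanish, and z^l is nonzero almost everywhere. *)
Lemma mom_eq0 F l : cintg nu F -> (forall x, ~~ (normsq x < 1) -> F x = 0) ->
  (forall m k, mom F (addm m l) (addm k l) = 0) -> {ae nu, forall x, F x = 0}.
Proof.
move=> iF F0 H; have : {ae nu, forall x, F x * mono l l x = 0}.
  apply: moment_uniqueness; first exact: cintg_mom.
    move=> x nx; rewrite F0 ?mul0r//; apply/negP => x1; apply: nx; exact: ball_polydisc.
  move=> a b; rewrite -[RHS](H a b); apply: eq_cint => x.
  rewrite -mulrA monoM; congr (_ * mono _ _ x); apply/funext => j; exact: addnC.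
apply: filterS2 (ae_nu_neq0 n ha) => x z0 /eqP; rewrite mulf_eq0 => /orP[/eqP//|].
rewrite mono_pw => /eqP[h]; exfalso.
have : 0 < pw (fun j => (l j)%:R) x.
  by apply: prodr_gt0 => j _; apply: powR_gt0; rewrite sqn_zc exprn_gt0// normc_gt0.
by rewrite h ltxx.
Qed.

End radial_moments.

(** * Invariance under the torus *)

#[local] Transparent torus_mean cint circle_int.

Section iterated_integral.
Context d1 d2 (T1 : measurableType d1) (T2 : measurableType d2) (R : realType).
Variables (m1 : {finite_measure set T1 -> \bar R}) (m2 : {finite_measure set T2 -> \bar R}).

Lemma cintg_cint (u : T1 * T2 -> R[i]) : cintg (m1 \x m2)%E u ->
  cintg m1 (fun x => cint m2 (fun y => u (x, y))).
Proof.
move=> ui; have mc := cmeas_cint ui; have [r i] := cintgP ui.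
have itg_fine (f : T1 -> \bar R) : m1.-integrable setT f -> m1.-integrable setT (EFin \o (fun x => fine (f x))).
  move=> fi; apply: (le_integrable measurableT _ _ fi).
    by apply/measurable_EFinP; apply: (measurableT_comp (fine_measurable measurableT)); case/integrableP: fi.
  by move=> x _ /=; case: (f x) => [a| |] //=; rewrite normr0 leey.
have ir := itg_fine _ (integrable_fubini_F r); have ii := itg_fine _ (integrable_fubini_F i).
have na (f : T1 -> R) : m1.-integrable setT (EFin \o f) -> m1.-integrable setT (EFin \o (fun x => `|f x|)).
  exact: integrable_norm.
apply: (le_cintg mc (fun x => normc_le_ReIm _)).
have := integrableD measurableT (na _ ir) (na _ ii).
by congr (_.-integrable _ _); apply/funext => x; rewrite /= ?EFinD.
Qed.

End iterated_integral.

#[local] Opaque torus_mean cint circle_int.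

Section torus_invariance.
Variables (R : realType) (n : nat) (alpha : R) (ha : -1 < alpha).
Local Notation P := (measurableTypeR R * measurableTypeR R)%type.
Local Notation X := (n.-tuple P).
Local Notation normc := (@Normc.normc R).
Local Notation nu := (@nu_alpha R n alpha ha).
Local Notation mom := (@mom R n alpha ha).
Variable F : X -> R[i].
Hypothesis iF : cintg nu F.
Hypothesis F0 : forall x, ~~ (normsq x < 1) -> F x = 0.
Implicit Types (u : 'I_n -> R[i]) (m k l : 'I_n -> nat) (x : X).

Definition invariant u := {ae nu, forall x, F (cmul u x) = F x}.

Let iFu u : unimodular u -> cintg nu (fun x => F (cmul u x)).
Proof. by move=> u1; exact: (cintg_scales (scales_nu_cmul ha u1) iF). Qed.

Let F0u u : unimodular u -> forall x, ~~ (normsq x < 1) -> F (cmul u x) = 0.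
Proof. by move=> u1 x nx; apply: F0; rewrite normsq_cmul. Qed.

Lemma mom_cmul u m k : unimodular u ->
  mono m k (pt u) * mom (fun x => F (cmul u x)) m k = mom F m k.
Proof.
move=> u1; rewrite !momE -cintZ; last exact: cintg_mom (iFu u1) (F0u u1).
rewrite -[RHS](cint_scales (scales_nu_cmul ha u1)); last exact: (cintg_mom m k iF F0).1.
by apply: eq_cint => x; rewrite /= mono_cmul mulrCA.
Qed.

Lemma mom_invariant u m k : unimodular u -> invariant u -> mom (fun x => F (cmul u x)) m k = mom F m k.
Proof.
move=> u1 Fu; apply: ae_eq_cint.
- exact: (cintg_mom m k (iFu u1) (F0u u1)).1.
- exact: (cintg_mom m k iF F0).1.
by apply: filterS Fu => x ->.
Qed.

Lemma invariant_mom0 u m k : unimodular u -> invariant u -> mono m k (pt u) != 1 -> mom F m k = 0.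
Proof.
move=> u1 Fu c1; have := mom_cmul m k u1; rewrite mom_invariant// => /eqP.
rewrite -subr_eq0 -[X in _ - X]mul1r -mulrBl mulf_eq0 subr_eq0 (negbTE c1).
by move/eqP.
Qed.

Lemma mono_diag_unimodular u l : unimodular u -> mono l l (pt u) = 1.
Proof.
by move=> u1; rewrite mono_diag big1// => j _; rewrite zc_pt u1 !expr1n.
Qed.

(** The moments of F(u z) - F(z), after multiplication by |z^l|^2, all vanish: where u acts on the
    monomial by 1 the two contributions are equal, and elsewhere both are 0. *)
Lemma invariant_of_mom u l : unimodular u ->
  (forall m k, mono m k (pt u) != 1 -> mom F (addm m l) (addm k l) = 0) -> invariant u.
Proof.
move=> u1 H; pose v x := F (cmul u x) - F x.
suff : {ae nu, forall x, v x = 0} by apply: filterS => x /eqP; rewrite subr_eq0 => /eqP.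
apply: (@mom_eq0 R n alpha ha v l); first exact: cintgB (iFu u1) iF.
  by move=> x nx; rewrite /v F0u// F0// subrr.
move=> m k; rewrite momE.
rewrite (eq_cint nu (v := fun x => F (cmul u x) * mono (addm m l) (addm k l) x - F x * mono (addm m l) (addm k l) x)); last first.
  by move=> x; rewrite /v mulrBl.
rewrite cintB; [|exact: cintg_mom (iFu u1) (F0u u1)|exact: cintg_mom].
have := mom_cmul (addm m l) (addm k l) u1.
have cE : mono (addm m l) (addm k l) (pt u) = mono m k (pt u).
  by rewrite -[LHS](monoM m k l l) mono_diag_unimodular// mulr1.
rewrite cE; have [->|c1] := eqVneq (mono m k (pt u)) 1.
  by rewrite mul1r => e; apply/eqP; rewrite subr_eq0; apply/eqP.
have h := H m k c1; rewrite !momE in h *; rewrite h subr0 => /eqP; rewrite mulf_eq0 => /orP[|/eqP//].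
by rewrite -normc_eq0 normc_mono_unimodular// oner_eq0.
Qed.

(** The mean of F over the circle in z_j, as the phase of w_j is uniform when w is distributed by
    nu_alpha. Unlike F it is invariant at every point, as condition (ii) asks of a
    representative. *)
Definition circle_average (j : 'I_n) x : R[i] :=
  (fine (nu setT))^-1%:C%C * cint nu (fun w => F (cmul (rot1 j (sg w j)) x)).

Let r1 j (w : X) : unimodular (rot1 j (sg w j)).
Proof. by apply: rot1_unimodular; exact: sg_unimodular. Qed.

Let mr j i : cmeas (fun w : X => rot1 j (sg w j) i).
Proof. by rewrite /rot1; case: eqP => _; [exact: cmeas_sg|exact: cmeas_cst]. Qed.

Let iu j : cintg (nu \x nu)%E (fun z => F (cmul (rot1 j (sg z.2 j)) z.1)).
Proof. by have := cintg_rotations (r := fun w => rot1 j (sg w j)) iF (mr j) (r1 j). Qed.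

Lemma circle_average_off j x : ~~ (normsq x < 1) -> circle_average j x = 0.
Proof.
move=> nx; rewrite /circle_average (eq_cint nu (v := fun=> 0)) ?cint0 ?mulr0// => w.
by apply: F0; rewrite normsq_cmul.
Qed.

Lemma cintg_circle_average j : cintg nu (circle_average j).
Proof. by apply: cintgZ; have := cintg_cint (iu j). Qed.

Lemma circle_average_rot j c x : normc c = 1 -> circle_average j (cmul (rot1 j c) x) = circle_average j x.
Proof.
move=> c1; rewrite /circle_average; congr (_ * _).
have rc := rot1_unimodular j c1.
have mpsi y : cmeas (fun w => F (cmul (rot1 j (sg w j)) y)).
  by have := cmeas_comp (iu j).1 (measurable_pair1 y).
rewrite -[RHS](cint_scales (scales_nu_cmul ha rc) (mpsi x)).
apply: ae_eq_cint; first exact: mpsi.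
  by apply: cmeas_comp (mpsi x) _; have [] := scales_nu_cmul ha rc.
apply: filterS (ae_nu_neq0 n ha) => w w0 /=; congr F; apply: eq_zc => i.
rewrite !zc_cmul sg_cmul// /rot1; case: (i == j); last by rewrite !mul1r.
by rewrite eqxx mulrA [c * _]mulrC.
Qed.

(** Each rotated copy of F has the moments of F, so by Fubini the average has them too. *)
Lemma circle_average_ae j : (forall c, normc c = 1 -> invariant (rot1 j c)) ->
  {ae nu, forall x, circle_average j x = F x}.
Proof.
move=> Fj; pose v x := circle_average j x - F x.
suff : {ae nu, forall x, v x = 0} by apply: filterS => x /eqP; rewrite subr_eq0 => /eqP.
have ia := cintg_circle_average j.
apply: (@mom_eq0 R n alpha ha v (fun=> 0%N)); first exact: cintgB.
  by move=> x nx; rewrite /v circle_average_off// F0// subrr.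
move=> m0 k0; set m := addm _ _; set k := addm k0 _; rewrite momE.
rewrite (eq_cint nu (v := fun x => circle_average j x * mono m k x - F x * mono m k x)); last first.
  by move=> x; rewrite /v mulrBl.
rewrite cintB; [|exact: cintg_mom ia (@circle_average_off j)|exact: cintg_mom].
apply/eqP; rewrite subr_eq0; apply/eqP.
pose u (z : X * X) := F (cmul (rot1 j (sg z.2 j)) z.1) * mono m k z.1.
have mu : cmeas u.
  by apply: cmeasM; [exact: (iu j).1|exact: (cmeas_comp (cmeas_mono R m k) measurable_fst)].
have iu' : cintg (nu \x nu)%E u.
  apply: (le_cintg2 mu _ (iu j)) => -[x w] /=; rewrite /u Normc.normcM /=.
  have [x1|nx] := boolP (normsq x < 1).
    by rewrite ler_piMr ?normc_ge0//; apply/mono_le1/ball_polydisc.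
  by rewrite F0u// [normc 0]Normc.normc0 mul0r.
have T0 := nu_setT_neq0 n ha.
have T1 : (fine (nu setT))^-1%:C%C * (fine (nu setT))%:C%C = 1 :> R[i].
  have t0 : fine (nu setT) != 0 by apply: contra T0 => /eqP ->.
  by rewrite -rcM mulVf.
transitivity ((fine (nu setT))^-1%:C%C * cint nu (fun x => cint nu (fun w => u (x, w)))).
  rewrite -cintZ; last exact: cintg_cint iu'.
  apply: ae_eq_cint.
  - exact: (cintg_mom m k ia (@circle_average_off j)).1.
  - by apply: cmeasZ; exact: (cintg_cint iu').1.
  apply: filterS (ae_cintg_slice (iu j)) => x ix.
  rewrite /circle_average -mulrA; congr (_ * _); rewrite mulrC -(cintZ _ ix).
  by apply: eq_cint => w; rewrite /u mulrC.
rewrite (cint_fubini iu'); last by move=> w; exact: (cintg_mom m k (iFu (r1 j w)) (F0u (r1 j w))).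
have e w : cint nu (fun x => u (x, w)) = mom F m k.
  by apply: (mom_invariant m k (r1 j w)); apply: Fj; exact: sg_unimodular.
rewrite (eq_cint nu e).
by rewrite cint_cst mulrA T1 mul1r.
Qed.

End torus_invariance.

(** * The symbol of the theorem *)

Section radial_symbol.
Variables (R : realType) (n : nat) (alpha : R) (ha : -1 < alpha).
Local Notation P := (measurableTypeR R * measurableTypeR R)%type.
Local Notation X := (n.-tuple P).
Local Notation normc := (@Normc.normc R).
Local Notation Re := (@complex.Re R).
Local Notation Im := (@complex.Im R).
Local Notation nu := (@nu_alpha R n alpha ha).
Local Notation mom := (@mom R n alpha ha).
Implicit Types (x : X) (m k l : 'I_n -> nat).
Variables (s : 'I_n -> R) (h : R -> R[i]) (M : R).
Hypothesis s0 : forall j, 0 <= s j.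
Hypothesis mRe_h : measurable_fun (`[0, 1[%classic : set R) (fun r => Re (h r)).
Hypothesis mIm_h : measurable_fun (`[0, 1[%classic : set R) (fun r => Im (h r)).
Hypothesis h_le : forall r : R, 0 <= r < 1 -> normc (h r) <= M.

Definition radial_symbol : Cspace R n -> R[i]^o :=
  fun z => (\prod_j normc (z ord0 j) `^ (2 * s j))%:C%C * h (vnorm z).

(** h as a function of t = |z|^2, extended by 0. With [one_phi] as its analogue for the constant
    symbol 1, [Num] and [Den] become instances of the same radial integral. *)
Let phi (t : R) : R[i] := if Num.sqrt t < 1 then h (Num.sqrt t) else 0.
Let one_phi (t : R) : R[i] := if t < 1 then 1 else 0.
Let G : X -> R[i] := ball_ext radial_symbol.
Let B : X -> R[i] := ball_ext (fun=> 1).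

Let M0 : 0 <= M.
Proof. by apply: le_trans (h_le (_ : 0 <= 0 < 1)); rewrite ?normc_ge0// lexx ltr01. Qed.

Let cmeas_phi : cmeas phi.
Proof.
have msqrt : measurable_fun setT (@Num.sqrt R) by apply: continuous_measurable_fun; exact: sqrt_continuous.
have mr (f : R -> R) : measurable_fun (`[0, 1[%classic : set R) f ->
    measurable_fun setT (fun t : R => (f \_ (`[0, 1[%classic : set R)) (Num.sqrt t)).
  by move=> mf; apply: (measurableT_comp _ msqrt); apply/(measurable_restrictT _ _).1.
have E (p : R[i] -> R) : p 0 = 0 -> (fun t => p (phi t)) =
    (fun t : R => ((fun r => p (h r)) \_ (`[0, 1[%classic : set R)) (Num.sqrt t)).
  move=> p0; apply/funext => t; rewrite patchE /phi.
  have -> : (Num.sqrt t \in (`[0, 1[%classic : set R)) = (Num.sqrt t < 1).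
    by rewrite -[LHS]/(_ \in mem _) mem_setE in_itv/= sqrtr_ge0.
  by case: ifP.
by split; [rewrite (E Re)//; exact: mr|rewrite (E Im)//; exact: mr].
Qed.

Let phi_le t : normc (phi t) <= M.
Proof.
rewrite /phi; case: ifP => t1; last by rewrite [normc _]Normc.normc0.
by apply: h_le; rewrite sqrtr_ge0.
Qed.

Let GE x : G x = (pw s x)%:C%C * phi (normsq x).
Proof.
rewrite /G /ball_ext /radial_symbol vnormE /phi.
have -> : (Num.sqrt (normsq x) < 1) = (normsq x < 1).
  by rewrite -[X in _ < X]sqrtr1 ltr_sqrt.
case: ifP => _; last by rewrite mulr0.
congr (_%:C%C * _); apply: eq_bigr => j _.
by rewrite of_coordsE sqn_zc powRrM -[X in X `^ s j]/((normc (zc x j)) `^ 2%:R) powR_mulrn ?normc_ge0.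
Qed.

Let BE x : B x = one_phi (normsq x). Proof. by []. Qed.

Lemma cmeas_radial_symbol : cmeas G.
Proof.
rewrite (_ : G = fun x => (pw s x)%:C%C * phi (normsq x)); last by apply/funext => x; exact: GE.
apply: cmeasM; first by apply: cmeas_real; exact: measurable_pw.
exact: (cmeas_comp cmeas_phi (@measurable_normsq R n)).
Qed.

Lemma radial_symbol_le x : normc (G x) <= M.
Proof.
rewrite {1}/G /ball_ext; case: ifP => x1; last by rewrite [normc _]Normc.normc0.
have -> : radial_symbol (of_coords x) = G x by rewrite /G /ball_ext x1.
rewrite GE Normc.normcM normc_real ger0_norm ?pw_ge0// -[M]mul1r.
by apply: ler_pM; rewrite ?pw_ge0 ?normc_ge0//; apply: pw_le1 => //; exact: ltW.
Qed.

Lemma radial_symbol_rot u x : unimodular u -> G (cmul u x) = G x.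
Proof.
move=> u1; rewrite !GE normsq_cmul//; congr (_%:C%C * _); apply: eq_bigr => j _.
by rewrite !sqn_zc zc_cmul Normc.normcM u1 mul1r.
Qed.

Let off (u : Cspace R n -> R[i]^o) x : ~~ (normsq x < 1) -> ball_ext u x = 0.
Proof. by rewrite /ball_ext => /negbTE ->. Qed.

Let offG x : ~~ (normsq x < 1) -> G x = 0. Proof. exact: off. Qed.

Let offB x : ~~ (normsq x < 1) -> B x = 0. Proof. exact: off. Qed.

Let iG : cintg nu G.
Proof. exact: (cintg_bounded _ cmeas_radial_symbol radial_symbol_le). Qed.

Let B_le x : normc (B x) <= 1.
Proof. by rewrite BE /one_phi; case: ifP => _; rewrite ?[normc _]Normc.normc1// [normc _]Normc.normc0. Qed.

Let cmeas_one_phi : cmeas one_phi.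
Proof.
have E (p : R[i] -> R) : (fun t => p (one_phi t)) = (fun t => if t < 1 then p 1 else p 0).
  by apply/funext => t; rewrite /one_phi; case: ifP.
by split; [rewrite (E Re)|rewrite (E Im)]; apply: measurable_fun_ifT => //; exact: measurable_fun_ltr.
Qed.

Let cmeasB_ : cmeas B.
Proof. exact: (cmeas_comp cmeas_one_phi (@measurable_normsq R n)). Qed.

Let iB : cintg nu B.
Proof. exact: (cintg_bounded _ cmeasB_ B_le). Qed.

Let Num m := mom G m m.
Let Den m := mom B m m.

Let Num_pw m : Num m = pw_mean ha phi (fun j => (m j)%:R + s j).
Proof.
apply: eq_cint => x; rewrite GE mono_pw pwD// rcM.
by move: (phi _) (_%:C%C) (_%:C%C) => a b c; ring.
Qed.

Let Den_pw m : Den m = pw_mean ha one_phi (fun j => (m j)%:R).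
Proof. by apply: eq_cint => x; rewrite BE mono_pw mulrC. Qed.

Let DenE m : Den m = cint nu (mono m m).
Proof.
apply: ae_eq_cint; first exact: (cintg_mom m m iB offB).1.
  exact: cmeas_mono.
by apply: filterS (ae_nu_ball n ha) => x x1; rewrite /B /ball_ext x1 mul1r.
Qed.

Let Den_neq0 m : Den m != 0.
Proof.
rewrite DenE; have := cint_mono_neq0 ha ([ffun j => m j] : {ffun 'I_n -> nat}).
by have -> : ([ffun j => m j] : {ffun 'I_n -> nat}) = m :> ('I_n -> nat) by apply/funext => j; rewrite ffunE.
Qed.

Let deg_sum (t : 'I_n -> R) m k : deg m = deg k -> \sum_j ((m j)%:R + t j) = \sum_j ((k j)%:R + t j).
Proof. by move=> mk; rewrite !big_split /= -!natr_sum -/(deg m) -/(deg k) mk. Qed.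

Let Num_deg m k : deg m = deg k -> Num m * (gshift s k)%:C%C = Num k * (gshift s m)%:C%C.
Proof.
move=> mk; rewrite !Num_pw; apply: (@pw_mean_degree R n alpha ha (fun j => (m j)%:R + s j) (fun j => (k j)%:R + s j) phi M _ _ (deg_sum s mk) cmeas_phi phi_le).
  by move=> j; rewrite addr_ge0.
by move=> j; rewrite addr_ge0.
Qed.

Let Den_deg m k : deg m = deg k -> Den m * (gbase R k)%:C%C = Den k * (gbase R m)%:C%C.
Proof.
move=> mk; rewrite !Den_pw.
have e : \sum_j ((m j)%:R : R) = \sum_j (k j)%:R by rewrite -!natr_sum -/(deg m) -/(deg k) mk.
apply: (@pw_mean_degree R n alpha ha (fun j => (m j)%:R) (fun j => (k j)%:R) one_phi 1 _ _ e cmeas_one_phi) => // t.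
by rewrite /one_phi; case: ifP => _; rewrite ?[normc _]Normc.normc1// [normc _]Normc.normc0.
Qed.

Let Num_le m : normc (Num m / Den m) <= M.
Proof.
pose D : R := (\int[nu]_x normc (B x * mono m m x))%R.
have DD : Den m = D%:C%C.
  rewrite -cint_real; apply: eq_cint => x; rewrite BE mono_pw /one_phi.
  by case: ifP => _; rewrite ?mul1r ?mul0r ?normc_real ?ger0_norm ?pw_ge0// [normc _]Normc.normc0.
have D0 : 0 <= D by apply: Rintegral_ge0 => x _; exact: normc_ge0.
have {}D0 : 0 < D.
  by rewrite lt_neqAle D0 andbT eq_sym; apply: contra (Den_neq0 m); rewrite DD => /eqP ->.
rewrite Normc.normcM Normc.normcV DD normc_real ger0_norm ?(ltW D0)// ler_pdivrMr//.
have iGm := cintg_mom m m iG offG.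
have iBm := cintg_mom m m iB offB.
apply: le_trans (normc_cint iGm) _; rewrite -RintegralZl//; last exact: iBm.2.
apply: le_Rintegral => //; [exact: iGm.2|exact: (integrableZl measurableT M iBm.2)|].
move=> x _; rewrite !Normc.normcM mulrA ler_wpM2r ?normc_ge0//.
rewrite BE /one_phi; case: ifPn => x1; last by rewrite /G off// !Normc.normc0 mulr0.
by rewrite [normc 1]Normc.normc1 mulr1 radial_symbol_le.
Qed.

Lemma eigenval_ratio (m : {ffun 'I_n -> nat}) : eigenval ha radial_symbol m = Num m / Den m.
Proof. by rewrite DenE. Qed.

Section nonconstant.
Hypothesis n0 : (0 < n)%N.
Hypothesis symbol_nonconst : ~ (exists c : R[i], ae_ball (fun z => radial_symbol z = c)).

(** All moments of (g - c) |z_1 ... z_n|^2 vanish: on the diagonal by the assumed equality, which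
    covers them because the shift by 1 makes the degree positive, and off the diagonal by rotation
    invariance. *)
Let not_constant c : ~ (forall m, (0 < deg m)%N -> Num m = c * Den m).
Proof.
move=> H; apply: symbol_nonconst; exists c.
pose v x := G x - c * B x.
have iv : cintg nu v by apply: cintgB => //; exact: cintgZ.
have v0 : {ae nu, forall x, v x = 0}.
  apply: (@mom_eq0 R n alpha ha v (fun=> 1%N) iv).
    by move=> x x1; rewrite /v /G /B !off// mulr0 subr0.
  move=> m k; have [mk|mk] := pselect (exists j, addm m (fun=> 1%N) j != addm k (fun=> 1%N) j).
    apply: mom_rot0 mk => //.
      by move=> x x1; rewrite /v /G /B !off// mulr0 subr0.
    by move=> u x u1; rewrite /v radial_symbol_rot// !BE normsq_cmul.
  have <- : addm m (fun=> 1%N) = addm k (fun=> 1%N).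
    by apply/funext => j; apply: contrapT => /eqP e; apply: mk; exists j.
  set m1 := addm _ _; have dm1 : (0 < deg m1)%N.
    by rewrite /deg (bigD1 (Ordinal n0))//= addn_gt0 /m1 /addm addn1.
  have := H m1 dm1; rewrite momE.
  rewrite (eq_cint nu (v := fun x => G x * mono m1 m1 x - c * (B x * mono m1 m1 x))); last first.
    by move=> x; rewrite /v mulrBl mulrA.
  rewrite cintB; [|exact: cintg_mom iG offG|apply: cintgZ; exact: cintg_mom iB offB].
  rewrite cintZ; last exact: cintg_mom iB offB.
  by move=> e; apply/eqP; rewrite subr_eq0; apply/eqP.
rewrite /ae_ball ball_coordsE; have /ae_nuP := v0.
apply: filterS => x h1 /= x1; have := h1 x1.
by rewrite /v /G /B /ball_ext x1 mulr1 => /eqP; rewrite subr_eq0 => /eqP.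
Qed.

Lemma eigenval_shift_invariant m k :
  (forall l, (forall j, (0 < l j)%N) -> Num (addm m l) / Den (addm m l) = Num (addm k l) / Den (addm k l)) ->
  deg m = deg k /\ (forall j, s j != 0 -> m j = k j).
Proof.
have mNum l j : moment_seq (fun i => Num (upd l j i)).
  exact: (moment_seq_mom (fun=> 0%N) (fun=> 0%N) l j iG offG).
have mDen l j : moment_seq (fun i => Den (upd l j i)).
  exact: (moment_seq_mom (fun=> 0%N) (fun=> 0%N) l j iB offB).
exact: (shift_invariant_deg s0 Num_deg Den_deg Den_neq0 Num_le mNum mDen not_constant).
Qed.

(** The difference of eigenvalues is replaced by its cross-multiplied numerator [E], which is a
    combination of products of moment sequences and hence a moment sequence in each variable. *)
Lemma eigenval_mom_dichotomy (F : X -> R[i]) m k : cintg nu F -> (forall x, ~~ (normsq x < 1) -> F x = 0) ->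
  (forall m k, (Num m / Den m - Num k / Den k) * mom F m k = 0) ->
  ~ (deg m = deg k /\ (forall j, s j != 0 -> m j = k j)) ->
  mom F (addm m (fun=> 1%N)) (addm k (fun=> 1%N)) = 0.
Proof.
move=> iF F0 H bad.
pose A l := mom F (addm m l) (addm k l).
pose E l := Num (addm m l) * Den (addm k l) - Num (addm k l) * Den (addm m l).
have mA l j : moment_seq (fun i => A (upd l j i)) by exact: moment_seq_mom.
have mE l j : moment_seq (fun i => E (upd l j i)).
  apply: moment_seqB; apply: moment_seqM; apply: moment_seq_mom => //; exact: off.
have AE l : (forall j, (0 < l j)%N) -> A l * E l = 0.
  move=> _; have d1 := Den_neq0 (addm m l); have d2 := Den_neq0 (addm k l).
  have := H (addm m l) (addm k l); rewrite -/(A l) /E => e.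
  move: e d1 d2; move: (A l) (Num _) (Num _) (Den _) (Den _) => a p q c d e c0 d0.
  transitivity ((q / d - p / c) * a * (c * d)); first by field; rewrite c0 d0.
  by rewrite e mul0r.
have [z|z] := multi_moment_seq_mul0 mA mE AE; first exact: z.
exfalso; apply: bad; apply: eigenval_shift_invariant => l lp.
have := z l lp => /eqP; rewrite subr_eq0 => /eqP e.
by apply/eqP; rewrite eqr_div ?Den_neq0//; apply/eqP.
Qed.

End nonconstant.

Lemma eigenval_deg_eq m k : deg m = deg k -> (forall j, s j != 0 -> m j = k j) ->
  Num m / Den m = Num k / Den k.
Proof. exact: (eigenvalue_eq s0 Num_deg Den_deg Den_neq0). Qed.

End radial_symbol.

Lemma ae_lebesgue_pick (R : realType) (Q : R -> Prop) (r : R) : 0 < r ->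
  {ae (@lebesgue_measure R), forall t, Q t} -> exists t, [/\ 0 < t, t < r & Q t].
Proof.
move=> r0 [N [mN N0 QN]]; apply: contrapT => no.
have sub : `]0, r[%classic `<=` N.
  move=> t /=; rewrite in_itv/= => /andP[t0 tr]; apply: QN => /= q.
  by apply: no; exists t.
have : (lebesgue_measure (`]0%R, r[%classic : set R) <= lebesgue_measure N)%E.
  by apply: le_measure; rewrite ?inE.
rewrite N0 lebesgue_measure_itv/= lte_fin r0 -EFinB lee_fin subr0.
by rewrite leNgt r0.
Qed.

Lemma ae_cintg d (T : measurableType d) (R : realType) (m : {measure set T -> \bar R}) (u v : T -> R[i]) :
  cmeas v -> cintg m u -> {ae m, forall x, u x = v x} -> cintg m v.
Proof.
move=> mv [mu /integrableP[mn iu]] uv; split=> //; apply/integrableP; split.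
  by apply/measurable_EFinP; exact: measurable_normc.
apply: le_lt_trans iu; rewrite le_eqVlt; apply/orP; left; apply/eqP.
apply: ae_eq_integral => //.
- by apply: measurableT_comp => //; apply/measurable_EFinP; exact: measurable_normc.
- exact: measurableT_comp.
by apply: filterS uv => x /= ->.
Qed.

(** * Symmetries of f as vanishing moments *)

Section symmetries.
Variables (R : realType) (n : nat) (alpha : R) (ha : -1 < alpha).
Local Notation P := (measurableTypeR R * measurableTypeR R)%type.
Local Notation X := (n.-tuple P).
Local Notation normc := (@Normc.normc R).
Local Notation nu := (@nu_alpha R n alpha ha).
Local Notation mom := (@mom R n alpha ha).
Implicit Types (f : Cspace R n -> R[i]^o) (x : X) (m k : 'I_n -> nat).

Lemma ae_ball_nu (Q : Cspace R n -> Prop) :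
  ae_ball Q <-> {ae nu, forall x, normsq x < 1 -> Q (of_coords x)}.
Proof.
rewrite ae_nuP /ae_ball ball_coordsE; split; apply: filterS => x h; first by move=> _; exact: h.
by move=> x1; exact: h.
Qed.

Lemma ball_ext_off f x : ~~ (normsq x < 1) -> ball_ext f x = 0.
Proof. by rewrite /ball_ext => /negbTE ->. Qed.

Lemma mono_const (c : R[i]) m k : mono m k (pt (fun=> c)) = c ^+ deg m * conjc c ^+ deg k.
Proof. by rewrite monoE big_split /= !prodrXr. Qed.

Lemma unimodular_const (c : R[i]) : normc c = 1 -> unimodular (fun _ : 'I_n => c).
Proof. by move=> c1 j. Qed.

Lemma ae_ball_scale f (c : R[i]) : normc c = 1 ->
  ae_ball (fun z => f (c *: z) = f z) <-> invariant ha (ball_ext f) (fun=> c).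
Proof.
move=> c1; have u1 := unimodular_const c1.
have E x : normsq x < 1 -> ball_ext f (cmul (fun=> c) x) = f (c *: of_coords x) /\ ball_ext f x = f (of_coords x).
  move=> x1; rewrite /ball_ext normsq_cmul// x1; split=> //; congr f; apply/rowP => j.
  by rewrite [RHS]mxE !of_coordsE zc_cmul.
rewrite ae_ball_nu; split; apply: filterS => x h.
  have [x1|nx] := boolP (normsq x < 1); first by have [-> ->] := E x x1; exact: h.
  by rewrite !ball_ext_off// normsq_cmul.
by move=> x1; have [<- <-] := E x x1.
Qed.

Lemma abs_coord_rot (j : 'I_n) x (c : R[i]) : normc c = 1 ->
  abs_coord j (of_coords (cmul (rot1 j c) x)) = abs_coord j (of_coords x).
Proof.
move=> c1; apply/rowP => i; rewrite [LHS]mxE [RHS]mxE !of_coordsE zc_cmul /rot1.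
by case: (i == j); rewrite ?mul1r// !normC_normc Normc.normcM c1 mul1r.
Qed.

Lemma pt_abs_coord (j : 'I_n) (z : Cspace R n) :
  pt (fun i => z ord0 i) = cmul (rot1 j (sg (pt (fun i => z ord0 i)) j)) (pt (fun i => abs_coord j z ord0 i)).
Proof.
apply: eq_zc => i; rewrite zc_cmul !zc_pt mxE /rot1; have [->|_] := eqVneq i j; last by rewrite mul1r.
by have := sgE (pt (fun i => z ord0 i)) j; rewrite zc_pt normC_normc mulrC.
Qed.

Lemma mono_eq1 (c : R[i]) a : normc c = 1 -> c ^+ a * conjc c ^+ a = 1.
Proof. by move=> c1; rewrite -exprMn mulcJ c1 !expr1n. Qed.

Variable f : Cspace R n -> R[i]^o.
Hypothesis iF : cintg nu (ball_ext f).

Let F0 x : ~~ (normsq x < 1) -> ball_ext f x = 0. Proof. exact: ball_ext_off. Qed.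

(** The hypothesis holds for almost every t only, so t is picked between 0 and pi / (|m| + |k| + 1),
    where e^(i t (|m| - |k|)) cannot be 1. *)
Lemma rotation_invariantP : {ae (@lebesgue_measure R), forall t : R,
    ae_ball (fun z => f (expi t *: z) = f z)} ->
  forall m k, deg m != deg k -> mom (ball_ext f) m k = 0.
Proof.
move=> H m k mk; have q0 : 0 < (deg m + deg k).+1%:R :> R by rewrite ltr0n.
have [t [t0 tr /(ae_ball_scale f (normc_expi t))]] := ae_lebesgue_pick (divr_gt0 (pi_gt0 R) q0) H.
move=> /(invariant_mom0 iF F0 (unimodular_const (normc_expi t))); apply.
rewrite mono_const; apply: expi_exp_neq1 => //.
have := tr; rewrite ltr_pdivlMr// mulrC; apply: le_lt_trans.
by rewrite ler_wpM2r ?(ltW t0)// ler_nat.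
Qed.

(** F' is invariant at every point of the ball under rotations of z_j, and f has the moments of
    F'. *)
Lemma coordinate_invariantP (j : 'I_n) (F' : Cspace R n -> R[i]^o) : measurable_ball F' ->
  (forall z, unit_ball z -> F' (abs_coord j z) = F' z) -> ae_ball (fun z => f z = F' z) ->
  forall m k, m j != k j -> mom (ball_ext f) m k = 0.
Proof.
move=> /measurable_ballP mF' F'abs /ae_ball_nu fF' m k mk.
have ae_eq : {ae nu, forall x, ball_ext f x = ball_ext F' x}.
  by apply: filterS fF' => x h; rewrite /ball_ext; case: ifP => // x1; exact: h.
have iF' := ae_cintg mF' iF ae_eq.
have F'0 x : ~~ (normsq x < 1) -> ball_ext F' x = 0 by exact: ball_ext_off.
rewrite (_ : mom (ball_ext f) m k = mom (ball_ext F') m k); last first.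
  apply: ae_eq_cint; [exact: (cintg_mom m k iF F0).1|exact: (cintg_mom m k iF' F'0).1|].
  by apply: filterS ae_eq => x ->.
have [t ht] := exists_expi_exp_neq1 R mk; have t1 := rot1_unimodular j (normc_expi t).
apply: (invariant_mom0 iF' F'0 t1); last by rewrite mono_rot1.
apply: aeW => x; rewrite /ball_ext normsq_cmul//; case: ifP => // x1.
have ub y : normsq y < 1 -> unit_ball (of_coords y).
  by move=> y1; apply/unit_ballP; under eq_bigr do rewrite of_coordsE.
rewrite -(F'abs (of_coords (cmul _ x))); last by apply: ub; rewrite normsq_cmul.
by rewrite abs_coord_rot ?normc_expi// F'abs//; exact: ub.
Qed.

(* The average over the circle in z_j depends on z_j only through |z_j| and equals f almost everywhere. *)
Lemma coordinate_average (j : 'I_n) : (forall c, normc c = 1 -> invariant ha (ball_ext f) (rot1 j c)) ->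
  exists F' : Cspace R n -> R[i]^o, [/\ measurable_ball F',
    forall z, unit_ball z -> F' (abs_coord j z) = F' z & ae_ball (fun z => f z = F' z)].
Proof.
move=> Fj; pose A := circle_average ha (ball_ext f) j.
exists (fun z => A (pt (fun i => z ord0 i))).
have AE x : A (pt (fun i => of_coords x ord0 i)) = A x.
  by congr A; apply: eq_zc => i; rewrite zc_pt of_coordsE.
split.
- apply/measurable_ballP; rewrite (_ : ball_ext _ = A); first exact: (cintg_circle_average iF j).1.
  apply/funext => x; rewrite /ball_ext AE; case: ifPn => // nx.
  by rewrite /A circle_average_off.
- move=> z _; rewrite [in RHS](pt_abs_coord j z) /A circle_average_rot//; exact: sg_unimodular.
- apply/ae_ball_nu; apply: filterS (circle_average_ae iF F0 Fj) => x h x1.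
  by rewrite AE /A h /ball_ext x1.
Qed.

End symmetries.

Theorem theorem1p2 (R : realType) (n : nat) (alpha : R)
    (s : 'I_n -> R) (h : R -> R[i]) (g f : Cspace R n -> R[i]^o) :
  (1 <= n)%N ->
  -1 < alpha ->
  (forall j, 0 <= s j) ->
  measurable_fun (`[0, 1[%classic : set R) (fun r : R => complex.Re (h r)) ->
  measurable_fun (`[0, 1[%classic : set R) (fun r : R => complex.Im (h r)) ->
  (exists M : R, forall r : R, 0 <= r < 1 -> Normc.normc (h r) <= M) ->
  ae_ball (fun z => g z =
    (\prod_j Normc.normc (z ord0 j) `^ (2 * s j))%:C%C * h (vnorm z)) ->
  ~ (exists c : R[i], ae_ball (fun z => g z = c)) ->
  L2 alpha f ->
  (forall (p : mpoly.mpoly n R[i]) (z : Cspace R n), unit_ball z ->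
     toeplitz alpha f (toeplitz alpha g (analytic_poly p)) z =
     toeplitz alpha g (toeplitz alpha f (analytic_poly p)) z)
  <->
  {ae (@lebesgue_measure R), forall t : R,
     ae_ball (fun z => f (expi t *: z) = f z)} /\
  (forall j : 'I_n, s j != 0 ->
     exists F : Cspace R n -> R[i]^o,
       [/\ measurable_ball F,
           forall z, unit_ball z -> F (abs_coord j z) = F z &
           ae_ball (fun z => f z = F z)]).
Proof.
move=> n1 ha s0 mRe mIm [M hM] gE g_nonconst Lf.
have nonconst : ~ (exists c : R[i], ae_ball (fun z => radial_symbol s h z = c)).
  move=> [c hc]; apply: g_nonconst; exists c; rewrite /ae_ball in gE hc *.
  by apply: filterS2 gE hc => x h1 h2 x1; rewrite h1// -(h2 x1).
have iF : cintg (nu_alpha ha) (ball_ext f) by apply: sqi_cintg; apply/L2_sqi.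
have F0 x : ~~ (normsq x < 1) -> ball_ext f x = 0 by exact: ball_ext_off.
have C := @toeplitz_commute_coef R n alpha ha f g (radial_symbol s h) M Lf gE
  (cmeas_radial_symbol s mRe mIm) (radial_symbol_le s0 hM) (@radial_symbol_rot R n s h).
split=> [/C H|[rot coord]]; last first.
  apply/C => m k.
  (* For each pair of exponents, either the eigenvalues agree or one of the two symmetries kills the
     moment of f. *)
  have [[mk smk]|bad] := pselect (deg m = deg k /\ (forall j, s j != 0 -> m j = k j)).
    by rewrite !eigenval_ratio (eigenval_deg_eq ha s0 mRe mIm hM mk smk) subrr mul0r.
  rewrite -[cint _ _]/(mom ha (ball_ext f) m k).
  have [mk|mk] := eqVneq (deg m) (deg k); last by rewrite (rotation_invariantP iF rot)// mulr0.
  have [j [sj mkj]] : exists j, s j != 0 /\ m j != k j.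
    apply: contrapT => no; apply: bad; split=> // j sj; apply: contrapT => /eqP mkj.
    by apply: no; exists j.
  have [F' [mF' F'abs fF']] := coord j sj.
  by rewrite (coordinate_invariantP iF mF' F'abs fF' mkj) mulr0.
have vanish m k : ~ (deg m = deg k /\ (forall j, s j != 0 -> m j = k j)) ->
    mom ha (ball_ext f) (addm m (fun=> 1%N)) (addm k (fun=> 1%N)) = 0.
  apply: (eigenval_mom_dichotomy s0 mRe mIm hM n1 nonconst iF F0) => a b.
  have := H [ffun j => a j] [ffun j => b j]; rewrite !eigenval_ratio.
  have E (q : 'I_n -> nat) : [ffun j => q j] = q :> ('I_n -> nat) by apply/funext => j; rewrite ffunE.
  by rewrite !E.
split=> [|j sj].
  apply: aeW => t; apply/(ae_ball_scale ha f (normc_expi t)).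
  (* At stake are only exponents m, k with e^(i t (|m| - |k|)) different from 1, and these have
     different degrees. *)
  apply: (invariant_of_mom iF F0 (l := fun=> 1%N) (unimodular_const (normc_expi t))) => m k c1.
  by apply: vanish => -[mk _]; move/eqP: c1; apply; rewrite mono_const mk mono_eq1// normc_expi.
apply: (coordinate_average iF) => c c1.
(* Here the exponents at stake have m_j and k_j different, while s_j is nonzero. *)
apply: (invariant_of_mom iF F0 (l := fun=> 1%N) (rot1_unimodular j c1)) => m k mk1.
by apply: vanish => -[_ /(_ j sj) mkj]; move/eqP: mk1; apply; rewrite mono_rot1 mkj mono_eq1.
Qed.
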